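(* Suppose there exist two continuous real-valued processes $Y^1=(Y^1_t)_{t\ge 0}$ and $Y^2=(Y^2_t)_{t\ge 0}$ in $\mathcal{C}^2$ such that for all $t\ge 0$ $$Y_t^1 = \operatorname*{ess\,sup}_{\theta\in\mathcal{T}_t}\ \mathbb{E}\Big[\int_t^{\theta} e^{-\beta s} f(0,X_s^0)\,ds - e^{-\beta\theta}c_{0,1} + Y^2_\theta \,\Big|\, \mathcal{F}_t\Big],\qquad Y^1_\infty = 0,$$ $$Y_t^2 = \operatorname*{ess\,sup}_{\theta\in\mathcal{T}_t}\ \mathbb{E}\Big[\int_t^{\theta} e^{-\beta s} f(1,X_s^1)\,ds - e^{-\beta\theta}c_{1,0} + Y^1_\theta \,\Big|\, \mathcal{F}_t\Big],\qquad Y^2_\infty = 0.$$ Then $Y^1_0 = \sup_{\alpha\in\mathcal{A}} K(\alpha,0,x)$. Moreover, the sequence $\widehat\alpha = (\widehat\tau_n)_{n\ge -1}$ defined by $\widehat\tau_{-1}=0$ and, for all $n\ge 0$, $$\widehat\tau_{2n} = \inf\{t\ge \widehat\tau_{2n-1} : Y^1_t = -c_{0,1}e^{-\beta t} + Y^2_t\},\qquad \widehat\tau_{2n+1} = \inf\{t\ge \widehat\tau_{2n} : Y^2_t = -c_{1,0}e^{-\beta t}+Y^1_t\},$$ is optimal for the impulse control problem, i.e. $\widehat\alpha\in\mathcal{A}$ and $K(\widehat\alpha,0,x)=\sup_{\alpha\in\mathcal{A}}K(\alpha,0,x)$.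
   Context: $(\Omega,\mathcal{F},(\mathcal{F}_t)_{t\ge0},\mathbb{P})$ is a probability space with a complete right-continuous filtration, and $W=(W_t)_{t\ge0}$ is a Brownian motion. $\mathcal{G}_t=\bigvee_{s<t}\mathcal{F}_s$ for $t>0$. $\mathcal{T}$ is the set of $\mathcal{G}$-stopping times, and $\mathcal{T}_t=\{\theta\in\mathcal{T}:\theta\ge t\}$. $\mathcal{C}^2$ is the set of $(\mathcal{F}_t)$-progressively measurable processes $X$ with $\mathbb{E}[\sup_{t\ge0}|X_t|^2]<\infty$. $Y_\infty$ denotes the value at $t=\infty$, as limit when $t\to\infty$. $\{0,1\}$ is the set of technologies. The switching cost from 0 to 1 is $c_{0,1}$ and from 1 to 0 is $c_{1,0}$, with $c_{0,1}>c_{1,0}>0$. $\beta>0$ is a discount coefficient and $f>0$ is the net profit function, $f:\{0,1\}\times\mathbb{R}\to(0,\infty)$. A strategy is a nondecreasing sequence $\alpha=(\tau_n)_{n\ge-1}$ of $\mathcal{G}$-stopping times with $\tau_{-1}=0$; put $\tau=\lim_n\tau_n$. The time $\tau_{2n}$ is an instant of switching from 0 to 1, and $\tau_{2n+1}$ from 1 to 0. The associated càdlàg $\{0,1\}$-valued process $\xi$ has $\xi_0=0$ and $$\xi_t=\xi_0\mathbf 1_{[0,\tau_0[}(t)+\sum_{n\ge0}\mathbf 1_{[\tau_{2n},\tau_{2n+1}[}(t)+\xi_{\tau^-}\mathbf 1_{[\tau,+\infty[}(t).$$ The log-value process satisfies $dX^\xi_t=b(\xi_t,X^\xi_t)dt+\sigma(\xi_t,X^\xi_t)dW_t$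 with initial value $x$, where $b:\{0,1\}\times\mathbb{R}\to\mathbb{R}$ and $\sigma:\{0,1\}\times\mathbb{R}\to\mathbb{R}^+$ are measurable and, for some $K\ge0$ and all $i\in\{0,1\}$, $x,y\in\mathbb{R}$: $|b(i,x)-b(i,y)|+|\sigma(i,x)-\sigma(i,y)|\le K|x-y|$ and $|b(i,x)|^2+|\sigma(i,x)|^2\le K^2(1+|x|^2)$. For $i\in\{0,1\}$, $X^i$ denotes the process corresponding to the constant regime $\xi\equiv i$, and $X_s^{\xi_s}=X_s^i$ on $\{\xi_s=i\}$. A strategy $\alpha$ is admissible ($\alpha\in\mathcal{A}$) if and only if $\mathbb{E}\int_0^{+\infty}e^{-\beta s}f(\xi_s,X_s^{\xi_s})ds<\infty$ and $\mathbb{E}\sum_{n\ge0}\{e^{-\beta\tau_{2n}}c_{0,1}+e^{-\beta\tau_{2n+1}}c_{1,0}\}<\infty$. The mean gain, with initial technology $0$ and initial value $x$, is $$K(\alpha,0,x)=\mathbb{E}_{0,x}\Big[\int_0^{+\infty}e^{-\beta s}f(\xi_s,X_s^{\xi_s})ds-\sum_{n\ge0}\{e^{-\beta\tau_{2n}}c_{0,1}+e^{-\beta\tau_{2n+1}}c_{1,0}\}\Big].$$ The impulse control problem is to find an admissible strategy maximizing $K(\cdot,0,x)$ over $\mathcal{A}$. *)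

(* Defs.v *)
From HB Require Import structures.
From mathcomp Require Import all_boot all_order all_algebra.
From mathcomp Require Import all_classical all_reals all_analysis.
From mathcomp Require Import measurable_realfun.

Set Implicit Arguments.
Unset Strict Implicit.
Unset Printing Implicit Defensive.
Import Order.TTheory GRing.Theory Num.Theory.
Import numFieldNormedType.Exports.

Local Open Scope classical_set_scope.
Local Open Scope ring_scope.

(* Time is the half-line [0, +oo[ of R: a process is a function R -> Omega -> _
   whose values at negative times are never used. Random times take values in
   \bar R, +oo included. A sub-sigma-algebra is a set of sets. *)

Definition measurable_wrt (Omega : Type) (M : set (set Omega))
    (d : measure_display) (T : measurableType d) (Z : Omega -> T) : Prop :=
  forall B : set T, measurable B -> M (Z @^-1` B).

Section Filtrations.
Context {R : realType} {d : measure_display} {Omega : measurableType d}.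
Variables (P : probability Omega R) (F : R -> set (set Omega)).

(* Completeness: already F 0 contains all subsets of P-null events. *)
Definition complete_right_continuous_filtration : Prop :=
  [/\ forall t, 0 <= t -> sigma_algebra [set: Omega] (F t),
      forall t, 0 <= t -> F t `<=` measurable,
      forall s t, 0 <= s -> s <= t -> F s `<=` F t,
      forall t, 0 <= t -> F t = \bigcap_(s in `]t, +oo[) F s
    & forall N, P.-negligible N -> F 0 N].

(* The left-continuous filtration G. At t = 0 the join over s < t is empty and
   G 0 is taken to be F 0; by right-continuity of F this does not affect which
   random times are G-stopping times. *)
Definition left_filtration (t : R) : set (set Omega) :=
  if 0 < t then <<s \bigcup_(s in `[0, t[) F s >> else F 0.

Definition stopping_time (theta : Omega -> \bar R) : Prop :=
  (forall w, (0 <= theta w)%E) /\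
  (forall t, 0 <= t -> left_filtration t [set w | (theta w <= t%:E)%E]).

Definition stopping_time_from (t : R) (theta : Omega -> \bar R) : Prop :=
  stopping_time theta /\ forall w, (t%:E <= theta w)%E.

Definition adapted (Z : R -> Omega -> R) : Prop :=
  forall t, 0 <= t -> measurable_wrt (F t) (Z t).

(* (s, w) |-> Z s w is measurable on [0, t] x Omega for the product of the Borel
   sigma-algebra and F t. *)
Definition progressively_measurable (Z : R -> Omega -> R) : Prop :=
  forall t, 0 <= t -> forall B : set R, measurable B ->
    <<s [set A `*` C | A in @measurable _ R & C in F t] >>
      [set sw : R * Omega | 0 <= sw.1 <= t /\ B (Z sw.1 sw.2)].

Definition continuous_paths (Z : R -> Omega -> R) : Prop :=
  forall w, {within `[0, +oo[, continuous (fun t => Z t w)}.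

(* The space C^2. *)
Definition square_sup_integrable (Z : R -> Omega -> R) : Prop :=
  progressively_measurable Z /\
  (\int[P]_w ereal_sup [set ((`|Z t w| ^+ 2)%:E) | t in `[0%R, +oo[]
     < +oo)%E.

Definition brownian_motion (W : R -> Omega -> R) : Prop :=
  [/\ adapted W, continuous_paths W,
      {ae P, forall w, W 0 w = 0},
      forall s t, 0 <= s -> s < t -> forall B : set R, measurable B ->
        P [set w | B (W t w - W s w)%R] = normal_prob 0 (Num.sqrt (t - s)) B
    & forall s t, 0 <= s -> s < t ->
        forall (A : set Omega) (B : set R), F s A -> measurable B ->
        P (A `&` [set w | B (W t w - W s w)%R]) =
        (P A * P [set w | B (W t w - W s w)%R])%E].

End Filtrations.

Section ConditionalExpectation.
Context {R : realType} {d : measure_display} {Omega : measurableType d}.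
Variable P : probability Omega R.

(* Z is a version of E[U | M]. Intended for U with integrable negative part, so
   that all the integrals below make sense in ]-oo, +oo]. *)
Definition is_cond_expectation (M : set (set Omega)) (U Z : Omega -> \bar R) :
    Prop :=
  measurable_wrt M Z /\
  forall A, M A -> (\int[P]_(w in A) Z w = \int[P]_(w in A) U w)%E.

(* Z is a version of the P-essential supremum of the family C. *)
Definition is_ess_supremum (C : set (Omega -> \bar R)) (Z : Omega -> \bar R) :
    Prop :=
  [/\ measurable_fun [set: Omega] Z,
      forall V, C V -> {ae P, forall w, (V w <= Z w)%E}
    & forall U : Omega -> \bar R, measurable_fun [set: Omega] U ->
        (forall V, C V -> {ae P, forall w, (V w <= U w)%E}) ->
        {ae P, forall w, (Z w <= U w)%E}].

End ConditionalExpectation.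

Section ItoIntegral.
Context {R : realType} {d : measure_display} {Omega : measurableType d}.
Variables (P : probability Omega R) (F : R -> set (set Omega)).
Variable W : R -> Omega -> R.

(* The integrand sum_(k < size) coef k * 1_(]time k, time k.+1]). *)
Record simple_integrand := SimpleIntegrand {
  simple_size : nat;
  simple_time : nat -> R;
  simple_coef : nat -> Omega -> R }.

Definition is_simple_integrand (h : simple_integrand) : Prop :=
  [/\ forall k, 0 <= simple_time h k <= simple_time h k.+1,
      forall k, measurable_wrt (F (simple_time h k)) (simple_coef h k)
    & forall k, exists M : R, forall w, `|simple_coef h k w| <= M].

Definition simple_value (h : simple_integrand) (s : R) (w : Omega) : R :=
  \sum_(k < simple_size h)
    simple_coef h k w * \1_(`]simple_time h k, simple_time h k.+1]) s.

Definition simple_integral (h : simple_integrand) (t : R) (w : Omega) : R :=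
  \sum_(k < simple_size h)
    simple_coef h k w * (W (Num.min (simple_time h k.+1) t) w -
                         W (Num.min (simple_time h k) t) w).

Definition cvg_in_probability0 (Z : nat -> Omega -> \bar R) : Prop :=
  forall e : R, 0 < e ->
    P [set w | (e%:E < Z n w)%E] @[n --> \oo] --> 0%E.

(* I is a version of \int_0^t H dW: limit in probability of the elementary
   integrals of simple integrands h n such that \int_0^t |h n - H|^2 ds tends to
   0 in probability. *)
Definition is_ito_integral (H : R -> Omega -> R) (t : R) (I : Omega -> R) :
    Prop :=
  progressively_measurable F H /\
  exists h : nat -> simple_integrand,
    [/\ forall n, is_simple_integrand (h n),
        cvg_in_probability0 (fun n w =>
          \int[lebesgue_measure]_(s in `[0%R, t])
             (`|simple_value (h n) s w - H s w| ^+ 2)%:E)%E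
      & cvg_in_probability0 (fun n w =>
          `|simple_integral (h n) t w - I w|%:E)].

(* Z solves dZ = b(xi, Z) dt + sigma(xi, Z) dW with Z_0 = x. *)
Definition log_value_process (b sigma : bool -> R -> R) (x : R)
    (xi : R -> Omega -> bool) (Z : R -> Omega -> R) : Prop :=
  [/\ adapted F Z, continuous_paths Z
    & forall t, 0 <= t -> exists I : Omega -> R,
        is_ito_integral (fun s w => sigma (xi s w) (Z s w)) t I /\
        {ae P, forall w, Z t w =
           x + \int[lebesgue_measure]_(s in `[0, t]) b (xi s w) (Z s w)
             + I w}].

End ItoIntegral.

Section Switching.
Context {R : realType} {d : measure_display} {Omega : measurableType d}.
Variables (P : probability Omega R) (F : R -> set (set Omega)).
(* The technologies 0 and 1 are false and true. X i is the log-value in the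
   constant regime i. *)
Variables (beta c01 c10 : R) (f : bool -> R -> R) (X : bool -> R -> Omega -> R).

(* e^(-beta theta), which is 0 when theta = +oo (for beta > 0). *)
Definition discount (theta : \bar R) : \bar R := expeR (- (beta%:E * theta))%E.

Definition value_at_infinity (Z : R -> Omega -> R) (w : Omega) : R :=
  lim (Z t w @[t --> +oo]).

Definition value_at (Z : R -> Omega -> R) (theta : Omega -> \bar R)
    (w : Omega) : R :=
  if theta w is r%:E then Z r w else value_at_infinity Z w.

(* \int_t^theta e^(-beta s) f(i, X^i_s) ds - e^(-beta theta) c + Z_theta *)
Definition stopping_payoff (i : bool) (c : R) (Z : R -> Omega -> R) (t : R)
    (theta : Omega -> \bar R) (w : Omega) : \bar R :=
  (\int[lebesgue_measure]_(s in [set s : R | (t%:E <= s%:E <= theta w)%E])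
      (expR (- (beta * s)) * f i (X i s w))%:E
   - c%:E * discount (theta w) + (value_at Z theta w)%:E)%E.

(* Y_t is the essential supremum, over the G-stopping times theta >= t, of the
   conditional expectations of stopping_payoff given F t. *)
Definition is_stopping_value (i : bool) (c : R) (Z Y : R -> Omega -> R) : Prop :=
  forall t, 0 <= t ->
    is_ess_supremum P
      [set V | exists2 theta, stopping_time_from F t theta &
         is_cond_expectation P (F t) (stopping_payoff i c Z t theta) V]
      (fun w => (Y t w)%:E).

(* A strategy (tau_n)_(n >= -1) is encoded with a shift of the index:
   a n is tau_(n - 1). *)
Definition strategy (a : nat -> Omega -> \bar R) : Prop :=
  [/\ forall n, stopping_time F (a n),
      forall w, a 0%N w = 0%E
    & forall n w, (a n w <= a n.+1 w)%E].

Definition switching_limit (a : nat -> Omega -> \bar R) (w : Omega) : \bar R :=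
  limn (fun n => a n w).

(* Some interval [tau_2n, tau_(2n+1)[ contains t. *)
Definition in_technology1 (a : nat -> Omega -> \bar R) (t : R) (w : Omega) :
    Prop :=
  exists n : nat, (a n.*2.+1 w <= t%:E < a n.*2.+2 w)%E.

(* The process xi. From tau = lim tau_n on it keeps its left limit at tau; if
   there is none (infinitely many distinct switching times before tau < +oo),
   which does not happen with positive probability for an admissible strategy,
   the value is 0 by convention. *)
Definition technology (a : nat -> Omega -> \bar R) (t : R) (w : Omega) : bool :=
  if (t%:E < switching_limit a w)%E then `[< in_technology1 a t w >]
  else `[< \forall s \near (fine (switching_limit a w))^'-,
             in_technology1 a s w >].

Definition discounted_profit (a : nat -> Omega -> \bar R) (w : Omega) : \bar R :=
  (\int[lebesgue_measure]_(s in `[0%R, +oo[)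
     (expR (- (beta * s)) *
      f (technology a s w) (X (technology a s w) s w))%:E)%E.

Definition switching_cost (a : nat -> Omega -> \bar R) (w : Omega) : \bar R :=
  (\sum_(0 <= n <oo) (discount (a n.*2.+1 w) * c01%:E +
                      discount (a n.*2.+2 w) * c10%:E))%E.

Definition admissible (a : nat -> Omega -> \bar R) : Prop :=
  [/\ strategy a,
      (\int[P]_w discounted_profit a w < +oo)%E
    & (\int[P]_w switching_cost a w < +oo)%E].

Definition mean_gain (a : nat -> Omega -> \bar R) : \bar R :=
  (\int[P]_w (discounted_profit a w - switching_cost a w))%E.

Definition optimal_gain : \bar R :=
  ereal_sup [set mean_gain a | a in admissible].

(* inf {t >= theta : Z_t = - c e^(-beta t) + Z'_t}, with inf of the empty set
   equal to +oo *)
Definition first_time (c : R) (Z Z' : R -> Omega -> R) (theta : \bar R)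
    (w : Omega) : \bar R :=
  ereal_inf [set t%:E | t in
    [set t : R | [/\ 0 <= t, (theta <= t%:E)%E
                   & Z t w = - (c * expR (- (beta * t))) + Z' t w]]].

(* With the same shift of the index: a switch from 0 to 1 follows an even
   number of switches. *)
Fixpoint candidate (Y1 Y2 : R -> Omega -> R) (n : nat) (w : Omega) : \bar R :=
  if n is k.+1 then
    if odd k then first_time c10 Y2 Y1 (candidate Y1 Y2 k w) w
    else first_time c01 Y1 Y2 (candidate Y1 Y2 k w) w
  else 0%E.

End Switching.

(* Main.v *)
Require Import Defs.
From HB Require Import structures.
From mathcomp Require Import all_boot all_order all_algebra.
From mathcomp Require Import all_classical all_reals all_analysis.
From mathcomp Require Import measurable_realfun ring lra.

Set Implicit Arguments.
Unset Strict Implicit.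
Unset Printing Implicit Defensive.
Import Order.TTheory GRing.Theory Num.Theory.
Import numFieldNormedType.Exports.

Local Open Scope classical_set_scope.
Local Open Scope ring_scope.

(* The value Y^1_0 dominates the gain of every strategy: Y^i + \int_0^. e^(-beta s) f(i, X^i_s) ds is
   the Snell envelope of the reward of switching out of regime i, so between two successive
   switching times it loses at least the profit minus the switching cost, and it loses exactly that
   when each switch waits for the obstacle to be hit. Along the candidate the gains therefore sum to
   E[1_A Y^1_0] on every A in F_0; the candidate times tend to +oo, because at a finite limit
   Y^1 - Y^2 would be both negative and positive.
   This identifies sup K with E[Y^1_0]. That Y^1_0 is itself constant requires the Brownian setting,
   since F_0 need not be trivial: an event D known at time t is replaced by its conditional
   probability given the Brownian path. This weight is known at time t, as the increments after t are
   independent of F_t, and the processes X^i are functionals of the path, being limits of Euler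
   schemes. Following the candidate on a dyadic grid with such weights gives
   E[1_A Y^1_0] <= P(A) E[Y^1_0] for every A in F_0. *)

(** * Real-valued integrals over a complete probability space *)

(** Constancy of [Y1 0] is not a formality: the essential supremum runs over stopping times that may
    use information in [F 0] unrelated to [W], so a priori the value could depend on it. The extra
    information is useless because the running profits are functionals of the Brownian path.
    Replacing an event by its conditional probability amounts to replacing a strategy by a
    randomised one. The weights stay adapted, and the supermartingale inequality survives
    integration against adapted weights in [[0, 1]]. Two further obstacles shape the proof. Stopping
    times refer to the left filtration, so an event of [F t] can be used only strictly after [t]:
    pasting needs a small delay, which continuity of the paths makes harmless. The Ito integral is
    only a limit in probability, and no moments of [X i] are used; the Euler estimate is therefore
    localised to paths that are bounded and oscillate little, with a constant that does not depend
    on the bound. *)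

Section Toolkit.
Context {R : realType} {d : measure_display} {Omega : measurableType d}.
Variable P : probability Omega R.
Hypothesis Pcomplete : measure_is_complete P.
Implicit Types f g : Omega -> R.

Definition L1 f := P.-integrable setT (EFin \o f).
Definition Ex f : R := Rintegral P setT f.

Lemma L1_meas f : L1 f -> measurable_fun setT f.
Proof. by move=> /measurable_int /measurable_EFinP. Qed.

Lemma L1D f g : L1 f -> L1 g -> L1 (fun w => f w + g w).
Proof. by move=> hf hg; exact: (integrableD _ hf hg). Qed.

Lemma L1N f : L1 f -> L1 (fun w => - f w).
Proof. by move=> hf; exact: (integrableN hf). Qed.

Lemma L1B f g : L1 f -> L1 g -> L1 (fun w => f w - g w).
Proof. by move=> hf hg; exact: (integrableB _ hf hg). Qed.

Lemma L1Z k f : L1 f -> L1 (fun w => k * f w).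
Proof. by move=> hf; exact: (integrableZl _ _ hf). Qed.

Lemma L1_cst k : L1 (fun=> k).
Proof. exact: finite_measure_integrable_cst. Qed.

Lemma L1_norm f : L1 f -> L1 (fun w => `|f w|).
Proof. by move=> hf; exact: (integrable_norm hf). Qed.

Lemma L1_sum (I : Type) (s : seq I) (Q : pred I) (h : I -> Omega -> R) :
  (forall i, Q i -> L1 (h i)) -> L1 (fun w => \sum_(i <- s | Q i) h i w).
Proof.
move=> hi.
have := @integrable_sum _ _ _ P setT measurableT _ s Q (fun i => EFin \o h i) hi.
by apply: eq_integrable => // w _ /=; rewrite sumEFin.
Qed.

Lemma L1_indic A : measurable A -> L1 (\1_A).
Proof. by move=> mA; apply: integrable_indic => //; rewrite ltey_eq fin_num_measure. Qed.

Lemma ae_meas f g : {ae P, forall w, f w = g w} -> measurable_fun setT f ->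
  measurable_fun setT g.
Proof.
move=> fg /measurable_EFinP mf; apply/measurable_EFinP.
apply: (ae_measurable_fun Pcomplete _ mf).
by apply: filterS fg => w /= -> _.
Qed.

Lemma L1_dom f g : measurable_fun setT f -> L1 g ->
  {ae P, forall w, `|f w| <= g w} -> L1 f.
Proof.
move=> mf hg fg.
(* Zeroing [f] where the bound fails makes the domination hold everywhere and changes [f] only on a
   null set. *)
suff : L1 (fun w => if `|f w| <= g w then f w else 0).
  move=> h; apply/integrableP; split; first exact/measurable_EFinP.
  move/integrableP : h => [mh]; apply: le_lt_trans.
  apply: ae_ge0_le_integral => //.
  - exact/measurableT_comp/measurable_EFinP.
  - exact: measurableT_comp.
  - by apply: filterS fg => w /= ->.
apply: (le_integrable measurableT _ _ hg) => [|w _ /=].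
  apply/measurable_EFinP; apply: measurable_fun_ifT => //.
  by apply: measurable_fun_ler; [exact: measurableT_comp|exact: L1_meas].
rewrite lee_fin; case: ifPn => [h|_]; first exact: (le_trans h (ler_norm _)).
by rewrite normr0 normr_ge0.
Qed.

Lemma L1_bnd f (M : R) : measurable_fun setT f -> (forall w, `|f w| <= M) -> L1 f.
Proof. by move=> mf h; apply: (L1_dom mf (L1_cst M)); exact: aeW. Qed.

Lemma L1M_bnd f g (M : R) : measurable_fun setT f -> (forall w, `|f w| <= M) ->
  L1 g -> L1 (fun w => f w * g w).
Proof.
move=> mf fM hg; apply: (L1_dom _ (L1Z M (L1_norm hg))).
  by apply: measurable_funM => //; exact: L1_meas.
by apply: aeW => w; rewrite normrM ler_wpM2r.
Qed.

Lemma indic_le1 (A : set Omega) w : `|\1_A w : R| <= 1.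
Proof. by rewrite indicE; case: (_ \in _); rewrite ?normr1 ?normr0. Qed.

Lemma indic_ge0 (A : set Omega) w : 0 <= (\1_A w : R).
Proof. by rewrite indicE; case: (_ \in _). Qed.

Lemma indicC (A : set Omega) w : \1_(~` A) w = 1 - \1_A w :> R.
Proof. by rewrite !indicE in_setC; case: (_ \in _); rewrite ?subr0 ?subrr. Qed.

Lemma indicI (A B : set Omega) w : \1_(A `&` B) w = \1_A w * \1_B w :> R.
Proof. by rewrite !indicE in_setI; case: (_ \in _); case: (_ \in _); rewrite ?mulr0 ?mul0r ?mulr1. Qed.

Lemma L1M_ind A f : measurable A -> L1 f -> L1 (fun w => \1_A w * f w).
Proof.
move=> mA; apply: (@L1M_bnd _ _ 1); [exact: measurable_indic|exact: indic_le1].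
Qed.

Lemma eq_L1 f g : f =1 g -> L1 f -> L1 g.
Proof. by move=> /funext ->. Qed.

Lemma ExD f g : L1 f -> L1 g -> Ex (fun w => f w + g w) = Ex f + Ex g.
Proof. by move=> hf hg; rewrite /Ex RintegralD. Qed.

Lemma ExB f g : L1 f -> L1 g -> Ex (fun w => f w - g w) = Ex f - Ex g.
Proof. by move=> hf hg; rewrite /Ex RintegralB. Qed.

Lemma ExZ k f : L1 f -> Ex (fun w => k * f w) = k * Ex f.
Proof. by move=> hf; rewrite /Ex RintegralZl. Qed.

Lemma ExN f : L1 f -> Ex (fun w => - f w) = - Ex f.
Proof.
move=> hf; rewrite -[RHS]mulN1r -ExZ//; congr Ex.
by apply/funext => w; rewrite mulN1r.
Qed.

Lemma Ex_cst k : Ex (fun=> k) = k.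
Proof. by rewrite /Ex Rintegral_cst//= (_ : P setT = 1%E) ?mulr1//; exact: probability_setT. Qed.

Lemma Ex_sum (I : Type) (s : seq I) (Q : pred I) (h : I -> Omega -> R) :
  (forall i, Q i -> L1 (h i)) ->
  Ex (fun w => \sum_(i <- s | Q i) h i w) = \sum_(i <- s | Q i) Ex (h i).
Proof.
move=> hi; elim: s => [|i s IH].
  rewrite big_nil -[RHS](Ex_cst 0); congr Ex.
  by apply/funext => w; rewrite big_nil.
rewrite big_cons -IH; case: ifPn => Qi.
  rewrite -ExD; [|exact: hi|exact: L1_sum].
  by congr Ex; apply/funext => w; rewrite big_cons Qi.
by congr Ex; apply/funext => w; rewrite big_cons (negbTE Qi).
Qed.

Lemma EFin_Ex f : L1 f -> (Ex f)%:E = (\int[P]_w (f w)%:E)%E.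
Proof. by move=> hf; rewrite /Ex /Rintegral fineK//; exact: integrable_fin_num hf. Qed.

Lemma Ex_eq f g : {ae P, forall w, f w = g w} -> L1 f -> Ex f = Ex g.
Proof.
move=> fg hf; rewrite /Ex /Rintegral; congr fine; apply: ae_eq_integral => //.
- exact/measurable_EFinP/L1_meas.
- exact/measurable_EFinP/(ae_meas fg)/L1_meas.
- by apply: filterS fg => w /= ->.
Qed.

Lemma Ex_ge0 f : {ae P, forall w, 0 <= f w} -> L1 f -> 0 <= Ex f.
Proof.
move=> f0 hf; rewrite (@Ex_eq f (fun w => `|f w|)) //.
  by apply: Rintegral_ge0.
by apply: filterS f0 => w h; rewrite ger0_norm.
Qed.

Lemma Ex_le f g : {ae P, forall w, f w <= g w} -> L1 f -> L1 g -> Ex f <= Ex g.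
Proof.
move=> fg hf hg; rewrite -subr_ge0 -ExB//; apply: Ex_ge0; last exact: L1B.
by apply: filterS fg => w; rewrite subr_ge0.
Qed.

Lemma Ex_ind A : measurable A -> Ex (\1_A) = fine (P A).
Proof. by move=> mA; rewrite /Ex /Rintegral integral_indic// setIT. Qed.

Lemma Ex_setE A f : measurable A -> L1 f ->
  (\int[P]_(w in A) (f w)%:E)%E = (Ex (fun w => \1_A w * f w))%:E.
Proof.
move=> mA hf; rewrite EFin_Ex; last exact: L1M_ind.
rewrite integral_mkcond; apply: eq_integral => w _.
by rewrite patchE indicE; case: ifPn => _; rewrite ?mul1r ?mul0r.
Qed.

(** Outside a measurable null set the limit is a pointwise one; completeness absorbs the change made
    on that null set. *)
Lemma ae_cvg_meas (f_ : nat -> Omega -> R) f :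
  (forall n, measurable_fun setT (f_ n)) ->
  {ae P, forall w, f_ n w @[n --> \oo] --> f w} -> measurable_fun setT f.
Proof.
move=> mf_ ff.
have [N [mN N0 subN]] := ff.
have mC : measurable_fun setT (\1_(~` N) : Omega -> R).
  exact/measurable_indic/measurableC.
have mh : measurable_fun setT (fun w => \1_(~` N) w * f w).
  apply: (@measurable_fun_cvg _ _ _ _ (fun n w => \1_(~` N) w * f_ n w)) => //.
    by move=> n; exact: measurable_funM.
  move=> w _; have [wN|wN] := boolP (w \in ~` N).
    rewrite indicE wN mul1r; under eq_fun do rewrite mul1r.
    apply: contrapT => H; move: wN; rewrite in_setC => /negP; apply.
    by rewrite inE; exact: subN.
  rewrite indicE (negbTE wN) mul0r; under eq_fun do rewrite mul0r.
  exact: cvg_cst.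
apply: (ae_meas _ mh).
exists N; split => // w /= H; apply: contrapT => wN; apply: H.
by rewrite indicE mem_set// mul1r.
Qed.

Lemma Ex_dct (f_ : nat -> Omega -> R) f g :
  (forall n, measurable_fun setT (f_ n)) ->
  {ae P, forall w, f_ n w @[n --> \oo] --> f w} ->
  L1 g -> {ae P, forall w, forall n, `|f_ n w| <= g w} ->
  L1 f /\ Ex (f_ n) @[n --> \oo] --> Ex f.
Proof.
move=> mf_ ff hg fg.
have mf := ae_cvg_meas mf_ ff.
have ef_ n : measurable_fun setT (EFin \o f_ n) by exact/measurable_EFinP.
have ef : measurable_fun setT (EFin \o f) by exact/measurable_EFinP.
have cf : {ae P, forall w, setT w -> (EFin \o f_ n) w @[n --> \oo] --> (EFin \o f) w}.
  by apply: filterS ff => w H _; apply/fine_cvgP; split => //; exact: nearW.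
have bf : {ae P, forall w n, setT w -> (`|(EFin \o f_ n) w| <= (EFin \o g) w)%E}.
  by apply: filterS fg => w H n _; rewrite /= lee_fin.
have [h1 _ h3] := dominated_convergence measurableT ef_ ef cf hg bf.
split => //.
have h_ n : L1 (f_ n).
  by apply: (L1_dom (mf_ n) hg); apply: filterS fg => w /(_ n).
by have /fine_cvgP[_] : (\int[P]_w (f_ n w)%:E)%E @[n --> \oo] --> (Ex f)%:E
  by rewrite EFin_Ex.
Qed.

Lemma Ex_fatou (f_ : nat -> Omega -> R) f (c_ : nat -> R) (c : R) :
  (forall n, L1 (f_ n)) -> (forall n w, 0 <= f_ n w) ->
  {ae P, forall w, f_ n w @[n --> \oo] --> f w} ->
  (forall n, Ex (f_ n) <= c_ n) -> c_ n @[n --> \oo] --> c ->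
  L1 f /\ Ex f <= c.
Proof.
move=> hf f0 ff fc cc.
(* The lower limit is defined at every point, so Fatou's lemma applies to it; it agrees with [f]
   almost everywhere. *)
pose F w := limn_einf (fun n => (f_ n w)%:E).
have FF : {ae P, forall w, F w = (f w)%:E}.
  apply: filterS ff => w H.
  have H' : (f_ n w)%:E @[n --> \oo] --> (f w)%:E.
    by apply/fine_cvgP; split => //; exact: nearW.
  by rewrite /F; have [-> _] := cvg_limn_einf_sup H'.
have mf : measurable_fun setT f by apply: ae_cvg_meas ff => n; exact: L1_meas.
have mF : measurable_fun setT F.
  apply: (ae_measurable_fun Pcomplete (f := EFin \o f)); last exact/measurable_EFinP.
  by apply: filterS FF => w -> _.
have F0 w : (0 <= F w)%E.
  rewrite /F limn_einf_lim; apply: lime_ge; first exact: is_cvg_einfs.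
  by apply: nearW => n; apply: le_ereal_inf_tmp => _ [m /= _ <-]; rewrite lee_fin.
have Fc : (\int[P]_w F w <= c%:E)%E.
  have := @fatou _ _ _ P setT measurableT (fun n w => (f_ n w)%:E)
    (fun n => (measurable_EFinP _ _).2 (L1_meas (hf n))) (fun n w _ => f0 n w).
  move=> /le_trans; apply; rewrite limn_einf_lim.
  have c' : (c_ n)%:E @[n --> \oo] --> c%:E.
    by apply/fine_cvgP; split => //; exact: nearW.
  have [<- _] := cvg_limn_einf_sup c'.
  rewrite limn_einf_lim; apply: lee_lim; [exact: is_cvg_einfs|exact: is_cvg_einfs|].
  apply: nearW => n; apply: le_ereal_inf_tmp => _ [m /= nm <-].
  apply: (@le_trans _ _ (\int[P]_w (f_ m w)%:E)%E); first by apply: ereal_inf_lbound; exists m.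
  by rewrite -EFin_Ex// lee_fin.
have E1 : (\int[P]_w (f w)%:E = \int[P]_w F w)%E.
  apply: ae_eq_integral => //; first exact/measurable_EFinP.
  by apply: filterS FF => w -> _.
have E2 : (\int[P]_w `|(f w)%:E| = \int[P]_w F w)%E.
  apply: ae_eq_integral => //.
    exact/measurableT_comp/measurable_EFinP.
  by apply: filterS FF => w <- _; rewrite gee0_abs.
have hfL : L1 f.
  apply/integrableP; split; first exact/measurable_EFinP.
  by rewrite E2 (le_lt_trans Fc) ?ltry.
by split => //; rewrite -lee_fin EFin_Ex// E1.
Qed.

(** Beppo Levi with the limit constructed rather than given: the bound [c] on the means forces the
    supremum to be finite almost everywhere. Subtracting [f_ 0] reduces to nonnegative functions,
    since no sign is assumed. *)
Lemma Ex_monotone (f_ : nat -> Omega -> R) (c : R) :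
  (forall n, L1 (f_ n)) ->
  (forall w, {homo f_^~ w : n m / (n <= m)%N >-> n <= m}) ->
  (forall n, Ex (f_ n) <= c) ->
  exists f, [/\ L1 f, {ae P, forall w, f_ n w @[n --> \oo] --> f w} & Ex f <= c].
Proof.
move=> hf nd fc.
pose g_ n w := f_ n w - f_ 0%N w.
have g0 n w : 0 <= g_ n w by rewrite subr_ge0 nd.
have hg n : L1 (g_ n) by exact: L1B.
have ndg w : {homo (fun n => (g_ n w)%:E) : n m / (n <= m)%N >-> (n <= m)%E}.
  by move=> n m nm; rewrite lee_fin lerB// nd.
pose G w := limn (fun n => (g_ n w)%:E).
have cG w : (g_ n w)%:E @[n --> \oo] --> G w.
  by have := ereal_nondecreasing_is_cvgn (ndg w).
have G0 w : (0 <= G w)%E.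
  by apply: lime_ge; [exact: cG|apply: nearW => n; rewrite lee_fin].
have mg n : measurable_fun setT (fun w => (g_ n w)%:E).
  by apply/measurable_EFinP/L1_meas.
have mG : measurable_fun setT G by apply: (emeasurable_fun_cvg (fun n w => (g_ n w)%:E)) => // w _; exact: cG.
have IG : (\int[P]_w G w <= (c - Ex (f_ 0%N))%:E)%E.
  rewrite (monotone_convergence P measurableT mg) //=; first last.
  - by move=> n w _; rewrite lee_fin.
  apply: lime_le.
    apply: ereal_nondecreasing_is_cvgn => n m nm; apply: ge0_le_integral => //.
    + by move=> w _; rewrite lee_fin.
    + by move=> w _; exact: ndg.
  by apply: nearW => n; rewrite -EFin_Ex// lee_fin ExB// lerB.
have iG : P.-integrable setT G.
  apply/integrableP; split => //; under eq_integral do rewrite gee0_abs//.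
  by rewrite (le_lt_trans IG) ?ltry.
have fG := integrable_ae measurableT iG.
have hgg : L1 (fine \o G).
  apply/integrableP; split; first by apply/measurable_EFinP/measurableT_comp.
  move/integrableP : iG => [_]; apply: le_lt_trans.
  apply: ae_ge0_le_integral => //.
  - apply: measurableT_comp => //; first apply/measurable_EFinP/measurableT_comp => //.
  - exact: measurableT_comp.
  - apply: filterS fG => w /(_ I) h _ /=.
    by rewrite ger0_norm ?fine_ge0// fineK// gee0_abs.
exists (fun w => fine (G w) + f_ 0%N w); split.
- exact: L1D.
- apply: filterS fG => w /(_ I) h.
  rewrite (_ : (fun n => f_ n w) = fun n => g_ n w + f_ 0%N w); last first.
    by apply/funext => n; rewrite /g_ subrK.
  apply: cvgD; last exact: cvg_cst.
  have /fine_cvgP[//] : (g_ n w)%:E @[n --> \oo] --> (fine (G w))%:E.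
    by rewrite fineK.
- rewrite ExD// -lerBrDr -lee_fin EFin_Ex//; apply: le_trans IG.
  apply: ae_ge0_le_integral => //.
  - by move=> w _; rewrite lee_fin fine_ge0.
  - by apply/measurable_EFinP/measurableT_comp.
  - by apply: filterS fG => w /(_ I) h _ /=; rewrite fineK.
Qed.

(** The partial sums increase with bounded means, so the series converges almost everywhere and its
    terms tend to 0. *)
Lemma ae_cvg0 (f_ : nat -> Omega -> R) (c : R) :
  (forall n, L1 (f_ n)) -> (forall n w, 0 <= f_ n w) ->
  (forall n, \sum_(i < n) Ex (f_ i) <= c) ->
  {ae P, forall w, f_ n w @[n --> \oo] --> 0}.
Proof.
move=> hf f0 fc.
have [|||f [_ cf _]] := @Ex_monotone (fun n w => \sum_(i < n) f_ i w) c.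
- by move=> n; exact: L1_sum.
- move=> w n m nm; rewrite -!(big_mkord xpredT (fun i => f_ i w)).
  by rewrite (big_cat_nat _ nm) //= lerDl sumr_ge0.
- by move=> n; rewrite Ex_sum.
apply: filterS cf => w H; apply: cvg_series_cvg_0; apply/cvg_ex; exists (f w).
by apply: cvg_trans H; apply: near_eq_cvg; apply: nearW => n; rewrite seriesEord.
Qed.

(** The indicators have summable means, hence tend to 0 almost everywhere, and an indicator below 1
    vanishes. *)
Lemma borel_cantelli (A : nat -> set Omega) :
  (forall n, measurable (A n)) -> (forall n, (P (A n) <= (2^-1 ^+ n)%:E)%E) ->
  {ae P, forall w, \forall n \near \oo, ~ A n w}.
Proof.
move=> mA PA.
have H : {ae P, forall w, (\1_(A n) w : R) @[n --> \oo] --> 0}.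
  apply: (@ae_cvg0 (fun n => \1_(A n)) 2).
  - by move=> n; exact: L1_indic.
  - by move=> n w; exact: indic_ge0.
  move=> n; apply: (@le_trans _ _ (\sum_(i < n) 2^-1 ^+ i)).
    apply: ler_sum => i _; rewrite Ex_ind// -lee_fin fineK//; exact: fin_num_measure.
  have := @subrX1 R 2^-1 n; have : 0 < 2^-1 ^+ n :> R by rewrite exprn_gt0.
  set s := \sum_(_ < _) _; lra.
apply: filterS H => w /cvgr0Pnorm_lt /(_ 1 ltr01); apply: filterS => n.
by move=> + An; rewrite indicE mem_set// normr1 ltxx.
Qed.

Lemma Ex_eq0 f : {ae P, forall w, 0 <= f w} -> L1 f -> Ex f <= 0 ->
  {ae P, forall w, f w = 0}.
Proof.
move=> f0 hf fE.
have E0 : Ex f = 0 by apply/eqP; rewrite eq_le fE Ex_ge0.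
have [+ _] := @ae_eq_integral_abs _ _ _ P setT measurableT (EFin \o f)
  ((measurable_EFinP _ _).2 (L1_meas hf)).
move=> H; have {H} : ae_eq P setT (EFin \o f) (cst 0%E).
  apply: H; rewrite -[RHS]/(0%:E) -E0 EFin_Ex//; apply: ae_eq_integral => //.
  - by apply: measurableT_comp => //; exact/measurable_EFinP/L1_meas.
  - exact/measurable_EFinP/L1_meas.
  - by apply: filterS f0 => w h _ /=; rewrite ger0_norm.
by apply: filterS => w /(_ I) /= [].
Qed.

End Toolkit.

(** * Sub-sigma-algebras and conditional expectation *)

Section SubSigmaAlgebra.
Context {R : realType} {d : measure_display} {Omega : measurableType d}.
Variables (P : probability Omega R) (M : set (set Omega)).
Hypothesis Pcomplete : measure_is_complete P.
Hypothesis hM : sigma_algebra [set: Omega] M.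
Hypothesis subM : M `<=` measurable.
Local Notation L1 := (L1 P).
Local Notation Ex := (Ex P).
Local Notation OM := (g_sigma_algebraType M).

Lemma measurable_OM (A : set Omega) : (measurable : set (set OM)) A = M A.
Proof. by rewrite -[in RHS](sigma_algebra_id hM). Qed.

Lemma measurable_wrtP d' (T : measurableType d') (Z : Omega -> T) :
  measurable_wrt M Z <-> measurable_fun [set: OM] (Z : OM -> T).
Proof.
split => [h _ B mB|h B mB]; first by rewrite setTI measurable_OM; exact: h.
by have := h measurableT B mB; rewrite setTI measurable_OM.
Qed.

Lemma sa0 : M set0. Proof. by case: hM. Qed.
Lemma saC A : M A -> M (~` A).
Proof. by case: hM => _ + _ => h /h; rewrite setTD. Qed.
Lemma saT : M setT. Proof. by rewrite -setC0; exact/saC/sa0. Qed.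
Lemma sa_bigcup (A : nat -> set Omega) : (forall n, M (A n)) -> M (\bigcup_n A n).
Proof. by case: hM => _ _; exact. Qed.
Lemma saI A B : M A -> M B -> M (A `&` B).
Proof. by rewrite -!measurable_OM => mA mB; exact: measurableI. Qed.
Lemma saU A B : M A -> M B -> M (A `|` B).
Proof. by rewrite -!measurable_OM => mA mB; exact: measurableU. Qed.
Lemma saD A B : M A -> M B -> M (A `\` B).
Proof. by rewrite -!measurable_OM => mA mB; exact: measurableD. Qed.

Lemma measurable_wrt_meas d' (T : measurableType d') (Z : Omega -> T) :
  measurable_wrt M Z -> measurable_fun setT Z.
Proof. by move=> h _ B mB; rewrite setTI; exact/subM/h. Qed.

Let idM : measurable_fun [set: Omega] (idfun : Omega -> OM).
Proof. by move=> _ B; rewrite measurable_OM setTI; exact: subM. Qed.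

(** The restriction of [P] to [M], carried by a copy of [Omega] whose measurable sets are exactly
    those of [M]; Radon-Nikodym derivatives taken there are [M]-measurable. *)
Let restr : set OM -> \bar R := fun A => P A.

Let restr0 : restr set0 = 0%E. Proof. by rewrite /restr measure0. Qed.
Let restr_ge0 A : (0 <= restr A)%E. Proof. exact: measure_ge0. Qed.
Let restr_sigma_additive : semi_sigma_additive restr.
Proof.
move=> A mA tA mU; apply: (@measure_semi_sigma_additive _ Omega _ P A) => //.
  by move=> i; apply: subM; rewrite -measurable_OM.
by apply: subM; rewrite -measurable_OM.
Qed.

HB.instance Definition _ := isMeasure.Build _ _ _ restr
  restr0 restr_ge0 restr_sigma_additive.

Let restrT : restr setT = 1%E. Proof. exact: probability_setT. Qed.
HB.instance Definition _ := Measure_isProbability.Build _ _ R restr restrT.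

Section charge_of.
Variables (U : Omega -> \bar R) (hU : P.-integrable setT U).

Let nu : set OM -> \bar R := fun A => (\int[P]_(w in A) U w)%E.
Let nu0 : nu set0 = 0%E. Proof. exact: integral_set0. Qed.
Let nu_fin A : measurable A -> nu A \is a fin_num.
Proof.
rewrite measurable_OM => /subM mA.
exact: (@fin_num_measure _ _ _ (induced_charge hU)).
Qed.
Let nu_sigma_additive : semi_sigma_additive nu.
Proof.
move=> A mA tA mU.
apply: (@charge_semi_sigma_additive _ Omega _ (induced_charge hU) A) => //.
  by move=> i; apply: subM; rewrite -measurable_OM.
by apply: subM; rewrite -measurable_OM.
Qed.

HB.instance Definition _ := isCharge.Build _ _ _ nu nu0 nu_fin nu_sigma_additive.

(** The conditional expectation is the Radon-Nikodym derivative of the charge [nu] with respect to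
    the restriction of [P]. Integrals against the restriction return to [P] through the pushforward
    along the identity. *)
Lemma cond_exp_integrable : exists V : Omega -> \bar R,
  [/\ measurable_wrt M V, P.-integrable setT V, (forall w, V w \is a fin_num) &
    forall A, M A -> (\int[P]_(w in A) V w = \int[P]_(w in A) U w)%E].
Proof.
have dom : nu `<< restr.
  move=> /= A A0 B mB BA; rewrite /nu; apply: null_set_integral.
  - by apply: subM; rewrite -measurable_OM.
  - apply: measurable_funTS; exact: measurable_int hU.
  - exact: (A0 _ mB BA).
pose V : OM -> \bar R := Radon_Nikodym nu restr.
have hV : restr.-integrable setT V.
  exact: Radon_Nikodym_integrable.
have mV : measurable_fun [set: OM] V by exact: measurable_int hV.
have hV' : P.-integrable [set: Omega] V.
  apply/integrableP; split.
    by apply: measurable_wrt_meas; apply/measurable_wrtP.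
  move/integrableP : hV => [_].
  rewrite (_ : (\int[restr]_x _)%E = (\int[pushforward P (idfun : Omega -> OM)]_x
    `|V x|)%E) //.
  by rewrite (ge0_integral_pushforward idM)//; exact: measurableT_comp.
exists V; split => //.
- exact/measurable_wrtP.
- by move=> w; exact: Radon_Nikodym_fin_num.
move=> A mA.
rewrite -[RHS]/(nu A) (Radon_Nikodym_integral dom) ?measurable_OM//.
rewrite [RHS](_ : _ = (\int[pushforward P (idfun : Omega -> OM)]_(x in A)
    V x)%E) //.
rewrite (integral_pushforward idM) ?measurable_OM//.
by apply: (integrableS measurableT) => //; exact: subM.
Qed.
End charge_of.

Lemma cond_exp f : L1 f -> exists V : Omega -> R,
  [/\ measurable_wrt M V, L1 V &
    forall A, M A -> Ex (fun w => \1_A w * V w) = Ex (fun w => \1_A w * f w)].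
Proof.
move=> hf; have [V [mV hV Vfin VE]] := cond_exp_integrable hf.
have VV : EFin \o (fine \o V) = V by apply/funext => w /=; rewrite fineK.
have hV' : L1 (fine \o V).
  by change (P.-integrable setT (EFin \o (fine \o V))); rewrite VV.
exists (fine \o V); split => //.
  apply/measurable_wrtP/measurableT_comp => //; exact/measurable_wrtP.
move=> A MA; apply: EFin_inj; rewrite -!Ex_setE//; [|exact: subM..].
by rewrite -VE//; apply: eq_integral => w _ /=; rewrite fineK.
Qed.

(** The negative part is tested on the event where [f] is negative, which itself belongs to [M]. *)
Lemma ae_ge0_of_sets f : measurable_wrt M f -> L1 f ->
  (forall A, M A -> 0 <= Ex (fun w => \1_A w * f w)) -> {ae P, forall w, 0 <= f w}.
Proof.
move=> Mf hf fA.
pose A := [set w | f w < 0].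
have MA : M A.
  have := Mf `]-oo, 0[%classic (measurable_itv _).
  by congr M; apply/seteqP; split => w; rewrite /A/= in_itv.
have mA := subM MA.
have h : {ae P, forall w, - (\1_A w * f w) = 0}.
  apply: (Ex_eq0 Pcomplete).
  - apply: aeW => w; rewrite indicE; have [|_] := boolP (w \in A).
      by rewrite inE /A/= mul1r oppr_ge0 => /ltW.
    by rewrite mul0r oppr0.
  - exact/L1N/L1M_ind.
  - by rewrite ExN ?oppr_le0 ?fA//; exact: L1M_ind.
apply: filterS h => w; rewrite leNgt => h; apply/negP => fw.
by move: h; rewrite indicE mem_set//; rewrite mul1r; lra.
Qed.

Lemma ae_eq_of_sets f g : measurable_wrt M f -> measurable_wrt M g -> L1 f -> L1 g ->
  (forall A, M A -> Ex (fun w => \1_A w * f w) = Ex (fun w => \1_A w * g w)) ->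
  {ae P, forall w, f w = g w}.
Proof.
move=> Mf Mg hf hg fg.
have H u v : measurable_wrt M u -> measurable_wrt M v -> L1 u -> L1 v ->
  (forall A, M A -> Ex (fun w => \1_A w * u w) = Ex (fun w => \1_A w * v w)) ->
  {ae P, forall w, u w <= v w}.
  move=> Mu Mv hu hv uv.
  have : {ae P, forall w, 0 <= v w - u w}.
    apply: ae_ge0_of_sets; last 2 first.
    - exact: L1B.
    - move=> A MA; rewrite (_ : (fun _ => _) = fun w => \1_A w * v w - \1_A w * u w).
        by rewrite ExB ?uv ?subrr//; apply: L1M_ind => //; exact: subM.
      by apply/funext => w; rewrite mulrBr.
    - by apply/measurable_wrtP/measurable_funB; exact/measurable_wrtP.
  by apply: filterS => w; rewrite subr_ge0.
have h1 := H _ _ Mf Mg hf hg fg.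
have h2 := H _ _ Mg Mf hg hf (fun A MA => esym (fg A MA)).
by apply: filterS2 h1 h2 => w a b; apply/eqP; rewrite eq_le a b.
Qed.

(** Counting the integers from 1 to [n] that do not exceed [y] recovers [y] up to its fractional
    part; this is the layer-cake approximation used for weights. *)
Lemma sum_thresholds (y : R) n : 0 <= y -> y <= n%:R ->
  `|y - \sum_(k < n) ((k.+1%:R <= y)%R)%:R| <= 1.
Proof.
move=> y0; elim: n => [|n IH] yn.
  by rewrite big_ord0 (_ : y = 0) ?subr0 ?normr0 //; apply/eqP; rewrite eq_le yn y0.
rewrite big_ord_recr /=; have [yn'|yn'] := leP y n%:R.
  rewrite (_ : n.+1%:R <= y = false) ?addr0 ?IH//.
  by apply/negbTE; rewrite -ltNge (le_lt_trans yn')// ltr_nat.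
have -> : \sum_(k < n) (((k.+1%:R <= y)%R)%:R : R) = n%:R.
  rewrite (eq_bigr (fun=> 1)) ?sumr_const ?card_ord// => k _.
  by rewrite (le_trans _ (ltW yn')) // ler_nat.
rewrite -natr1 in yn *; case: (lerP (n%:R + 1) y) => h; rewrite /= ?mulr1n ?mulr0n ler_norml; apply/andP; split; lra.
Qed.

(** An inequality tested on events extends to adapted weights: up to [1/(n+1)], [a] is uniformly an
    average of indicators of its level sets, which lie in [M]. This is how conditional probabilities
    can later stand in for events. *)
Lemma weight_ge0 (a g : Omega -> R) : L1 g ->
  (forall B, M B -> 0 <= Ex (fun w => \1_B w * g w)) ->
  measurable_wrt M a -> (forall w, 0 <= a w <= 1) ->
  0 <= Ex (fun w => a w * g w).
Proof.
move=> hg gB Ma a01.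
pose A n k := [set w | k.+1%:R <= n.+1%:R * a w].
have MA n k : M (A n k).
  have := Ma `[k.+1%:R / n.+1%:R, +oo[%classic (measurable_itv _).
  congr M; apply/seteqP; split => w; rewrite /A/= in_itv/= andbT ler_pdivrMr ?ltr0n//.
    by rewrite mulrC.
  by rewrite mulrC.
pose b n w : R := n.+1%:R^-1 * \sum_(k < n.+1) \1_(A n k) w.
have ab n w : `|a w - b n w| <= n.+1%:R^-1.
  have /andP[a0 a1] := a01 w.
  have := @sum_thresholds (n.+1%:R * a w) n.+1 (mulr_ge0 (ler0n _ _) a0).
  rewrite -[X in _ <= X]mulr1 ler_wpM2l// => /(_ isT) H.
  rewrite (_ : a w - b n w = n.+1%:R^-1 * (n.+1%:R * a w - \sum_(k < n.+1) \1_(A n k) w)).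
    rewrite normrM ger0_norm// -[leRHS]mulr1 ler_wpM2l//.
    rewrite (eq_bigr (fun k : 'I__ => ((k.+1%:R <= n.+1%:R * a w)%R)%:R)) // => k _.
    rewrite indicE; congr (_ %:R); congr nat_of_bool.
    by apply/idP/idP; rewrite inE.
  by rewrite mulrBr mulrA mulVf ?mul1r// pnatr_eq0.
have ma : measurable_fun setT a by exact: measurable_wrt_meas Ma.
have hag : L1 (fun w => a w * g w).
  apply: (L1M_bnd ma (M := 1)) => // w; have /andP[a0 a1] := a01 w.
  by rewrite ger0_norm.
have hAg n k : L1 (fun w => \1_(A n k) w * g w) by apply: L1M_ind => //; exact: subM.
have bE n : (fun w => b n w * g w) =
    fun w => n.+1%:R^-1 * \sum_(k < n.+1) (\1_(A n k) w * g w).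
  by apply/funext => w; rewrite /b -mulrA mulr_suml.
have hbg n : L1 (fun w => b n w * g w).
  by rewrite bE; apply/L1Z/L1_sum => k _; exact: hAg.
have b0 n : 0 <= Ex (fun w => b n w * g w).
  rewrite bE ExZ; last by apply: L1_sum => k _; exact: hAg.
  rewrite mulr_ge0// Ex_sum; last by move=> k _; exact: hAg.
  by apply: sumr_ge0 => k _; exact: gB.
(* The approximation error is at most the mean of [|g|] over [n+1]; the integral of the
   approximation itself is nonnegative. *)
have H n : - (n.+1%:R^-1 * Ex (fun w => `|g w|)) <= Ex (fun w => a w * g w).
  have -> : Ex (fun w => a w * g w) =
      Ex (fun w => (a w - b n w) * g w) + Ex (fun w => b n w * g w).
    rewrite -ExD//; first by congr Ex; apply/funext => w; rewrite mulrBl subrK.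
    by apply: eq_L1 (L1B hag (hbg n)) => w; rewrite mulrBl.
  rewrite -[leLHS]addr0 lerD// -ExZ; last exact: L1_norm.
  rewrite -ExN; last exact/L1Z/L1_norm.
  apply: (Ex_le Pcomplete).
  - apply: aeW => w; rewrite lerNl (le_trans _ (ler_wpM2r _ (ab n w)))//.
    by rewrite -normrM -normrN ler_norm.
  - exact/L1N/L1Z/L1_norm.
  - by apply: eq_L1 (L1B hag (hbg n)) => w; rewrite mulrBl.
rewrite leNgt; apply/negP => neg.
have G0 : 0 <= Ex (fun w => `|g w|) by apply: (Ex_ge0 Pcomplete); [exact: aeW|exact: L1_norm].
set G := Ex (fun w => `|g w|) in H G0; set e := Ex _ in neg H.
have [n nG] : exists n, G / - e < n.+1%:R.
  exists (Num.truncn (G / - e)); exact: truncnS_gt.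
move: nG; rewrite ltr_pdivrMr ?oppr_gt0// mulrC => h.
have : n.+1%:R^-1 * G < - e by rewrite mulrC ltr_pdivrMr ?ltr0n.
have := H n; rewrite lerNl => h1 h2; have := lt_le_trans h2 h1; by rewrite ltxx.
Qed.

Lemma weight_eq0 (a g : Omega -> R) : L1 g ->
  (forall B, M B -> Ex (fun w => \1_B w * g w) = 0) ->
  measurable_wrt M a -> (forall w, 0 <= a w <= 1) ->
  Ex (fun w => a w * g w) = 0.
Proof.
move=> hg gB Ma a01.
have ma : measurable_fun setT a by exact: measurable_wrt_meas Ma.
have hag : L1 (fun w => a w * g w).
  apply: (L1M_bnd ma (M := 1)) => // w; have /andP[a0 a1] := a01 w.
  by rewrite ger0_norm.
apply/eqP; rewrite eq_le; apply/andP; split; last first.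
  by apply: weight_ge0 => // B MB; rewrite gB.
rewrite -oppr_ge0 -ExN//.
rewrite (_ : (fun _ => _) = fun w => a w * (fun w => - g w) w); last first.
  by apply/funext => w; rewrite mulrN.
apply: weight_ge0 => //; first exact: L1N.
move=> B MB; rewrite (_ : (fun _ => _) = fun w => - (\1_B w * g w)); last first.
  by apply/funext => w; rewrite mulrN.
by rewrite ExN ?gB ?oppr0//; apply: L1M_ind => //; exact: subM.
Qed.

(** [Z] is truncated at [n+1], the truncation is mapped affinely into [[0, 1]] so that the bounded
    case applies, and [K |Z|] dominates the passage to the limit. *)
Lemma weight_eq0_unbounded (Z h : Omega -> R) (K : R) : L1 Z -> measurable_wrt M Z ->
  measurable_fun setT h -> (forall w, `|h w| <= K) ->
  (forall B, M B -> Ex (fun w => \1_B w * h w) = 0) -> Ex (fun w => Z w * h w) = 0.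
Proof.
move=> hZ MZ mh hK hB.
have hh : L1 h by exact: L1_bnd hK.
pose Zn n w : R := Num.max (- n.+1%:R) (Num.min n.+1%:R (Z w)).
have MZn n : measurable_wrt M (Zn n).
  apply/measurable_wrtP/measurable_maxr => //; apply: measurable_minr => //.
  exact/measurable_wrtP.
have mZn n : measurable_fun setT (Zn n) by exact: measurable_wrt_meas.
have Znb n w : - n.+1%:R <= Zn n w <= n.+1%:R.
  have n0 : 0 <= n.+1%:R :> R by exact: ler0n.
  rewrite /Zn le_max lexx /= ge_max ge_min lexx andbT /=.
  by rewrite (le_trans _ n0)// oppr_le0.
have Zn0 n : Ex (fun w => Zn n w * h w) = 0.
  have n0 : 0 < n.+1%:R :> R by exact: ltr0n.
  pose a w := (Zn n w + n.+1%:R) / (2 * n.+1%:R).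
  have : Ex (fun w => a w * h w) = 0.
    apply: weight_eq0 => //.
      apply/measurable_wrtP; apply: measurable_funM => //.
      by apply: measurable_funD => //; exact/measurable_wrtP.
    move=> w; have := Znb n w; rewrite /a => /andP[? ?].
    rewrite divr_ge0 ?ler_pdivrMr; nra.
  have hZh : L1 (fun w => Zn n w * h w).
    by apply: (@L1M_bnd _ _ _ _ _ _ n.+1%:R) => // w; rewrite ler_norml Znb.
  rewrite (_ : (fun _ => _) = fun w => (2 * n.+1%:R)^-1 * (Zn n w * h w) + 2^-1 * h w); last first.
    by apply/funext => w; rewrite /a; field; lra.
  rewrite ExD ?ExZ //; [|exact: L1Z|exact: L1Z].
  have := hB _ saT; rewrite (_ : (fun _ => _) = h); last first.
    by apply/funext => w; rewrite indicT mul1r.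
  move=> ->; rewrite mulr0 addr0 => /eqP; rewrite mulf_eq0 invr_eq0 => /orP[/eqP|/eqP//].
  by lra.
have [] := @Ex_dct _ _ _ P Pcomplete (fun n w => Zn n w * h w) (fun w => Z w * h w)
  (fun w => K * `|Z w|).
- by move=> n; exact: measurable_funM.
- apply: aeW => w; apply: cvgM; last exact: cvg_cst.
  apply: cvg_near_cst; near=> n; rewrite /Zn.
  have : `|Z w| < n.+1%:R.
    near: n; exists (Num.truncn `|Z w|) => // n /= nZ.
    by rewrite (lt_le_trans (truncnS_gt _))// ler_nat.
  by rewrite ltr_norml => /andP[/ltW ? /ltW ?]; rewrite min_r// max_r.
- exact/L1Z/L1_norm.
- apply: aeW => w n; rewrite normrM mulrC ler_pM//.
  have n0 : 0 <= n.+1%:R :> R by exact: ler0n.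
  rewrite /Zn; case: (leP n.+1%:R (Z w)) => Zw.
    rewrite max_r ?(le_trans _ n0) ?oppr_le0//.
    by rewrite ger0_norm// (le_trans Zw)// ler_norm.
  case: (leP (- n.+1%:R) (Z w)) => Zw' //.
  by rewrite normrN ger0_norm// -normrN ler_normr; apply/orP; left; lra.
rewrite (_ : (fun n => Ex (fun w => Zn n w * h w)) = fun=> 0); last first.
  by apply/funext => n; rewrite Zn0.
move=> _ H; rewrite -(cvg_lim (@Rhausdorff R) H) lim_cst//.
Unshelve. all: by end_near.
Qed.

(** Needed for a payoff whose mean might be infinite: finiteness of the mean total profit is a
    consequence of the value equation, and cannot be used to form the conditional expectation that
    proves it. *)
Lemma cond_exp_ge0 (U : Omega -> \bar R) : measurable_fun setT U ->
  (forall w, (0 <= U w)%E) ->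
  exists2 V, is_cond_expectation P M U V & forall w, (0 <= V w)%E.
Proof.
move=> mU U0.
pose Un n w := fine (mine (U w) n%:R%:E).
have Un_fin n w : mine (U w) n%:R%:E \is a fin_num.
  rewrite fin_numElt (lt_le_trans ltNy0) ?le_min ?U0 ?lee_fin//=.
  by rewrite gt_min ltry orbT.
have UnE n w : (Un n w)%:E = mine (U w) n%:R%:E by rewrite /Un fineK.
have Un0 n w : 0 <= Un n w by rewrite -lee_fin UnE le_min U0 lee_fin /=.
have mUn n : measurable_fun setT (Un n).
  by apply/measurableT_comp => //; exact: measurable_mine.
have hUn n : L1 (Un n).
  apply: (@L1_bnd _ _ _ _ _ n%:R) => // w; rewrite ger0_norm//.
  by rewrite -lee_fin UnE ge_min lexx orbT.
have /choice[V_ HV] n := cond_exp (hUn n).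
have V0 n : {ae P, forall w, 0 <= V_ n w}.
  have [MV hV VE] := HV n; apply: ae_ge0_of_sets => // A MA; rewrite VE//.
  apply: (Ex_ge0 Pcomplete); last by apply: L1M_ind => //; exact: subM.
  by apply: aeW => w; rewrite mulr_ge0// indic_ge0.
have Vnd n : {ae P, forall w, V_ n w <= V_ n.+1 w}.
  have [MV hV VE] := HV n; have [MV' hV' VE'] := HV n.+1.
  have : {ae P, forall w, 0 <= V_ n.+1 w - V_ n w}.
    apply: ae_ge0_of_sets => //.
    - by apply/measurable_wrtP; apply: measurable_funB; exact/measurable_wrtP.
    - exact: L1B.
    - move=> A MA; have mA := subM MA.
      rewrite (_ : (fun _ => _) = fun w => \1_A w * V_ n.+1 w - \1_A w * V_ n w); last first.
        by apply/funext => w; rewrite mulrBr.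
      rewrite ExB ?VE ?VE' ?subr_ge0//; [|exact: L1M_ind|exact: L1M_ind].
      apply: (Ex_le Pcomplete); [|exact: L1M_ind|exact: L1M_ind].
      apply: aeW => w; rewrite ler_wpM2l ?indic_ge0// -lee_fin !UnE le_min2//.
      by rewrite lee_fin ler_nat.
  by apply: filterS => w; rewrite subr_ge0.
(* The versions [V_] increase only almost everywhere. Running maxima started from 0 increase
   everywhere, so their limit needs no exceptional set; the start shifts the index by one. *)
pose W_ := fix W_ n w := if n is m.+1 then Num.max (W_ m w) (V_ m w) else 0.
have W0 n w : 0 <= W_ n w.
  by case: n => // n; elim: n => [|n IH] /=; rewrite le_max ?lexx// IH.
have Wnd w : {homo W_^~ w : n m / (n <= m)%N >-> n <= m}.
  apply: homo_leq => [x|y x z|n]; [exact: lexx|exact: le_trans|].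
  by rewrite /= le_max lexx.
have MW n : measurable_wrt M (W_ n).
  elim: n => [|n IH]; apply/measurable_wrtP; first exact: measurable_cst.
  apply: measurable_maxr; first exact/measurable_wrtP.
  by apply/measurable_wrtP; have [] := HV n.
have WV n : {ae P, forall w, W_ n.+1 w = V_ n w}.
  have /ae_foralln V0' := V0; have /ae_foralln Vnd' := Vnd.
  apply: filterS2 V0' Vnd' => w h0 hn.
  elim: n => [|n IH]; first by rewrite /= max_r.
  by rewrite [LHS]/= -[Num.max (W_ n w) _]/(W_ n.+1 w) IH max_r.
pose V w := limn (fun n => (W_ n w)%:E).
have cV w : (W_ n w)%:E @[n --> \oo] --> V w.
  by apply: ereal_nondecreasing_is_cvgn => n m nm; rewrite lee_fin Wnd.
exists V; last first.
  by move=> w; apply: lime_ge; [exact: cV|apply: nearW => n; rewrite lee_fin].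
split.
  apply/measurable_wrtP; apply: (@emeasurable_fun_cvg _ OM R setT (fun n (w : OM) => (W_ n w)%:E)).
    by move=> n; apply/measurable_EFinP/measurable_wrtP.
  by move=> w _; exact: cV.
move=> A MA; have mA := subM MA.
have mWn n : measurable_fun setT (W_ n) by exact: measurable_wrt_meas.
rewrite (monotone_convergence P mA (g' := fun n w => (W_ n w)%:E)); first last.
- by move=> w _ n m nm; rewrite lee_fin Wnd.
- by move=> n w _; rewrite lee_fin.
- by move=> n; apply/measurable_EFinP/measurable_funTS.
have UE w : U w = limn (fun n => (Un n w)%:E).
  apply/esym/cvg_lim => //; case: (U w) (U0 w) (UnE ^~ w) => [r| |//] r0 UnE'.
    apply: cvg_near_cst; near=> n; rewrite UnE' min_l// lee_fin.
    have : r < n%:R.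
      near: n; exists (Num.truncn r).+1 => // n /= nr.
      by rewrite (lt_le_trans (truncnS_gt _))// ler_nat.
    exact: ltW.
  under eq_fun do rewrite UnE' min_r ?leey//.
  by apply/cvgenyP; exact: cvg_id.
rewrite (eq_integral (fun w => limn (fun n => (Un n w)%:E))); last by move=> w _; exact: UE.
rewrite (monotone_convergence P mA (g' := fun n w => (Un n w)%:E)); first last.
- by move=> w _ n m nm; rewrite !UnE le_min2// lee_fin ler_nat.
- by move=> n w _; rewrite lee_fin.
- by move=> n; apply/measurable_EFinP/measurable_funTS.
have cW : cvgn (fun n => \int[P]_(w in A) (W_ n w)%:E)%E.
  apply: ereal_nondecreasing_is_cvgn => n m nm; apply: ge0_le_integral => //.
  - by move=> w _; rewrite lee_fin.
  - by apply/measurable_EFinP/measurable_funTS.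
  - by apply/measurable_EFinP/measurable_funTS.
  - by move=> w _; rewrite lee_fin Wnd.
apply/esym/cvg_lim => //.
have : (fun n => \int[P]_(w in A) (W_ n w)%:E)%E @ \oo -->
  limn (fun n => \int[P]_(w in A) (W_ n w)%:E)%E := cW.
rewrite -cvg_shiftS; apply: cvg_trans; apply: near_eq_cvg; apply: nearW => n.
have [MV hV VE] := HV n.
rewrite Ex_setE// -VE// -Ex_setE//; apply: ae_eq_integral => //.
- by apply/measurable_EFinP/measurable_funTS; first [exact: mWn|exact: L1_meas hV].
- by apply/measurable_EFinP/measurable_funTS; first [exact: mWn|exact: L1_meas hV].
- by apply: filterS (WV n) => w -> _.
Unshelve. all: by end_near.
Qed.

End SubSigmaAlgebra.

(** * Filtrations and stopping times *)

Section Filtration.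
Context {R : realType} {d : measure_display} {Omega : measurableType d}.
Variables (P : probability Omega R) (F : R -> set (set Omega)).
Hypothesis hF : complete_right_continuous_filtration P F.
Local Notation L1 := (L1 P).
Local Notation Ex := (Ex P).
Local Notation LF := (left_filtration F).

Lemma filt_sa t : 0 <= t -> sigma_algebra setT (F t).
Proof. by case: hF => h _ _ _ _; exact: h. Qed.
Lemma filt_meas t : 0 <= t -> F t `<=` measurable.
Proof. by case: hF => _ h _ _ _; exact: h. Qed.
Lemma filt_mono s t : 0 <= s -> s <= t -> F s `<=` F t.
Proof. by case: hF => _ _ h _ _; exact: h. Qed.
Lemma filt_null N : P.-negligible N -> F 0 N.
Proof. by case: hF => _ _ _ _ h; exact: h. Qed.
Lemma filt_complete : measure_is_complete P.
Proof. by move=> N /filt_null; exact: filt_meas. Qed.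
Local Notation Pc := filt_complete.

Lemma left_sa t : 0 <= t -> sigma_algebra setT (LF t).
Proof.
by rewrite /left_filtration; case: ifP => _ _; [exact: smallest_sigma_algebra|exact: filt_sa].
Qed.

Lemma left_sub t : 0 <= t -> LF t `<=` F t.
Proof.
move=> t0; rewrite /left_filtration; case: ifPn => [tpos|].
  apply: smallest_sub; first exact: filt_sa.
  move=> A [s /=]; rewrite in_itv/= => /andP[s0 /ltW st]; exact: filt_mono.
by rewrite -leNgt => tn; apply: filt_mono.
Qed.

Lemma sub_left s t : 0 <= s -> s < t -> F s `<=` LF t.
Proof.
move=> s0 st A FA; rewrite /left_filtration (le_lt_trans s0 st).
by apply: sub_sigma_algebra; exists s => //=; rewrite in_itv/= s0.
Qed.

Lemma left_meas t : 0 <= t -> LF t `<=` measurable.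
Proof. by move=> t0 A /(left_sub t0); exact: filt_meas. Qed.

Lemma left_mono s t : 0 <= s -> s <= t -> LF s `<=` LF t.
Proof.
move=> s0; rewrite le_eqVlt => /predU1P[->//|st] A /(left_sub s0).
exact: sub_left.
Qed.

Lemma st_lt theta t : stopping_time F theta -> 0 <= t ->
  LF t [set w | (theta w < t%:E)%E].
Proof.
move=> [th0 th] t0; have sa := left_sa t0.
(* A strict inequality is a countable union of weak ones at earlier times; the first conjunct
   discards the times [t - 1/(n+1)] that are negative. *)
rewrite (_ : [set _ | _] = \bigcup_n [set w | 0 <= t - n.+1%:R^-1 /\
    (theta w <= (t - n.+1%:R^-1)%:E)%E]); last first.
  apply/seteqP; split => w /=.
    case E : (theta w) (th0 w) => [r| |] //=; rewrite ?lte_fin ?lee_fin.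
    move=> r0 rt.
    have rt' : 0 < t - r by rewrite subr_gt0.
    exists (Num.truncn (t - r)^-1) => //=; rewrite E lee_fin.
    have h : (Num.truncn (t - r)^-1).+1%:R^-1 <= t - r.
      rewrite -[leRHS]invrK lef_pV2 ?posrE ?invr_gt0 ?ltr0n//.
      exact/ltW/truncnS_gt.
    by move: h; set u := _^-1; split; lra.
  move=> [n _] /= [_] /le_lt_trans; apply; rewrite lte_fin.
  by rewrite ltrBlDr ltrDl invr_gt0 ltr0n.
apply: (sa_bigcup sa) => n.
have [h|h] := leP 0 (t - n.+1%:R^-1).
  rewrite (_ : [set _ | _] = [set w | (theta w <= (t - n.+1%:R^-1)%:E)%E]).
    apply: (@left_mono (t - n.+1%:R^-1)) => //; last exact: th.
    by rewrite lerBlDr lerDl.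
  by apply/seteqP; split => w //= [].
rewrite (_ : [set _ | _] = set0); first exact: sa0 sa.
by apply/seteqP; split => w //= [].
Qed.

Lemma st_meas theta : stopping_time F theta -> measurable_fun setT theta.
Proof.
move=> [th0 th].
apply: (measurability _ (ErealGenInftyO.measurableE R)) => // _ [_ [x ->] <-].
rewrite setTI; have [x0|x0] := leP 0 x.
  apply: (left_meas x0); have := st_lt (conj th0 th) x0.
  by congr (LF x _); apply/seteqP; split => w /=; rewrite in_itv.
rewrite (_ : _ @^-1` _ = set0)//; apply/seteqP; split => w //=.
rewrite in_itv/= => h; have := le_lt_trans (th0 w) h.
by rewrite lte_fin => /(lt_trans x0); rewrite ltxx.
Qed.

Lemma st_max s t : stopping_time F s -> stopping_time F t ->
  stopping_time F (fun w => maxe (s w) (t w)).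
Proof.
move=> hs ht; split => [w|u u0]; first by rewrite le_max hs.1.
have := saI (left_sa u0) (hs.2 u u0) (ht.2 u u0).
by congr (LF u _); apply/seteqP; split => w /=; rewrite ge_max => /andP.
Qed.

Lemma st_min s t : stopping_time F s -> stopping_time F t ->
  stopping_time F (fun w => mine (s w) (t w)).
Proof.
move=> hs ht; split => [w|u u0]; first by rewrite le_min hs.1 ht.1.
have := saU (left_sa u0) (hs.2 u u0) (ht.2 u u0).
by congr (LF u _); apply/seteqP; split => w /=; rewrite ge_min => /orP.
Qed.

Lemma st_cst (x : \bar R) : (0 <= x)%E -> stopping_time F (fun=> x).
Proof.
move=> x0; split => // u u0; have sa := left_sa u0.
have [h|h] := boolP (x <= u%:E)%E.
  by rewrite (_ : [set _ | _] = setT); [exact: saT sa|apply/seteqP; split].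
by rewrite (_ : [set _ | _] = set0); [exact: sa0 sa|apply/seteqP; split].
Qed.

Definition cell (n k : nat) (u : \bar R) : bool :=
  ((k%:R / n.+1%:R)%:E <= u < (k.+1%:R / n.+1%:R)%:E)%E.

Definition tick (n k : nat) : R := k.+1%:R / n.+1%:R.

(* Strict rounding up to the grid of mesh 1 / (n + 1), with value +oo beyond the
   horizon n + 1. *)
Definition roundup (n : nat) (u : \bar R) : \bar R :=
  if (u < n.+1%:R%:E)%E then (tick n (Num.truncn (fine u * n.+1%:R)))%:E else +oo%E.

Lemma cellP n k (u : \bar R) : (0 <= u)%E -> cell n k u ->
  [/\ (u < (tick n k)%:E)%E, fine u - n.+1%:R^-1 <= fine u &
   Num.truncn (fine u * n.+1%:R) = k].
Proof.
move=> u0 /andP[]; case: u u0 => [u| |]//; rewrite lee_fin => u0.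
rewrite lee_fin lte_fin => h1 h2; split => //=.
  by rewrite lerBlDr lerDl.
apply: truncn_def; move: h1 h2; rewrite ler_pdivrMr ?ltr0n// ltr_pdivlMr ?ltr0n//.
by move=> -> ->.
Qed.

Lemma cell_truncn n (u : \bar R) : (0 <= u)%E -> (u < n.+1%:R%:E)%E ->
  cell n (Num.truncn (fine u * n.+1%:R)) u /\
  (Num.truncn (fine u * n.+1%:R) < n.+1 * n.+1)%N.
Proof.
case: u => [u| |]//; rewrite lee_fin lte_fin => u0 un /=.
have h0 : 0 <= u * n.+1%:R by rewrite mulr_ge0.
have /andP[h1 h2] := truncn_itv h0; split.
  by rewrite /cell lee_fin lte_fin ler_pdivrMr ?ltr0n// ltr_pdivlMr ?ltr0n// h1.
rewrite -(ltr_nat R) natrM (le_lt_trans h1)// ltr_pM2r// ltr0n//.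
Qed.

(** This reduces a random time to finitely many deterministic ones: a mesh of [1/(n+1)] up to the
    horizon [n+1] has [(n+1)^2] cells, and everything beyond is sent to [+oo]. *)
Lemma roundup_sum n (G : \bar R -> R) u : (0 <= u)%E ->
  G (roundup n u) = \sum_(k < n.+1 * n.+1) (cell n k u)%:R * G (tick n k)%:E +
                    ((n.+1%:R%:E <= u)%E)%:R * G +oo%E.
Proof.
move=> u0; rewrite /roundup; case: ltP => un /=.
  have [c kn] := cell_truncn u0 un.
  rewrite mul0r addr0 (bigD1 (Ordinal kn))//= c mul1r big1 ?addr0// => i /eqP ik.
  case: (boolP (cell n i u)) => [|_]; last by rewrite mul0r.
  by move=> /(cellP u0)[_ _ h]; exfalso; apply: ik; exact: val_inj.
rewrite mul1r big1 ?add0r// => i _; case: (boolP (cell n i u)) => [|_]; last by rewrite mul0r.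
move=> /andP[_ h]; have := le_lt_trans un h.
rewrite lte_fin ltr_pdivlMr ?ltr0n// -natrM ltr_nat ltnNge.
by rewrite (ltn_ord i).
Qed.

Lemma roundup_ge n u : (0 <= u)%E -> (u <= roundup n u)%E.
Proof.
move=> u0; rewrite /roundup; case: ifPn => [un|_]; last exact: leey.
by have [/(cellP u0)[/ltW]] := cell_truncn u0 un.
Qed.

Lemma tick_gt0 n k : 0 < tick n k.
Proof. by rewrite divr_gt0 ?ltr0n. Qed.

Lemma roundup_cvg u : (0 <= u)%E -> roundup n u @[n --> \oo] --> u.
Proof.
case: u => [u| |]// u0; last first.
  rewrite (_ : roundup^~ +oo%E = cst +oo%E); first exact: cvg_cst.
  by apply/funext => n; rewrite /roundup ltNge leey.
rewrite lee_fin in u0.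
have H : (u + harmonic n) @[n --> \oo] --> u.
  by rewrite -[X in _ --> X]addr0; apply: cvgD; [exact: cvg_cst|exact: cvg_harmonic].
have H' : (fun n => (u + harmonic n)%:E) @ \oo --> u%:E.
  by apply/fine_cvgP; split => //; exact: nearW.
apply: (squeeze_cvge _ (cvg_cst u%:E) H'); near=> n.
rewrite roundup_ge ?lee_fin//= /roundup lte_fin.
have -> : u < n.+1%:R.
  near: n; exists (Num.truncn u) => // n /= nu.
  by rewrite (lt_le_trans (truncnS_gt _))// ler_nat.
rewrite lee_fin /tick -natr1 mulrDl mul1r /harmonic /= lerD2r.
rewrite ler_pdivrMr ?ltr0n//; have : 0 <= u * n.+1%:R by rewrite mulr_ge0.
by move=> /truncn_itv/andP[].
Unshelve. all: by end_near.
Qed.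

(** Cells are closed on the left and open on the right, so membership is expressed by strict
    inequalities [theta < t] alone and is known to the left filtration at the end of the cell. *)
Lemma st_cell theta n k : stopping_time F theta ->
  LF (tick n k) [set w | cell n k (theta w)].
Proof.
move=> st; have t0 := ltW (tick_gt0 n k); have sa := left_sa t0.
have k0 : 0 <= k%:R / n.+1%:R :> R by rewrite divr_ge0.
have kt : k%:R / n.+1%:R <= tick n k by rewrite ler_pM2r ?invr_gt0 ?ltr0n// ler_nat.
have := saI sa (saC sa (left_mono k0 kt (st_lt st k0))) (st_lt st t0).
congr (LF _ _); apply/seteqP; split => w /=.
  by move=> [/negP]; rewrite -leNgt /cell => -> ->.
by move=> /andP[h1 h2]; split => //; apply/negP; rewrite -leNgt.
Qed.

Lemma roundup_st theta n : stopping_time F theta ->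
  stopping_time F (fun w => roundup n (theta w)).
Proof.
move=> st; split => [w|t t0].
  exact: (le_trans (st.1 w) (roundup_ge _ (st.1 w))).
have sa := left_sa t0.
rewrite (_ : [set _ | _] = \bigcup_k [set w | tick n k <= t /\
   ((theta w < n.+1%:R%:E)%E /\ cell n k (theta w))]); last first.
  apply/seteqP; split => w /=.
    rewrite /roundup; case: ifPn => // un; rewrite lee_fin => h.
    have [c _] := cell_truncn (st.1 w) un.
    by exists (Num.truncn (fine (theta w) * n.+1%:R)).
  move=> [k _] /= [kt [un /(cellP (st.1 w))[_ _ h]]].
  by rewrite /roundup un h lee_fin.
apply: (sa_bigcup sa) => k; have [kt|kt] := leP (tick n k) t; last first.
  by rewrite (_ : [set _ | _] = set0); [exact: sa0 sa|apply/seteqP; split => w //= []].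
have [nt|nt] := ltnP k (n.+1 * n.+1).
  rewrite (_ : [set _ | _] = [set w | cell n k (theta w)]).
    by apply: (left_mono (ltW (tick_gt0 n k)) kt); exact: st_cell.
  apply/seteqP; split => w /=; first by case=> _ [].
  move=> c; split => //; split => //; have /andP[_ h2] := c; apply: (lt_le_trans h2).
  by rewrite lee_fin ler_pdivrMr ?ltr0n// -natrM ler_nat.
rewrite (_ : [set _ | _] = set0); first exact: sa0 sa.
apply/seteqP; split => w //= [_ [h1 /andP[h2 _]]].
have := le_lt_trans h2 h1; rewrite lte_fin ltr_pdivrMr ?ltr0n// -natrM ltr_nat.
by rewrite ltnNge nt.
Qed.

End Filtration.

(** * Snell envelopes *)

Lemma indic_bool {R : realType} (T : Type) (b : T -> bool) w :
  \1_[set w | b w] w = (b w)%:R :> R.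
Proof. by rewrite indicE; congr (nat_of_bool _)%:R; apply/idP/idP; rewrite inE. Qed.

(** * Processes evaluated at stopping times *)

Section GoodProcess.
Context {R : realType} {d : measure_display} {Omega : measurableType d}.
Variables (P : probability Omega R) (F : R -> set (set Omega)).
Hypothesis hF : complete_right_continuous_filtration P F.
Local Notation L1 := (L1 P).
Local Notation Ex := (Ex P).
Let Pc := filt_complete hF.

(** The time index includes [+oo]. Continuity along sequences and one integrable bound for all times
    are what dominated convergence needs to replace a stopping time by its roundings. *)
Definition regular (Z : \bar R -> Omega -> R) : Prop :=
  [/\ forall u, (0 <= u)%E -> measurable_fun setT (Z u),
      {ae P, forall w, forall (u_ : nat -> \bar R) u, (forall n, (0 <= u_ n)%E) ->
         u_ n @[n --> \oo] --> u -> Z (u_ n) w @[n --> \oo] --> Z u w}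
    & exists2 g, L1 g & {ae P, forall w, forall u, (0 <= u)%E -> `|Z u w| <= g w}].

Section regular.
Variable Z : \bar R -> Omega -> R.
Hypothesis hZ : regular Z.

Lemma roundup_meas theta n : stopping_time F theta ->
  measurable_fun setT (fun w => Z (roundup n (theta w)) w).
Proof.
move=> st; have [mZ _ _] := hZ; have mth := st_meas hF st.
rewrite (_ : (fun w => _) = fun w => \sum_(k < n.+1 * n.+1)
    \1_[set w | cell n k (theta w)] w * Z (@tick R n k)%:E w +
    \1_[set w | (n.+1%:R%:E <= theta w)%E] w * Z +oo%E w).
  apply: measurable_funD.
    apply: measurable_sum => k; apply: measurable_funM.
      apply: measurable_indic; apply: (left_meas hF (ltW (tick_gt0 n k))).
      exact: (st_cell hF).
    by apply: mZ; rewrite lee_fin ltW// tick_gt0.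
  apply: measurable_funM; last exact: mZ.
  apply: measurable_indic.
  by have := emeasurable_fun_c_infty measurableT mth n.+1%:R%:E; rewrite setTI.
apply/funext => w; rewrite (roundup_sum n (Z ^~ w) (st.1 w)).
congr (_ + _ * _).
  by apply: eq_bigr => k _; rewrite indic_bool.
by rewrite indic_bool.
Qed.

Lemma regular_meas theta : stopping_time F theta ->
  measurable_fun setT (fun w => Z (theta w) w).
Proof.
move=> st; have [mZ cZ _] := hZ.
apply: (ae_cvg_meas Pc (f_ := fun n w => Z (roundup n (theta w)) w)).
  by move=> n; exact: roundup_meas.
apply: filterS cZ => w; apply => [n|]; last exact/roundup_cvg/st.1.
exact: (le_trans (st.1 w) (roundup_ge _ (st.1 w))).
Qed.

Lemma regular_L1 theta : stopping_time F theta -> L1 (fun w => Z (theta w) w).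
Proof.
move=> st; have [_ _ [g hg gZ]] := hZ.
apply: (L1_dom (regular_meas st) hg); apply: filterS gZ => w; apply; exact: st.1.
Qed.

Lemma regular_Ex_cvg (th_ : nat -> Omega -> \bar R) theta (A : set Omega) :
  (forall n, stopping_time F (th_ n)) -> stopping_time F theta -> measurable A ->
  {ae P, forall w, th_ n w @[n --> \oo] --> theta w} ->
  Ex (fun w => \1_A w * Z (th_ n w) w) @[n --> \oo] -->
  Ex (fun w => \1_A w * Z (theta w) w).
Proof.
move=> st_ st mA th; have [_ cZ [g hg gZ]] := hZ.
have [] // := @Ex_dct _ _ _ P Pc (fun n w => \1_A w * Z (th_ n w) w)
  (fun w => \1_A w * Z (theta w) w) g.
- move=> n; apply: measurable_funM; [exact: measurable_indic|exact: regular_meas].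
- apply: filterS2 cZ th => w cw tw; apply: cvgM; first exact: cvg_cst.
  by apply: cw => // n; exact: (st_ n).1.
- apply: filterS gZ => w gw n; rewrite normrM -[leRHS]mul1r ler_pM//.
    exact: indic_le1.
  by apply: gw; exact: (st_ n).1.
Qed.

End regular.
End GoodProcess.

(** * Snell envelopes at random times *)

Section AbstractSnell.
Context {R : realType} {d : measure_display} {Omega : measurableType d}.
Variables (P : probability Omega R) (F : R -> set (set Omega)).
Hypothesis hF : complete_right_continuous_filtration P F.
Local Notation L1 := (L1 P).
Local Notation Ex := (Ex P).
Let Pc := filt_complete hF.
Variables N S : \bar R -> Omega -> R.
Hypotheses (hN : regular P N) (hS : regular P S).
Hypothesis NSoo : {ae P, forall w, N +oo%E w = S +oo%E w}.
(** The essential supremum enters only through this bound and the next, both at deterministic times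
    and free of conditional expectations; [N] will be the value and [S] the reward, each with past
    profit added. *)
Hypothesis snell_ge : forall t theta A, 0 <= t -> stopping_time_from F t theta ->
  F t A -> Ex (fun w => \1_A w * S (theta w) w) <= Ex (fun w => \1_A w * N t%:E w).
Hypothesis snell_le : forall t e, 0 <= t -> 0 < e ->
  exists2 theta, stopping_time_from F t theta &
    Ex (N t%:E) <= Ex (fun w => S (theta w) w) + e.

Let hNt t : 0 <= t -> L1 (N t%:E).
Proof. by move=> t0; exact: (regular_L1 hF hN (st_cst hF (x := t%:E) _)). Qed.

Let mA0 A : F 0 A -> measurable A. Proof. exact: (filt_meas hF). Qed.

Section Grid.
Variables (sigma : Omega -> \bar R) (n : nat).
Hypothesis st : stopping_time F sigma.
Let E k := [set w | cell n k (sigma w)].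
Let Eoo := [set w | (n.+1%:R%:E <= sigma w)%E].
Let FE k : F (@tick R n k) (E k).
Proof. by apply: (left_sub hF (ltW (tick_gt0 n k))); exact: (st_cell hF). Qed.
Let mE k : measurable (E k).
Proof. exact: (filt_meas hF (ltW (tick_gt0 n k)) (FE k)). Qed.
Let mEoo : measurable Eoo.
Proof.
by have := emeasurable_fun_c_infty measurableT (st_meas hF st) n.+1%:R%:E; rewrite setTI.
Qed.

Lemma Ex_roundup (A : set Omega) (G : \bar R -> Omega -> R) : measurable A ->
  (forall k, L1 (G (@tick R n k)%:E)) -> L1 (G +oo%E) ->
  Ex (fun w => \1_A w * G (roundup n (sigma w)) w) =
  \sum_(k < n.+1 * n.+1) Ex (fun w => \1_(A `&` E k) w * G (@tick R n k)%:E w) +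
  Ex (fun w => \1_(A `&` Eoo) w * G +oo%E w).
Proof.
move=> mA hG hGoo.
have h k : L1 (fun w => \1_(A `&` E k) w * G (@tick R n k)%:E w).
  by apply: L1M_ind => //; exact: measurableI.
rewrite -Ex_sum// -ExD; last 2 first.
- exact: L1_sum.
- by apply: L1M_ind => //; exact: measurableI.
congr Ex; apply/funext => w; rewrite (roundup_sum n (G ^~ w) (st.1 w)).
rewrite mulrDr mulr_sumr; congr (_ + _).
  apply: eq_bigr => k _; rewrite indicI mulrA; congr (_ * _ * _).
  by rewrite indic_bool.
rewrite indicI mulrA; congr (_ * _ * _).
by rewrite indic_bool.
Qed.
End Grid.

(** Rounding [sigma] up to a grid reduces the claim to the deterministic bound on each cell, and
    regularity removes the rounding. On the part sent beyond the horizon both sides are taken at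
    [+oo], where [N] and [S] agree. *)
Lemma snell_ge_st sigma theta A : stopping_time F sigma -> stopping_time F theta ->
  (forall w, (sigma w <= theta w)%E) -> F 0 A ->
  Ex (fun w => \1_A w * S (theta w) w) <= Ex (fun w => \1_A w * N (sigma w) w).
Proof.
move=> sts stt le FA; have mA := mA0 FA.
(* The rounded start may overtake [theta], so [theta] is delayed with it; if [sigma < theta] the
   delay eventually disappears, and otherwise both converge to the same time. *)
pose s_ n w := roundup n (sigma w); pose t_ n w := maxe (theta w) (s_ n w).
have sts_ n : stopping_time F (s_ n) by exact: (roundup_st hF).
have stt_ n : stopping_time F (t_ n) by exact: (st_max hF).
have cs w : s_ n w @[n --> \oo] --> sigma w by exact/roundup_cvg/sts.1.
have ct w : t_ n w @[n --> \oo] --> theta w.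
  have [e|ne] := eqVneq (sigma w) (theta w).
    rewrite (_ : t_^~ w = s_^~ w) -?e ?cs//; apply/funext => n.
    by rewrite /t_ -e max_r// /s_ roundup_ge// sts.1.
  have lt : (sigma w < theta w)%E by rewrite lt_neqAle ne le.
  apply: cvg_near_cst; have : \forall n \near \oo, (s_ n w < theta w)%E.
    exact: (cs w _ (open_ereal_lt' lt)).
  by apply: filterS => n h; rewrite /t_ max_l// ltW.
have := regular_Ex_cvg hF hS stt_ stt mA (aeW _ ct).
have := regular_Ex_cvg hF hN sts_ sts mA (aeW _ cs).
move=> c1 c2; rewrite -(cvg_lim (@Rhausdorff R) c1) -(cvg_lim (@Rhausdorff R) c2).
apply: ler_lim; [by apply/cvg_ex; eexists; exact: c2|by apply/cvg_ex; eexists; exact: c1|].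
apply: nearW => n.
have hS' k : L1 (fun w => S (maxe (theta w) (@tick R n k)%:E) w).
  apply: (regular_L1 hF hS); apply: (st_max hF) => //; apply: (st_cst hF).
  by rewrite lee_fin ltW// tick_gt0.
rewrite /s_ /t_ (Ex_roundup sts (G := N))//; last 2 first.
- by move=> k; apply: hNt; rewrite ltW// tick_gt0.
- by apply: (regular_L1 hF hN); exact: (st_cst hF).
rewrite (Ex_roundup sts (G := fun u w => S (maxe (theta w) u) w))//; last first.
  by apply: (regular_L1 hF hS); apply: (st_max hF) => //; exact: (st_cst hF).
have mEoo : measurable (A `&` [set w | (n.+1%:R%:E <= sigma w)%E]).
  apply: measurableI => //.
  by have := emeasurable_fun_c_infty measurableT (st_meas hF sts) n.+1%:R%:E; rewrite setTI.
apply: lerD.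
  apply: ler_sum => k _; have t0 := ltW (tick_gt0 (R := R) n k).
  apply: (snell_ge (theta := fun w => maxe (theta w) (@tick R n k)%:E)) => //.
    split; last by move=> w; rewrite le_max lexx orbT.
    by apply: (st_max hF) => //; exact: (st_cst hF).
  apply: (saI (filt_sa hF t0)); first exact: (filt_mono hF _ t0 FA).
  by apply: (left_sub hF t0); exact: (st_cell hF).
apply: (Ex_le Pc).
- by apply: filterS NSoo => w ->; rewrite (max_idPr (leey _)).
- apply: L1M_ind => //; apply: (regular_L1 hF hS).
  by apply: (st_max hF) => //; exact: (st_cst hF).
- by apply: L1M_ind => //; apply: (regular_L1 hF hN); exact: (st_cst hF).
Qed.

(** A time nearly optimal in total mean is nearly optimal on each event of [F t] with the same
    error, since on the complement it cannot do better than [N]. *)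
Lemma snell_le_set t e A theta : 0 <= t -> stopping_time_from F t theta ->
  Ex (N t%:E) <= Ex (fun w => S (theta w) w) + e -> F t A ->
  Ex (fun w => \1_A w * N t%:E w) <= Ex (fun w => \1_A w * S (theta w) w) + e.
Proof.
move=> t0 stt H FA; have mA := filt_meas hF t0 FA.
have hSt := regular_L1 hF hS stt.1.
have := snell_ge t0 stt (saC (filt_sa hF t0) FA).
have dec f : L1 f -> Ex f = Ex (fun w => \1_A w * f w) + Ex (fun w => \1_(~` A) w * f w).
  move=> hf; rewrite -ExD; [|exact: L1M_ind|by apply: L1M_ind => //; exact: measurableC].
  by congr Ex; apply/funext => w; rewrite indicC; ring.
by move: H; rewrite (dec _ (hNt t0)) (dec _ hSt); lra.
Qed.

(** Near-optimal times chosen for each grid point are pasted along the cells of [sigma]; each is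
    used only on an event known at its grid point, so the result is a stopping time. *)
Lemma snell_le_st sigma e : stopping_time F sigma -> 0 < e ->
  exists theta, [/\ stopping_time F theta, (forall w, (sigma w <= theta w)%E) &
    Ex (fun w => N (sigma w) w) <= Ex (fun w => S (theta w) w) + e].
Proof.
move=> sts e0.
pose s_ n w := roundup n (sigma w).
have sts_ n : stopping_time F (s_ n) by exact: (roundup_st hF).
have := regular_Ex_cvg hF hN sts_ sts measurableT
  (aeW _ (fun w => roundup_cvg (sts.1 w))).
have idT (f : Omega -> R) : (fun w => \1_setT w * f w) = f.
  by apply/funext => w; rewrite indicT mul1r.
rewrite idT; under eq_fun do rewrite idT.
move=> /cvgr_distC_lt /(_ (e / 2) ltac:(lra)) [n _ /(_ _ (leqnn n))] /= Hn.
(* Half of [e] pays for rounding [sigma]; the other half is shared equally among the [m] cells. *)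
pose m := (n.+1 * n.+1)%N; pose e' := e / 2 / m%:R.
have m0 : 0 < m%:R :> R by rewrite ltr0n.
have e'0 : 0 < e' by rewrite /e'; apply: divr_gt0 => //; lra.
have /choice[th_ Hth] k : exists theta, stopping_time_from F (@tick R n k) theta /\
    Ex (N (@tick R n k)%:E) <= Ex (fun w => S (theta w) w) + e'.
  by have [theta h1 h2] := snell_le (ltW (tick_gt0 n k)) e'0; exists theta.
(* Beyond the horizon no grid point is left, and never stopping costs nothing there because [N] and
   [S] agree at [+oo]. *)
pose theta w := if (sigma w < n.+1%:R%:E)%E then
  th_ (Num.truncn (fine (sigma w) * n.+1%:R)) w else +oo%E.
have th_cell w k : cell n k (sigma w) -> (k < m)%N -> theta w = th_ k w.
  move=> c km; have [_ _ h] := cellP (sts.1 w) c; rewrite /theta h.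
  have /andP[_ h2] := c; rewrite (lt_le_trans h2)// lee_fin ler_pdivrMr ?ltr0n//.
  by rewrite -natrM ler_nat.
have th_oo w : (n.+1%:R%:E <= sigma w)%E -> theta w = +oo%E.
  by rewrite /theta leNgt => /negbTE ->.
have leth w : (sigma w <= theta w)%E.
  have [h|h] := ltP (sigma w) n.+1%:R%:E; last by rewrite th_oo// leey.
  have [c km] := cell_truncn (sts.1 w) h; rewrite (th_cell _ _ c km).
  have [/ltW h1 _ _] := cellP (sts.1 w) c; apply: (le_trans h1).
  by have [[_ ->]] := Hth (Num.truncn (fine (sigma w) * n.+1%:R)).
have stt : stopping_time F theta.
  split => [w|t t0]; first exact: le_trans (sts.1 w) (leth w).
  have sa := left_sa hF t0.
  rewrite (_ : [set _ | _] = \bigcup_k [set w | (k < m)%N /\ (@tick R n k <= t /\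
     (cell n k (sigma w) /\ (th_ k w <= t%:E)%E))]); last first.
    apply/seteqP; split => w /=.
      have [h|h] := ltP (sigma w) n.+1%:R%:E; last by rewrite th_oo.
      have [c km] := cell_truncn (sts.1 w) h; rewrite (th_cell _ _ c km) => ht.
      exists (Num.truncn (fine (sigma w) * n.+1%:R)) => //; split => //; split => //.
      rewrite -lee_fin; apply: le_trans ht.
      by have [[_ ->]] := Hth (Num.truncn (fine (sigma w) * n.+1%:R)).
    by move=> [k _] /= [km [_ [c]]]; rewrite (th_cell _ _ c km).
  apply: (sa_bigcup sa) => k; have [km|km] := ltnP k m; last first.
    by rewrite (_ : [set _ | _] = set0); [exact: sa0 sa|apply/seteqP; split => w //= []].
  have [kt|kt] := leP (@tick R n k) t; last first.
    by rewrite (_ : [set _ | _] = set0); [exact: sa0 sa|apply/seteqP; split => w //= [_ []]].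
  have h1 := left_mono hF (ltW (tick_gt0 n k)) kt (st_cell hF n k sts).
  have := saI sa h1 ((Hth k).1.1.2 t t0).
  congr (left_filtration F t _); apply/seteqP; split => w /=.
    by move=> [c h]; split => //; split.
  by move=> [_ [_ [c h]]]; split.
exists theta; split => //.
have hSk k : L1 (fun w => S (th_ k w) w) := regular_L1 hF hS (Hth k).1.1.
have hSoo : L1 (S +oo%E) by apply: (regular_L1 hF hS (theta := fun=> +oo%E)); exact: (st_cst hF).
have hNoo : L1 (N +oo%E) by apply: (regular_L1 hF hN (theta := fun=> +oo%E)); exact: (st_cst hF).
have mE k : measurable [set w | cell n k (sigma w)].
  exact: (left_meas hF (ltW (tick_gt0 n k)) (st_cell hF n k sts)).
have mEoo : measurable [set w | (n.+1%:R%:E <= sigma w)%E].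
  by have := emeasurable_fun_c_infty measurableT (st_meas hF sts) n.+1%:R%:E; rewrite setTI.
have eN := Ex_roundup (n := n) sts (G := N) measurableT
  (fun k => hNt (ltW (tick_gt0 n k))) hNoo.
have eS : Ex (fun w => S (theta w) w) = \sum_(k < m)
    Ex (fun w => \1_[set w | cell n k (sigma w)] w * S (th_ k w) w) +
    Ex (fun w => \1_[set w | (n.+1%:R%:E <= sigma w)%E] w * S +oo%E w).
  rewrite -Ex_sum; last by move=> k _; exact: L1M_ind.
  rewrite -ExD; [|by apply: L1_sum => k _; exact: L1M_ind|exact: L1M_ind].
  congr Ex; apply/funext => w.
  have [h|h] := ltP (sigma w) n.+1%:R%:E.
    have [c km] := cell_truncn (sts.1 w) h; rewrite (th_cell _ _ c km).
    rewrite [X in _ = _ + X * _]indicE memNset ?mul0r ?addr0 /=; last first.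
      by apply/negP; rewrite -ltNge.
    rewrite (bigD1 (Ordinal km))//= indicE mem_set// mul1r big1 ?addr0// => i /eqP ik.
    rewrite indicE memNset ?mul0r//= => /(cellP (sts.1 w))[_ _ hh].
    by apply: ik; exact: val_inj.
  rewrite th_oo// [X in _ = _ + X * _]indicE mem_set// mul1r big1 ?add0r// => i _.
  rewrite indicE memNset ?mul0r//= => /andP[_ h2]; have := le_lt_trans h h2.
  by rewrite lte_fin ltr_pdivlMr ?ltr0n// -natrM ltr_nat ltnNge (ltn_ord i).
rewrite idT setTI in eN.
have key : Ex (fun w => N (s_ n w) w) <= Ex (fun w => S (theta w) w) + e / 2.
  rewrite /s_ eN eS addrAC; apply: lerD; last first.
    apply: (Ex_le Pc); [|exact: L1M_ind|exact: L1M_ind].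
    by apply: filterS NSoo => w ->.
  have -> : e / 2 = \sum_(k < m) e'.
    by rewrite sumr_const card_ord -mulr_natr /e'; field; lra.
  rewrite -big_split; apply: ler_sum => k _ /=; rewrite setTI.
  have t0 := ltW (tick_gt0 (R := R) n k).
  apply: snell_le_set => //; [exact: (Hth k).1|exact: (Hth k).2|].
  by apply: (left_sub hF t0); exact: (st_cell hF).
by move: Hn; rewrite ltr_norml => /andP[h1 h2]; rewrite /s_ in key; lra.
Qed.

(** A near-optimal time after [theta] is also available from [sigma]. Its reward nearly equals [N]
    at [theta] in total and is at most [N] at [theta] off [A], so it nearly reaches it on [A]. *)
Lemma snell_supermg sigma theta A : stopping_time F sigma -> stopping_time F theta ->
  (forall w, (sigma w <= theta w)%E) -> F 0 A ->
  Ex (fun w => \1_A w * N (theta w) w) <= Ex (fun w => \1_A w * N (sigma w) w).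
Proof.
move=> sts stt le FA; have mA := mA0 FA.
have dec f : L1 f -> Ex f = Ex (fun w => \1_A w * f w) + Ex (fun w => \1_(~` A) w * f w).
  move=> hf; rewrite -ExD; [|exact: L1M_ind|by apply: L1M_ind => //; exact: measurableC].
  by congr Ex; apply/funext => w; rewrite indicC; ring.
apply/ler_addgt0Pr => e e0.
have [th [st' le' H]] := snell_le_st stt e0.
have h1 := snell_ge_st sts st' (fun w => le_trans (le w) (le' w)) FA.
have h2 := snell_ge_st stt st' le' (saC (filt_sa hF (lexx 0)) FA).
move: H; rewrite (dec _ (regular_L1 hF hN stt)) (dec _ (regular_L1 hF hS st')).
lra.
Qed.

(** Times with optimality error [2^-n] have summable gaps [N - S], so the gap tends to 0 almost
    surely and, by the assumption on [tau], they cannot stay away below [tau]. The supermartingale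
    property at their minimum with [tau] then gives the missing inequality. *)
Lemma snell_optimal sigma tau A : stopping_time F sigma -> stopping_time F tau ->
  (forall w, (sigma w <= tau w)%E) ->
  {ae P, forall w u, (0 <= u)%E -> S u w <= N u w} ->
  {ae P, forall w, forall th_ : nat -> \bar R, (forall n, (sigma w <= th_ n)%E) ->
     (N (th_ n) w - S (th_ n) w) @[n --> \oo] --> (0 : R) ->
     mine (th_ n) (tau w) @[n --> \oo] --> tau w} ->
  F 0 A ->
  Ex (fun w => \1_A w * N (tau w) w) = Ex (fun w => \1_A w * N (sigma w) w).
Proof.
move=> sts stt le SN htau FA; have mA := mA0 FA.
have sup B : F 0 B -> Ex (fun w => \1_B w * N (tau w) w) <=
    Ex (fun w => \1_B w * N (sigma w) w) by exact: snell_supermg.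
have dec f : L1 f -> Ex f = Ex (fun w => \1_A w * f w) + Ex (fun w => \1_(~` A) w * f w).
  move=> hf; rewrite -ExD; [|exact: L1M_ind|by apply: L1M_ind => //; exact: measurableC].
  by congr Ex; apply/funext => w; rewrite indicC; ring.
have idT (f : Omega -> R) : (fun w => \1_setT w * f w) = f.
  by apply/funext => w; rewrite indicT mul1r.
have FT : F 0 setT := saT (filt_sa hF (lexx 0)).
(* The supermartingale inequality holds on [A] and on its complement, so equality of the total means
   forces equality on each. *)
suff tot : Ex (fun w => N (sigma w) w) <= Ex (fun w => N (tau w) w).
  have h1 := sup _ FA; have h2 := sup _ (saC (filt_sa hF (lexx 0)) FA).
  move: tot; rewrite (dec _ (regular_L1 hF hN sts)) (dec _ (regular_L1 hF hN stt)).
  by move=> tot; apply/eqP; rewrite eq_le h1 /=; lra.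
have e0 n : 0 < 2^-1 ^+ n :> R by rewrite exprn_gt0.
have /choice[th_ Hth] n := snell_le_st sts (e0 n).
have st_ n : stopping_time F (th_ n) by have [] := Hth n.
have le_ n w : (sigma w <= th_ n w)%E by have [_ ->] := Hth n.
pose D n w := `|N (th_ n w) w - S (th_ n w) w|.
have hND n := regular_L1 hF hN (st_ n); have hSD n := regular_L1 hF hS (st_ n).
have hD n : L1 (D n) by apply/L1_norm/L1B.
have D0 : {ae P, forall w, D n w @[n --> \oo] --> 0}.
  apply: (@ae_cvg0 _ _ _ P D 2) => // [n w|n]; first exact: normr_ge0.
  apply: (@le_trans _ _ (\sum_(i < n) 2^-1 ^+ i)).
    apply: ler_sum => i _.
    have -> : Ex (D i) = Ex (fun w => N (th_ i w) w - S (th_ i w) w).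
      apply: (Ex_eq Pc) => //; apply: filterS SN => w h; rewrite /D ger0_norm//.
      by rewrite subr_ge0; apply: h; exact: (st_ i).1.
    rewrite ExB// lerBlDr addrC; have [_ _ H] := Hth i; apply: le_trans H.
    by have := snell_supermg sts (st_ i) (le_ i) FT; rewrite !idT.
  have := @subrX1 R 2^-1 n; have := e0 n.
  set s := \sum_(_ < _) _; lra.
have cmin : {ae P, forall w, mine (th_ n w) (tau w) @[n --> \oo] --> tau w}.
  apply: filterS2 D0 htau => w d0; apply => //.
  exact/norm_cvg0P.
have := regular_Ex_cvg hF hN (fun n => st_min hF (st_ n) stt) stt measurableT cmin.
rewrite idT; under eq_fun do rewrite idT.
have c2 : Ex (fun w => N (sigma w) w) - 2^-1 ^+ n @[n --> \oo] --> Ex (fun w => N (sigma w) w).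
  rewrite -[X in _ --> X]subr0; apply: cvgB; first exact: cvg_cst.
  by apply: cvg_expr; rewrite ger0_norm; lra.
move=> c1; rewrite -(cvg_lim (@Rhausdorff R) c1) -(cvg_lim (@Rhausdorff R) c2).
apply: ler_lim; [by apply/cvg_ex; eexists; exact: c2|by apply/cvg_ex; eexists; exact: c1|].
apply: nearW => n; have [_ _ H] := Hth n; rewrite lerBlDr; apply: (le_trans H).
rewrite lerD2r; apply: (@le_trans _ _ (Ex (fun w => N (th_ n w) w))).
  apply: (Ex_le Pc) => //; apply: filterS SN => w h; apply: h; exact: (st_ n).1.
have le2 w : (mine (th_ n w) (tau w) <= th_ n w)%E by rewrite ge_min lexx.
by have := snell_supermg (st_min hF (st_ n) stt) (st_ n) le2 FT; rewrite !idT.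
Qed.

End AbstractSnell.

Section VersionUniqueness.
Context {R : realType} {d : measure_display} {Omega : measurableType d}.
Variables (P : probability Omega R) (M : set (set Omega)).
Hypothesis Pcomplete : measure_is_complete P.
Hypothesis hM : sigma_algebra [set: Omega] M.
Hypothesis subM : M `<=` measurable.
Local Notation L1 := (L1 P).
Local Notation Ex := (Ex P).

(** A version may take infinite values a priori. The events where it is nonnegative and negative
    belong to [M], and the finite integrals there make it integrable, after which two integrable
    versions are compared. *)
Lemma cond_exp_unique (V : Omega -> \bar R) (v : Omega -> R) :
  measurable_wrt M V -> measurable_wrt M v -> L1 v ->
  (forall A, M A -> (\int[P]_(w in A) V w = (Ex (fun w => \1_A w * v w))%:E)%E) ->
  {ae P, forall w, V w = (v w)%:E}.
Proof.
move=> MV Mv hv VE.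
have mV : measurable_fun setT V := measurable_wrt_meas subM MV.
pose A := [set w | (0 <= V w)%E].
have MA : M A.
  have := MV `[0%E, +oo[%classic (emeasurable_itv _).
  by congr M; apply/seteqP; split => w; rewrite /A/= in_itv/= andbT.
have mA := subM MA.
have iV : P.-integrable setT V.
  apply/integrableP; split => //.
  rewrite -(setUv A) ge0_integral_setU//=; first last.
  - by apply/disj_setPCl.
  - by rewrite setUv; exact: measurableT_comp.
  - exact: measurableC.
  rewrite (_ : \int[P]_(w in A) _ = \int[P]_(w in A) V w)%E; last first.
    by apply: eq_integral => w; rewrite inE /A/= => h; rewrite gee0_abs.
  rewrite (_ : \int[P]_(w in ~` A) _ = - \int[P]_(w in ~` A) V w)%E; last first.
    have -> : (\int[P]_(w in ~` A) V w = - \int[P]_(w in ~` A) - V w)%E.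
      rewrite -integral_ge0N; first by apply: eq_integral => w _; rewrite oppeK.
      by move=> w /negP; rewrite -ltNge => /ltW; rewrite oppe_ge0.
    rewrite oppeK; apply: eq_integral => w; rewrite inE /A/= => /negP; rewrite -ltNge => /ltW h.
    by rewrite lee0_abs.
  rewrite !VE//; last exact: saC.
  by rewrite -EFinN -EFinD ltry.
have fV := integrable_ae measurableT iV.
have hfV : L1 (fine \o V).
  apply/integrableP; split; first by apply/measurable_EFinP/measurableT_comp.
  move/integrableP : iV => [_]; apply: le_lt_trans.
  apply: ae_ge0_le_integral => //.
  - by do 2 apply: measurableT_comp => //; exact: measurableT_comp.
  - exact: measurableT_comp.
  - by apply: filterS fV => w /(_ I) + _ /=; case: (V w).
have : {ae P, forall w, fine (V w) = v w}.
  apply: (ae_eq_of_sets Pcomplete hM subM) => //.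
    by apply/(measurable_wrtP hM)/measurableT_comp => //; exact/(measurable_wrtP hM).
  move=> B MB; apply: EFin_inj; rewrite -(Ex_setE (subM MB) hfV) -VE//.
  apply: ae_eq_integral; [exact: subM|exact/measurable_funTS/measurable_EFinP/measurableT_comp|
    exact: measurable_funTS|].
  by apply: filterS fV => w /(_ I) + _ /=; case: (V w).
by apply: filterS2 fV => w /(_ I) h <-; rewrite fineK.
Qed.
End VersionUniqueness.

(** * The essential supremum is nearly attained *)

Section EssSupAttained.
Context {R : realType} {d : measure_display} {Omega : measurableType d}.
Variables (P : probability Omega R) (F : R -> set (set Omega)).
Hypothesis hF : complete_right_continuous_filtration P F.
Local Notation L1 := (L1 P).
Local Notation Ex := (Ex P).
Let Pc := filt_complete hF.
Variables (S : \bar R -> Omega -> R) (t : R) (q Y : Omega -> R).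
(** [G] stands for the payoff counted from time [t]; almost surely it is the reward [S], counted
    from time 0, minus the profit [q] made before [t]. *)
Variable G : (Omega -> \bar R) -> Omega -> \bar R.
Hypotheses (hS : regular P S) (t0 : 0 <= t) (hq : L1 q) (hY : L1 Y).
Hypothesis GS : forall theta, stopping_time_from F t theta ->
  {ae P, forall w, G theta w = (S (theta w) w - q w)%:E}.
Hypothesis hess : is_ess_supremum P
  [set V | exists2 theta, stopping_time_from F t theta &
     is_cond_expectation P (F t) (G theta) V] (EFin \o Y).

Let hM := filt_sa hF t0.
Let subM := filt_meas hF t0.
Let U (theta : Omega -> \bar R) (w : Omega) : R := S (theta w) w - q w.

Let hU theta : stopping_time_from F t theta -> L1 (U theta).
Proof. by move=> [st _]; apply: L1B => //; exact: (regular_L1 hF hS). Qed.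

Let GE theta A : stopping_time_from F t theta -> measurable A ->
  (\int[P]_(w in A) G theta w = (Ex (fun w => \1_A w * U theta w))%:E)%E.
Proof.
move=> st mA; rewrite -Ex_setE//; last exact: hU.
have mU := L1_meas (hU st).
apply: ae_eq_integral => //.
- apply: measurable_funTS; apply: (ae_measurable_fun Pc (f := EFin \o U theta)).
    by apply: filterS (GS st) => w ->.
  exact/measurable_EFinP.
- exact/measurable_funTS/measurable_EFinP.
- by apply: filterS (GS st) => w ->.
Qed.

Let version theta : stopping_time_from F t theta -> exists V : Omega -> R,
  [/\ measurable_wrt (F t) V, L1 V, {ae P, forall w, V w <= Y w} &
    forall A, F t A -> Ex (fun w => \1_A w * V w) = Ex (fun w => \1_A w * U theta w)].
Proof.
move=> st; have [V [MV hV VE]] := cond_exp hM subM (hU st).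
exists V; split => //; have [_ h _] := hess.
suff : {ae P, forall w, ((V w)%:E <= (EFin \o Y) w)%E} by apply: filterS => w; rewrite lee_fin.
apply: (h (EFin \o V)); exists theta => //; split.
  by apply/(measurable_wrtP hM)/measurable_EFinP/(measurable_wrtP hM).
by move=> A MA; rewrite GE; [rewrite Ex_setE ?VE//; exact: subM|by []|exact: subM].
Qed.

Lemma ess_sup_ge theta A : stopping_time_from F t theta -> F t A ->
  Ex (fun w => \1_A w * U theta w) <= Ex (fun w => \1_A w * Y w).
Proof.
move=> st MA; have [V [MV hV VY VE]] := version st.
have mA := subM MA.
rewrite -VE//; apply: (Ex_le Pc); [|exact: L1M_ind|exact: L1M_ind].
by apply: filterS VY => w h; rewrite ler_wpM2l ?indic_ge0.
Qed.

(** An event of [F t] is known to the left filtration only after [t], so two times are first delayed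
    past [t] before being pasted on it. *)
Let later (theta : Omega -> \bar R) (n : nat) (w : Omega) : \bar R := maxe (theta w) (t + n.+1%:R^-1)%:E.

Let later_cvg theta w : (t%:E <= theta w)%E -> later theta n w @[n --> \oo] --> theta w.
Proof.
have H : (t + harmonic n)%:E @[n --> \oo] --> t%:E.
  apply/fine_cvgP; split; first exact: nearW.
  rewrite -[X in _ --> X]addr0; apply: cvgD; [exact: cvg_cst|exact: cvg_harmonic].
rewrite le_eqVlt => /predU1P[e|lt].
  rewrite /later -e; apply: cvg_trans H; apply: near_eq_cvg; apply: nearW => n.
  by rewrite max_r// lee_fin lerDl.
apply: cvg_near_cst; have : \forall n \near \oo, ((t + harmonic n)%:E < theta w)%E.
  exact: (H _ (open_ereal_lt' lt)).
by apply: filterS => n h; rewrite /later max_l// ltW.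
Qed.

Let later_st theta n : stopping_time_from F t theta -> stopping_time F (later theta n).
Proof.
move=> [st _]; apply: (st_max hF) => //; apply: (st_cst hF).
by rewrite lee_fin addr_ge0.
Qed.

(** The pasted time follows [theta1] on [B] and [theta2] elsewhere, after a delay whose effect on
    each mean is below [e / 2] by regularity. *)
Let glue theta1 theta2 B C e : stopping_time_from F t theta1 ->
  stopping_time_from F t theta2 -> F t B -> F t C -> B `&` C = set0 -> 0 < e ->
  exists2 theta, stopping_time_from F t theta &
   Ex (fun w => \1_B w * U theta1 w) + Ex (fun w => \1_C w * U theta2 w) <=
   Ex (fun w => \1_(B `|` C) w * U theta w) + e.
Proof.
move=> st1 st2 MB MC BC e0.
have mB := subM MB; have mC := subM MC.
have c1 := regular_Ex_cvg hF hS (fun n => later_st n st1) st1.1 mB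
  (aeW _ (fun w => later_cvg (st1.2 w))).
have c2 := regular_Ex_cvg hF hS (fun n => later_st n st2) st2.1 mC
  (aeW _ (fun w => later_cvg (st2.2 w))).
have e2 : 0 < e / 2 by lra.
have [n [N1 N2]] : exists n,
   `|Ex (fun w => \1_B w * S (theta1 w) w) - Ex (fun w => \1_B w * S (later theta1 n w) w)| < e / 2 /\
   `|Ex (fun w => \1_C w * S (theta2 w) w) - Ex (fun w => \1_C w * S (later theta2 n w) w)| < e / 2.
  move/cvgr_distC_lt : c1 => /(_ _ e2) [n1 _ h1].
  move/cvgr_distC_lt : c2 => /(_ _ e2) [n2 _ h2].
  exists (maxn n1 n2); split.
    have h := h1 _ (leq_maxl n1 n2); first [exact: h|by rewrite distrC].
  have h := h2 _ (leq_maxr n1 n2); first [exact: h|by rewrite distrC].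
pose theta w := if w \in B then later theta1 n w else later theta2 n w.
have tlt : t < t + n.+1%:R^-1 by rewrite ltrDl invr_gt0 ltr0n.
have st : stopping_time_from F t theta.
  split; last first.
    by move=> w; rewrite /theta; case: ifP => _; rewrite le_max lee_fin (ltW tlt) orbT.
  split=> [w|u u0].
    by rewrite /theta; case: ifP => _; [exact: (later_st n st1).1|exact: (later_st n st2).1].
  have sa := left_sa hF u0.
  have [ut|tu] := leP u t.
    rewrite (_ : [set _ | _] = set0); first exact: sa0 sa.
    apply/seteqP; split => w //=; rewrite /theta => h.
    have : ((t + n.+1%:R^-1)%:E <= u%:E)%E.
      by apply: le_trans h; case: ifP => _; rewrite le_max lexx orbT.
    by rewrite lee_fin leNgt (le_lt_trans ut).
  have LB := sub_left t0 tu MB.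
  have := saU sa (saI sa LB ((later_st n st1).2 u u0))
    (saI sa (saC sa LB) ((later_st n st2).2 u u0)).
  congr (left_filtration F u _); apply/seteqP; split => w; rewrite /= /theta.
    by move=> [[h1 h2]|[h1 h2]]; [rewrite mem_set|rewrite memNset].
  by case: ifPn => [/set_mem|/negP h]; [left|right; split => // /mem_set].
exists theta => //.
have dec th A : L1 (fun w => S (th w) w) -> measurable A ->
  Ex (fun w => \1_A w * (S (th w) w - q w)) = Ex (fun w => \1_A w * S (th w) w) - Ex (fun w => \1_A w * q w).
  move=> h mA; rewrite -ExB; [|exact: L1M_ind|exact: L1M_ind].
  by congr Ex; apply/funext => w; rewrite mulrBr.
have eU : Ex (fun w => \1_(B `|` C) w * U theta w) =
    Ex (fun w => \1_B w * (S (later theta1 n w) w - q w)) +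
    Ex (fun w => \1_C w * (S (later theta2 n w) w - q w)).
  rewrite -ExD; last 2 first.
  - by apply: L1M_ind => //; apply: L1B => //; exact: (regular_L1 hF hS (later_st n st1)).
  - by apply: L1M_ind => //; apply: L1B => //; exact: (regular_L1 hF hS (later_st n st2)).
  congr Ex; apply/funext => w; rewrite /U /theta !indicE in_setU.
  have [wB|wB] := boolP (w \in B) => /=; last by rewrite mul0r add0r.
  rewrite (_ : w \in C = false) ?mul0r ?addr0//; apply/negP => wC.
  suff : set0 w by [].
  by rewrite -BC; split; exact: set_mem.
have l1 := regular_L1 hF hS (later_st n st1).
have l2 := regular_L1 hF hS (later_st n st2).
have l3 := regular_L1 hF hS st1.1; have l4 := regular_L1 hF hS st2.1.
rewrite eU /U (dec (later theta1 n) B l1 mB) (dec (later theta2 n) C l2 mC).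
rewrite (dec theta1 B l3 mB) (dec theta2 C l4 mC).
by move: N1 N2; rewrite !ltr_norml => /andP[a1 a2] /andP[b1 b2]; lra.
Qed.

(** A substitute for belonging to the family, which pasting with a delay does not preserve: on any
    event of [F t] the mean of [Z] is reached within any [e]. *)
Let attainable (Z : Omega -> R) := forall B e, F t B -> 0 < e ->
  exists2 theta, stopping_time_from F t theta &
    Ex (fun w => \1_B w * Z w) <= Ex (fun w => \1_B w * U theta w) + e.

(** The comparison event [Z2 <= Z1] lies in [F t] and splits [B]; two thirds of [e] go to the pieces
    and one third to pasting them. *)
Let attainable_max Z1 Z2 : L1 Z1 -> L1 Z2 -> measurable_wrt (F t) Z1 ->
  measurable_wrt (F t) Z2 -> attainable Z1 -> attainable Z2 ->
  attainable (fun w => Num.max (Z1 w) (Z2 w)).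
Proof.
move=> h1 h2 M1 M2 a1 a2 B e MB e0.
pose D := [set w | Z2 w <= Z1 w].
have MD : F t D.
  have m : measurable_fun [set: g_sigma_algebraType (F t)] (fun w => Z2 w <= Z1 w).
    by apply: measurable_fun_ler; exact/(measurable_wrtP hM).
  have := m measurableT [set true] I; rewrite setTI (measurable_OM hM).
  by congr (F t _); apply/seteqP; split.
have MB1 := saI hM MB MD; have MB2 := saI hM MB (saC hM MD).
have e3 : 0 < e / 3 by lra.
have [th1 st1 H1] := a1 _ _ MB1 e3; have [th2 st2 H2] := a2 _ _ MB2 e3.
have [|th st H] := glue st1 st2 MB1 MB2 _ e3.
  by apply/seteqP; split => // w [[_ +] [_]].
exists th => //.
rewrite -setIUr setUv setIT in H.
have -> : Ex (fun w => \1_B w * Num.max (Z1 w) (Z2 w)) =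
   Ex (fun w => \1_(B `&` D) w * Z1 w) + Ex (fun w => \1_(B `&` ~` D) w * Z2 w).
  rewrite -ExD; [|by apply: L1M_ind => //; exact: subM|by apply: L1M_ind => //; exact: subM].
  congr Ex; apply/funext => w; rewrite !indicI indicC -!mulrA -mulrDr; congr (_ * _).
  rewrite indic_bool; have [h|h] := leP (Z2 w) (Z1 w); rewrite /=; lra.
lra.
Qed.

(** Running maxima of a maximising sequence stay attainable, so their limit [Z] has mean at most the
    supremum of the means. Every member of the family lies below [Z] almost surely, hence so does
    the essential supremum, and its mean is at most that supremum. *)
Lemma ess_sup_attained e : 0 < e -> exists2 theta, stopping_time_from F t theta &
  Ex Y <= Ex (U theta) + e.
Proof.
move=> e0.
have idT (f : Omega -> R) : (fun w => \1_setT w * f w) = f.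
  by apply/funext => w; rewrite indicT mul1r.
have FT : F t setT := saT hM.
pose E := [set Ex (U theta) | theta in [set theta | stopping_time_from F t theta]].
have stt : stopping_time_from F t (fun=> t%:E).
  by split => //; apply: (st_cst hF); rewrite lee_fin.
have ubE : has_ubound E.
  exists (Ex Y) => _ [theta /= st <-].
  by have := ess_sup_ge st FT; rewrite !idT.
have neE : E !=set0 by exists (Ex (U (fun=> t%:E))); exists (fun=> t%:E).
have supE theta : stopping_time_from F t theta -> Ex (U theta) <= sup E.
  by move=> st; apply: ub_le_sup => //; exists theta.
have /choice[th_ Hth] n : exists theta, stopping_time_from F t theta /\
    sup E - 2^-1 ^+ n < Ex (U theta).
  have [|_ [theta st <-] h] := @sup_adherent _ E (2^-1 ^+ n) _ (conj neE ubE).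
    by rewrite exprn_gt0.
  by exists theta.
have /choice[V_ HV] n := version (Hth n).1.
have attV theta V : stopping_time_from F t theta ->
  (forall A, F t A -> Ex (fun w => \1_A w * V w) = Ex (fun w => \1_A w * U theta w)) ->
  attainable V.
  by move=> st VE B r MB r0; exists theta => //; rewrite VE// lerDl ltW.
pose M_ := fix M_ n w := if n is m.+1 then Num.max (M_ m w) (V_ m.+1 w) else V_ 0%N w.
have hM_ n : [/\ L1 (M_ n), measurable_wrt (F t) (M_ n) & attainable (M_ n)].
  elim: n => [|n [i1 i2 i3]].
    by have [v1 v2 v3 v4] := HV 0%N; split => //; exact: (attV _ _ (Hth 0%N).1).
  have [v1 v2 v3 v4] := HV n.+1; split => //; last first.
    by apply: attainable_max => //; exact: (attV _ _ (Hth n.+1).1).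
    by apply/(measurable_wrtP hM)/measurable_maxr; exact/(measurable_wrtP hM).
  apply: (L1_dom _ (L1D (L1_norm i1) (L1_norm v2))).
    by apply: measurable_maxr; [exact: (L1_meas i1)|exact: (L1_meas v2)].
  by apply: aeW => w /=; rewrite maxEle; case: ifP => _; rewrite ?lerDl ?lerDr.
have nd w : {homo M_^~ w : n m / (n <= m)%N >-> n <= m}.
  apply: homo_leq => [x|y x z|n]; [exact: lexx|exact: le_trans|].
  by rewrite /= le_max lexx.
have att_le Z : attainable Z -> Ex Z <= sup E.
  move=> aZ; apply/ler_addgt0Pr => r r0; have [th st] := aZ _ _ FT r0.
  by rewrite !idT => /le_trans; apply; rewrite lerD2r supE.
have VM n w : V_ n w <= M_ n w by case: n => [|n] /=; rewrite ?le_max lexx ?orbT.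
have MleE n : Ex (M_ n) <= sup E by apply: att_le; have [] := hM_ n.
have [Z [hZ cZ ZE]] := Ex_monotone (fun n => let: And3 h _ _ := hM_ n in h) nd MleE.
have MZ : {ae P, forall w n, M_ n w <= Z w}.
  apply: filterS cZ => w cw n; rewrite -(cvg_lim (@Rhausdorff R) cw).
  apply: limr_ge; first by apply/cvg_ex; exists (Z w).
  by exists n => // m /= nm; exact: nd.
have VZ theta V : stopping_time_from F t theta -> L1 V -> measurable_wrt (F t) V ->
  (forall A, F t A -> Ex (fun w => \1_A w * V w) = Ex (fun w => \1_A w * U theta w)) ->
  {ae P, forall w, V w <= Z w}.
  move=> st hV MV VE.
  have hmax n : L1 (fun w => Num.max (V w) (M_ n w)).
    have [i1 i2 i3] := hM_ n.
    apply: (L1_dom _ (L1D (L1_norm hV) (L1_norm i1))).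
      by apply: measurable_maxr; [exact: (L1_meas hV)|exact: (L1_meas i1)].
    by apply: aeW => w /=; rewrite maxEle; case: ifP => _; rewrite ?lerDl ?lerDr.
  have maxE n : Ex (fun w => Num.max (V w) (M_ n w)) <= sup E.
    have [i1 i2 i3] := hM_ n; apply: att_le; apply: attainable_max => //.
    exact: (attV _ _ st).
  pose D w := Num.max (V w) (Z w) - Z w.
  have hmaxZ : L1 (fun w => Num.max (V w) (Z w)).
    apply: (L1_dom _ (L1D (L1_norm hV) (L1_norm hZ))).
      by apply: measurable_maxr; [exact: (L1_meas hV)|exact: (L1_meas hZ)].
    by apply: aeW => w /=; rewrite maxEle; case: ifP => _; rewrite ?lerDl ?lerDr.
  have hD : L1 D by exact: L1B.
  have D0 w : 0 <= D w by rewrite subr_ge0 le_max lexx orbT.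
  (* The maximum of [V] with [M_ n] has mean at most the supremum, and [M_ n] alone is within [2^-n]
     of it; so [V] can exceed [Z] only by a vanishing amount in mean. *)
  have DE n : Ex D <= 2^-1 ^+ n.
    have [i1 i2 i3] := hM_ n.
    apply: (@le_trans _ _ (Ex (fun w => Num.max (V w) (M_ n w) - M_ n w))).
      apply: (Ex_le Pc) => //; last exact: L1B.
      apply: filterS MZ => w /(_ n) h; rewrite /D.
      by case: (leP (V w) (Z w)); case: (leP (V w) (M_ n w)); lra.
    rewrite ExB//; have := maxE n; have [_ h] := Hth n.
    have [v1 v2 v3 v4] := HV n; have := v4 _ FT; rewrite !idT => vE.
    have := Ex_le Pc (aeW _ (VM n)) v2 i1; lra.
  have : {ae P, forall w, D w = 0}.
    apply: (Ex_eq0 Pc) => //; first exact: aeW.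
    have c : (2^-1 ^+ n : R) @[n --> \oo] --> 0 by apply: cvg_expr; rewrite ger0_norm; lra.
    rewrite -(cvg_lim (@Rhausdorff R) c); apply: limr_ge; first by apply/cvg_ex; exists 0.
    exact: nearW.
  by apply: filterS => w; rewrite /D; case: (leP (V w) (Z w)) => // h; lra.
have YZ : {ae P, forall w, Y w <= Z w}.
  have [_ _ h] := hess.
  suff : {ae P, forall w, ((EFin \o Y) w <= (Z w)%:E)%E} by apply: filterS => w; rewrite lee_fin.
  apply: h; first exact/measurable_EFinP/(L1_meas hZ).
  move=> V [theta st [MV VE]].
  have [v [v1 v2 v3 v4]] := version st.
  have Vv : {ae P, forall w, V w = (v w)%:E}.
    apply: (cond_exp_unique Pc hM subM) => // A MA.
    by rewrite VE// GE //; [rewrite v4|exact: subM].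
  by apply: filterS2 Vv (VZ _ _ st v2 v1 v4) => w ->; rewrite lee_fin.
have YE : Ex Y <= sup E by apply: le_trans ZE; exact: (Ex_le Pc).
have [|_ [theta st <-] h] := @sup_adherent _ E e _ (conj neE ubE); first by [].
by exists theta => //; lra.
Qed.

End EssSupAttained.

(** * Paths and profit processes *)

Section Paths.
Context {R : realType}.

Lemma path_cvg (g : R -> R) (u_ : nat -> R) (u : R) :
  {within `[0, +oo[, continuous g} -> (forall n, 0 <= u_ n) -> 0 <= u ->
  u_ n @[n --> \oo] --> u -> g (u_ n) @[n --> \oo] --> g u.
Proof.
move=> /subspace_continuousP gc u_0 u0 cu.
have /= h := gc u; apply: (cvg_trans _ (h _)); last by rewrite /= in_itv/= u0.
move=> B /= HB; rewrite /nbhs /=.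
have : \forall x \near u, x \in `[0%R, +oo[ -> B (g x) by exact: HB.
move=> H; have : \forall n \near \oo, u_ n \in `[0%R, +oo[ -> B (g (u_ n)) by exact: (cu _ H).
by apply: filterS => n; apply; rewrite in_itv /= u_0.
Qed.

Definition grid_floor (n : nat) (s : R) : R := (Num.truncn (s * n.+1%:R))%:R / n.+1%:R.

Lemma grid_floor_ge0 n s : 0 <= grid_floor n s.
Proof. by rewrite divr_ge0. Qed.

Lemma grid_floor_itv n s : 0 <= s -> grid_floor n s <= s < grid_floor n s + n.+1%:R^-1.
Proof.
move=> s0; have : 0 <= s * n.+1%:R by rewrite mulr_ge0.
move=> /truncn_itv/andP[h1 h2]; rewrite /grid_floor ler_pdivrMr ?ltr0n// h1 /=.
rewrite -[X in _ + X]mul1r -mulrDl natr1 ltr_pdivlMr ?ltr0n//.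
Qed.

Lemma grid_floor_cvg s : 0 <= s -> grid_floor n s @[n --> \oo] --> s.
Proof.
move=> s0; have H : s - harmonic n @[n --> \oo] --> s.
  by rewrite -[X in _ --> X]subr0; apply: cvgB; [exact: cvg_cst|exact: cvg_harmonic].
apply: (squeeze_cvgr _ H (cvg_cst s)); apply: nearW => n.
by have := grid_floor_itv n s0; rewrite /harmonic /=; set u := _^-1; lra.
Qed.

(** Sampling at the left end of a grid cell gives jointly measurable step processes, which converge
    by continuity of the paths. Taking the maximum with 0 avoids negative times, where the process
    is arbitrary. *)
Lemma joint_measurable d (T : measurableType d) (Z : R -> T -> R) :
  (forall s, 0 <= s -> measurable_fun setT (Z s)) ->
  (forall w, {within `[0, +oo[, continuous (Z ^~ w)}) ->
  measurable_fun setT (fun p : R * T => Z (Num.max 0 p.1) p.2).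
Proof.
move=> mZ cZ.
have m0 : measurable_fun setT (fun p : R * T => Num.max 0 p.1 : R).
  by apply: measurable_maxr.
apply: (@measurable_fun_cvg _ _ _ _
    (fun n (p : R * T) => Z (grid_floor n (Num.max 0 p.1)) p.2)) => //; last first.
  move=> [s w] _ /=; have s0 : 0 <= Num.max 0 s by rewrite le_max lexx.
  apply: (@path_cvg (Z ^~ w) (fun n => grid_floor n (Num.max 0 s)) _ (cZ w)) => //.
    by move=> n; exact: grid_floor_ge0.
  exact: grid_floor_cvg.
move=> n _ B mB; rewrite setTI.
pose C k := [set p : R * T | k%:R / n.+1%:R <= Num.max 0 p.1 < k.+1%:R / n.+1%:R].
have mC k : measurable (C k).
  have := m0 measurableT `[k%:R / n.+1%:R, k.+1%:R / n.+1%:R[%classic (measurable_itv _).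
  by rewrite setTI; congr measurable; apply/seteqP; split => p; rewrite /C/= in_itv.
have CE k p : C k p -> grid_floor n (Num.max 0 p.1) = k%:R / n.+1%:R.
  move=> /andP[h1 h2]; rewrite /grid_floor; congr (_%:R / _); apply: truncn_def.
  by rewrite -ler_pdivrMr ?ltr0n// -ltr_pdivlMr ?ltr0n// h1.
rewrite (_ : _ @^-1` _ = \bigcup_k (C k `&` (setT `*` (Z (k%:R / n.+1%:R) @^-1` B)))).
  apply: bigcupT_measurable => k; apply: measurableI => //; apply: measurableX => //.
  by rewrite -[X in measurable X]setTI; apply: mZ => //; rewrite divr_ge0.
apply/seteqP; split => [p /= Bp|p [k _ [Cp [_ /= Bp]]]].
  exists (Num.truncn (Num.max 0 p.1 * n.+1%:R)) => //; split => //.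
  rewrite /C /=; have s0 : 0 <= Num.max 0 p.1 by rewrite le_max lexx.
  have := grid_floor_itv n s0; rewrite /grid_floor => /andP[-> h] /=.
  by move: h; rewrite -[X in _ + X]mul1r -mulrDl natr1.
by rewrite /= (CE k).
Qed.

Lemma measurable_integral_param d (T : measurableType d) (h : R * T -> R) (D : set R) :
  measurable_fun setT h -> (forall p, 0 <= h p) -> measurable D ->
  measurable_fun setT (fun w => \int[lebesgue_measure]_(s in D) (h (s, w))%:E)%E.
Proof.
move=> mh h0 mD.
pose k (p : R * T) : \bar R := (\1_D p.1 * h p)%:E.
have mk : measurable_fun setT k.
  apply/measurable_EFinP; apply: measurable_funM => //.
  by apply: (measurableT_comp (f := \1_D : R -> R)) => //; exact: measurable_indic.
have k0 p : (0 <= k p)%E by rewrite lee_fin mulr_ge0// indicE.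
have := measurable_fun_fubini_tonelli_G (m1 := lebesgue_measure) k mk k0.
congr (measurable_fun _ _); apply/funext => w; rewrite /fubini_G [RHS]integral_mkcond.
apply: eq_integral => s _; rewrite patchE /k /= indicE.
by case: ifPn; rewrite ?mul1r ?mul0r.
Qed.

Definition time_itv (t : R) (u : \bar R) : set R := [set s | (t%:E <= s%:E <= u)%E].

Lemma measurable_time_itv t u : measurable (time_itv t u).
Proof.
case: u => [u| |].
- rewrite (_ : time_itv _ _ = `[t, u]%classic); first exact: measurable_itv.
  by apply/seteqP; split => s; rewrite /time_itv /= in_itv /= !lee_fin.
- rewrite (_ : time_itv _ _ = `[t, +oo[%classic); first exact: measurable_itv.
  by apply/seteqP; split => s; rewrite /time_itv /= in_itv /= lee_fin leey.
- rewrite (_ : time_itv _ _ = set0)//; apply/seteqP; split => s //=.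
  by rewrite /time_itv/= leeNy_eq andbF.
Qed.

Lemma time_itvy t : time_itv t +oo%E = `[t, +oo[%classic.
Proof. by apply/seteqP; split => s; rewrite /time_itv /= in_itv /= lee_fin leey. Qed.

Lemma time_itv_sub t u : 0 <= t -> time_itv t u `<=` `[0, +oo[%classic.
Proof.
move=> t0 s /andP[+ _]; rewrite lee_fin /= in_itv/= andbT.
exact: le_trans.
Qed.

Local Notation Rp := (`[0%R, +oo[%classic : set R).

Lemma fine_integral_cvg (h : R -> R) (u_ : nat -> \bar R) (u : \bar R) :
  measurable_fun Rp h ->
  (forall s, 0 <= s -> 0 <= h s) ->
  (\int[lebesgue_measure]_(s in Rp) (h s)%:E < +oo)%E ->
  u_ n @[n --> \oo] --> u ->
  fine (\int[lebesgue_measure]_(s in time_itv 0 (u_ n)) (h s)%:E)%E @[n --> \oo] -->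
  fine (\int[lebesgue_measure]_(s in time_itv 0 u) (h s)%:E)%E.
Proof.
move=> mh h0 hfin cu.
have hint : lebesgue_measure.-integrable Rp (EFin \o h).
  apply/integrableP; split; first exact/measurable_EFinP.
  apply: le_lt_trans hfin; rewrite le_eqVlt; apply/orP; left; apply/eqP.
  apply: eq_integral => s; rewrite inE /= in_itv /= andbT => s0.
  by rewrite ger0_norm// h0.
have mD v : measurable (time_itv 0 v) := measurable_time_itv 0 v.
have sD v : time_itv 0 v `<=` Rp by exact: time_itv_sub.
pose k v : R -> \bar R := (EFin \o h) \_ (time_itv 0 v).
have mk v : measurable_fun setT (k v).
  apply/(measurable_restrictT _ (mD v))/measurable_EFinP.
  exact: (measurable_funS (measurable_itv _) (sD v) mh).
have gint : lebesgue_measure.-integrable setT ((EFin \o h) \_ Rp).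
  exact: (iffLR (@integrable_mkcond _ _ _ (@lebesgue_measure R) Rp _ (measurable_itv _)) hint).
have cae : {ae @lebesgue_measure R, forall s, setT s -> k (u_ n) s @[n --> \oo] --> k u s}.
  (* The indicators of [[0, u_n]] converge to that of [[0, u]] except possibly at the point [u],
     which has measure 0. *)
  exists [set fine u]; split => //; first exact: lebesgue_measure_set1.
  move=> s /= H; apply: contrapT => su; apply: H => _.
  apply: cvg_near_cst; rewrite /k.
  have [lt|gt|eq] := ltgtP s%:E u.
  + have : \forall n \near \oo, (s%:E < u_ n)%E by exact: (cu _ (open_ereal_gt' lt)).
    apply: filterS => n hn; rewrite !patchE.
    rewrite (_ : (s \in time_itv 0 (u_ n)) = (s \in time_itv 0 u))//.
    by apply/idP/idP; rewrite !inE /time_itv /= => /andP[-> _]; apply: ltW.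
  + have : \forall n \near \oo, (u_ n < s%:E)%E by exact: (cu _ (open_ereal_lt' gt)).
    apply: filterS => n hn; rewrite !patchE.
    rewrite (_ : (s \in time_itv 0 (u_ n)) = (s \in time_itv 0 u))//.
    by apply/idP/idP; rewrite !inE /time_itv /= => /andP[_]; rewrite leNgt ?hn ?gt.
  + by exfalso; apply: su; rewrite -eq.
have bae : {ae @lebesgue_measure R, forall s n, setT s ->
    (`|k (u_ n) s| <= ((EFin \o h) \_ Rp) s)%E}.
  apply: aeW => s n _; rewrite /k !patchE; case: ifPn => [|_].
    rewrite inE => /[dup] /(sD _) s0 _; rewrite mem_set//=.
    by rewrite ger0_norm// h0//; move: s0; rewrite /= in_itv/= andbT.
  rewrite abse0; case: ifPn => // ; rewrite inE /= in_itv /= andbT lee_fin.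
  exact: h0.
have [kint _ c] := @dominated_convergence _ _ _ (@lebesgue_measure R) setT measurableT
  (fun n => k (u_ n)) (k u) _ (fun n => mk (u_ n)) (mk u) cae gint bae.
have fin v : (\int[lebesgue_measure]_(s in time_itv 0 v) (h s)%:E)%E \is a fin_num.
  apply: integrable_fin_num; first exact: mD.
  exact: (@integrableS _ _ _ (@lebesgue_measure R) _ _ _ (measurable_itv _) (mD v) (sD v) hint).
have /fine_cvgP[_] // : (\int[lebesgue_measure]_(s in time_itv 0 (u_ n)) (h s)%:E)%E @[n --> \oo] -->
  (fine (\int[lebesgue_measure]_(s in time_itv 0 u) (h s)%:E))%:E%E.
rewrite fineK//; under eq_fun do rewrite integral_mkcond; rewrite integral_mkcond.
exact: c.
Qed.

Lemma integral_between (h : R -> R) (t : R) (u : \bar R) :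
  measurable_fun Rp h -> (forall s, 0 <= h s) ->
  (\int[lebesgue_measure]_(s in Rp) (h s)%:E < +oo)%E ->
  0 <= t -> (t%:E <= u)%E ->
  (\int[lebesgue_measure]_(s in time_itv t u) (h s)%:E)%E =
  (fine (\int[lebesgue_measure]_(s in time_itv 0 u) (h s)%:E)%E -
   fine (\int[lebesgue_measure]_(s in time_itv 0 t%:E) (h s)%:E)%E)%:E.
Proof.
move=> mh h0 hfin t0 tu.
have mr : measurable_fun Rp (fun s => (h s)%:E).
  by apply/measurable_EFinP; exact: mh.
have r0 s : (0 <= (h s)%:E)%E by rewrite lee_fin h0.
have fin D : measurable D -> D `<=` Rp ->
    (\int[lebesgue_measure]_(s in D) (h s)%:E)%E \is a fin_num.
  move=> mD sD; rewrite ge0_fin_numE; last exact: integral_ge0.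
  apply: (le_lt_trans _ hfin); exact: ge0_subset_integral.
have e : (\int[lebesgue_measure]_(s in time_itv 0 u) (h s)%:E =
   \int[lebesgue_measure]_(s in `[0%R, t[) (h s)%:E +
   \int[lebesgue_measure]_(s in time_itv t u) (h s)%:E)%E.
  rewrite -ge0_integral_setU//=.
  - congr (integral _ _ _); apply/seteqP; split => s; rewrite /time_itv /= in_itv/= !lee_fin.
      by move=> /andP[s0 su]; case: (leP t s) => ts; [right; rewrite su|left; rewrite s0].
    move=> [/andP[s0 st]|/andP[ts su]]; first by rewrite s0 (le_trans _ tu)// lee_fin ltW.
    by rewrite (le_trans t0 ts).
  - exact: measurable_time_itv.
  - apply: (measurable_funS _ _ mr); first exact: measurable_itv.
    move=> s [|/(time_itv_sub t0)//]; rewrite /= !in_itv/= => /andP[->//].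
  - apply/disj_setPS => s []; rewrite /time_itv /= in_itv/= => /andP[_ st] /andP[+ _].
    by rewrite lee_fin leNgt st.
have e' : (\int[lebesgue_measure]_(s in `[0%R, t[) (h s)%:E =
    \int[lebesgue_measure]_(s in time_itv 0 t%:E) (h s)%:E)%E.
  rewrite (_ : time_itv 0 t%:E = `[0, t]%classic); last first.
    by apply/seteqP; split => s; rewrite /time_itv /= in_itv/= !lee_fin.
  apply: integral_itv_bndo_bndc; apply: (measurable_funS _ _ mr); first exact: measurable_itv.
  by move=> s; rewrite /= !in_itv/= => /andP[->].
rewrite EFinB !fineK//.
- rewrite e e' addeAC subee ?add0e//; apply: fin; first exact: measurable_time_itv.
  exact: time_itv_sub.
- by apply: fin; [exact: measurable_time_itv|exact: time_itv_sub].
- by apply: fin; [exact: measurable_time_itv|exact: time_itv_sub].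
Qed.

End Paths.

(** * Accumulated profit *)

Section Profit.
Context {R : realType}.
Local Notation Rp := (`[0%R, +oo[%classic : set R).
Variables (beta : R) (g : R -> R).
Hypotheses (hg : forall y, 0 < g y) (mg : measurable_fun [set: R] g).

Definition rate (T : Type) (x : R -> T -> R) (s : R) (w : T) : R :=
  expR (- (beta * s)) * g (x s w).

Lemma rate_ge0 T (x : R -> T -> R) s w : 0 <= rate x s w.
Proof. by rewrite mulr_ge0 ?expR_ge0// ltW. Qed.

Section measurability.
Context d (T : measurableType d).
Variable x : R -> T -> R.
Hypothesis mx : forall s, 0 <= s -> measurable_fun setT (x s).
Hypothesis cx : forall w, {within `[0, +oo[, continuous (x ^~ w)}.

Let mrate : measurable_fun setT
  (fun p : R * T => expR (- (beta * p.1)) * g (x (Num.max 0 p.1) p.2)).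
Proof.
apply: measurable_funM.
  apply: (measurableT_comp (f := expR)); first exact: measurable_expR.
  by apply: measurableT_comp => //; exact: measurable_funM.
by apply: (measurableT_comp mg); exact: joint_measurable.
Qed.

Lemma measurable_rate w : measurable_fun Rp (rate x ^~ w).
Proof.
apply: (eq_measurable_fun (fun s => expR (- (beta * s)) * g (x (Num.max 0 s) w))).
  by move=> s; rewrite inE /= in_itv/= andbT => s0; rewrite max_r.
apply: measurable_funTS.
apply: (measurableT_comp (f := fun p : R * T => expR (- (beta * p.1)) *
  g (x (Num.max 0 p.1) p.2)) mrate (g := fun s => (s, w))).
exact: measurable_fun_pair.
Qed.

Lemma measurable_integral_rate (D : set R) : measurable D -> D `<=` Rp ->
  measurable_fun setT (fun w => \int[lebesgue_measure]_(s in D) (rate x s w)%:E)%E.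
Proof.
move=> mD sD.
have := measurable_integral_param mrate _ mD.
have h0 (p : R * T) : 0 <= expR (- (beta * p.1)) * g (x (Num.max 0 p.1) p.2).
  by rewrite mulr_ge0 ?expR_ge0// ltW.
move=> /(_ h0); congr (measurable_fun _ _); apply/funext => w.
apply: eq_integral => s; rewrite inE => /sD; rewrite /= in_itv/= andbT => s0.
by rewrite max_r.
Qed.
End measurability.

(** The default value of [fine] appears only where the total profit is infinite, a null event once
    its mean is known to be finite. *)
Definition profit_until (T : Type) (x : R -> T -> R) (u : \bar R) (w : T) : R :=
  fine (\int[lebesgue_measure]_(s in time_itv 0 u) (rate x s w)%:E)%E.

Lemma profit_until_ge0 T (x : R -> T -> R) u w : 0 <= profit_until x u w.
Proof.
by apply: fine_ge0; apply: integral_ge0 => s _; rewrite lee_fin rate_ge0.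
Qed.

End Profit.

(** * Regularity of values, profits and discount factors *)

Section Regularity.
Context {R : realType} {d : measure_display} {Omega : measurableType d}.
Local Notation Rp := (`[0%R, +oo[%classic : set R).
Variables (P : probability Omega R) (F : R -> set (set Omega)).
Hypothesis hF : complete_right_continuous_filtration P F.
Local Notation L1 := (L1 P).
Local Notation Ex := (Ex P).
Let Pc := filt_complete hF.

Lemma regularD Z1 Z2 : regular P Z1 -> regular P Z2 ->
  regular P (fun u w => Z1 u w + Z2 u w).
Proof.
move=> [m1 c1 [g1 h1 b1]] [m2 c2 [g2 h2 b2]]; split.
- by move=> u u0; apply: measurable_funD; [exact: m1|exact: m2].
- by apply: filterS2 c1 c2 => w a b u_ u u0 cu; apply: cvgD; [exact: a|exact: b].
- exists (fun w => g1 w + g2 w); first exact: L1D.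
  by apply: filterS2 b1 b2 => w a b u u0; rewrite (le_trans (ler_normD _ _))// lerD ?a ?b.
Qed.

Lemma regularZ (k : R) Z : regular P Z -> regular P (fun u w => k * Z u w).
Proof.
move=> [m c [g h b]]; split.
- by move=> u u0; apply: measurable_funM => //; exact: m.
- by apply: filterS c => w a u_ u u0 cu; apply: cvgM; [exact: cvg_cst|exact: a].
- exists (fun w => `|k| * g w); first exact: L1Z.
  by apply: filterS b => w a u u0; rewrite normrM ler_wpM2l ?a.
Qed.

(** Sets of the product sigma-algebra have all their sections in [F t], and the section at time [t]
    is the required event. *)
Lemma progressively_measurable_adapted Z : progressively_measurable F Z -> adapted F Z.
Proof.
move=> h t t0 B mB; have sa := filt_sa hF t0.
suff sub : <<s [set A `*` C | A in @measurable _ R & C in F t] >> `<=`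
    [set E : set (R * Omega) | forall s, F t [set w | E (s, w)]].
  have := sub _ (h t t0 B mB) t; congr (F t _); apply/seteqP; split => w.
    by move=> /= [].
  by rewrite /= t0 lexx.
apply: smallest_sub; first split.
- by move=> s; exact: (sa0 sa).
- move=> E HE s; rewrite (_ : [set w | _] = ~` [set w | E (s, w)]); first by apply: (saC sa); exact: HE.
  by rewrite setTD.
- move=> E HE s; rewrite (_ : [set w | _] = \bigcup_n [set w | E n (s, w)]).
    by apply: (sa_bigcup sa) => n; exact: HE.
  by apply/seteqP; split => w [n _ hn]; exists n.
move=> _ [D mD [C FC <-]] s.
have [Ds|Ds] := pselect (D s).
  by rewrite (_ : [set w | _] = C)//; apply/seteqP; split => w //= [].
by rewrite (_ : [set w | _] = set0); [exact: (sa0 sa)|apply/seteqP; split => w //= []].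
Qed.

(* The value at +oo is set to 0, the almost sure limit in the theorem. *)
Definition extend (Z : R -> Omega -> R) (u : \bar R) (w : Omega) : R :=
  if u is r%:E then Z r w else 0.

Section extend.
Variable Z : R -> Omega -> R.
Hypotheses (cZ : continuous_paths Z) (iZ : square_sup_integrable P F Z).
Hypothesis Zoo : {ae P, forall w, Z t w @[t --> +oo] --> (0 : R)}.

Lemma process_meas t : 0 <= t -> measurable_fun setT (Z t).
Proof.
move=> t0; have aZ := progressively_measurable_adapted iZ.1.
by apply: (measurable_wrt_meas (filt_meas hF t0)); exact: aZ.
Qed.

(** By continuity the supremum of the squares over all times is one over rational times, hence
    measurable; it is integrable, and [z <= 1 + z^2] turns it into a bound for [|Z|]. *)
Lemma process_bound : exists2 g, L1 g &
  {ae P, forall w t, 0 <= t -> `|Z t w| <= g w}.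
Proof.
(* An enumeration of the nonnegative rationals; numbers that code no pair give 0. *)
pose q (n : nat) : R := if unpickle n is Some (a, b) then a%:R / b.+1%:R else 0.
have q0 n : 0 <= q n by rewrite /q; case: unpickle => // -[a b]; rewrite divr_ge0.
pose H w := esups (fun n => ((`|Z (q n) w| ^+ 2)%:E : \bar R)) 0%N.
have HE w : ereal_sup [set ((`|Z t w| ^+ 2)%:E) | t in `[0%R, +oo[%classic] = H w.
  apply/eqP; rewrite eq_le; apply/andP; split.
    apply: ge_ereal_sup => _ [t /= + <-]; rewrite in_itv/= andbT => t0.
    have c : ((`|Z (grid_floor n t) w| ^+ 2)%:E : \bar R) @[n --> \oo] --> (`|Z t w| ^+ 2)%:E.
      apply/fine_cvgP; split; first exact: nearW.
      have c0 := @path_cvg _ (Z ^~ w) (fun n => grid_floor n t) t (@cZ w)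
        (fun n => grid_floor_ge0 n t) t0 (grid_floor_cvg t0).
      have cn : `|Z (grid_floor n t) w| @[n --> \oo] --> `|Z t w| by exact: cvg_norm c0.
      by rewrite /= expr2; under eq_fun do rewrite expr2; apply: cvgM.
    rewrite -(cvg_lim _ c)//; apply: lime_le; first by apply/cvg_ex; eexists; exact: c.
    apply: nearW => n; apply: ereal_sup_ubound.
    exists (pickle (Num.truncn (t * n.+1%:R), n)) => //.
    by rewrite /q pickleK.
  apply: ge_ereal_sup => _ [n _ <-]; apply: ereal_sup_ubound; exists (q n) => //=.
  by rewrite in_itv/= q0.
have mH : measurable_fun setT H.
  apply: measurable_fun_esups => n; apply/measurable_EFinP.
  by apply: measurable_funX; apply: measurableT_comp => //; exact: process_meas.
have H0 w : (0 <= H w)%E.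
  apply: (@le_trans _ _ (`|Z (q 0%N) w| ^+ 2)%:E); first by rewrite lee_fin exprn_ge0.
  by apply: ereal_sup_ubound; exists 0%N.
have Hoo : (\int[P]_w H w < +oo)%E.
  by have [_] := iZ; under eq_integral do rewrite HE.
have iH : P.-integrable setT H.
  by apply/integrableP; split => //; under eq_integral do rewrite gee0_abs//.
have fH := integrable_ae measurableT iH.
exists (fun w => 1 + fine (H w)).
  apply: L1D; first exact: L1_cst.
  apply/integrableP; split; first by apply/measurable_EFinP/measurableT_comp.
  move/integrableP : iH => [_]; apply: le_lt_trans.
  apply: ae_ge0_le_integral => //.
  - by do 2 apply: measurableT_comp => //; exact: measurableT_comp.
  - exact: measurableT_comp.
  - by apply: filterS fH => w /(_ I) + _ /=; case: (H w).
apply: filterS fH => w /(_ I) fHw t t0.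
have h : `|Z t w| ^+ 2 <= fine (H w).
  rewrite -lee_fin fineK// -HE; apply: ereal_sup_ubound; exists t => //=.
  by rewrite in_itv/= t0.
have := sqr_ge0 (`|Z t w| - 1); have := sqr_ge0 `|Z t w|; move: h.
by move: (`|Z t w|) (fine (H w)) => z y; rewrite !expr2; nra.
Qed.

Lemma extend_regular : regular P (extend Z).
Proof.
split.
- by move=> [u| |] //= u0; [exact: process_meas|exact: measurable_cst].
- apply: filterS Zoo => w z0 u_ u u0 cu.
  have u00 : (0 <= u)%E.
    rewrite -(cvg_lim _ cu)//; apply: lime_ge; last exact: nearW.
    by apply/cvg_ex; exists u.
  case: u cu u00 => [u| |] // cu u00.
    move/fine_cvgP : cu => [fu cu].
    apply: cvg_trans (@path_cvg _ (Z ^~ w) (fine \o u_) u (@cZ w) _ u00 cu).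
      by apply: near_eq_cvg; apply: filterS fu => n /= ; case: (u_ n).
    by move=> n; exact: fine_ge0.
  apply/cvgr0Pnorm_lt => e e0.
  move/cvgr0Pnorm_lt : z0 => /(_ e e0) [A [_ hA]].
  move/cvgeyPgt : cu => /(_ A); apply: filterS => n; case: (u_ n) => [r| |] //=.
  + by rewrite lte_fin; exact: hA.
  + by rewrite normr0.
- have [g g1 gZ] := process_bound; exists g => //.
  apply: filterS gZ => w h [u| |] //= u0; first exact: h.
  by rewrite normr0 (le_trans _ (h 0 (lexx 0))).
Qed.

Lemma value_at_extend theta : {ae P, forall w, value_at Z theta w = extend Z (theta w) w
   \/ theta w = -oo%E}.
Proof.
apply: filterS Zoo => w z0; rewrite /value_at /extend; case: (theta w) => [r| |]; [by left| |by right].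
by left; exact: (cvg_lim (@Rhausdorff R) z0).
Qed.

End extend.

Section profit.
Variables (beta : R) (g : R -> R) (x : R -> Omega -> R).
Hypotheses (hg : forall y, 0 < g y) (mg : measurable_fun [set: R] g).
Hypotheses (ax : adapted F x) (cx : continuous_paths x).

Definition total_profit w := (\int[lebesgue_measure]_(s in Rp) (rate beta g x s w)%:E)%E.
Hypothesis total_fin : (\int[P]_w total_profit w < +oo)%E.

Lemma adapted_meas s : 0 <= s -> measurable_fun setT (x s).
Proof.
by move=> s0; apply: (measurable_wrt_meas (filt_meas hF s0)); exact: ax.
Qed.

Lemma total_profit_meas : measurable_fun setT total_profit.
Proof.
by apply: (measurable_integral_rate beta hg mg adapted_meas cx).
Qed.

Lemma total_profit_ge0 w : (0 <= total_profit w)%E.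
Proof. by apply: integral_ge0 => s _; rewrite lee_fin rate_ge0. Qed.

Lemma total_profit_ae : {ae P, forall w, (total_profit w < +oo)%E}.
Proof.
have : P.-integrable setT total_profit.
  apply/integrableP; split; first exact: total_profit_meas.
  by under eq_integral do rewrite (gee0_abs (total_profit_ge0 _)).
move=> /(integrable_ae measurableT); apply: filterS => w /(_ I).
by rewrite fin_numElt => /andP[].
Qed.

Lemma total_profit_L1 : L1 (fun w => fine (total_profit w)).
Proof.
apply/integrableP; split; first exact/measurable_EFinP/measurableT_comp/total_profit_meas.
apply: le_lt_trans total_fin; apply: ge0_le_integral => //.
- by do 2 apply: measurableT_comp => //; apply: measurableT_comp => //; exact: total_profit_meas.
- exact: total_profit_meas.
move=> w _ /=; have := total_profit_ge0 w; case: (total_profit w) => [r| |] //=.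
  by rewrite lee_fin => r0; rewrite ger0_norm.
by rewrite normr0.
Qed.

Lemma profit_until_regular : regular P (profit_until beta g x).
Proof.
split.
- move=> u u0; apply: measurableT_comp => //.
  apply: (measurable_integral_rate beta hg mg adapted_meas cx).
    exact: measurable_time_itv.
  exact: time_itv_sub.
- apply: filterS total_profit_ae => w h u_ u _ cu.
  apply: (@fine_integral_cvg _ (rate beta g x ^~ w) u_ u _ _ h cu).
    exact: (measurable_rate beta mg adapted_meas cx w).
  by move=> s _; exact: rate_ge0.
- exists (fun w => fine (total_profit w)); first exact: total_profit_L1.
  apply: filterS total_profit_ae => w h u u0.
  rewrite ger0_norm ?profit_until_ge0//; apply: fine_le.
  + rewrite ge0_fin_numE; last by apply: integral_ge0 => s _; rewrite lee_fin rate_ge0.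
    apply: (le_lt_trans _ h); apply: ge0_subset_integral => //.
    * exact: measurable_time_itv.
    * by apply/measurable_EFinP; exact: (measurable_rate beta mg adapted_meas cx).
    * by move=> s _; rewrite lee_fin rate_ge0.
    * exact: time_itv_sub.
  + by rewrite ge0_fin_numE// total_profit_ge0.
  + apply: ge0_subset_integral => //.
    * exact: measurable_time_itv.
    * by apply/measurable_EFinP; exact: (measurable_rate beta mg adapted_meas cx).
    * by move=> s _; rewrite lee_fin rate_ge0.
    * exact: time_itv_sub.
Qed.

Lemma profit_between w t u : 0 <= t -> (t%:E <= u)%E -> (total_profit w < +oo)%E ->
  (\int[lebesgue_measure]_(s in time_itv t u) (rate beta g x s w)%:E)%E =
  (profit_until beta g x u w - profit_until beta g x t%:E w)%:E.
Proof.
move=> t0 tu h; apply: integral_between => //; last by move=> s; exact: rate_ge0.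
exact: (measurable_rate beta mg adapted_meas cx).
Qed.

End profit.

Definition disc (beta : R) (u : \bar R) : R := fine (discount beta u).

Lemma discE (beta : R) (u : \bar R) : 0 < beta -> (0 <= u)%E ->
  [/\ discount beta u = (disc beta u)%:E, 0 <= disc beta u <= 1 &
    disc beta u = if u is r%:E then expR (- (beta * r)) else 0].
Proof.
move=> b0; rewrite /disc /discount; case: u => [u| |] // u0.
  split => //=; rewrite expR_ge0 /= -[leRHS]expR0 ler_expR oppr_le0 mulr_ge0//.
  exact: ltW.
by rewrite gt0_muley ?lte_fin//= lexx ler01.
Qed.

Lemma disc_regular (beta : R) : 0 < beta -> regular P (fun u _ => disc beta u).
Proof.
move=> b0; split.
- by move=> u _; exact: measurable_cst.
- apply: aeW => _ u_ u u0 cu.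
  have u00 : (0 <= u)%E.
    rewrite -(cvg_lim _ cu)//; apply: lime_ge; last exact: nearW.
    by apply/cvg_ex; exists u.
  have [_ _ ->] := discE b0 u00.
  case: u cu u00 => [u| |] // cu u00.
    move/fine_cvgP : cu => [fu cu].
    have c : expR (- (beta * (fine \o u_) n)) @[n --> \oo] --> expR (- (beta * u)).
      apply: (cvg_comp _ expR); last exact: continuous_expR.
      by apply: cvgN; apply: cvgM => //; exact: cvg_cst.
    apply: cvg_trans c; apply: near_eq_cvg; apply: filterS fu => n /= h.
    by have [_ _ ->] := discE b0 (u0 n); case: (u_ n) h.
  apply/cvgr0Pnorm_lt => e e0.
  move/cvgeyPgt : cu => /(_ (- ln e / beta)); apply: filterS => n.
  have [_ _ ->] := discE b0 (u0 n); case: (u_ n) => [r| |] //=; last by rewrite normr0.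
  rewrite lte_fin ltr_pdivrMr// => h.
  by rewrite ger0_norm ?expR_ge0// -[ltRHS](lnK e0) ltr_expR; lra.
- exists (fun=> 1); first exact: L1_cst.
  apply: aeW => _ u u0; have [_ /andP[h1 h2] _] := discE b0 u0.
  by rewrite ger0_norm.
Qed.

End Regularity.

(** * First times and the stopping problem *)

Section ZeroSets.
Context {R : realType}.

(** [|g|] attains its minimum on the compact segment, and that minimum is below every [e]. *)
Lemma zero_in_segment (g : R -> R) (a b : R) :
  {within `[0, +oo[, continuous g} -> 0 <= a -> a <= b ->
  (forall e, 0 < e -> exists2 p, a <= p <= b & `|g p| < e) ->
  exists2 s, a <= s <= b & g s = 0.
Proof.
move=> gc a0 ab H.
have sub : `[a, b] `<=` `[0, +oo[.
  by move=> s /=; rewrite !in_itv/= => /andP[h _]; rewrite (le_trans a0 h).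
have cc : {within `[a, b], continuous (fun s => `|g s|)}.
  move=> s; apply: cvg_norm; exact: (continuous_subspaceW sub gc).
have [s /[!in_itv]/= sab smin] := EVT_min ab cc.
exists s => //; apply/eqP; rewrite -normr_eq0 eq_le normr_ge0 andbT.
apply/ler_addgt0Pr => e e0; rewrite add0r.
have [p pab pe] := H e e0; apply/ltW/(le_lt_trans _ pe)/smin.
by rewrite in_itv.
Qed.

Lemma ecvg_below (v_ : nat -> \bar R) (u : \bar R) :
  (forall n, (0 <= v_ n <= u)%E) ->
  (forall y : R, 0 <= y -> (y%:E < u)%E -> \forall n \near \oo, (y%:E < v_ n)%E) ->
  v_ n @[n --> \oo] --> u.
Proof.
move=> vu H; have u0 : (0 <= u)%E by have /andP[h1 h2] := vu 0%N; exact: le_trans h2.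
case: u u0 vu H => [r| |] // r0 vu H.
  have fv n : v_ n \is a fin_num.
    by have /andP[h1 h2] := vu n; rewrite ge0_fin_numE// (le_lt_trans h2)// ltry.
  apply/fine_cvgP; split; first exact: nearW.
  apply/cvgrPdist_lt => e e0.
  have vr n : fine (v_ n) <= r by rewrite -lee_fin fineK//; have /andP[] := vu n.
  have v0 n : 0 <= fine (v_ n) by rewrite fine_ge0//; have /andP[] := vu n.
  have [rz|rp] := leP r 0.
    apply: nearW => n; rewrite ger0_norm ?subr_ge0//=.
    by have := v0 n; have := vr n; rewrite /=; lra.
  have ylt : ((Num.max 0 (r - e))%:E < r%:E)%E by rewrite lte_fin gt_max rp /=; lra.
  have /H := ylt; rewrite le_max lexx => /(_ isT); apply: filterS => n.
  rewrite -[X in (_ < X)%E -> _](fineK (fv n)) lte_fin gt_max => /andP[_ h].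
  by rewrite ger0_norm ?subr_ge0//=; lra.
apply/cvgeyPgt => A.
have [A0|A0] := leP 0 A; first by apply: H => //; rewrite ltry.
have := H 0 (lexx 0) (ltry 0); apply: filterS => n; apply: lt_trans.
by rewrite lte_fin.
Qed.
End ZeroSets.

Section FirstTime.
Context {R : realType} {d : measure_display} {Omega : measurableType d}.
Variables (F : R -> set (set Omega)) (P : probability Omega R).
Hypothesis hF : complete_right_continuous_filtration P F.
Variables (beta c : R) (Y Z : R -> Omega -> R).
Hypotheses (cY : continuous_paths Y) (cZ : continuous_paths Z).
Hypotheses (aY : adapted F Y) (aZ : adapted F Z).
Local Notation LF := (left_filtration F).

Let D t w := Y t w + c * expR (- (beta * t)) - Z t w.

Let cD w : {within `[0, +oo[, continuous (D ^~ w)}.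
Proof.
move=> t; apply: cvgB; last exact: cZ.
apply: cvgD; first exact: cY.
apply: cvgM; first exact: cvg_cst.
have : continuous (fun s : R => expR (- (beta * s))).
  move=> s; apply: (cvg_comp _ expR); last exact: continuous_expR.
  by apply: cvgN; apply: cvgM; [exact: cvg_cst|exact: cvg_id].
by move=> h; exact: (continuous_subspaceT h).
Qed.

Let D0E t w : D t w = 0 <-> Y t w = - (c * expR (- (beta * t))) + Z t w.
Proof. by rewrite /D; split => h; lra. Qed.

Lemma first_time_ge theta w : (theta <= first_time beta c Y Z theta w)%E.
Proof. by apply: le_ereal_inf_tmp => _ [t /= [_ h _] <-]. Qed.

Lemma first_time_ge0 theta w : (0 <= first_time beta c Y Z theta w)%E.
Proof. by apply: le_ereal_inf_tmp => _ [t /= [h _ _] <-]; rewrite lee_fin. Qed.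

Lemma first_time_le theta w t : 0 <= t -> (theta <= t%:E)%E -> D t w = 0 ->
  (first_time beta c Y Z theta w <= t%:E)%E.
Proof.
by move=> t0 th /D0E h; apply: ereal_inf_lbound; exists t.
Qed.

(** The zero set of a continuous path is closed, so the infimum is attained as soon as it is
    finite. *)
Lemma first_time_attained theta w r : first_time beta c Y Z theta w = r%:E ->
  Y r w = - (c * expR (- (beta * r))) + Z r w.
Proof.
move=> h; apply/D0E.
have r0 : 0 <= r by rewrite -lee_fin -h first_time_ge0.
have H n : exists t, [/\ 0 <= t, r <= t < r + n.+1%:R^-1 & D t w = 0].
  have n0 : 0 < n.+1%:R^-1 :> R by rewrite invr_gt0 ltr0n.
  have ff : first_time beta c Y Z theta w \is a fin_num by rewrite h.
  have [_ [t /= [t0 tht /D0E Dt] <-] lt] := lb_ereal_inf_adherent n0 ff.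
  exists t; split => //; rewrite -lee_fin -h first_time_le //=.
  by move: lt; rewrite -[ereal_inf _]/(first_time beta c Y Z theta w) h -EFinD lte_fin.
have /choice[t_ Ht] := H.
have ct : t_ n @[n --> \oo] --> r.
  have H1 : r + harmonic n @[n --> \oo] --> r.
    by rewrite -[X in _ --> X]addr0; apply: cvgD; [exact: cvg_cst|exact: cvg_harmonic].
  apply: (squeeze_cvgr _ (cvg_cst r) H1); apply: nearW => n.
  by have [_ /andP[-> /ltW ->]] := Ht n.
have t0 n : 0 <= t_ n by have [] := Ht n.
have := @path_cvg _ (D ^~ w) t_ r (@cD w) t0 r0 ct.
rewrite (_ : (fun n => D (t_ n) w) = fun=> 0); last first.
  by apply/funext => n; have [_ _ ->] := Ht n.
by move=> h'; rewrite -(cvg_lim (@Rhausdorff R) h') lim_cst.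
Qed.

(** For [t > 0], a continuous adapted process is determined at [t] by its values at the earlier
    times [t (1 - 1/(n+1))], hence is measurable for the left filtration. *)
Let D_left t : 0 <= t -> measurable_wrt (LF t) (D t).
Proof.
have Dm s M : sigma_algebra setT M -> F s `<=` M -> 0 <= s -> measurable_wrt M (D s).
  move=> sa sub s0; apply/(measurable_wrtP sa).
  have mY : measurable_fun [set: g_sigma_algebraType M] (Y s : g_sigma_algebraType M -> R).
    by apply/(measurable_wrtP sa) => B mB; exact/sub/aY.
  have mZ : measurable_fun [set: g_sigma_algebraType M] (Z s : g_sigma_algebraType M -> R).
    by apply/(measurable_wrtP sa) => B mB; exact/sub/aZ.
  by apply: measurable_funB => //; apply: measurable_funD.
move=> t0; have sa := left_sa hF t0; have [tpos|] := ltP 0 t; last first.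
  by move=> tn; apply: Dm => // A FA; rewrite /left_filtration ltNge tn /= (_ : 0 = t) //; apply/eqP; rewrite eq_le t0.
apply/(measurable_wrtP sa).
pose s_ n := t * (1 - harmonic n).
have h0 n : 0 < (harmonic n : R) <= 1 by rewrite /harmonic /= invr_gt0 ltr0n invf_le1 ?ltr0n// ler1n.
have s0 n : 0 <= s_ n by rewrite mulr_ge0// subr_ge0; have /andP[] := h0 n.
have st n : s_ n < t by rewrite gtr_pMr//; have /andP[h _] := h0 n; lra.
apply: (@measurable_fun_cvg _ _ _ _ (fun n (w : g_sigma_algebraType (LF t)) => D (s_ n) w)).
  by move=> n; apply/(measurable_wrtP sa); apply: Dm => //; exact: sub_left.
move=> w _; apply: (@path_cvg _ (D ^~ w) s_ t (@cD w) s0 t0).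
rewrite -[X in _ --> X]mulr1; apply: cvgM; first exact: cvg_cst.
by rewrite -[X in _ --> X]subr0; apply: cvgB; [exact: cvg_cst|exact: cvg_harmonic].
Qed.

(** By compactness a zero exists in [[theta, t]] exactly when [|D|] gets below every [1/(n+1)] at
    countably many test times there, and each such event is known at its test time. *)
Lemma first_time_stopping theta : stopping_time F theta ->
  stopping_time F (fun w => first_time beta c Y Z (theta w) w).
Proof.
move=> st; split => [w|t t0]; first exact: first_time_ge0.
have sa := left_sa hF t0.
pose q (m : nat) : R := if unpickle m is Some (a, b) then a%:R / b.+1%:R else 0.
have q0 m : 0 <= q m by rewrite /q; case: unpickle => // -[a b]; rewrite divr_ge0.
(* Capping the rationals at [t] adds [t] itself to the test times, which matters when the only zero
   is at [t]. *)
pose p m := Num.min (q m) t.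
have p0 m : 0 <= p m by rewrite le_min q0.
have pt m : p m <= t by rewrite ge_min lexx orbT.
have qE a b : q (pickle (a, b)) = a%:R / b.+1%:R by rewrite /q pickleK.
pose A n m := [set w | (theta w <= (p m)%:E)%E] `&` [set w | `|D (p m) w| < n.+1%:R^-1].
have MA n m : LF t (A n m).
  apply: (saI sa); first exact: (left_mono hF (p0 m) (pt m) (st.2 _ (p0 m))).
  apply: (left_mono hF (p0 m) (pt m)).
  have mD := (measurable_wrtP (left_sa hF (p0 m)) _).1 (D_left (p0 m)).
  have mn : measurable_fun [set: g_sigma_algebraType (LF (p m))] (fun w => `|D (p m) w|).
    exact: measurableT_comp.
  have := (measurable_wrtP (left_sa hF (p0 m)) _).2 mn `]-oo, n.+1%:R^-1[%classic (measurable_itv _).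
  by congr (LF _ _); apply/seteqP; split => w /=; rewrite in_itv.
rewrite (_ : [set w | _] = ~` \bigcup_n ~` \bigcup_m A n m); last first.
  rewrite setC_bigcup; under eq_bigcapr do rewrite setCK.
  apply/seteqP; split => w /=.
    move=> le n _.
    case E : (first_time beta c Y Z (theta w) w) le (first_time_ge0 (theta w) w) => [s| |] //.
    rewrite !lee_fin => st' s0.
    have Ds : D s w = 0 by apply/D0E; exact: (first_time_attained E).
    have ths : (theta w <= s%:E)%E by rewrite -E first_time_ge.
    have n0 : 0 < n.+1%:R^-1 :> R by rewrite invr_gt0 ltr0n.
    move: st'; rewrite le_eqVlt => /predU1P[est|lst].
      exists (pickle ((Num.truncn t).+1, 0%N)) => //.
      have -> : A n (pickle ((Num.truncn t).+1, 0%N)) = [set w | (theta w <= t%:E)%E] `&`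
          [set w | `|D t w| < n.+1%:R^-1].
        rewrite /A (_ : p _ = t) // /p qE divr1 min_r//; exact/ltW/truncnS_gt.
      by split => /=; rewrite -est// Ds normr0.
    (* Rational times approach the zero from above so as to stay after [theta], which may coincide
       with the zero. *)
    pose r_ j := grid_floor j s + j.+1%:R^-1.
    have rs j : s <= r_ j by have /andP[_ /ltW] := grid_floor_itv j s0.
    have r0 j : 0 <= r_ j by exact: le_trans (rs j).
    have cr : r_ j @[j --> \oo] --> s.
      rewrite -[X in _ --> X]addr0; apply: cvgD; first exact: grid_floor_cvg.
      exact: cvg_harmonic.
    have := @path_cvg _ (D ^~ w) r_ s (@cD w) r0 s0 cr; rewrite Ds => cDr.
    have [j [jt jD]] : exists j, r_ j < t /\ `|D (r_ j) w| < n.+1%:R^-1.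
      move/cvgr0Pnorm_lt : cDr => /(_ _ n0) [j1 _ h1].
      have [j2 _ h2] : \forall j \near \oo, r_ j < t.
        move/cvgrPdist_lt : cr => /(_ (t - s)); rewrite subr_gt0 => /(_ lst).
        by apply: filterS => j; rewrite ltr_norml => /andP[u1 u2]; lra.
      by exists (maxn j1 j2); split; [apply: h2; exact: leq_maxr|apply: h1; exact: leq_maxl].
    exists (pickle ((Num.truncn (s * j.+1%:R)).+1, j)) => //.
    have rE : p (pickle ((Num.truncn (s * j.+1%:R)).+1, j)) = r_ j.
      rewrite /p qE (_ : _ / _ = r_ j) ?min_l//; first exact: ltW.
      by rewrite /r_ /grid_floor -natr1 mulrDl mul1r.
    rewrite /A rE; split => //=.
    by rewrite (le_trans ths)// lee_fin.
  move=> H; have [m0 _ [/= th0 _]] := H 0%N I.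
  have thfin : theta w \is a fin_num.
    by rewrite ge0_fin_numE ?st.1// (le_lt_trans th0)// ltry.
  have a0 : 0 <= fine (theta w) by rewrite fine_ge0// st.1.
  have at' : fine (theta w) <= t.
    by rewrite -lee_fin fineK// (le_trans th0)// lee_fin.
  have [s /andP[as' st'] Ds] : exists2 s, fine (theta w) <= s <= t & D s w = 0.
    apply: (@zero_in_segment _ (D ^~ w)) => // e e0.
    have [m _ [/= thm Dm]] := H (Num.truncn e^-1) I.
    exists (p m); first by rewrite pt andbT -lee_fin fineK.
    apply: (lt_trans Dm); rewrite -[ltRHS]invrK ltf_pV2 ?posrE ?invr_gt0 ?ltr0n//.
    exact: truncnS_gt.
  apply: (@le_trans _ _ s%:E); last by rewrite lee_fin.
  apply: first_time_le => //; first exact: le_trans as'.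
  by rewrite -[theta w]fineK// lee_fin.
apply: (saC sa); apply: (sa_bigcup sa) => n; apply: (saC sa).
by apply: (sa_bigcup sa) => m; exact: MA.
Qed.

(** If the times returned infinitely often below some [y] that precedes the first zero, compactness
    of [[theta, y]] would produce an earlier zero. Infinite [th_ n] are unconstrained, which is
    harmless since the minimum is taken. *)
Lemma first_time_min_cvg theta w (th_ : nat -> \bar R) : (0 <= theta)%E ->
  (forall n, (theta <= th_ n)%E) ->
  (forall e, 0 < e -> \forall n \near \oo, forall r, th_ n = r%:E -> `|D r w| < e) ->
  mine (th_ n) (first_time beta c Y Z theta w) @[n --> \oo] -->
  first_time beta c Y Z theta w.
Proof.
move=> th0 le H; set tau := first_time _ _ _ _ _ _.
apply: ecvg_below => [n|y y0 yt].
  by rewrite le_min ge_min lexx orbT andbT (le_trans th0 (le n)) first_time_ge0.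
apply: contrapT => nH.
have inf n : exists2 m, (n <= m)%N & (th_ m <= y%:E)%E.
  apply: contrapT => h; apply: nH; exists n => // m /= nm.
  rewrite lt_min yt andbT ltNge; apply/negP => h'; apply: h; by exists m.
have thy : (theta <= y%:E)%E by have [m _ h] := inf 0%N; exact: le_trans (le m) h.
have thfin : theta \is a fin_num by rewrite ge0_fin_numE// (le_lt_trans thy)// ltry.
have [s /andP[as' sy] Ds] : exists2 s, fine theta <= s <= y & D s w = 0.
  apply: (@zero_in_segment _ (D ^~ w)) => //.
  - by rewrite fine_ge0.
  - by rewrite -lee_fin fineK.
  move=> e e0; have [n _ hn] := H e e0; have [m nm thm] := inf n.
  have fm : th_ m \is a fin_num.
    by rewrite ge0_fin_numE ?(le_trans th0)// (le_lt_trans thm)// ltry.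
  exists (fine (th_ m)); last by apply: (hn m nm); rewrite fineK.
  by rewrite -!lee_fin !fineK// le thm.
have : (tau <= s%:E)%E.
  apply: first_time_le => //; first by apply: (le_trans _ as'); rewrite fine_ge0.
  by rewrite -[theta]fineK// lee_fin.
by rewrite leNgt => /negP; apply; rewrite (le_lt_trans _ yt)// lee_fin.
Qed.

End FirstTime.

(** * Value and reward of one stopping problem *)

Section StoppingValue.
Context {R : realType} {d : measure_display} {Omega : measurableType d}.
Variables (P : probability Omega R) (F : R -> set (set Omega)).
Hypothesis hF : complete_right_continuous_filtration P F.
Local Notation L1 := (L1 P).
Local Notation Ex := (Ex P).
Let Pc := filt_complete hF.
Variables (beta c : R) (f : bool -> R -> R) (X : bool -> R -> Omega -> R) (i : bool).
Hypotheses (hbeta : 0 < beta) (hf : forall y, 0 < f i y).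
Hypothesis hfm : measurable_fun [set: R] (f i).
Hypotheses (aX : adapted F (X i)) (cX : continuous_paths (X i)).
Variables Y Z : R -> Omega -> R.
Hypotheses (cY : continuous_paths Y) (cZ : continuous_paths Z).
Hypotheses (iY : square_sup_integrable P F Y) (iZ : square_sup_integrable P F Z).
Hypothesis Yoo : {ae P, forall w, Y t w @[t --> +oo] --> (0 : R)}.
Hypothesis Zoo : {ae P, forall w, Z t w @[t --> +oo] --> (0 : R)}.
Hypothesis hval : is_stopping_value P F beta f X i c Z Y.
Local Notation total := (total_profit beta (f i) (X i)).
Local Notation profit := (profit_until beta (f i) (X i)).

(** Profit is counted from time 0 here and in [value], whatever the starting time, so that the
    stopping problems started at all times share a single Snell envelope. *)
Definition reward (u : \bar R) (w : Omega) : R :=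
  profit_until beta (f i) (X i) u w + (- c) * disc beta u + extend Z u w.
Definition value (u : \bar R) (w : Omega) : R :=
  extend Y u w + profit_until beta (f i) (X i) u w.

Lemma process_L1 t : 0 <= t -> L1 (Y t).
Proof. by move=> t0; exact: (regular_L1 hF (extend_regular hF cY iY Yoo) (st_cst hF (x := t%:E) t0)). Qed.

(** Never stopping is allowed and pays the total profit, as the cost and the other value vanish at
    infinity. Its conditional expectation is therefore bounded by [Y 0], which is integrable. *)
Lemma total_profit_integral_fin : (\int[P]_w total w < +oo)%E.
Proof.
have mt := total_profit_meas hF beta hf hfm aX cX.
have t0' w : (0 <= total w)%E by exact: total_profit_ge0.
have Fz : 0 <= (0 : R) by [].
have [V [MV VE] V0] := cond_exp_ge0 Pc (filt_sa hF Fz) (filt_meas hF Fz) mt t0'.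
have [_ h _] := hval (lexx 0).
have {h} VY : {ae P, forall w, (V w <= (Y 0 w)%:E)%E}.
  apply: h; exists (fun=> +oo%E).
    by split; [exact: (st_cst hF)|move=> w; exact: leey].
  split => // A MA; rewrite VE//; have mA := filt_meas hF Fz MA.
  have e : {ae P, forall w, total w = stopping_payoff beta f X i c Z 0 (fun=> +oo%E) w}.
    apply: filterS Zoo => w z0; rewrite /stopping_payoff -/(time_itv 0 +oo%E) time_itvy.
    have [-> _ ->] := discE hbeta (leey (0 : \bar R)); rewrite mule0 sube0.
    rewrite (_ : value_at Z (fun=> +oo%E) w = 0) ?adde0//.
    exact: (cvg_lim (@Rhausdorff R) z0).
  apply: ae_eq_integral => //.
  - exact: measurable_funTS.
  - apply: measurable_funTS; apply: (ae_measurable_fun Pc _ mt).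
    by apply: filterS e => w -> _.
  - by apply: filterS e => w -> _.
have -> : (\int[P]_w total w = \int[P]_w V w)%E by rewrite VE//; exact: (saT (filt_sa hF Fz)).
have hY := process_L1 Fz.
apply: (@le_lt_trans _ _ (\int[P]_w `|(Y 0 w)%:E|)%E); last by case/integrableP : hY.
apply: ae_ge0_le_integral => //.
- exact: (measurable_wrt_meas (filt_meas hF Fz) MV).
- by apply: measurableT_comp => //; exact/measurable_EFinP/(L1_meas hY).
- by apply: filterS VY => w h _; rewrite (le_trans h)// lee_fin ler_norm.
Qed.

Lemma reward_regular : regular P reward.
Proof.
apply: (regularD (regularD _ (regularZ _ (disc_regular P hbeta)))).
  exact: (profit_until_regular hF hf hfm aX cX total_profit_integral_fin).
exact: (extend_regular hF cZ iZ Zoo).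
Qed.

Lemma value_regular : regular P value.
Proof.
apply: (regularD (extend_regular hF cY iY Yoo)).
exact: (profit_until_regular hF hf hfm aX cX total_profit_integral_fin).
Qed.

Lemma payoff_ae t theta : 0 <= t -> stopping_time_from F t theta ->
  {ae P, forall w, stopping_payoff beta f X i c Z t theta w =
                   (reward (theta w) w - profit t%:E w)%:E}.
Proof.
move=> t0 [st le].
apply: filterS2 (total_profit_ae hF hf hfm aX cX total_profit_integral_fin)
  (value_at_extend Zoo theta) => w tw vw.
rewrite /stopping_payoff -/(time_itv t (theta w)).
rewrite (profit_between hF hf hfm aX cX t0 (le w) tw).
have [-> _ _] := discE hbeta (st.1 w).
case: vw => [->|h]; last by have := st.1 w; rewrite h.
rewrite -EFinM -EFinB -EFinD; congr (_%:E); rewrite /reward; ring.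
Qed.

Let profit_L1 t : 0 <= t -> L1 (profit t%:E).
Proof.
move=> t0; have h := profit_until_regular hF hf hfm aX cX total_profit_integral_fin.
exact: (regular_L1 hF h (st_cst hF (x := t%:E) t0)).
Qed.

Lemma value_snell_ge t theta A : 0 <= t -> stopping_time_from F t theta -> F t A ->
  Ex (fun w => \1_A w * reward (theta w) w) <= Ex (fun w => \1_A w * value t%:E w).
Proof.
move=> t0 st FA; have mA := filt_meas hF t0 FA.
have := ess_sup_ge hF reward_regular t0 (profit_L1 t0) (process_L1 t0)
  (fun th => payoff_ae t0 (theta := th)) (hval t0) st FA.
have hp := L1M_ind mA (profit_L1 t0).
have hr := regular_L1 hF reward_regular st.1.
have hv := regular_L1 hF value_regular (st_cst hF (x := t%:E) t0).
rewrite (_ : (fun w => \1_A w * (_ - _)) =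
    fun w => \1_A w * reward (theta w) w - \1_A w * profit t%:E w); last first.
  by apply/funext => w; rewrite mulrBr.
rewrite (_ : (fun w => \1_A w * Y t w) =
    fun w => \1_A w * value t%:E w - \1_A w * profit t%:E w); last first.
  by apply/funext => w; rewrite /value /=; ring.
by rewrite !ExB//; [lra|exact: L1M_ind|exact: L1M_ind].
Qed.

Lemma value_snell_le t e : 0 <= t -> 0 < e ->
  exists2 theta, stopping_time_from F t theta &
    Ex (value t%:E) <= Ex (fun w => reward (theta w) w) + e.
Proof.
move=> t0 e0.
have [theta st H] := ess_sup_attained hF reward_regular t0 (profit_L1 t0) (process_L1 t0)
  (fun th => payoff_ae t0 (theta := th)) (hval t0) e0.
exists theta => //; move: H.
have hr := regular_L1 hF reward_regular st.1.
have e1 : Ex (value t%:E) = Ex (Y t) + Ex (profit t%:E) := ExD (process_L1 t0) (profit_L1 t0).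
by rewrite (ExB hr (profit_L1 t0)) e1; lra.
Qed.

Lemma value_oo w : value +oo%E w = reward +oo%E w.
Proof.
rewrite /value /reward /=; have [_ _ ->] := discE hbeta (leey (0 : \bar R)).
by rewrite mulr0 !addr0 add0r.
Qed.

(** Stopping at once is allowed, which gives the inequality at each fixed time outside a null event;
    rational times share one such event, and continuity extends the inequality to all times. *)
Lemma process_ge_obstacle :
  {ae P, forall w t, 0 <= t -> - (c * expR (- (beta * t))) + Z t w <= Y t w}.
Proof.
have H t : 0 <= t -> {ae P, forall w, 0 <= value t%:E w - reward t%:E w}.
  move=> t0; have sa := filt_sa hF t0.
  have hr := regular_L1 hF reward_regular (st_cst hF (x := t%:E) t0).
  have hv := regular_L1 hF value_regular (st_cst hF (x := t%:E) t0).
  have aY := progressively_measurable_adapted hF iY.1.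
  have aZ := progressively_measurable_adapted hF iZ.1.
  apply: (ae_ge0_of_sets Pc (filt_meas hF t0)); last 2 first.
  - exact: L1B.
  - move=> A FA; have mA := filt_meas hF t0 FA.
    rewrite (_ : (fun _ => _) = fun w => \1_A w * value t%:E w - \1_A w * reward t%:E w).
      rewrite ExB ?subr_ge0//; [|exact: L1M_ind|exact: L1M_ind].
      apply: (value_snell_ge (theta := fun=> t%:E)) => //; split => //.
      exact: (st_cst hF).
    by apply/funext => w; rewrite mulrBr.
  rewrite (_ : (fun w => _) = fun w => Y t w - Z t w + c * disc beta t%:E).
    apply/(measurable_wrtP sa); apply: measurable_funD => //; apply: measurable_funB.
      by apply/(measurable_wrtP sa); exact: aY.
    by apply/(measurable_wrtP sa); exact: aZ.
  by apply/funext => w; rewrite /value /reward /=; ring.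
pose q (m : nat) : R := if unpickle m is Some (a, b) then a%:R / b.+1%:R else 0.
have q0 m : 0 <= q m by rewrite /q; case: unpickle => // -[a b]; rewrite divr_ge0.
have /ae_foralln : forall m, {ae P, forall w, 0 <= value (q m)%:E w - reward (q m)%:E w}.
  by move=> m; exact: H.
apply: filterS => w h t t0; rewrite -subr_ge0.
pose D s := Y s w + c * expR (- (beta * s)) - Z s w.
have DE s : 0 <= s -> value s%:E w - reward s%:E w = D s.
  move=> s0; rewrite /value /reward /D /=.
  have s0' : (0 <= s%:E)%E by rewrite lee_fin.
  by have [_ _ ->] := discE hbeta s0'; ring.
rewrite (_ : _ - _ = D t); last by rewrite /D; ring.
have c0 := @path_cvg _ _ _ _ (@cY w) (fun n => grid_floor_ge0 n t) t0 (grid_floor_cvg t0).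
have c1 := @path_cvg _ _ _ _ (@cZ w) (fun n => grid_floor_ge0 n t) t0 (grid_floor_cvg t0).
have c2 : expR (- (beta * grid_floor n t)) @[n --> \oo] --> expR (- (beta * t)).
  apply: (cvg_comp _ expR); last exact: continuous_expR.
  by apply: cvgN; apply: cvgM; [exact: cvg_cst|exact: grid_floor_cvg].
have cD : D (grid_floor n t) @[n --> \oo] --> D t.
  by apply: cvgB c1; apply: cvgD c0 _; apply: cvgM c2; exact: cvg_cst.
rewrite -(cvg_lim (@Rhausdorff R) cD); apply: limr_ge; first by apply/cvg_ex; eexists; exact: cD.
apply: nearW => n; rewrite -DE ?grid_floor_ge0//.
have := h (pickle (Num.truncn (t * n.+1%:R), n)).
by rewrite /q pickleK.
Qed.

Lemma reward_le_value : {ae P, forall w u, (0 <= u)%E -> reward u w <= value u w}.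
Proof.
apply: filterS process_ge_obstacle => w h [t| |] // t0; last by rewrite value_oo.
have := h t; rewrite -lee_fin => /(_ t0); rewrite /value /reward /=.
by have [_ _ ->] := discE hbeta t0; lra.
Qed.

Lemma value_ge_reward sigma theta A : stopping_time F sigma -> stopping_time F theta ->
  (forall w, (sigma w <= theta w)%E) -> F 0 A ->
  Ex (fun w => \1_A w * reward (theta w) w) <= Ex (fun w => \1_A w * value (sigma w) w).
Proof.
apply: (snell_ge_st hF value_regular reward_regular).
- by apply: aeW => w; exact: value_oo.
- by move=> *; exact: value_snell_ge.
Qed.

(** Unlike in the version at stopping times, the event may be any of [F s], as needed to integrate
    against weights known at time [s]. *)
Lemma value_supermg s t A : 0 <= s -> s <= t -> F s A ->
  Ex (fun w => \1_A w * value t%:E w) <= Ex (fun w => \1_A w * value s%:E w).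
Proof.
move=> s0 st FA; have t0 := le_trans s0 st.
apply/ler_addgt0Pr => e e0.
have [th sth H] := value_snell_le t0 e0.
have FtA := filt_mono hF s0 st FA.
have sth' : stopping_time_from F s th.
  by split; [exact: sth.1|move=> w; rewrite (le_trans _ (sth.2 w))// lee_fin].
have h1 := value_snell_ge s0 sth' FA.
have := snell_le_set hF value_regular reward_regular
  (fun t th A a b c => value_snell_ge a b c) t0 sth H FtA.
by move=> h2; apply: (le_trans h2); rewrite lerD2r.
Qed.

(** At the first time the obstacle is met, so the reward is the value there, and it remains to see
    that the value loses nothing before. A vanishing gap between value and reward is a vanishing
    distance to the obstacle, which keeps near-optimal times from staying before the first hit. *)
Lemma first_time_reward sigma A : stopping_time F sigma -> F 0 A ->
  Ex (fun w => \1_A w * reward (first_time beta c Y Z (sigma w) w) w) =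
  Ex (fun w => \1_A w * value (sigma w) w).
Proof.
move=> st FA.
have aY := progressively_measurable_adapted hF iY.1.
have aZ := progressively_measurable_adapted hF iZ.1.
pose tau w := first_time beta c Y Z (sigma w) w.
have stt : stopping_time F tau := first_time_stopping hF beta c cY cZ aY aZ st.
transitivity (Ex (fun w => \1_A w * value (tau w) w)).
  congr Ex; apply/funext => w; congr (_ * _).
  have := first_time_attained (beta := beta) (c := c) cY cZ (theta := sigma w) (w := w).
  have := stt.1 w; rewrite -/(tau w); case: (tau w) => [r| |] // r0 h; last by rewrite value_oo.
  rewrite /value /reward /= (h r)//.
  by have [_ _ ->] := discE hbeta r0; ring.
apply: (snell_optimal hF value_regular reward_regular) => //.
- by apply: aeW => w; exact: value_oo.
- by move=> *; exact: value_snell_ge.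
- by move=> *; exact: value_snell_le.
- by move=> w; exact: first_time_ge.
- exact: reward_le_value.
apply: aeW => w th_ le c0.
apply: (first_time_min_cvg cY cZ) => //; first exact: st.1.
move=> e e0; move/cvgr0Pnorm_lt : c0 => /(_ e e0); apply: filterS => n + r thr.
have r0 : (0 <= r%:E)%E by rewrite -thr (le_trans (st.1 w)).
rewrite thr /value /reward /=; have [_ _ ->] := discE hbeta r0.
by apply: le_lt_trans; rewrite le_eqVlt; apply/orP; left; apply/eqP; congr (`|_|); ring.
Qed.

End StoppingValue.

(** * Strategies and their gains *)

Section StrategyPaths.
Context {R : realType} {d : measure_display} {Omega : measurableType d}.
Local Notation Rp := (`[0%R, +oo[%classic : set R).
Variables (beta c01 c10 : R) (f : bool -> R -> R) (X : bool -> R -> Omega -> R).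
Hypotheses (hbeta : 0 < beta) (hc01 : 0 <= c01) (hc10 : 0 <= c10).
Hypothesis hf : forall i y, 0 < f i y.
Variable a : nat -> Omega -> \bar R.
Variable w : Omega.
Hypotheses (a0 : a 0%N w = 0%E) (am : forall n, (a n w <= a n.+1 w)%E).
Local Notation rt i := (rate beta (f i) (X i) ^~ w).

Definition switch_cost (i : bool) : R := if i then c10 else c01.

Lemma switch_cost_ge0 i : 0 <= switch_cost i.
Proof. by case: i. Qed.

Lemma switching_mono : {homo a^~ w : n m / (n <= m)%N >-> (n <= m)%E}.
Proof. by apply: homo_leq => [x|y x z|n]; [exact: lexx|exact: le_trans|exact: am]. Qed.

Lemma switching_ge0 n : (0 <= a n w)%E.
Proof. by rewrite -a0; exact: switching_mono. Qed.

(** With the shifted index, technology [odd k] is in use between [a k] and [a k.+1]. *)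
Definition partial_profit (n : nat) : R := \sum_(k < n)
  (profit_until beta (f (odd k)) (X (odd k)) (a k.+1 w) w -
   profit_until beta (f (odd k)) (X (odd k)) (a k w) w).

Definition partial_cost (n : nat) : R := \sum_(k < n)
  switch_cost (odd k) * disc beta (a k.+1 w).

Lemma disc_ge0 u : (0 <= u)%E -> 0 <= disc beta u.
Proof. by move=> u0; have [_ /andP[]] := discE hbeta u0. Qed.

Lemma switching_costE :
  (partial_cost m.*2)%:E @[m --> \oo] --> switching_cost beta c01 c10 a w.
Proof.
rewrite /switching_cost.
rewrite (_ : (fun m => (partial_cost m.*2)%:E) = fun m => (\sum_(0 <= n < m)
    (discount beta (a n.*2.+1 w) * c01%:E + discount beta (a n.*2.+2 w) * c10%:E))%E).
  by apply: is_cvg_nneseries => n _ _; rewrite adde_ge0// mule_ge0 ?lee_fin// /discount expeR_ge0.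
apply/funext; elim=> [|m IH]; first by rewrite /partial_cost big_ord0 big_geq.
rewrite big_nat_recr//= -IH /partial_cost doubleS !big_ord_recr /= !EFinD -!addeA.
rewrite odd_double; congr (_ + (_ + _))%E.
  by have [-> _ _] := discE hbeta (switching_ge0 m.*2.+1); rewrite -EFinM mulrC.
by have [-> _ _] := discE hbeta (switching_ge0 m.*2.+2); rewrite -EFinM mulrC.
Qed.

Lemma partial_cost_ge0 n : 0 <= partial_cost n.
Proof.
apply: sumr_ge0 => k _; rewrite mulr_ge0 ?switch_cost_ge0//.
exact/disc_ge0/switching_ge0.
Qed.

Lemma partial_cost_mono : {homo partial_cost : n m / (n <= m)%N >-> n <= m}.
Proof.
apply: homo_leq => [x|y x z|n]; [exact: lexx|exact: le_trans|].
rewrite /partial_cost big_ord_recr lerDl mulr_ge0 ?switch_cost_ge0//.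
exact/disc_ge0/switching_ge0.
Qed.

Lemma partial_cost_le m : ((partial_cost m.*2)%:E <= switching_cost beta c01 c10 a w)%E.
Proof.
rewrite -(cvg_lim _ switching_costE)//; apply: lime_ge.
  by apply/cvg_ex; eexists; exact: switching_costE.
exists m => // n /= mn; rewrite lee_fin; apply: partial_cost_mono.
by rewrite leq_double.
Qed.

(** If the times stayed below [A], each switch from 0 to 1 would cost at least
    [c01 * expR (- (beta * A))], and infinitely many of them would exceed the finite total. *)
Lemma switching_cvgy_of_cost : 0 < c01 ->
  (switching_cost beta c01 c10 a w < +oo)%E -> a n w @[n --> \oo] --> +oo%E.
Proof.
move=> c0 H; apply/cvgeyPgt => A; apply: contrapT => nA.
have aA n : (a n w <= A%:E)%E.
  rewrite leNgt; apply/negP => h; apply: nA; exists n => // m /= nm.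
  by apply: (lt_le_trans h); exact: switching_mono.
have A0 : 0 <= A by have := aA 0%N; rewrite a0 lee_fin.
have dn n : expR (- (beta * A)) <= disc beta (a n w).
  have [_ _ ->] := discE hbeta (switching_ge0 n).
  case: (a n w) (aA n) (switching_ge0 n) => [r| |] //=; rewrite !lee_fin => rA r0.
  by rewrite ler_expR lerN2 ler_pM2l.
have low m : m%:R * (c01 * expR (- (beta * A))) <= partial_cost m.*2.
  elim: m => [|m IH]; first by rewrite mul0r partial_cost_ge0.
  rewrite -natr1 mulrDl mul1r doubleS /partial_cost !big_ord_recr /= odd_double /=.
  rewrite -addrA lerD// -[leLHS]addr0 lerD ?ler_wpM2l//.
  by rewrite mulr_ge0// disc_ge0// switching_ge0.
have e0 : 0 < c01 * expR (- (beta * A)) by rewrite mulr_gt0 ?expR_gt0.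
have cfin : switching_cost beta c01 c10 a w \is a fin_num.
  by rewrite ge0_fin_numE// (le_trans _ (partial_cost_le 0))// lee_fin partial_cost_ge0.
pose q := fine (switching_cost beta c01 c10 a w).
have := truncnS_gt (q / (c01 * expR (- (beta * A)))).
rewrite ltr_pdivrMr// => /lt_le_trans /(_ (low _)); rewrite ltNge => /negP; apply.
by rewrite -lee_fin /q fineK// partial_cost_le.
Qed.

Hypothesis ay : a n w @[n --> \oo] --> +oo%E.

Lemma switching_limity : switching_limit a w = +oo%E.
Proof. exact: cvg_lim ay. Qed.

Lemma technology_between k s : (a k w <= s%:E)%E -> (s%:E < a k.+1 w)%E ->
  technology a s w = odd k.
Proof.
move=> h1 h2; rewrite /technology switching_limity ltry.
apply/idP/idP => [/asboolP[n /andP[n1 n2]]|ok].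
  have [lt|gt|->] := ltngtP k n.*2.+1; last by rewrite /= odd_double.
    by have := le_trans n1 (ltW (lt_le_trans h2 (switching_mono lt)));
       rewrite leNgt (lt_le_trans h2 (switching_mono lt)) // in n1.
  have := le_lt_trans (switching_mono gt) (le_lt_trans h1 n2).
  by rewrite ltxx.
apply/asboolP; exists k./2.
have ke : k = k./2.*2.+1 by rewrite -[LHS]odd_double_half ok.
by rewrite -ke h1 h2.
Qed.

Lemma switching_index s : 0 <= s -> exists k, (a k w <= s%:E < a k.+1 w)%E.
Proof.
move=> s0; have [k sk] : exists k, (s%:E < a k w)%E.
  by move/cvgeyPgt : ay => /(_ s) [k _ h]; exists k; exact: h (leqnn k).
have ex : exists k, (s%:E < a k w)%E by exists k.
case: (ex_minnP ex) => -[|n] h hmin.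
  by move: h; rewrite a0 lte_fin ltNge s0.
by exists n; rewrite h andbT leNgt; apply/negP => /hmin; rewrite ltnn.
Qed.

Let tech s : R := rate beta (f (technology a s w)) (X (technology a s w)) s w.

Hypothesis mrt : forall i, measurable_fun Rp (rt i).
Hypothesis rt_fin : forall i, (\int[lebesgue_measure]_(s in Rp) (rt i s)%:E < +oo)%E.

Lemma measurable_technology : measurable [set s | technology a s w = true].
Proof.
rewrite (_ : [set s | _] = \bigcup_n [set s | (a n.*2.+1 w <= s%:E < a n.*2.+2 w)%E]).
  apply: bigcupT_measurable => n.
  have := @EFin_measurable R setT measurableT _ (emeasurable_itv `[a n.*2.+1 w, a n.*2.+2 w[).
  by rewrite setTI; congr measurable; apply/seteqP; split => s; rewrite /= in_itv.
apply/seteqP; split => s /=; rewrite /technology switching_limity ltry.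
  by move=> /asboolP[n h]; exists n.
by move=> [n _ h]; apply/asboolP; exists n.
Qed.

Lemma measurable_technology_rate : measurable_fun Rp tech.
Proof.
have mB := measurable_technology.
apply: (eq_measurable_fun (fun s => \1_[set s | technology a s w = true] s * rt true s +
   \1_[set s | technology a s w = false] s * rt false s)).
  move=> s _; rewrite /tech !indicE; have [h|h] := boolP (technology a s w).
    by rewrite mem_set// memNset ?mul1r ?mul0r ?addr0 //= h.
  by rewrite memNset ?mem_set ?mul1r ?mul0r ?add0r //= (negbTE h).
have mC : measurable [set s | technology a s w = false].
  rewrite (_ : mkset _ = ~` [set s | technology a s w = true]); first exact: measurableC.
  by apply/seteqP; split => s /=; case: technology.
apply: measurable_funD; apply: measurable_funM => //; exact/measurable_funTS/measurable_indic.
Qed.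

Lemma technology_rate_fin : (\int[lebesgue_measure]_(s in Rp) (tech s)%:E < +oo)%E.
Proof.
apply: (@le_lt_trans _ _ (\int[lebesgue_measure]_(s in Rp) ((rt true s)%:E + (rt false s)%:E))%E).
  apply: ge0_le_integral => //.
  - by move=> s _; rewrite lee_fin rate_ge0.
  - by apply/measurable_EFinP; exact measurable_technology_rate.
  - by apply: emeasurable_funD; apply/measurable_EFinP; exact: mrt.
  - by move=> s _; rewrite -EFinD lee_fin /tech; case: technology; rewrite ?lerDl ?lerDr rate_ge0.
rewrite ge0_integralD//.
- by rewrite lte_add_pinfty.
- by move=> s _; rewrite lee_fin rate_ge0.
- apply/measurable_EFinP; exact: mrt.
- by move=> s _; rewrite lee_fin rate_ge0.
- apply/measurable_EFinP; exact: mrt.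
Qed.

Lemma partial_profitE n : partial_profit n =
  fine (\int[lebesgue_measure]_(s in time_itv 0 (a n w)) (tech s)%:E)%E.
Proof.
have t0 s : 0 <= tech s by exact: rate_ge0.
elim: n => [|n IH].
  rewrite /partial_profit big_ord0 a0 (_ : time_itv 0 0%:E = [set 0]).
    by rewrite integral_set1.
  apply/seteqP; split => s; rewrite /time_itv /= !lee_fin.
    by move=> /andP[h1 h2]; apply/eqP; rewrite eq_le h1 h2.
  by move=> ->; rewrite lexx.
rewrite /partial_profit big_ord_recr /= -/(partial_profit n) IH.
have := am n; have := switching_ge0 n.
(* Once a switching time is infinite, so is the next one, and the increment vanishes. *)
case E : (a n w) => [r| |] // r0 rn; last first.
  by move: rn; rewrite leye_eq => /eqP ->; rewrite subrr addr0.
rewrite lee_fin in r0.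
have e1 := integral_between measurable_technology_rate t0 technology_rate_fin r0 rn.
have e2 := integral_between (mrt (odd n)) (fun s => rate_ge0 beta (hf (odd n)) (X (odd n)) s w) (rt_fin (odd n)) r0 rn.
rewrite -[_ - _]/(fine (_ - _)%:E) -e2.
suff -> : (\int[lebesgue_measure]_(s in time_itv r (a n.+1 w)) (rt (odd n) s)%:E)%E =
   (\int[lebesgue_measure]_(s in time_itv r (a n.+1 w)) (tech s)%:E)%E.
  by rewrite e1 /=; ring.
have sub := @time_itv_sub _ r (a n.+1 w) r0.
have mRp : measurable Rp by exact: measurable_itv.
apply: ae_eq_integral.
- exact: measurable_time_itv.
- by apply/measurable_EFinP; exact: (measurable_funS mRp sub (mrt _)).
- by apply/measurable_EFinP; exact: (measurable_funS mRp sub measurable_technology_rate).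
(* The closed interval contains the next switching time, where the technology may already have
   changed; this one point has measure 0. *)
exists [set fine (a n.+1 w)]; split => //; first exact: lebesgue_measure_set1.
move=> s /= H; apply: contrapT => sn; apply: H => /andP[h1 h2].
rewrite /tech (@technology_between n)//; first by rewrite E.
rewrite lt_neqAle h2 andbT; apply/eqP => h; apply: sn; rewrite -h//.
Qed.

Lemma discounted_profit_fin : discounted_profit beta f X a w \is a fin_num.
Proof.
rewrite ge0_fin_numE; first exact: technology_rate_fin.
by apply: integral_ge0 => s _; rewrite lee_fin mulr_ge0 ?expR_ge0// ltW.
Qed.

Lemma partial_profit_cvg :
  partial_profit n @[n --> \oo] --> fine (discounted_profit beta f X a w).
Proof.
rewrite (_ : partial_profit = fun n =>
    fine (\int[lebesgue_measure]_(s in time_itv 0 (a n w)) (tech s)%:E)%E).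
  have := @fine_integral_cvg _ tech (a ^~ w) +oo%E measurable_technology_rate
    (fun s _ => rate_ge0 _ (hf _) _ _ _) technology_rate_fin ay.
  by rewrite time_itvy.
by apply/funext => n; exact: partial_profitE.
Qed.

(** Whatever the strategy, its profit rate is at most the sum of the two constant-regime rates; this
    gives one integrable bound for all switching sequences. *)
Lemma partial_profit_bound n : 0 <= partial_profit n <=
  fine (\int[lebesgue_measure]_(s in Rp) (rt true s)%:E)%E +
  fine (\int[lebesgue_measure]_(s in Rp) (rt false s)%:E)%E.
Proof.
have t0 s : 0 <= tech s by exact: rate_ge0.
have g0 u : (0 <= \int[lebesgue_measure]_(s in u) (tech s)%:E)%E.
  by apply: integral_ge0 => s _; rewrite lee_fin.
have r0 i : (0 <= \int[lebesgue_measure]_(s in Rp) (rt i s)%:E)%E.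
  by apply: integral_ge0 => s _; rewrite lee_fin rate_ge0.
have sub := @time_itv_sub _ 0 (a n w) (lexx 0).
have mRp : measurable Rp by exact: measurable_itv.
have mI := @measurable_time_itv R 0 (a n w).
have le1 : (\int[lebesgue_measure]_(s in time_itv 0 (a n w)) (tech s)%:E <=
    \int[lebesgue_measure]_(s in Rp) (tech s)%:E)%E.
  apply: ge0_subset_integral => //.
    by apply/measurable_EFinP; exact measurable_technology_rate.
  by move=> s _; rewrite lee_fin.
have fi i : (\int[lebesgue_measure]_(s in Rp) (rt i s)%:E)%E \is a fin_num.
  by rewrite ge0_fin_numE//; exact: rt_fin.
rewrite partial_profitE fine_ge0//= -fineD//; apply: fine_le.
- by rewrite ge0_fin_numE// (le_lt_trans le1)// technology_rate_fin.
- by rewrite fin_numD; apply/andP; split; exact: fi.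
apply: (le_trans le1); rewrite -ge0_integralD//.
- apply: ge0_le_integral => //.
  + by move=> s _; rewrite lee_fin.
  + by apply/measurable_EFinP; exact measurable_technology_rate.
  + by apply: emeasurable_funD; apply/measurable_EFinP; exact: mrt.
  + by move=> s _; rewrite -EFinD lee_fin /tech; case: technology; rewrite ?lerDl ?lerDr rate_ge0.
- by move=> s _; rewrite lee_fin rate_ge0.
- apply/measurable_EFinP; exact: mrt.
- by move=> s _; rewrite lee_fin rate_ge0.
- apply/measurable_EFinP; exact: mrt.
Qed.

End StrategyPaths.

Lemma cvg_reindex {T : Type} (Q : set_system T) (u : nat -> T) (k : nat -> nat) :
  (forall m, m <= k m)%N -> u n @[n --> \oo] --> Q -> u (k m) @[m --> \oo] --> Q.
Proof.
move=> h uQ; apply: cvg_trans uQ => B [N _ NB]; exists N => // m Nm.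
by apply: NB; apply: leq_trans (h m).
Qed.

Lemma leq_double_self m : (m <= m.*2)%N.
Proof. by rewrite -addnn leq_addr. Qed.

(** * Gains along a strategy and along the candidate *)

Section Switching.
Context {R : realType} {d : measure_display} {Omega : measurableType d}.
Variables (P : probability Omega R) (F : R -> set (set Omega)).
Hypothesis hF : complete_right_continuous_filtration P F.
Local Notation L1 := (L1 P).
Local Notation Ex := (Ex P).
Let Pc := filt_complete hF.
Variables (beta c01 c10 : R) (f : bool -> R -> R) (X : bool -> R -> Omega -> R).
Hypotheses (hbeta : 0 < beta) (hc10 : 0 < c10) (hc : c10 < c01).
Hypothesis hf : forall i y, 0 < f i y.
Hypothesis hfm : forall i, measurable_fun [set: R] (f i).
Hypothesis aX : forall i, adapted F (X i).
Hypothesis cX : forall i, continuous_paths (X i).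
Variable Y : bool -> R -> Omega -> R.
Hypothesis cY : forall i, continuous_paths (Y i).
Hypothesis iY : forall i, square_sup_integrable P F (Y i).
Hypothesis Yoo : forall i, {ae P, forall w, Y i t w @[t --> +oo] --> (0 : R)}.
Local Notation cost := (switch_cost c01 c10).
Hypothesis hval : forall i, is_stopping_value P F beta f X i (cost i) (Y (~~ i)) (Y i).
Local Notation profit i := (profit_until beta (f i) (X i)).
Local Notation total i := (total_profit beta (f i) (X i)).
Local Notation V i := (value beta f X i (Y i)).
Local Notation W i := (reward beta (cost i) f X i (Y (~~ i))).
Let hc01 : 0 < c01. Proof. exact: lt_trans hc. Qed.

Let total_fin i : (\int[P]_w total i w < +oo)%E.
Proof.
exact: (total_profit_integral_fin hF hbeta (hf i) (hfm i) (@aX i) (@cX i)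
  (@cY i) (iY i) (Yoo i) (Yoo (~~ i)) (@hval i)).
Qed.

Let regP i : regular P (profit i).
Proof. exact: (profit_until_regular hF (hf i) (hfm i) (@aX i) (@cX i) (total_fin i)). Qed.

Let regY i : regular P (extend (Y i)).
Proof. exact: (extend_regular hF (@cY i) (iY i) (Yoo i)). Qed.

Let regV i : regular P (V i).
Proof. exact: (regularD (regY i) (regP i)). Qed.

Let regW i : regular P (W i).
Proof.
apply: (regularD (regularD (regP i) (regularZ _ (disc_regular P hbeta)))).
exact: regY.
Qed.

Section Chain.
Variable a : nat -> Omega -> \bar R.
Hypothesis sa : strategy F a.

Let ast n : stopping_time F (a n). Proof. by case: sa. Qed.
Let a0 w : a 0%N w = 0%E. Proof. by case: sa. Qed.
Let am n w : (a n w <= a n.+1 w)%E. Proof. by case: sa. Qed.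

Local Notation PP := (fun n w => partial_profit beta f X a w n).
Local Notation PC := (fun n w => partial_cost beta c01 c10 a w n).

(** The gain made up to the [n]-th switch plus the value of continuing from there. One more switch
    adds a reward minus a value, so the comparison with [Y false 0] is made one switch at a time. *)
Definition chain_gain n w := partial_profit beta f X a w n -
  partial_cost beta c01 c10 a w n + extend (Y (odd n)) (a n w) w.

Lemma chain_gainS n w : chain_gain n.+1 w =
  chain_gain n w + (W (odd n) (a n.+1 w) w - V (odd n) (a n w) w).
Proof.
rewrite /chain_gain /partial_profit /partial_cost !big_ord_recr /= /reward /value.
by ring.
Qed.

Lemma partial_profit_L1 n : L1 (PP n).
Proof.
apply: L1_sum => k _; apply: L1B; first exact: (regular_L1 hF (regP _) (ast k.+1)).
exact: (regular_L1 hF (regP _) (ast k)).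
Qed.

Lemma partial_cost_L1 n : L1 (PC n).
Proof.
apply: L1_sum => k _; apply: L1Z.
exact: (regular_L1 hF (disc_regular P hbeta) (ast k.+1)).
Qed.

Lemma chain_gain_L1 n : L1 (chain_gain n).
Proof.
apply: L1D; last exact: (regular_L1 hF (regY _) (ast n)).
by apply: L1B; [exact: partial_profit_L1|exact: partial_cost_L1].
Qed.

Lemma Ex_chain_gain0 A : Ex (fun w => \1_A w * chain_gain 0 w) =
  Ex (fun w => \1_A w * Y false 0 w).
Proof.
congr Ex; apply/funext => w; rewrite /chain_gain /partial_profit /partial_cost !big_ord0.
by rewrite a0 /= subr0 add0r.
Qed.

Lemma Ex_chain_gainS A n : measurable A -> Ex (fun w => \1_A w * chain_gain n.+1 w) =
  Ex (fun w => \1_A w * chain_gain n w) +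
  (Ex (fun w => \1_A w * W (odd n) (a n.+1 w) w) -
   Ex (fun w => \1_A w * V (odd n) (a n w) w)).
Proof.
move=> mA.
have h1 := L1M_ind mA (regular_L1 hF (regW (odd n)) (ast n.+1)).
have h2 := L1M_ind mA (regular_L1 hF (regV (odd n)) (ast n)).
have h3 := L1M_ind mA (chain_gain_L1 n).
rewrite -(ExB h1 h2) -(ExD h3 (L1B h1 h2)); congr Ex; apply/funext => w.
by rewrite chain_gainS; ring.
Qed.

Lemma chain_gain_le A n : F 0 A -> Ex (fun w => \1_A w * chain_gain n w) <=
  Ex (fun w => \1_A w * Y false 0 w).
Proof.
move=> FA; have mA := filt_meas hF (lexx 0) FA.
elim: n => [|n IH]; first by rewrite Ex_chain_gain0.
rewrite Ex_chain_gainS//; apply: (le_trans _ IH); rewrite gerDl subr_le0.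
exact: (value_ge_reward hF hbeta (hf _) (hfm _) (@aX _) (@cX _) (@cY _) (@cY _) (iY _) (iY _)
  (Yoo _) (Yoo _) (@hval _) (ast n) (ast n.+1) (am n) FA).
Qed.

Section Limit.
Hypothesis ay : {ae P, forall w, a n w @[n --> \oo] --> +oo%E}.
Hypothesis cost_fin : (\int[P]_w switching_cost beta c01 c10 a w < +oo)%E.

Definition profit_of w := fine (discounted_profit beta f X a w).
Definition cost_of w := fine (switching_cost beta c01 c10 a w).

Let cost_cvg w : (PC m.*2 w)%:E @[m --> \oo] --> switching_cost beta c01 c10 a w.
Proof. exact: (switching_costE hbeta (ltW hc01) (ltW hc10) (a0 w) (am ^~ w)). Qed.

Let cost_meas : measurable_fun setT (switching_cost beta c01 c10 a).
Proof.
apply: (emeasurable_fun_cvg (fun m w => (PC m.*2 w)%:E)) => [m|w _]; last exact: cost_cvg.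
exact/measurable_EFinP/(L1_meas (partial_cost_L1 _)).
Qed.

Let cost_ge0 w : (0 <= switching_cost beta c01 c10 a w)%E.
Proof.
apply: (@le_trans _ _ (PC 0%N.*2 w)%:E).
  by rewrite lee_fin (partial_cost_ge0 hbeta (ltW hc01) (ltW hc10) (a0 w) (am ^~ w)).
exact: (partial_cost_le hbeta (ltW hc01) (ltW hc10) (a0 w) (am ^~ w)).
Qed.

Let cost_int : P.-integrable setT (switching_cost beta c01 c10 a).
Proof.
by apply/integrableP; split; [exact: cost_meas|under eq_integral do rewrite gee0_abs//].
Qed.

Lemma cost_ofE : {ae P, forall w, switching_cost beta c01 c10 a w = (cost_of w)%:E}.
Proof.
by apply: filterS (integrable_ae measurableT cost_int) => w /(_ I) h; rewrite /cost_of fineK.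
Qed.

Lemma cost_of_L1 : L1 cost_of.
Proof.
apply/integrableP; split; first exact/measurable_EFinP/measurableT_comp.
move/integrableP : cost_int => [_]; apply: le_lt_trans.
apply: ae_ge0_le_integral => //.
- by do 2 apply: measurableT_comp => //; exact: measurableT_comp.
- exact: measurableT_comp.
- by apply: filterS cost_ofE => w -> _.
Qed.

Let total_ae : {ae P, forall w i, (total i w < +oo)%E}.
Proof.
have h i := total_profit_ae hF (hf i) (hfm i) (@aX i) (@cX i) (total_fin i).
by apply: filterS2 (h true) (h false) => w h1 h2 [].
Qed.

Let mrate i w := measurable_rate beta (hfm i) (adapted_meas hF (@aX i)) (@cX i) w.

Lemma profit_ofE : {ae P, forall w, discounted_profit beta f X a w = (profit_of w)%:E}.
Proof.
apply: filterS2 ay total_ae => w aw tw; rewrite /profit_of fineK//.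
exact: (discounted_profit_fin hf aw (mrate ^~ w) tw).
Qed.

Lemma partial_profit_profit_of : {ae P, forall w, PP n w @[n --> \oo] --> profit_of w}.
Proof.
apply: filterS2 ay total_ae => w aw tw.
exact: (partial_profit_cvg hf (a0 w) (am ^~ w) aw (mrate ^~ w) tw).
Qed.

Let tot w := fine (total true w) + fine (total false w).
Let tot_L1 : L1 tot.
Proof.
have h i := total_profit_L1 hF (hf i) (hfm i) (@aX i) (@cX i) (total_fin i).
exact: L1D.
Qed.

Let PP_bound : {ae P, forall w n, 0 <= PP n w <= tot w}.
Proof.
apply: filterS2 ay total_ae => w aw tw n.
exact: (partial_profit_bound hf (a0 w) (am ^~ w) aw (mrate ^~ w) tw).
Qed.

Lemma profit_of_L1 : L1 profit_of.
Proof.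
have [] // := @Ex_dct _ _ _ P Pc PP profit_of tot _ partial_profit_profit_of tot_L1.
  by move=> n; exact: (L1_meas (partial_profit_L1 n)).
by apply: filterS PP_bound => w h n; have /andP[h1 h2] := h n; rewrite ger0_norm.
Qed.

(** Only even indices are followed: the cost series groups switches in pairs, and the remaining
    value is then always [Y false], which vanishes at infinity. *)
Lemma chain_gain_cvg_ae : {ae P, forall w, chain_gain m.*2 w @[m --> \oo] -->
  profit_of w - cost_of w}.
Proof.
have [_ cE _] := regY false.
have H : {ae P, forall w, extend (Y false) (a m.*2 w) w @[m --> \oo] --> (0 : R)}.
  apply: filterS2 ay cE => w aw h; apply: (h (fun m => a m.*2 w) +oo%E).
    by move=> m; exact: (ast m.*2).1.
  exact: (cvg_reindex (k := double) leq_double_self aw).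
have H2 : {ae P, forall w, PP m.*2 w @[m --> \oo] --> profit_of w}.
  apply: filterS partial_profit_profit_of => w h.
  exact: (cvg_reindex (k := double) leq_double_self h).
have H3 : {ae P, forall w, PC m.*2 w @[m --> \oo] --> cost_of w}.
  apply: filterS cost_ofE => w h; have := @cost_cvg w.
  by rewrite h => /fine_cvgP[].
apply: filterS3 H H2 H3 => w h1 h2 h3.
rewrite -[X in _ --> X]addr0 /chain_gain.
by under eq_fun do rewrite odd_double; apply: cvgD => //; apply: cvgB.
Qed.

Lemma chain_gain_cvg A : measurable A ->
  Ex (fun w => \1_A w * chain_gain m.*2 w) @[m --> \oo] -->
  Ex (fun w => \1_A w * (profit_of w - cost_of w)).
Proof.
move=> mA; have [_ _ [g hg gY]] := regY false.
have [] // := @Ex_dct _ _ _ P Pc (fun m w => \1_A w * chain_gain m.*2 w)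
  (fun w => \1_A w * (profit_of w - cost_of w)) (fun w => tot w + cost_of w + g w).
- move=> m; apply: measurable_funM; first exact: measurable_indic.
  exact: (L1_meas (chain_gain_L1 _)).
- by apply: filterS chain_gain_cvg_ae => w h; apply: cvgM => //; exact: cvg_cst.
- by apply: L1D => //; apply: L1D => //; exact: cost_of_L1.
apply: filterS3 PP_bound cost_ofE gY => w h1 h2 h3 m.
rewrite normrM -[leRHS]mul1r ler_pM ?indic_le1//.
rewrite /chain_gain odd_double (le_trans (ler_normD _ _))// lerD ?h3 ?(ast _).1//.
rewrite (le_trans (ler_normB _ _))//; have /andP[p1 p2] := h1 m.*2.
have pc0 := partial_cost_ge0 hbeta (ltW hc01) (ltW hc10) (a0 w) (am ^~ w) m.*2.
rewrite !ger0_norm// lerD// -lee_fin -h2.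
exact: (partial_cost_le hbeta (ltW hc01) (ltW hc10) (a0 w) (am ^~ w)).
Qed.

Let dp_meas : measurable_fun setT (discounted_profit beta f X a).
Proof.
apply: (ae_measurable_fun Pc (f := EFin \o profit_of)).
  by apply: filterS profit_ofE => w -> _.
exact/measurable_EFinP/(L1_meas profit_of_L1).
Qed.

Lemma mean_gainE : mean_gain P beta c01 c10 f X a =
  (Ex (fun w => profit_of w - cost_of w))%:E.
Proof.
have h := L1B profit_of_L1 cost_of_L1; rewrite (EFin_Ex h).
apply: ae_eq_integral => //.
- exact: emeasurable_funB.
- exact/measurable_EFinP/(L1_meas h).
- by apply: filterS2 profit_ofE cost_ofE => w -> -> _.
Qed.

Lemma discounted_profit_integral_fin : (\int[P]_w discounted_profit beta f X a w < +oo)%E.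
Proof.
rewrite (@ae_eq_integral _ _ _ P setT (EFin \o profit_of))//.
- by rewrite -EFin_Ex ?ltry//; exact: profit_of_L1.
- exact/measurable_EFinP/(L1_meas profit_of_L1).
- by apply: filterS profit_ofE => w -> _.
Qed.

End Limit.
End Chain.

Lemma admissible_cvgy a : admissible P F beta c01 c10 f X a ->
  {ae P, forall w, a n w @[n --> \oo] --> +oo%E}.
Proof.
move=> [sa _ cf]; have [st a0 am] := sa.
apply: filterS (cost_ofE sa cf) => w h.
apply: (switching_cvgy_of_cost hbeta (ltW hc01) (ltW hc10) (a0 w) (am ^~ w)) => //.
by rewrite h ltry.
Qed.

Lemma mean_gain_le a : admissible P F beta c01 c10 f X a ->
  (mean_gain P beta c01 c10 f X a <= (Ex (Y false 0))%:E)%E.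
Proof.
move=> adm; have ay := admissible_cvgy adm; have [sa _ cf] := adm.
rewrite mean_gainE// lee_fin.
have idT (g : Omega -> R) : (fun w => \1_setT w * g w) = g.
  by apply/funext => w; rewrite indicT mul1r.
have FT : F 0 setT := saT (filt_sa hF (lexx 0)).
have := chain_gain_cvg sa ay cf measurableT; rewrite idT => c.
rewrite -(cvg_lim (@Rhausdorff R) c); apply: limr_le; first by apply/cvg_ex; eexists; exact: c.
by apply: nearW => m; have := chain_gain_le sa m.*2 FT; rewrite !idT.
Qed.

Local Notation cand := (candidate beta c01 c10 (Y false) (Y true)).

Lemma candidateS k w : cand k.+1 w =
  first_time beta (cost (odd k)) (Y (odd k)) (Y (~~ odd k)) (cand k w) w.
Proof. by rewrite /=; case: (odd k). Qed.

Lemma candidate_strategy : strategy F cand.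
Proof.
have aY i := progressively_measurable_adapted hF (iY i).1.
split => [n|//|n w]; last by rewrite candidateS; exact: first_time_ge.
elim: n => [|n IH]; first exact: (st_cst hF).
have := first_time_stopping hF beta (cost (odd n)) (@cY (odd n)) (@cY (~~ odd n))
  (aY (odd n)) (aY (~~ odd n)) IH.
by congr (stopping_time F _); apply/funext => w; rewrite candidateS.
Qed.

(** The obstacle is met exactly at finite hitting times and all paths are continuous, so the
    contradiction at a finite limit is reached for every [w], without a null event. *)
Lemma candidate_cvgy w : cand n w @[n --> \oo] --> +oo%E.
Proof.
have [st _ am] := candidate_strategy.
have nd : {homo (fun n => cand n w) : n m / (n <= m)%N >-> (n <= m)%E}.
  by apply: homo_leq => [x|y x z|n]; [exact: lexx|exact: le_trans|exact: am].
apply/cvgeyPgt => A; apply: contrapT => nA.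
have aA n : (cand n w <= A%:E)%E.
  rewrite leNgt; apply/negP => h; apply: nA; exists n => // m /= nm.
  by apply: (lt_le_trans h); exact: nd.
pose r n := fine (cand n w).
have rE n : cand n w = (r n)%:E.
  by rewrite /r fineK// ge0_fin_numE ?(st n).1// (le_lt_trans (aA n))// ltry.
have r0 n : 0 <= r n by rewrite -lee_fin -rE (st n).1.
have ndr : {homo r : n m / (n <= m)%N >-> n <= m}.
  by move=> n m nm; rewrite -lee_fin -!rE nd.
have [l cl] : exists l : R, r n @[n --> \oo] --> l.
  apply/cvg_ex; apply: nondecreasing_is_cvgn => //.
  by exists A => _ [n _ <-]; rewrite -lee_fin -rE.
have l0 : 0 <= l by rewrite -(cvg_lim (@Rhausdorff R) cl); apply: limr_ge; [apply/cvg_ex; exists l|exact: nearW].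
pose D t := Y false t w - Y true t w.
have cD (u_ : nat -> R) : (forall n, 0 <= u_ n) -> u_ n @[n --> \oo] --> l ->
    D (u_ n) @[n --> \oo] --> D l.
  by move=> u0 ul; apply: cvgB; [exact: (path_cvg (@cY false w))|exact: (path_cvg (@cY true w))].
have ce (u_ : nat -> R) : u_ n @[n --> \oo] --> l ->
    expR (- (beta * u_ n)) @[n --> \oo] --> expR (- (beta * l)).
  move=> ul; apply: (cvg_comp _ expR); last exact: continuous_expR.
  by apply: cvgN; apply: cvgM => //; exact: cvg_cst.
have att k := first_time_attained (@cY (odd k)) (@cY (~~ odd k)) (esym (etrans (esym (rE k.+1)) (candidateS k w))).
have odd1 m : D (r m.*2.+1) = - c01 * expR (- (beta * r m.*2.+1)).
  by have := att m.*2; rewrite odd_double /D /= => ->; ring.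
have odd2 m : D (r m.*2.+2) = c10 * expR (- (beta * r m.*2.+2)).
  by have := att m.*2.+1; rewrite /= odd_double /D /= => ->; ring.
have c1 : r m.*2.+1 @[m --> \oo] --> l.
  by apply: (cvg_reindex (k := fun m => m.*2.+1) _ cl) => m; rewrite leqW// leq_double_self.
have c2 : r m.*2.+2 @[m --> \oo] --> l.
  by apply: (cvg_reindex (k := fun m => m.*2.+2) _ cl) => m; rewrite !leqW// leq_double_self.
have d1 := cD _ (fun m => r0 m.*2.+1) c1.
have d2 := cD _ (fun m => r0 m.*2.+2) c2.
have e1 : D l = - c01 * expR (- (beta * l)).
  rewrite -(cvg_lim (@Rhausdorff R) d1); apply: (cvg_lim (@Rhausdorff R)).
  by under eq_fun do rewrite odd1; apply: cvgM; [exact: cvg_cst|exact: (ce (fun m => r m.*2.+1))].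
have e2 : D l = c10 * expR (- (beta * l)).
  rewrite -(cvg_lim (@Rhausdorff R) d2); apply: (cvg_lim (@Rhausdorff R)).
  by under eq_fun do rewrite odd2; apply: cvgM; [exact: cvg_cst|exact: (ce (fun m => r m.*2.+2))].
have : 0 < (c10 + c01) * expR (- (beta * l)) by rewrite mulr_gt0 ?expR_gt0 ?addr_gt0.
by rewrite mulrDl -e2 e1 mulNr addNr ltxx.
Qed.

Lemma chain_gain_candidate A n : F 0 A ->
  Ex (fun w => \1_A w * chain_gain cand n w) = Ex (fun w => \1_A w * Y false 0 w).
Proof.
move=> FA; have mA := filt_meas hF (lexx 0) FA.
have sa := candidate_strategy; have [st _ _] := sa.
elim: n => [|n IH]; first by rewrite (Ex_chain_gain0 sa).
rewrite (Ex_chain_gainS sa)// IH.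
rewrite (_ : Ex (fun w => \1_A w * W (odd n) (cand n.+1 w) w) =
             Ex (fun w => \1_A w * V (odd n) (cand n w) w)) ?subrr ?addr0//.
under eq_fun do rewrite candidateS.
exact: (first_time_reward hF hbeta (hf _) (hfm _) (@aX _) (@cX _) (@cY _) (@cY _) (iY _) (iY _)
  (Yoo _) (Yoo _) (@hval _) (st n) FA).
Qed.

(** The mean of [chain_gain] is constant along the candidate, so the mean cost of [2m] switches
    equals the mean profit plus the mean remaining value minus the mean of [Y false 0], which is
    bounded uniformly in [m]. *)
Lemma candidate_cost_fin : (\int[P]_w switching_cost beta c01 c10 cand w < +oo)%E.
Proof.
have sa := candidate_strategy; have [st a0 am] := sa.
have idT (g : Omega -> R) : (fun w => \1_setT w * g w) = g.
  by apply/funext => w; rewrite indicT mul1r.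
have FT : F 0 setT := saT (filt_sa hF (lexx 0)).
have total_ae : {ae P, forall w i, (total i w < +oo)%E}.
  have h i := total_profit_ae hF (hf i) (hfm i) (@aX i) (@cX i) (total_fin i).
  by apply: filterS2 (h true) (h false) => w h1 h2 [].
pose tot w := fine (total true w) + fine (total false w).
have tot_L1 : L1 tot.
  have h i := total_profit_L1 hF (hf i) (hfm i) (@aX i) (@cX i) (total_fin i).
  exact: L1D.
have [_ _ [g hg gY]] := regY false.
pose C := Ex (fun w => tot w + g w) - Ex (Y false 0).
have hPP m := partial_profit_L1 sa m.*2; have hPC m := partial_cost_L1 sa m.*2.
have hY m := regular_L1 hF (regY false) (st m.*2).
have bound m : Ex (fun w => partial_cost beta c01 c10 cand w m.*2) <= C.
  have := chain_gain_candidate m.*2 FT; rewrite !idT => e.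
  have hG := chain_gain_L1 sa m.*2.
  have -> : Ex (fun w => partial_cost beta c01 c10 cand w m.*2) =
     Ex (fun w => partial_profit beta f X cand w m.*2 + extend (Y false) (cand m.*2 w) w) -
     Ex (Y false 0).
    rewrite -e -(ExB (L1D (hPP m) (hY m)) hG); congr Ex; apply/funext => w.
    by rewrite /chain_gain odd_double; ring.
  rewrite lerD2r; apply: (Ex_le Pc); [|exact: (L1D (hPP m) (hY m))|exact: (L1D tot_L1 hg)].
  apply: filterS2 total_ae gY => w tw gw; apply: lerD.
    have /andP[] // := partial_profit_bound hf (a0 w) (am ^~ w) (candidate_cvgy w)
      (fun i => measurable_rate beta (hfm i) (adapted_meas hF (@aX i)) (@cX i) w) tw m.*2.
  by rewrite (le_trans (ler_norm _))// gw// (st _).1.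
pose PC m w := (partial_cost beta c01 c10 cand w m.*2)%:E.
have cC w : PC m w @[m --> \oo] --> switching_cost beta c01 c10 cand w.
  exact: (switching_costE hbeta (ltW hc01) (ltW hc10) (a0 w) (am ^~ w)).
have PC0 m w : (0 <= PC m w)%E.
  by rewrite lee_fin (partial_cost_ge0 hbeta (ltW hc01) (ltW hc10) (a0 w) (am ^~ w)).
have mPC m : measurable_fun setT (PC m) by exact/measurable_EFinP/(L1_meas (hPC m)).
have nd w : {homo PC^~ w : n m / (n <= m)%N >-> (n <= m)%E}.
  move=> n m nm; rewrite lee_fin.
  by apply: (partial_cost_mono hbeta (ltW hc01) (ltW hc10) (a0 w) (am ^~ w)); rewrite leq_double.
rewrite (eq_integral (fun w => limn (PC^~ w))); last first.
  by move=> w _; apply/esym/cvg_lim => //; exact: cC.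
rewrite (monotone_convergence P measurableT mPC)//.
apply: (@le_lt_trans _ _ C%:E); last exact: ltry.
apply: lime_le.
  apply: ereal_nondecreasing_is_cvgn => n m nm; apply: ge0_le_integral => //.
  by move=> w _; exact: nd.
by apply: nearW => m; rewrite /PC -EFin_Ex// lee_fin.
Qed.

Lemma candidate_admissible : admissible P F beta c01 c10 f X cand.
Proof.
split; [exact: candidate_strategy| |exact: candidate_cost_fin].
apply: discounted_profit_integral_fin; [exact: candidate_strategy|].
exact: aeW candidate_cvgy.
Qed.

Lemma Ex_candidate_gain A : F 0 A ->
  Ex (fun w => \1_A w * (profit_of cand w - cost_of cand w)) =
  Ex (fun w => \1_A w * Y false 0 w).
Proof.
move=> FA; have mA := filt_meas hF (lexx 0) FA.
have := chain_gain_cvg candidate_strategy (aeW _ candidate_cvgy) candidate_cost_fin mA.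
rewrite (_ : (fun m => _) = fun=> Ex (fun w => \1_A w * Y false 0 w)); last first.
  by apply/funext => m; exact: chain_gain_candidate.
by move=> h; rewrite -(cvg_lim (@Rhausdorff R) h) lim_cst.
Qed.

Lemma mean_gain_candidate : mean_gain P beta c01 c10 f X cand = (Ex (Y false 0))%:E.
Proof.
have idT (g : Omega -> R) : (fun w => \1_setT w * g w) = g.
  by apply/funext => w; rewrite indicT mul1r.
rewrite (mean_gainE candidate_strategy (aeW _ candidate_cvgy) candidate_cost_fin).
have := Ex_candidate_gain (saT (filt_sa hF (lexx 0))).
by rewrite !idT => ->.
Qed.

Lemma optimal_gainE : optimal_gain P F beta c01 c10 f X = (Ex (Y false 0))%:E.
Proof.
apply/eqP; rewrite eq_le; apply/andP; split.
  by apply: ge_ereal_sup => _ [a adm <-]; exact: mean_gain_le.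
rewrite -mean_gain_candidate; apply: ereal_sup_ubound; exists cand => //.
exact: candidate_admissible.
Qed.

End Switching.

(** * Brownian increments and the discrete isometry *)

Section NormalLaw.
Context {R : realType}.
Local Notation mu := (@lebesgue_measure R).
Implicit Types (s : R) (B : set R).

(** The Radon-Nikodym derivative and the density have the same integral over every measurable set,
    so they agree almost everywhere. *)
Lemma integral_normal_prob s (phi : R -> \bar R) : measurable_fun setT phi ->
  (forall y, (0 <= phi y)%E) ->
  (\int[normal_prob 0%R s]_y phi y = \int[mu]_y (phi y * (normal_pdf 0 s y)%:E))%E.
Proof.
move=> mphi phi0; have dom := normal_prob_dominates 0 s.
rewrite -(Radon_Nikodym_SigmaFinite.change_of_variables dom phi0 measurableT mphi).
have mg : measurable_fun setT (Radon_Nikodym_SigmaFinite.f (normal_prob 0%R s) mu).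
  exact: measurable_int (Radon_Nikodym_SigmaFinite.f_integrable dom).
have mp : measurable_fun setT (fun y => (normal_pdf 0 s y)%:E).
  by apply/measurable_EFinP; exact: measurable_normal_pdf.
apply: ae_eq_integral => //; [exact: emeasurable_funM|exact: emeasurable_funM|].
have : ae_eq mu setT (fun y => (normal_pdf 0 s y)%:E)
    (Radon_Nikodym_SigmaFinite.f (normal_prob 0%R s) mu).
  apply: integral_ae_eq => //; first exact: integrable_normal_pdf.
  by move=> E _ mE; rewrite -(Radon_Nikodym_SigmaFinite.f_integral dom mE).
by apply: filterS => y /(_ I) <- _.
Qed.

(** With [u = y^2 / (4 s^2)] this comes down to [u * expR (- u) <= 1]: one of two equal exponential
    factors pays for the square, and the other is that of the wider Gaussian. Integrated, it bounds
    the second moment by [8 s^2], which is not sharp but sufficient. *)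
Lemma normal_pdf_dominated s y : 0 < s ->
  y ^+ 2 * normal_pdf 0 s y <= 8 * s ^+ 2 * normal_pdf 0 (Num.sqrt 2 * s) y.
Proof.
move=> s0; have s2 : 0 < Num.sqrt 2 :> R by rewrite sqrtr_gt0.
have s20 : 0 < s ^+ 2 by rewrite exprn_gt0.
rewrite !normal_pdfE ?gt_eqF ?mulr_gt0//.
have pE : normal_peak (Num.sqrt 2 * s) = (Num.sqrt 2)^-1 * normal_peak s.
  by rewrite /normal_peak exprMn sqr_sqrtr// -mulrA -mulrnAr sqrtrM// invfM.
pose u := y ^+ 2 / (4 * s ^+ 2).
have eE : normal_fun 0 (Num.sqrt 2 * s) y = expR (- u).
  rewrite /normal_fun subr0 exprMn sqr_sqrtr// mulNr; congr (expR (- (_ / _))); ring.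
have eE2 : normal_fun 0 s y = expR (- u) * expR (- u).
  rewrite -expRD /normal_fun subr0 mulNr; congr expR; rewrite /u; field.
  by rewrite gt_eqF.
have yE : y ^+ 2 = 4 * s ^+ 2 * u by rewrite /u; field; rewrite gt_eqF.
have ue : u * expR (- u) <= 1.
  rewrite expRN ler_pdivrMr ?expR_gt0// mul1r.
  by apply: (le_trans _ (expR_ge1Dx _)); rewrite lerDr.
have s22 : 1 <= 2 / Num.sqrt 2 :> R.
  rewrite ler_pdivlMr//; have : Num.sqrt 2 ^+ 2 = 2 :> R by rewrite sqr_sqrtr.
  by move: s2; clear; nra.
have p0 := normal_peak_ge0 s; have e0 := expR_ge0 (- u).
rewrite pE eE eE2 yE.
have -> : 4 * s ^+ 2 * u * (normal_peak s * (expR (- u) * expR (- u))) =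
  (u * expR (- u)) * (4 * s ^+ 2 * (normal_peak s * expR (- u))) by ring.
have -> : 8 * s ^+ 2 * ((Num.sqrt 2)^-1 * normal_peak s * expR (- u)) =
  (2 / Num.sqrt 2) * (4 * s ^+ 2 * (normal_peak s * expR (- u))) by field; rewrite gt_eqF.
apply: ler_wpM2r; first by rewrite !mulr_ge0// ltW.
exact: le_trans s22.
Qed.

Lemma normal_prob_opp s B : s != 0 -> measurable B ->
  normal_prob 0 s (-%R @^-1` B) = normal_prob 0 s B :> \bar R.
Proof.
move=> s0 mB.
rewrite /normal_prob; have pN y : normal_pdf 0 s (- y) = normal_pdf 0 s y.
  by rewrite !normal_pdfE// /normal_fun !subr0 sqrrN.
have mp : measurable_fun B (fun y => (normal_pdf 0 s y)%:E).
  by apply/measurable_EFinP/measurable_funTS; exact: measurable_normal_pdf.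
transitivity (\int[pushforward lebesgue_measure (-%R : _ -> measurableTypeR R)]_(y in B)
    (normal_pdf 0 s y)%:E)%E.
  rewrite ge0_integral_pushforward.
  - by apply: eq_integral => y _; rewrite /= pN.
  - exact: oppr_measurable.
  - exact: mB.
  - exact: mp.
  - by move=> y _; rewrite lee_fin normal_pdf_ge0.
by apply: eq_measure_integral => //= A mA _; exact: lebesgue_measureN.
Qed.
End NormalLaw.

Lemma norm_le_1Dsqr {R : realType} (y : R) : `|y| <= 1 + y ^+ 2.
Proof.
have := sqr_ge0 (`|y| - 1); rewrite -(real_normK (num_real y)).
by move: (normr_ge0 y); set z := `|y|; nra.
Qed.

(** * Moments of a normal variable *)

Section SameLaw.
Context {R : realType} {d : measure_display} {Omega : measurableType d}.
Variable P : probability Omega R.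
Local Notation L1 := (L1 P).
Local Notation Ex := (Ex P).

Lemma same_law_integral d' (T : measurableType d') (m : {measure set T -> \bar R})
    (V : Omega -> T) (phi : T -> \bar R) :
  measurable_fun setT V -> (forall B, measurable B -> P (V @^-1` B) = m B) ->
  measurable_fun setT phi -> (forall y, (0 <= phi y)%E) ->
  (\int[P]_w phi (V w) = \int[m]_y phi y)%E.
Proof.
move=> mV VE mphi phi0.
transitivity (\int[pushforward P V]_y phi y)%E.
  by rewrite (ge0_integral_pushforward mV P measurableT).
by apply: eq_measure_integral => A mA _; exact: VE.
Qed.

Variables (s : R) (V : Omega -> R).
Hypotheses (s0 : 0 < s) (mV : measurable_fun setT V).
Hypothesis VE : forall B, measurable B -> P (V @^-1` B) = normal_prob 0 s B.

Let sqr_fin : (\int[P]_w ((V w) ^+ 2)%:E <= (8 * s ^+ 2)%:E)%E.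
Proof.
pose phi (y : R) := (y ^+ 2)%:E.
have mphi : measurable_fun setT phi by apply/measurable_EFinP; exact: measurable_funX.
have phi0 y : (0 <= phi y)%E by rewrite lee_fin sqr_ge0.
rewrite (same_law_integral (m := normal_prob 0%R s) mV VE mphi phi0) integral_normal_prob//.
have s2 : 0 < Num.sqrt 2 * s by rewrite mulr_gt0// sqrtr_gt0.
apply: (@le_trans _ _ (\int[lebesgue_measure]_y
    ((8 * s ^+ 2)%:E * (normal_pdf 0 (Num.sqrt 2 * s) y)%:E))%E).
  apply: ge0_le_integral => //.
  - by move=> y _; rewrite -EFinM lee_fin mulr_ge0 ?sqr_ge0 ?normal_pdf_ge0.
  - apply: emeasurable_funM; apply/measurable_EFinP; first exact: measurable_funX.
    exact: measurable_normal_pdf.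
  - by apply: emeasurable_funM => //; apply/measurable_EFinP; exact: measurable_normal_pdf.
  - by move=> y _; rewrite -!EFinM lee_fin normal_pdf_dominated.
rewrite ge0_integralZl//.
- by rewrite integral_normal_pdf mule1.
- by apply/measurable_EFinP; exact: measurable_normal_pdf.
- by move=> y _; rewrite lee_fin normal_pdf_ge0.
- by rewrite lee_fin mulr_ge0// sqr_ge0.
Qed.

Lemma normal_sqr_L1 : L1 (fun w => V w ^+ 2).
Proof.
apply/integrableP; split; first by apply/measurable_EFinP; exact: measurable_funX.
apply: (@le_lt_trans _ _ (8 * s ^+ 2)%:E); last exact: ltry.
apply: le_trans sqr_fin; rewrite le_eqVlt; apply/orP; left; apply/eqP.
by apply: eq_integral => w _; rewrite /= ger0_norm// sqr_ge0.
Qed.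

Lemma normal_sqr_le : Ex (fun w => V w ^+ 2) <= 8 * s ^+ 2.
Proof. by rewrite -lee_fin (EFin_Ex normal_sqr_L1). Qed.

Lemma normal_L1 : L1 V.
Proof.
have h := L1D (L1_cst P 1) normal_sqr_L1; apply/integrableP; split.
  exact/measurable_EFinP.
move/integrableP : h => [mh]; apply: le_lt_trans; apply: ge0_le_integral => //.
- by apply/measurable_EFinP; exact: measurableT_comp.
- exact: measurableT_comp.
- move=> w _; rewrite /= lee_fin; apply: le_trans (ler_norm _).
  exact: norm_le_1Dsqr.
Qed.

(** [V] and [- V] have the same law, so the positive and negative parts of [V] have the same
    mean. *)
Lemma normal_mean : Ex V = 0.
Proof.
have mN : measurable_fun setT (fun w => - V w) by exact: measurableT_comp.
have h (phi : R -> \bar R) : measurable_fun setT phi -> (forall y, (0 <= phi y)%E) ->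
    (\int[P]_w phi (- V w)%R = \int[P]_w phi (V w))%E.
  move=> mphi phi0; rewrite (same_law_integral (m := normal_prob 0%R s) mV VE mphi phi0).
  apply: (same_law_integral (m := normal_prob 0%R s) mN _ mphi phi0) => B mB.
  apply: etrans; last exact: (normal_prob_opp (lt0r_neq0 s0) mB).
  rewrite -VE//.
  by rewrite -[X in measurable X]setTI; exact: oppr_measurable.
pose q (y : R) := Num.max y 0.
have mq : measurable_fun setT q by exact: measurable_maxr.
have q0 y : (0 <= (q y)%:E)%E by rewrite lee_fin le_max lexx orbT.
have Lq (V' : Omega -> R) : measurable_fun setT V' -> (forall w, `|V' w| = `|V w|) -> L1 (fun w => q (V' w)).
  move=> mV' e; apply: (L1_dom _ (L1_norm normal_L1)); first exact: measurableT_comp.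
  apply: aeW => w; rewrite -e ger0_norm; last by rewrite -lee_fin q0.
  by rewrite ge_max ler_norm normr_ge0.
have L1q := Lq V mV (fun=> erefl); have L2q := Lq _ mN (fun w => normrN (V w)).
have -> : Ex V = Ex (fun w => q (V w) - q (- V w)).
  congr Ex; apply/funext => w; rewrite /q; case: (leP (V w) 0) => h0.
    by rewrite max_l ?oppr_ge0// sub0r opprK.
  by rewrite max_r ?oppr_le0 ?ltW// subr0.
rewrite (ExB L1q L2q); apply/eqP; rewrite subr_eq0; apply/eqP/EFin_inj.
rewrite (EFin_Ex L1q) (EFin_Ex L2q); apply/esym.
by apply: (h (fun y => (q y)%:E)) => //; exact/measurable_EFinP.
Qed.
End SameLaw.

(** * Measurability for a sub-sigma-algebra *)

Section MeasurableWrt.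
Context {R : realType} {d : measure_display} {Omega : measurableType d}.
Variable M : set (set Omega).
Hypothesis hM : sigma_algebra [set: Omega] M.
Implicit Types Y Z : Omega -> R.
Local Notation wrt := (measurable_wrt M).

Lemma wrtD Y Z : wrt Y -> wrt Z -> wrt (fun w => Y w + Z w).
Proof. by move=> /(measurable_wrtP hM) ? /(measurable_wrtP hM) ?; apply/(measurable_wrtP hM); exact: measurable_funD. Qed.

Lemma wrtB Y Z : wrt Y -> wrt Z -> wrt (fun w => Y w - Z w).
Proof. by move=> /(measurable_wrtP hM) ? /(measurable_wrtP hM) ?; apply/(measurable_wrtP hM); exact: measurable_funB. Qed.

Lemma wrtM Y Z : wrt Y -> wrt Z -> wrt (fun w => Y w * Z w).
Proof. by move=> /(measurable_wrtP hM) ? /(measurable_wrtP hM) ?; apply/(measurable_wrtP hM); exact: measurable_funM. Qed.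

Lemma wrt_cst (y : R) : wrt (fun=> y).
Proof. by apply/(measurable_wrtP hM); exact: measurable_cst. Qed.

Lemma wrt_comp d' d'' (T : measurableType d') (T' : measurableType d'') (g : T -> T')
    (Z : Omega -> T) : measurable_fun setT g -> measurable_wrt M Z ->
  measurable_wrt M (fun w => g (Z w)).
Proof. by move=> mg hZ B mB; apply: (hZ (g @^-1` B)); rewrite -[X in measurable X]setTI; exact: mg. Qed.

Lemma wrt_sum (I : Type) (r : seq I) (Q : pred I) (Y : I -> Omega -> R) :
  (forall i, Q i -> wrt (Y i)) -> wrt (fun w => \sum_(i <- r | Q i) Y i w).
Proof.
move=> h; elim: r => [|i r IH].
  have -> : (fun w => \sum_(i <- [::] | Q i) Y i w) = fun=> 0.
    by apply/funext => w; rewrite big_nil.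
  exact: wrt_cst.
have -> : (fun w => \sum_(i <- i :: r | Q i) Y i w) = fun w => if Q i then
    Y i w + \sum_(j <- r | Q j) Y j w else \sum_(j <- r | Q j) Y j w.
  by apply/funext => w; rewrite big_cons.
by case Qi: (Q i) => //; apply: wrtD => //; exact: h.
Qed.

Lemma wrt_indic (A : set Omega) : M A -> wrt (\1_A : Omega -> R).
Proof.
move=> MA; apply/(measurable_wrtP hM).
by apply: (@measurable_indic _ (g_sigma_algebraType M)); rewrite measurable_OM.
Qed.

Lemma wrt_ae (P : probability Omega R) Y Z : measure_is_complete P -> M `<=` measurable ->
  (forall N, P.-negligible N -> M N) ->
  {ae P, forall w, Y w = Z w} -> wrt Y -> wrt Z.
Proof.
move=> Pc subM nullM YZ hY B mB.
have N : P.-negligible [set w | Y w <> Z w] by [].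
have -> : Z @^-1` B = (Y @^-1` B `\` [set w | Y w <> Z w]) `|`
   ([set w | Y w <> Z w] `&` Z @^-1` B).
  apply/seteqP; split => w /=; last by move=> [[h /contrapT <-]|[]].
  by move=> h; have [e|e] := pselect (Y w = Z w); [left; split; [rewrite e|]|right].
apply: saU => //; first by apply: saD => //; [exact: hY|exact: nullM].
by apply: nullM; apply: negligibleS N; exact: subIsetl.
Qed.

(** Since [M] contains the null events, both the set of divergence and any change made on it are
    harmless for [M]-measurability. *)
Lemma wrt_cvg (P : probability Omega R) (Y : nat -> Omega -> R) Z :
  measure_is_complete P -> M `<=` measurable -> (forall N, P.-negligible N -> M N) ->
  (forall n, wrt (Y n)) -> {ae P, forall w, Y n w @[n --> \oo] --> Z w} -> wrt Z.
Proof.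
move=> Pc subM nullM hY YZ; pose N := [set w | ~ (Y n w @[n --> \oo] --> Z w)].
have MN : M (~` N) by apply: saC => //; apply: nullM; exact: YZ.
apply: (@wrt_ae P (fun w => \1_(~` N) w * Z w)) => //.
  apply: filterS YZ => w h; have hN : (~` N) w by move=> nh; exact: nh.
  by rewrite indicE mem_set// mul1r.
apply/(measurable_wrtP hM).
apply: (@measurable_fun_cvg _ (g_sigma_algebraType M) R setT
  (fun n w => \1_(~` N) w * Y n w)) => [n|w _].
  by apply/(measurable_wrtP hM); apply: wrtM; [exact: wrt_indic|exact: hY].
have [h|h] := pselect ((~` N) w); last first.
  by under eq_fun do rewrite indicE memNset// mul0r; rewrite indicE memNset// mul0r; exact: cvg_cst.
by apply: cvgM; [exact: cvg_cst|exact: contrapT h].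
Qed.

End MeasurableWrt.

Lemma mul_le_sqrD {R : realType} (y z : R) : 0 <= y -> 0 <= z -> y * z <= y ^+ 2 + z ^+ 2.
Proof. by move=> y0 z0; have := sqr_ge0 (y - z); nra. Qed.

(** * Independence of increments and the isometry *)

Section Increments.
Context {R : realType} {d : measure_display} {Omega : measurableType d}.
Variables (P : probability Omega R) (F : R -> set (set Omega)) (W : R -> Omega -> R).
Hypothesis hF : complete_right_continuous_filtration P F.
Hypothesis hW : brownian_motion P F W.
Local Notation L1 := (L1 P).
Local Notation Ex := (Ex P).
Let Pc := filt_complete hF.

Section Increment.
Variables s t : R.
Hypotheses (s0 : 0 <= s) (st : s < t).
Local Notation V := (fun w => W t w - W s w).
Let t0 : 0 <= t. Proof. exact: le_trans (ltW st). Qed.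
Let sd : 0 < Num.sqrt (t - s). Proof. by rewrite sqrtr_gt0 subr_gt0. Qed.

Lemma increment_wrt : measurable_wrt (F t) V.
Proof.
have [aW _ _ _ _] := hW.
have hs : measurable_wrt (F t) (W s) by move=> B mB; apply: (filt_mono hF s0 (ltW st)); exact: aW.
exact: (wrtB (filt_sa hF t0) (aW _ t0) hs).
Qed.

Lemma increment_meas : measurable_fun setT V.
Proof. exact: (measurable_wrt_meas (filt_meas hF t0) increment_wrt). Qed.

Let law B : measurable B -> P (V @^-1` B) = normal_prob 0 (Num.sqrt (t - s)) B.
Proof. by have [_ _ _ h _] := hW; exact: h. Qed.

Lemma increment_L1 : L1 V. Proof. exact: normal_L1 sd increment_meas law. Qed.

Lemma increment_sqr_L1 : L1 (fun w => V w ^+ 2).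
Proof. exact: normal_sqr_L1 sd increment_meas law. Qed.

Lemma increment_mean : Ex V = 0.
Proof. exact: normal_mean sd increment_meas law. Qed.

Lemma increment_sqr_le : Ex (fun w => V w ^+ 2) <= 8 * (t - s).
Proof.
have := normal_sqr_le sd increment_meas law.
by rewrite sqr_sqrtr// subr_ge0 ltW.
Qed.

(** Independence is given for events only. Here the sigma-algebra is that of the increment,
    [phi (V w)] is the weight, and the centred indicator of [B] is the function with mean zero on
    every event. *)
Lemma Ex_indic_increment (phi : R -> R) (B : set Omega) : measurable_fun setT phi ->
  L1 (fun w => phi (V w)) -> F s B ->
  Ex (fun w => \1_B w * phi (V w)) = fine (P B) * Ex (fun w => phi (V w)).
Proof.
move=> mphi hphi FB; have mB := filt_meas hF s0 FB; have mV := increment_meas.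
pose M := preimage_set_system setT V (@measurable _ R).
have sM : sigma_algebra setT M by apply: sigma_algebra_preimage; exact: sigma_algebra_measurable.
have subM : M `<=` measurable by move=> _ [C mC <-]; exact: mV.
have h1 : L1 (\1_B : Omega -> R) by exact: L1_indic.
suff : Ex (fun w => phi (V w) * (\1_B w - fine (P B))) = 0.
  have -> : (fun w => phi (V w) * (\1_B w - fine (P B))) =
     (fun w => \1_B w * phi (V w) - fine (P B) * phi (V w)) by apply/funext => w; ring.
  by rewrite (ExB (L1M_ind mB hphi) (L1Z _ hphi)) (ExZ _ hphi) => /subr0_eq.
apply: (weight_eq0_unbounded (K := 2) Pc sM subM hphi).
- move=> C mC; exists (phi @^-1` C); last by rewrite setTI.
  by rewrite -[X in measurable X]setTI; exact: mphi.
- exact: (L1_meas (L1B h1 (L1_cst P _))).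
- move=> w; have /andP[] : 0 <= fine (P B) <= 1.
    by rewrite fine_ge0// -lee_fin fineK ?probability_le1// fin_num_measure.
  move=> p0 p1; rewrite (le_trans (ler_normB _ _))// (ger0_norm p0).
  have -> : 2 = 1 + 1 :> R by ring.
  by rewrite lerD// indic_le1.
move=> _ [C mC <-]; rewrite setTI; set D := V @^-1` C.
have mD : measurable D by rewrite -[X in measurable X]setTI; exact: mV.
have -> : (fun w => \1_D w * (\1_B w - fine (P B))) =
     (fun w => \1_(B `&` D) w - fine (P B) * \1_D w :> R).
  by apply/funext => w; rewrite indicI; ring.
rewrite (ExB (L1_indic P (measurableI _ _ mB mD)) (L1Z _ (L1_indic P mD))).
rewrite (ExZ _ (L1_indic P mD)) !Ex_ind//; last exact: measurableI.
have [_ _ _ _ ind] := hW; rewrite (ind _ _ s0 st _ _ FB mC).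
by rewrite fineM ?fin_num_measure// subrr.
Qed.

(** The roles are exchanged: the centred [phi (V w)] has mean zero on events of [F s], and [Z] is
    the weight. *)
Lemma Ex_mul_increment (Z : Omega -> R) (phi : R -> R) : measurable_fun setT phi ->
  L1 (fun w => phi (V w)) -> measurable_wrt (F s) Z -> L1 Z ->
  L1 (fun w => Z w * phi (V w)) ->
  Ex (fun w => Z w * phi (V w)) = Ex Z * Ex (fun w => phi (V w)).
Proof.
move=> mphi hphi aZ hZ hZp.
have sF := filt_sa hF s0; have mF := filt_meas hF s0.
pose h w := phi (V w) - Ex (fun w => phi (V w)).
have hh : L1 h by apply: L1B => //; exact: L1_cst.
have Bh B : F s B -> Ex (fun w => \1_B w * h w) = 0.
  move=> FB; have mB := mF _ FB.
  have -> : (fun w => \1_B w * h w) =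
     (fun w => \1_B w * phi (V w) - Ex (fun w => phi (V w)) * \1_B w).
    by apply/funext => w; rewrite /h; ring.
  rewrite (ExB (L1M_ind mB hphi) (L1Z _ (L1_indic P mB))) (ExZ _ (L1_indic P mB)).
  by rewrite Ex_indic_increment// Ex_ind// mulrC subrr.
have hZh : L1 (fun w => Z w * h w).
  have := L1B hZp (L1Z (Ex (fun w => phi (V w))) hZ); apply: eq_L1 => w.
  by rewrite /h; ring.
suff : Ex (fun w => Z w * h w) = 0.
  have -> : (fun w => Z w * h w) = (fun w => Z w * phi (V w) - Ex (fun w => phi (V w)) * Z w).
    by apply/funext => w; rewrite /h; ring.
  by rewrite (ExB hZp (L1Z _ hZ)) (ExZ _ hZ) mulrC => /subr0_eq.
(* The weight lemma needs a bounded weight, so [Z] is truncated first. *)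
pose clip n (y : R) := Num.max (- n.+1%:R) (Num.min n.+1%:R y).
have mclip n : measurable_fun setT (clip n).
  by apply: measurable_maxr => //; exact: measurable_minr.
have clip_le n y : `|clip n y| <= n.+1%:R.
  by rewrite /clip ler_norml le_max lexx/= ge_max ge_min lexx/= andbT lerNl (le_trans _ (ler0n _ _))// oppr_le0.
have clip_id n y : `|y| <= n.+1%:R -> clip n y = y.
  by rewrite ler_norml => /andP[y1 y2]; rewrite /clip min_r// max_r.
have clip_norm n y : `|clip n y| <= `|y|.
  have [h'|h'] := leP `|y| n.+1%:R; first by rewrite clip_id.
  exact: le_trans (clip_le _ _) (ltW h').
have e n : Ex (fun w => clip n (Z w) * h w) = 0.
  have n0 : 0 < n.+1%:R *+ 2 :> R by rewrite pmulrn_lgt0.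
  pose a w := (clip n (Z w) + n.+1%:R) / (n.+1%:R *+ 2).
  have aw : measurable_wrt (F s) a.
    apply: (wrt_comp (g := fun y => (clip n y + n.+1%:R) / (n.+1%:R *+ 2)) _ aZ).
    by apply: measurable_funM => //; apply: measurable_funD.
  have a01 w : 0 <= a w <= 1.
    have := clip_le n (Z w); rewrite ler_norml => /andP[c1 c2].
    have c3 : 0 <= clip n (Z w) + n.+1%:R by rewrite -lerBlDr sub0r.
    have c4 : clip n (Z w) + n.+1%:R <= n.+1%:R *+ 2 by rewrite mulr2n lerD2r.
    by rewrite /a divr_ge0 ?(ltW n0)//= ler_pdivrMr// mul1r.
  have E0 := weight_eq0 Pc mF hh Bh aw a01.
  have E1 : Ex h = 0.
    have := Bh _ (saT sF); congr (_ = _); congr Ex; apply/funext => w.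
    by rewrite indicT mul1r.
  have ha : L1 (fun w => a w * h w).
    apply: (L1M_bnd (M := 1) (measurable_wrt_meas mF aw) _ hh) => w.
    by have /andP[a0 a1] := a01 w; rewrite ger0_norm.
  have -> : (fun w => clip n (Z w) * h w) =
     (fun w => (n.+1%:R *+ 2) * (a w * h w) - n.+1%:R * h w).
    by apply/funext => w; rewrite mulrA /a [_ *+ 2 * _]mulrC divfK ?gt_eqF//; ring.
  by rewrite (ExB (L1Z _ ha) (L1Z _ hh)) (ExZ _ ha) (ExZ _ hh) E0 E1 !mulr0 subrr.
have [] // := @Ex_dct _ _ _ P Pc (fun n w => clip n (Z w) * h w) (fun w => Z w * h w)
  (fun w => `|Z w * h w|).
- move=> n; apply: measurable_funM; last exact: (L1_meas hh).
  by apply: measurableT_comp => //; exact: (L1_meas hZ).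
- apply: aeW => w; apply: cvgM; last exact: cvg_cst.
  apply: cvg_near_cst; exists (Num.truncn `|Z w|) => // n /= hn.
  apply: clip_id; apply: ltW; apply: (lt_le_trans (truncnS_gt _)).
  by rewrite ler_nat.
- exact: L1_norm.
- by apply: aeW => w n; rewrite !normrM ler_wpM2r.
move=> _; under eq_fun do rewrite e; move=> c.
by rewrite -(cvg_lim (@Rhausdorff R) c) lim_cst.
Qed.

End Increment.

Definition discrete_integral (t_ : nat -> R) (g : nat -> Omega -> R) (k : nat) (w : Omega) : R :=
  \sum_(j < k) g j w * (W (t_ j.+1) w - W (t_ j) w).

Section Isometry.
Variables (t_ : nat -> R) (g : nat -> Omega -> R) (M : nat -> R).
Hypotheses (t0 : 0 <= t_ 0%N) (tS : forall j, t_ j < t_ j.+1).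
Hypothesis ag : forall j, measurable_wrt (F (t_ j)) (g j).
Hypothesis gM : forall j w, `|g j w| <= M j.

Let t_ge0 j : 0 <= t_ j.
Proof. by elim: j => // j IH; exact: le_trans (ltW (tS j)). Qed.

Let gm j : measurable_fun setT (g j).
Proof. exact: (measurable_wrt_meas (filt_meas hF (t_ge0 j)) (@ag j)). Qed.

Lemma discrete_integral_wrt k : measurable_wrt (F (t_ k)) (discrete_integral t_ g k).
Proof.
have t_mono : {homo t_ : i j / (i <= j)%N >-> i <= j}.
  by apply: homo_leq => [x|y x z|j]; [exact: lexx|exact: le_trans|exact: ltW].
apply: (wrt_sum (filt_sa hF (t_ge0 k))) => j _.
apply: (wrtM (filt_sa hF (t_ge0 k))).
  by move=> B mB; apply: (filt_mono hF (t_ge0 j) (t_mono _ _ (ltnW (ltn_ord j)))); exact: ag.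
move=> B mB; apply: (filt_mono hF (t_ge0 j.+1) (t_mono _ _ (ltn_ord j))).
exact: (increment_wrt (t_ge0 j) (tS j)).
Qed.

(** Expanding the square, the cross term vanishes because the new increment is centred and
    independent of its past. The factor 8 is the crude second-moment constant, hence an inequality;
    boundedness of each [g j] keeps all products integrable. *)
Lemma discrete_isometry k : L1 (fun w => discrete_integral t_ g k w ^+ 2) /\
  Ex (fun w => discrete_integral t_ g k w ^+ 2) <=
    8 * \sum_(j < k) (t_ j.+1 - t_ j) * Ex (fun w => g j w ^+ 2).
Proof.
elim: k => [|k [IH1 IH2]].
  rewrite big_ord0 mulr0 (_ : (fun w => _) = fun=> 0); first by rewrite Ex_cst; split => //; exact: L1_cst.
  by apply/funext => w; rewrite /discrete_integral big_ord0 expr2 mul0r.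
set S := discrete_integral t_ g in IH1 IH2 *; pose V w := W (t_ k.+1) w - W (t_ k) w.
have SS w : S k.+1 w = S k w + g k w * V w by rewrite /S /discrete_integral big_ord_recr.
have aS := discrete_integral_wrt k; have sF := filt_sa hF (t_ge0 k).
have mS := measurable_wrt_meas (filt_meas hF (t_ge0 k)) aS.
have V1 : L1 V := increment_L1 (t_ge0 k) (tS k).
have V2 : L1 (fun w => V w ^+ 2) := increment_sqr_L1 (t_ge0 k) (tS k).
have S1 : L1 (S k).
  apply: (L1_dom mS (L1D (L1_cst P 1) IH1)); apply: aeW => w; exact: norm_le_1Dsqr.
have Sg1 : L1 (fun w => S k w * g k w).
  have := L1M_bnd (@gm k) (@gM k) S1; apply: eq_L1 => w; exact: mulrC.
have SV1 : L1 (fun w => S k w * V w).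
  apply: (L1_dom _ (L1D IH1 V2)); first by apply: measurable_funM => //; exact: (L1_meas V1).
  apply: aeW => w; rewrite normrM -(real_normK (num_real (S k w))) -(real_normK (num_real (V w))).
  move: (normr_ge0 (S k w)) (normr_ge0 (V w)); set y := `|S k w|; set z := `|V w|.
  exact: mul_le_sqrD.
have SgV : L1 (fun w => S k w * g k w * V w).
  have := L1M_bnd (@gm k) (@gM k) SV1; apply: eq_L1 => w; ring.
have g2m : measurable_fun setT (fun w => g k w ^+ 2) by exact: measurable_funX.
have g2M w : `|g k w ^+ 2| <= M k ^+ 2.
  by rewrite normrX lerXn2r ?nnegrE// (le_trans _ (gM k w)).
have g2 : L1 (fun w => g k w ^+ 2) := L1_bnd P g2m g2M.
have gV : L1 (fun w => g k w ^+ 2 * V w ^+ 2) := L1M_bnd g2m g2M V2.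
have e1 : Ex (fun w => S k w * g k w * V w) = 0.
  rewrite (Ex_mul_increment (t_ge0 k) (tS k) (phi := id) _ V1 (wrtM sF aS (@ag k)) Sg1 SgV)//.
  by rewrite (increment_mean (t_ge0 k) (tS k)) mulr0.
have e2 : Ex (fun w => g k w ^+ 2 * V w ^+ 2) =
    Ex (fun w => g k w ^+ 2) * Ex (fun w => V w ^+ 2).
  apply: (Ex_mul_increment (t_ge0 k) (tS k) (phi := fun y => y ^+ 2)) => //.
  by apply: (wrt_comp (g := fun y : R => y ^+ 2) _ (@ag k)); exact: measurable_funX.
have E : (fun w => S k.+1 w ^+ 2) =
    (fun w => S k w ^+ 2 + 2 * (S k w * g k w * V w) + g k w ^+ 2 * V w ^+ 2).
  by apply/funext => w; rewrite SS; ring.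
have h1 := L1D IH1 (L1Z 2 SgV).
rewrite E; split; first exact: L1D.
rewrite (ExD h1 gV) (ExD IH1 (L1Z 2 SgV)) (ExZ _ SgV) e1 mulr0 addr0 e2.
rewrite big_ord_recr/= mulrDr lerD// mulrA mulrC.
apply: ler_wpM2r; last exact: increment_sqr_le (t_ge0 k) (tS k).
by apply: Ex_ge0 => //; apply: aeW => w; exact: sqr_ge0.
Qed.

End Isometry.
End Increments.

(** * Discretisation of the stochastic integral *)

Section DyadicGrid.
Context {R : realType}.
Implicit Types (m p q r k : nat) (s t u : R).

(** Dyadic grids are nested, unlike those of mesh [1/(n+1)], so schemes of different levels can be
    compared on a common refinement. *)
Definition dyadic p r : R := r%:R / (2 ^ p)%:R.
Definition mesh p : R := (2 ^ p)%:R^-1.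
Definition dyadic_floor p s : R := dyadic p (Num.truncn (s * (2 ^ p)%:R)).

Let pow_gt0 p : 0 < (2 ^ p)%:R :> R. Proof. by rewrite ltr0n expn_gt0. Qed.

Lemma mesh_gt0 p : 0 < mesh p. Proof. by rewrite invr_gt0. Qed.

Lemma dyadic_ge0 p r : 0 <= dyadic p r. Proof. by rewrite divr_ge0. Qed.

Lemma dyadic0 p : dyadic p 0 = 0. Proof. by rewrite /dyadic mul0r. Qed.

Lemma dyadicS p r : dyadic p r.+1 = dyadic p r + mesh p.
Proof. by rewrite /dyadic /mesh -natr1 mulrDl mul1r. Qed.

Lemma dyadic_lt p r r' : (dyadic p r < dyadic p r') = (r < r')%N.
Proof. by rewrite /dyadic ltr_pM2r ?invr_gt0// ltr_nat. Qed.

Lemma dyadic_le p r r' : (dyadic p r <= dyadic p r') = (r <= r')%N.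
Proof. by rewrite /dyadic ler_pM2r ?invr_gt0// ler_nat. Qed.

Lemma dyadic_refine m q k : dyadic (m + q) (k * 2 ^ q) = dyadic m k.
Proof.
rewrite /dyadic expnD !natrM invfM [RHS](_ : _ = k%:R / (2 ^ m)%:R * ((2 ^ q)%:R / (2 ^ q)%:R)).
  by ring.
by rewrite divff ?mulr1// gt_eqF.
Qed.

Lemma lt_dyadic p u r : 0 <= u -> (u < dyadic p r) = (Num.truncn (u * (2 ^ p)%:R) < r)%N.
Proof. by move=> u0; rewrite /dyadic ltr_pdivlMr// truncn_lt_nat// mulr_ge0. Qed.

Lemma dyadic_floor_itv p s : 0 <= s -> dyadic_floor p s <= s < dyadic_floor p s + mesh p.
Proof.
by move=> s0; rewrite -dyadicS lt_dyadic// ltnS leqnn andbT leNgt lt_dyadic// ltnn.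
Qed.

Lemma dyadic_floor_cell p r s : dyadic p r <= s < dyadic p r.+1 -> dyadic_floor p s = dyadic p r.
Proof.
move=> /andP[h1 h2]; have s0 : 0 <= s := le_trans (dyadic_ge0 p r) h1.
rewrite /dyadic_floor; congr dyadic; apply/eqP; rewrite eqn_leq.
rewrite -ltnS -lt_dyadic// h2/= leqNgt -lt_dyadic// -leNgt//.
Qed.

Lemma mesh_cvg0 : mesh p @[p --> \oo] --> 0.
Proof.
suff -> : mesh = fun p => 1 * 2^-1 ^+ p by apply: cvg_geometric; rewrite gtr0_norm ?invf_lt1// ltr1n.
by apply/funext => p; rewrite /mesh mul1r natrX exprVn.
Qed.

Lemma dyadic_floor_cvg s : 0 <= s -> dyadic_floor p s @[p --> \oo] --> s.
Proof.
move=> s0; have H : s - mesh p @[p --> \oo] --> s.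
  by rewrite -[X in _ --> X]subr0; apply: cvgB; [exact: cvg_cst|exact: mesh_cvg0].
apply: (squeeze_cvgr _ H (cvg_cst s)); apply: nearW => p.
have /andP[-> h] := dyadic_floor_itv p s0.
by rewrite andbT lerBlDr ltW.
Qed.

Lemma integral_dyadic_floor p N (G : R -> R -> R) :
  (forall r, measurable_fun (`[dyadic p r, dyadic p r.+1[%classic : set R) (G (dyadic p r))) ->
  measurable_fun (`[0, dyadic p N[%classic : set R) (fun s => G (dyadic_floor p s) s) /\
  (\int[lebesgue_measure]_(s in `[0%R, dyadic p N[) (G (dyadic_floor p s) s)%:E =
   \sum_(r < N) \int[lebesgue_measure]_(s in `[dyadic p r, dyadic p r.+1[) (G (dyadic p r) s)%:E)%E.
Proof.
move=> mG; elim: N => [|N [IH1 IH2]].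
  rewrite dyadic0 big_ord0 set_itvco0 integral_set0; split => //; exact: measurable_fun_set0.
have sp : `[0, dyadic p N.+1[%classic = `[0, dyadic p N[%classic `|`
   `[dyadic p N, dyadic p N.+1[%classic :> set R.
  by rewrite -itv_bndbnd_setU// bnd_simp ?dyadic_ge0// dyadic_le.
have e : {in (`[dyadic p N, dyadic p N.+1[%classic : set R), (G (dyadic p N)) =1
    (fun s => G (dyadic_floor p s) s)}.
  by move=> s /[!inE]/= h; rewrite (dyadic_floor_cell (p := p) (r := N))//; move: h; rewrite in_itv.
have m2 := eq_measurable_fun _ e (mG N).
split; first by rewrite sp; apply/measurable_funU.
rewrite sp integral_setU_EFin//; last 2 first.
- by apply/measurable_funU.
- apply/disj_setPS => s [] /=; rewrite !in_itv/= => /andP[_ h1] /andP[h2 _].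
  by have := lt_le_trans h1 h2; rewrite ltxx.
rewrite big_ord_recr/= -IH2; congr (_ + _)%E; apply: eq_integral => s hs.
by rewrite e.
Qed.

(** The sums are integrals of the step functions obtained by composing [G] with the dyadic floor.
    Besides a bound, only convergence along floors is asked of [G], because simple integrands jump
    and are merely left-continuous. *)
Lemma riemann_sum_cvg m k (G : R -> R) (C : R) :
  (forall s, 0 <= s <= dyadic m k -> `|G s| <= C) ->
  (forall s, 0 <= s -> G (dyadic_floor p s) @[p --> \oo] --> G s) ->
  exists2 I : R, (\int[lebesgue_measure]_(s in `[0%R, dyadic m k]) (G s)%:E = I%:E)%E &
    (\sum_(r < k * 2 ^ q) mesh (m + q) * G (dyadic (m + q) r)) @[q --> \oo] --> I.
Proof.
move=> GC Gc; pose D : set R := `[0, dyadic m k[%classic.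
have mD : measurable D by exact: measurable_itv.
have Dle s : D s -> 0 <= s <= dyadic m k by rewrite /D /= in_itv/= => /andP[-> /ltW].
have cell p N := @integral_dyadic_floor p N (fun a _ => G a) (fun r => @measurable_cst _ _ _ _ _ (G (dyadic p r))).
pose f_ q s := G (dyadic_floor (m + q) s).
have [mf Ef] : (forall q, measurable_fun D (f_ q)) /\
    (forall q, \int[lebesgue_measure]_(s in D) (f_ q s)%:E =
       (\sum_(r < k * 2 ^ q) mesh (m + q) * G (dyadic (m + q) r))%:E)%E.
  split=> q; have := cell (m + q)%N (k * 2 ^ q)%N; rewrite dyadic_refine => -[h1 h2] //.
  rewrite /D h2 -sumEFin; apply: eq_bigr => r _.
  rewrite integral_cst//= lebesgue_measure_itv/= lte_fin dyadic_lt ltnSn -EFinB -EFinM.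
  by rewrite dyadicS; congr (_%:E); ring.
have fG s : D s -> f_ q s @[q --> \oo] --> G s.
  move=> /Dle/andP[s0 _]; apply: (cvg_reindex (k := addn m) _ (Gc s s0)) => q.
  exact: leq_addl.
have mG : measurable_fun D G by apply: measurable_fun_cvg fG.
have C0 : 0 <= C by apply: le_trans (GC 0 _) => //; rewrite lexx dyadic_ge0.
have iC : (@lebesgue_measure R).-integrable D (fun=> C%:E).
  apply/integrableP; split; first exact: measurable_cst.
  rewrite integral_cst//= /D lebesgue_measure_itv/=; case: ifP => _; last by rewrite mule0 ltry.
  by rewrite -EFinB -EFinM ltry.
have [] := @dominated_convergence _ _ _ (@lebesgue_measure R) D mD (fun q s => (f_ q s)%:E)
  (EFin \o G) (fun=> C%:E).
- move=> q; apply/measurable_EFinP; have h := mf q. exact h.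
- apply/measurable_EFinP. exact mG.
- by apply: aeW => s Ds; apply/fine_cvgP; split; [exact: nearW|exact: fG].
- exact: iC.
- apply: aeW => s q /Dle/andP[s0 st]; rewrite lee_fin GC// dyadic_ge0/=.
  by rewrite (le_trans _ st)//; have /andP[] := dyadic_floor_itv (m + q) s0.
move=> iG _ cG.
have fin : (\int[lebesgue_measure]_(s in D) (G s)%:E)%E \is a fin_num.
  apply: integrable_fin_num; first exact: mD.
  exact iG.
exists (fine (\int[lebesgue_measure]_(s in D) (G s)%:E)%E).
  rewrite fineK//; apply/esym/integral_itv_bndo_bndc; exact/measurable_EFinP.
move: cG; under eq_fun do rewrite Ef; rewrite -(fineK fin).
by move/fine_cvgP => [].
Qed.

Lemma indic_itvoc u v y : \1_(`]u, v]%classic : set R) y = (u < y <= v)%R%:R :> R.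
Proof. by rewrite indicE mem_setE in_itv. Qed.

(** The interval is open on the left and closed on the right, so its indicator is left-continuous,
    and floors approach from below. *)
Lemma indicator_floor_cvg u v s : 0 <= u -> 0 <= s ->
  \1_(`]u, v]%classic : set R) (dyadic_floor p s) @[p --> \oo] --> (\1_(`]u, v]%classic : set R) s : R).
Proof.
move=> u0 s0; have c := dyadic_floor_cvg s0.
have le p : dyadic_floor p s <= s by have /andP[] := dyadic_floor_itv p s0.
apply: cvg_near_cst; rewrite indic_itvoc.
have [us|us] := ltP u s; last first.
  by apply: nearW => p; rewrite indic_itvoc ltNge (le_trans (le p) us).
have [sv|sv] := leP s v.
  near=> p; rewrite indic_itvoc (le_trans (le p) sv) andbT.
  suff -> : u < dyadic_floor p s by [].
  by near: p; exact: (cvgr_gt s c).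
near=> p; rewrite indic_itvoc [X in _ && X]leNgt.
suff -> : v < dyadic_floor p s by rewrite /= andbF.
by near: p; exact: (cvgr_gt s c).
Unshelve. all: by end_near. Qed.

Lemma sum_increments_from (w_ : nat -> R) a N :
  \sum_(r < N) (a <= r)%N%:R * (w_ r.+1 - w_ r) = w_ N - w_ (minn a N).
Proof.
elim: N => [|N IH]; first by rewrite big_ord0 minn0 subrr.
rewrite big_ord_recr/= IH; have [aN|Na] := leqP a N.
  by rewrite (minn_idPl (leqW aN)) /=; ring.
by rewrite (minn_idPr Na) /=; ring.
Qed.

Lemma sum_indicator_increments_cvg m k (g : R -> R) u v :
  {within `[0, +oo[, continuous g} -> 0 <= u <= v ->
  (\sum_(r < k * 2 ^ q) \1_(`]u, v]%classic : set R) (dyadic (m + q) r) *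
     (g (dyadic (m + q) r.+1) - g (dyadic (m + q) r))) @[q --> \oo] -->
  g (Num.min v (dyadic m k)) - g (Num.min u (dyadic m k)).
Proof.
move=> cg /andP[u0 uv]; have v0 := le_trans u0 uv; set t := dyadic m k.
(* The first grid index strictly beyond [y]: the indicator of []u, v]] is a difference of two
   thresholds, and each threshold sum telescopes. *)
pose a p (y : R) := (Num.truncn (y * (2 ^ p)%:R)).+1.
pose c q (y : R) := Num.min (dyadic (m + q) (a (m + q)%N y)) t.
have ind p r : \1_(`]u, v]%classic : set R) (dyadic p r) = (a p u <= r)%N%:R - (a p v <= r)%N%:R :> R.
  rewrite indic_itvoc /a -!lt_dyadic//.
  have [h|h] := leP (dyadic p r) v; rewrite ?andbT ?andbF ?subr0//.
  by rewrite (le_lt_trans uv h) subrr.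
have E q : \sum_(r < k * 2 ^ q) \1_(`]u, v]%classic : set R) (dyadic (m + q) r) *
     (g (dyadic (m + q) r.+1) - g (dyadic (m + q) r)) = g (c q v) - g (c q u).
  under eq_bigr do rewrite ind mulrBl.
  rewrite big_split/= sumrN.
  rewrite (sum_increments_from (fun r => g (dyadic (m + q) r))).
  rewrite (sum_increments_from (fun r => g (dyadic (m + q) r))).
  have mn y : dyadic (m + q) (minn (a (m + q)%N y) (k * 2 ^ q)) = c q y.
    rewrite /c /t -(dyadic_refine m q k) /Order.min dyadic_lt /minn.
    by case: ifP.
  by rewrite !mn; ring.
under eq_fun do rewrite E.
have cc y : 0 <= y -> g (c q y) @[q --> \oo] --> g (Num.min y t).
  move=> y0; apply: (path_cvg cg).
  - by move=> q; rewrite le_min !dyadic_ge0.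
  - by rewrite le_min y0 dyadic_ge0.
  have H : dyadic_floor (m + q) y + mesh (m + q) @[q --> \oo] --> y.
    rewrite -[X in _ --> X]addr0; apply: (cvg_reindex (u := fun p => dyadic_floor p y + mesh p) (k := addn m)).
      by move=> q; exact: leq_addl.
    by apply: cvgD; [exact: dyadic_floor_cvg|exact: mesh_cvg0].
  have ct : (fun z => Num.min z t) z @[z --> y] --> Num.min y t.
    exact: (continuous_min (f := id) (g := cst t) (x := y) (@cvg_id _ _) (@cvg_cst _ _ _ _ _)).
  apply: cvg_comp ct; apply: cvg_trans H; apply: near_eq_cvg; apply: nearW => q.
  by rewrite /a dyadicS.
by apply: cvgB; exact: cc.
Qed.

End DyadicGrid.

Lemma path_bounded {R : realType} (g : R -> R) (t : R) :
  {within `[0, +oo[, continuous g} -> exists2 C, 0 <= C & forall s, 0 <= s <= t -> `|g s| <= C.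
Proof.
move=> cg; have [t0|t0] := ltP t 0.
  by exists 0 => // s /andP[s0 st]; have := le_lt_trans (le_trans s0 st) t0; rewrite ltxx.
have sub : (`[0, t]%classic : set R) `<=` `[0, +oo[%classic.
  by move=> s; rewrite /= !in_itv/= => /andP[->].
have ct := continuous_subspaceW sub cg.
have [a _ ha] := EVT_max t0 ct; have [b _ hb] := EVT_min t0 ct.
exists (`|g a| + `|g b|); first by rewrite addr_ge0.
move=> s st; have {}st : s \in `[0, t] by rewrite in_itv.
have := ha _ st; have := hb _ st; have := ler_norm (g a); have := ler_norm (- g b).
rewrite normrN ler_norml => h1 h2 h3 h4; have := normr_ge0 (g a); have := normr_ge0 (g b).
by move=> p1 p2; apply/andP; split; lra.
Qed.

(** * Convergence in probability *)

Section Probabilities.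
Context {R : realType} {d : measure_display} {Omega : measurableType d}.
Variable P : probability Omega R.
Hypothesis Pc : measure_is_complete P.
Local Notation L1 := (L1 P).
Local Notation Ex := (Ex P).
Definition pr (A : set Omega) : R := fine (P A).

Lemma pr_le A B : measurable A -> measurable B -> A `<=` B -> pr A <= pr B.
Proof.
by move=> mA mB AB; rewrite fine_le ?fin_num_measure// le_measure ?inE.
Qed.

Lemma prU A B : measurable A -> measurable B -> pr (A `|` B) <= pr A + pr B.
Proof.
move=> mA mB; rewrite /pr -lee_fin EFinD !fineK ?fin_num_measure//; last exact: measurableU.
exact: measureU2.
Qed.

Lemma pr_le_U A B C : measurable A -> measurable B -> measurable C -> A `<=` B `|` C ->
  pr A <= pr B + pr C.
Proof.
by move=> mA mB mC h; apply: le_trans (prU mB mC); apply: pr_le => //; exact: measurableU.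
Qed.

Lemma pr_ae A B : measurable A -> measurable B -> {ae P, forall w, A w <-> B w} -> pr A = pr B.
Proof.
move=> mA mB AB; rewrite /pr -!Ex_ind//; apply: (Ex_eq Pc); last exact: L1_indic.
by apply: filterS AB => w h; rewrite !indicE; congr (_%:R); congr nat_of_bool; apply/idP/idP; rewrite !inE => /h.
Qed.

Lemma measurable_gt_set (V : Omega -> R) (e : R) : measurable_fun setT V ->
  measurable [set w | e < V w].
Proof.
move=> mV; have := mV measurableT _ (measurable_itv `]e, +oo[).
by rewrite setTI; congr measurable; apply/seteqP; split=> w /=; rewrite in_itv/= andbT.
Qed.

Lemma pr_cvg0 (Z : nat -> Omega -> R) (e : R) : (forall n, measurable_fun setT (Z n)) ->
  {ae P, forall w, Z n w @[n --> \oo] --> (0 : R)} -> 0 < e ->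
  \forall n \near \oo, pr [set w | e < `|Z n w|] <= e.
Proof.
move=> mZ Z0 e0; have mA n : measurable [set w | e < `|Z n w|].
  by apply: measurable_gt_set; exact: measurableT_comp.
have [] // := @Ex_dct _ _ _ P Pc (fun n => \1_[set w | e < `|Z n w|]) (fun=> 0) (fun=> 1).
- apply: filterS Z0 => w h; apply: cvg_near_cst.
  near=> n; rewrite indicE memNset//=; apply/negP; rewrite -leNgt ltW//.
  by near: n; move/cvgr0_norm_lt : h; exact.
- exact: L1_cst.
- by apply: aeW => w n; exact: indic_le1.
move=> _; rewrite Ex_cst => /cvgr0_norm_le/(_ _ e0); apply: filterS => n.
by rewrite Ex_ind//; apply: le_trans; exact: ler_norm.
Unshelve. all: by end_near. Qed.

Lemma chebyshev_sqr (V : Omega -> R) (e : R) : measurable_fun setT V ->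
  L1 (fun w => V w ^+ 2) -> 0 < e ->
  pr [set w | e < `|V w|] <= Ex (fun w => V w ^+ 2) / e ^+ 2.
Proof.
move=> mV V2 e0; have mA : measurable [set w | e < `|V w|].
  by apply: measurable_gt_set; exact: measurableT_comp.
rewrite ler_pdivlMr ?exprn_gt0// /pr -Ex_ind// mulrC -(ExZ _ (L1_indic P mA)).
apply: (Ex_le Pc) => //; last exact: (L1Z _ (L1_indic P mA)).
apply: aeW => w; rewrite indicE; have [h|h] := boolP (w \in _); last by rewrite mulr0 sqr_ge0.
move: h; rewrite inE => /= h; rewrite mulr1 -(real_normK (num_real (V w))).
by rewrite lerXn2r ?nnegrE ?(ltW e0) ?normr_ge0 ?(ltW h).
Qed.

(* A countable family of tail bounds turns smallness in probability into
   almost sure convergence along the family. *)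
Lemma cvg_of_small (Z : nat -> Omega -> R) : (forall n, measurable_fun setT (Z n)) ->
  (forall n, pr [set w | 2^-1 ^+ n < `|Z n w|] <= 2^-1 ^+ n) ->
  {ae P, forall w, Z n w @[n --> \oo] --> (0 : R)}.
Proof.
move=> mZ h; have mA n : measurable [set w | 2^-1 ^+ n < `|Z n w|].
  by apply: measurable_gt_set; exact: measurableT_comp.
have : {ae P, forall w, \forall n \near \oo, ~ [set w | 2^-1 ^+ n < `|Z n w|] w}.
  apply: borel_cantelli => // n; rewrite -[X in (X <= _)%E]fineK ?fin_num_measure// lee_fin.
  exact: h.
apply: filterS => w hw; apply/norm_cvg0P.
apply: (squeeze_cvgr _ (cvg_cst (0 : R)) (_ : 2^-1 ^+ n @[n --> \oo] --> (0 : R))).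
  by apply: filterS hw => n /negP; rewrite -leNgt normr_ge0 => ->.
by apply: cvg_expr; rewrite gtr0_norm ?invf_lt1// ltr1n.
Qed.

End Probabilities.

(** * Discrete integrals of small energy *)

Section TruncatedIsometry.
Context {R : realType} {d : measure_display} {Omega : measurableType d}.
Variables (P : probability Omega R) (F : R -> set (set Omega)) (W : R -> Omega -> R).
Hypothesis hF : complete_right_continuous_filtration P F.
Hypothesis hW : brownian_motion P F W.
Local Notation L1 := (L1 P).
Local Notation Ex := (Ex P).
Let Pc := filt_complete hF.
Variables (t_ : nat -> R) (g : nat -> Omega -> R).
Hypotheses (t0 : 0 <= t_ 0%N) (tS : forall j, t_ j < t_ j.+1).
Hypothesis ag : forall j, measurable_wrt (F (t_ j)) (g j).

Definition energy (k : nat) (w : Omega) : R := \sum_(j < k) (t_ j.+1 - t_ j) * g j w ^+ 2.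

Let t_ge0 j : 0 <= t_ j.
Proof. by elim: j => // j IH; exact: le_trans (ltW (tS j)). Qed.

Let t_mono : {homo t_ : i j / (i <= j)%N >-> i <= j}.
Proof. by apply: homo_leq => [x|y x z|j]; [exact: lexx|exact: le_trans|exact: ltW]. Qed.

Let dt_gt0 j : 0 < t_ j.+1 - t_ j. Proof. by rewrite subr_gt0. Qed.

Let term_ge0 j w : 0 <= (t_ j.+1 - t_ j) * g j w ^+ 2.
Proof. by rewrite mulr_ge0 ?sqr_ge0// ltW. Qed.

Lemma energy_mono w : {homo energy ^~ w : j k / (j <= k)%N >-> j <= k}.
Proof.
apply: homo_leq => [x|y x z|k]; [exact: lexx|exact: le_trans|].
by rewrite /energy big_ord_recr/= lerDl.
Qed.

Lemma energy_wrt j k : (k <= j.+1)%N -> measurable_wrt (F (t_ j)) (energy k).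
Proof.
move=> kj; apply: (wrt_sum (filt_sa hF (t_ge0 j))) => i _.
apply: (wrt_comp (g := fun y : R => (t_ i.+1 - t_ i) * y ^+ 2)).
  by apply: measurable_funM => //; exact: measurable_funX.
move=> B mB; apply: (filt_mono hF (t_ge0 i) (t_mono _)); last exact: ag.
by rewrite -ltnS (leq_trans (ltn_ord i)).
Qed.

Lemma energy_meas k : measurable_fun setT (energy k).
Proof. exact: (measurable_wrt_meas (filt_meas hF (t_ge0 k)) (energy_wrt (leqnSn k))). Qed.

(** The integrand is cut off once its energy would exceed [c]. The cut integrand has energy at most
    [c], so the isometry and Chebyshev's inequality give [8 c / e^2], and it differs from the
    original only where the total energy exceeds [c]. *)
Lemma discrete_integral_small k c e : 0 < c -> 0 < e ->
  pr P [set w | e < `|discrete_integral W t_ g k w|] <=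
  pr P [set w | c < energy k w] + 8 * c / e ^+ 2.
Proof.
(* [energy j.+1] involves the integrand up to index [j] only and is known at time [t_ j], so the cut
   is adapted; it also bounds [g' j]. *)
move=> c0 e0; pose g' j w := (energy j.+1 w <= c)%R%:R * g j w.
have ag' j : measurable_wrt (F (t_ j)) (g' j).
  have sF := filt_sa hF (t_ge0 j); apply: (wrtM sF) => //.
  rewrite -(_ : \1_[set w | energy j.+1 w <= c] = fun w => (energy j.+1 w <= c)%R%:R).
    apply: (wrt_indic sF).
    have := energy_wrt (leqnn j.+1) (measurable_itv `]-oo, c]).
    by congr (F _ _); apply/seteqP; split => w /=; rewrite in_itv.
  by apply/funext => w; exact: indic_bool.
pose M j := Num.sqrt (c / (t_ j.+1 - t_ j)).
have g'M j w : `|g' j w| <= M j.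
  rewrite /g' /M; have [h|h] := leP (energy j.+1 w) c; last by rewrite mul0r normr0 sqrtr_ge0.
  rewrite mul1r -(ler_pXn2r (n := 2))// ?nnegrE// ?sqrtr_ge0//.
  have cd : 0 <= c / (t_ j.+1 - t_ j) by rewrite divr_ge0// ltW.
  rewrite (sqr_sqrtr cd) real_normK ?num_real// ler_pdivlMr// mulrC.
  apply: le_trans h; rewrite /energy big_ord_recr/= lerDr sumr_ge0//.
have sm k' w : \sum_(j < k') (t_ j.+1 - t_ j) * g' j w ^+ 2 <= Num.min (energy k' w) c.
  elim: k' => [|k' IH]; first by rewrite big_ord0 le_min (ltW c0) andbT /energy big_ord0.
  rewrite big_ord_recr/= /g'; have [h|h] := leP (energy k'.+1 w) c.
    rewrite mul1r [leRHS]/energy big_ord_recr/= lerD2r (le_trans IH)//.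
    by rewrite ge_min lexx.
  rewrite mul0r expr2 mul0r mulr0 addr0.
  by rewrite (le_trans IH)// ge_min lexx orbT.
have iso := discrete_isometry hF hW t0 tS ag' g'M k; case: iso => V2 V2le.
have mV := discrete_integral_wrt hF hW t0 tS ag' k.
have {}mV := measurable_wrt_meas (filt_meas hF (t_ge0 k)) mV.
have mV0 := discrete_integral_wrt hF hW t0 tS ag k.
have {}mV0 := measurable_wrt_meas (filt_meas hF (t_ge0 k)) mV0.
have L j : L1 (fun w => g' j w ^+ 2).
  have mg' := measurable_wrt_meas (filt_meas hF (t_ge0 j)) (ag' j).
  apply: (L1_bnd P (M := M j ^+ 2)); first exact: measurable_funX.
  by move=> w; rewrite normrX lerXn2r ?nnegrE ?sqrtr_ge0.
have E8 : Ex (fun w => discrete_integral W t_ g' k w ^+ 2) <= 8 * c.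
  apply: (le_trans V2le); rewrite ler_pM2l//.
  under eq_bigr do rewrite -(ExZ _ (L _)).
  rewrite -Ex_sum; last by move=> j _; exact: L1Z.
  rewrite -[leRHS](Ex_cst P); apply: (Ex_le Pc); last exact: L1_cst.
    by apply: aeW => w; rewrite (le_trans (sm _ _))// ge_min lexx orbT.
  by apply: L1_sum => j _; exact: L1Z.
have h := chebyshev_sqr Pc mV V2 e0.
apply: (@le_trans _ _ (pr P [set w | c < energy k w] +
    pr P [set w | e < `|discrete_integral W t_ g' k w|])).
  apply: pr_le_U.
  - by apply: measurable_gt_set; exact: measurableT_comp.
  - by apply: measurable_gt_set; exact: energy_meas.
  - by apply: measurable_gt_set; exact: measurableT_comp.
  move=> w /= ew; have [Ec|Ec] := ltP c (energy k w); [by left|right].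
  rewrite (_ : discrete_integral W t_ g' k w = discrete_integral W t_ g k w)//.
  apply: eq_bigr => j _; rewrite /g' (le_trans _ Ec) ?mul1r//.
  exact: (energy_mono w (ltn_ord j)).
rewrite lerD2l (le_trans h)// ler_pM2r// invr_gt0 exprn_gt0//.
Qed.

End TruncatedIsometry.

Lemma cvg_sum_ord {R : realType} (n : nat) (f : 'I_n -> nat -> R) (l : 'I_n -> R) :
  (forall j, f j q @[q --> \oo] --> l j) ->
  \sum_(j < n) f j q @[q --> \oo] --> \sum_(j < n) l j.
Proof.
elim: n f l => [|n IH] f l fl.
  by under eq_fun do rewrite big_ord0; rewrite big_ord0; exact: cvg_cst.
under eq_fun do rewrite big_ord_recr/=; rewrite big_ord_recr/=.
by apply: cvgD; [apply: IH => j; exact: fl|exact: fl].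
Qed.

Section SimpleIntegrands.
Context {R : realType} {d : measure_display} {Omega : measurableType d}.
Variables (P : probability Omega R) (F : R -> set (set Omega)) (W : R -> Omega -> R).
Hypothesis hF : complete_right_continuous_filtration P F.
Hypothesis cW : continuous_paths W.
Variable h : @simple_integrand R d Omega.
Hypothesis hs : is_simple_integrand F h.

Lemma simple_value_wrt u : 0 <= u -> measurable_wrt (F u) (simple_value h u).
Proof.
move=> u0; have [tt ac _] := hs; have sF := filt_sa hF u0; apply: (wrt_sum sF) => j _.
have [/andP[t0 _]] := (tt j); have [tu|ut] := ltP (simple_time h j) u.
  by apply: (wrtM sF); [move=> B mB; apply: (filt_mono hF t0 (ltW tu)); exact: ac|exact: wrt_cst].
rewrite (_ : (fun w => _) = fun=> 0); first exact: (wrt_cst sF).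
by apply/funext => w; rewrite indic_itvoc ltNge ut mulr0.
Qed.

Lemma simple_value_bound : exists C, forall u w, `|simple_value h u w| <= C.
Proof.
have [_ _ bc] := hs; have [M hM] := choice bc.
exists (\sum_(j < simple_size h) M j) => u w; rewrite (le_trans (ler_norm_sum _ _ _))//.
apply: ler_sum => j _; rewrite normrM indic_itvoc -[leRHS]mulr1 ler_pM//.
by case: (_ < _ <= _)%R; rewrite ?normr1 ?normr0.
Qed.

Lemma simple_value_floor_cvg s w : 0 <= s ->
  simple_value h (dyadic_floor p s) w @[p --> \oo] --> simple_value h s w.
Proof.
move=> s0; have [tt _ _] := hs; apply: cvg_sum_ord => j; apply: cvgM; first exact: cvg_cst.
by apply: indicator_floor_cvg => //; have /andP[] := tt j.
Qed.

Lemma simple_integral_grid_cvg m k w :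
  discrete_integral W (dyadic (m + q)) (fun r => simple_value h (dyadic (m + q) r)) (k * 2 ^ q) w
    @[q --> \oo] --> simple_integral W h (dyadic m k) w.
Proof.
have [tt _ _] := hs.
have E q : discrete_integral W (dyadic (m + q)) (fun r => simple_value h (dyadic (m + q) r))
    (k * 2 ^ q) w = \sum_(j < simple_size h) simple_coef h j w *
    \sum_(r < k * 2 ^ q) \1_(`]simple_time h j, simple_time h j.+1]%classic : set R)
       (dyadic (m + q) r) * (W (dyadic (m + q) r.+1) w - W (dyadic (m + q) r) w).
  rewrite /discrete_integral /simple_value.
  under eq_bigr do rewrite mulr_suml.
  rewrite exchange_big; apply: eq_bigr => j _; rewrite mulr_sumr.
  by apply: eq_bigr => r _; rewrite mulrA.
under eq_fun do rewrite E.
apply: cvg_sum_ord => j; apply: cvgM; first exact: cvg_cst.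
by apply: (sum_indicator_increments_cvg (g := W ^~ w)) => //; exact: cW.
Qed.

End SimpleIntegrands.

(** * Euler sums approximate the solution *)

Section Discretisation.
Context {R : realType} {d : measure_display} {Omega : measurableType d}.
Variables (P : probability Omega R) (F : R -> set (set Omega)) (W : R -> Omega -> R).
Hypothesis hF : complete_right_continuous_filtration P F.
Hypothesis hW : brownian_motion P F W.
Local Notation L1 := (L1 P).
Local Notation Ex := (Ex P).
Let Pc := filt_complete hF.
Variables (b s : R -> R) (K x : R) (Z : R -> Omega -> R).
Hypotheses (aZ : adapted F Z) (cZ : continuous_paths Z).
Hypothesis lip : forall y z, `|b y - b z| + `|s y - s z| <= K * `|y - z|.

Lemma lip_b y z : `|b y - b z| <= K * `|y - z|.
Proof. by apply: le_trans (lip y z); rewrite lerDl. Qed.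

Lemma lip_s y z : `|s y - s z| <= K * `|y - z|.
Proof. by apply: le_trans (lip y z); rewrite lerDr. Qed.

Lemma lip_cvg (c : R -> R) (T : Type) (G : set_system T) (FG : Filter G) (u_ : T -> R) u :
  (forall y z, `|c y - c z| <= K * `|y - z|) ->
  u_ n @[n --> G] --> u -> c (u_ n) @[n --> G] --> c u.
Proof.
move=> lc uu; apply/subr_cvg0/norm_cvg0P.
have h : K * `|u_ n - u| @[n --> G] --> 0.
  rewrite -[X in _ --> X](mulr0 K); apply: cvgM; first exact: cvg_cst.
  by apply/norm_cvg0P/subr_cvg0.
by apply: (squeeze_cvgr _ (cvg_cst 0) h); apply: nearW => n; rewrite normr_ge0 lc.
Qed.

Lemma lip_measurable (c : R -> R) : (forall y z, `|c y - c z| <= K * `|y - z|) ->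
  measurable_fun setT c.
Proof.
by move=> lc; apply: continuous_measurable_fun => y; apply: lip_cvg => //; exact: cvg_id.
Qed.

Lemma lip_bounded_path (c : R -> R) t w : (forall y z, `|c y - c z| <= K * `|y - z|) ->
  exists C, forall u, 0 <= u <= t -> `|c (Z u w)| <= C.
Proof.
move=> lc; have [C C0 hC] := path_bounded t (@cZ w).
exists (`|K| * C + `|c 0|) => u ut; rewrite -[c (Z u w)](subrK (c 0)).
rewrite (le_trans (ler_normD _ _))// lerD2r (le_trans (lc _ _))// subr0.
by rewrite (le_trans (ler_norm _))// normrM normr_id ler_wpM2l// hC.
Qed.

Lemma lip_floor_cvg (c : R -> R) u w : (forall y z, `|c y - c z| <= K * `|y - z|) -> 0 <= u ->
  c (Z (dyadic_floor p u) w) @[p --> \oo] --> c (Z u w).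
Proof.
move=> lc u0; apply: lip_cvg => //; apply: (path_cvg (@cZ w)) => //.
  by move=> p; exact: dyadic_ge0.
exact: dyadic_floor_cvg.
Qed.

Lemma lip_wrt (c : R -> R) u : (forall y z, `|c y - c z| <= K * `|y - z|) -> 0 <= u ->
  measurable_wrt (F u) (fun w => c (Z u w)).
Proof. by move=> lc u0; apply: (wrt_comp (g := c)); [exact: lip_measurable|exact: aZ]. Qed.

Hypothesis sol : forall t : R, 0 <= t -> exists I : Omega -> R,
  is_ito_integral P F W (fun u w => s (Z u w)) t I /\
  {ae P, forall w, Z t w = x + \int[lebesgue_measure]_(u in `[0, t]) b (Z u w) + I w}.

Definition diffusion_coef (m : nat) (r : nat) (w : Omega) : R := s (Z (dyadic m r) w).

Definition drift_sum (m k : nat) (w : Omega) : R :=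
  \sum_(r < k) mesh m * b (Z (dyadic m r) w).

Definition euler_sum (m k : nat) (w : Omega) : R :=
  drift_sum m k w + discrete_integral W (dyadic m) (diffusion_coef m) k w.

(** The Ito integral is known only through some simple integrand [H] close to [s (Z u w)] in energy.
    On a fine grid the stochastic part of the Euler sum differs from the discrete integral of [H] by
    a discrete integral of small energy, while the latter converges pathwise to the simple integral
    of [H]. *)
Lemma euler_sum_small m k (e : R) : 0 < e -> exists q,
  pr P [set w | e < `|Z (dyadic m k) w - (x + euler_sum (m + q) (k * 2 ^ q) w)|] <= e.
Proof.
move=> e0; pose t : R := dyadic m k; have t0 : 0 <= t := dyadic_ge0 m k.
have [I [[_ [h [hs h1 h2]]] ZI]] := sol t0.
have d0 p : 0 <= dyadic p 0 :> R by exact: dyadic_ge0.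
have dS p j : dyadic p j < dyadic p j.+1 :> R by rewrite dyadic_lt.
(* Five events cost [eta] each in probability, and the cut-off estimate with energy [2 eta] and
   level [e / 2] costs [64 eta / e^2]. Three errors of size [eta] and one of size [e / 2] must stay
   within [e], whence [eta <= e / 6]. *)
pose c := 5 + 64 / e ^+ 2.
have c0 : 0 < c by rewrite addr_gt0// divr_gt0// exprn_gt0.
pose eta := Num.min (e / 6) (e / c).
have eta0 : 0 < eta by rewrite lt_min !divr_gt0.
have eta1 : 6 * eta <= e by rewrite -ler_pdivlMl// mulrC ge_min lexx.
have eta2 : c * eta <= e by rewrite -ler_pdivlMl// mulrC ge_min lexx orbT.
have [n [n1 n2]] : exists n, pr P [set w | (eta%:E < \int[lebesgue_measure]_(u in `[0%R, t])
      (`|simple_value (h n) u w - s (Z u w)| ^+ 2)%:E)%E] <= eta /\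
    pr P [set w | eta < `|simple_integral W (h n) t w - I w|] <= eta.
  have g1 := h1 _ eta0; have g2 := h2 _ eta0.
  move/fine_cvgP : g1 => [_ /cvgr0_norm_le/(_ _ eta0) g1].
  move/fine_cvgP : g2 => [_ /cvgr0_norm_le/(_ _ eta0) g2].
  have [n [p1 p2]] := filter_ex (filterI g1 g2); exists n.
  by split; [exact: le_trans (ler_norm _) p1|exact: le_trans (ler_norm _) p2].
set H := h n in n1 n2; have sH : is_simple_integrand F H := hs n.
have cW : continuous_paths W by case: hW.
pose G w u := (simple_value H u w - s (Z u w)) ^+ 2.
have AE w : exists y : R,
    (\int[lebesgue_measure]_(u in `[0%R, t]) (G w u)%:E = y%:E)%E /\
    (\sum_(r < k * 2 ^ q) mesh (m + q) * G w (dyadic (m + q) r)) @[q --> \oo] --> y.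
  have [C1 hC1] := simple_value_bound sH.
  have [C2 hC2] := lip_bounded_path t w lip_s.
  have [||J h3 h4] := @riemann_sum_cvg _ m k (G w) ((C1 + C2) ^+ 2).
  - move=> u ut; rewrite normrX lerXn2r ?nnegrE//.
      by rewrite (le_trans (normr_ge0 (simple_value H u w + s (Z u w))))// (le_trans (ler_normD _ _))// lerD// hC2.
    by rewrite (le_trans (ler_normB _ _))// lerD// hC2.
  - move=> u u0; have cc : simple_value H (dyadic_floor p u) w - s (Z (dyadic_floor p u) w)
        @[p --> \oo] --> simple_value H u w - s (Z u w).
      apply: cvgB; first exact: (simple_value_floor_cvg sH).
      exact: (@lip_floor_cvg s u w lip_s u0).
    by rewrite /G expr2; under eq_fun do rewrite expr2; exact: cvgM.
  by exists J.
have {AE} [A Ah] := choice AE.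
have BE w : exists y : R,
    (\int[lebesgue_measure]_(u in `[0%R, t]) (b (Z u w))%:E = y%:E)%E /\
    drift_sum (m + q) (k * 2 ^ q) w @[q --> \oo] --> y.
  have [C hC] := lip_bounded_path t w lip_b.
  have [||J h3 h4] := @riemann_sum_cvg _ m k (fun u => b (Z u w)) C.
  - by move=> u ut; exact: hC.
  - by move=> u u0; apply: lip_floor_cvg => //; exact: lip_b.
  by exists J.
have {BE} [B Bh] := choice BE.
have fm u (V : Omega -> R) : 0 <= u -> measurable_wrt (F u) V -> measurable_fun setT V.
  by move=> u0 hV; exact: (measurable_wrt_meas (filt_meas hF u0) hV).
have Zm u : 0 <= u -> measurable_fun setT (Z u) by move=> u0; exact: (fm u _ u0 (aZ u0)).
pose g p r w := simple_value H (dyadic p r) w - diffusion_coef p r w.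
have ag p r : measurable_wrt (F (dyadic p r)) (g p r).
  have u0 : 0 <= dyadic p r :> R := dyadic_ge0 p r.
  exact: (wrtB (filt_sa hF u0) (simple_value_wrt hF sH u0) (lip_wrt lip_s u0)).
have asv p r : measurable_wrt (F (dyadic p r)) (simple_value H (dyadic p r)).
  exact: (simple_value_wrt hF sH (dyadic_ge0 p r)).
pose kq q := (k * 2 ^ q)%N.
pose N q := energy (dyadic (m + q)) (g (m + q)%N) (kq q).
have NE q w : N q w = \sum_(r < kq q) mesh (m + q) * G w (dyadic (m + q) r).
  by apply: eq_bigr => r _; rewrite dyadicS addrC addKr.
have mN q : measurable_fun setT (N q) by exact: (energy_meas hF (d0 _) (dS _) (ag _)).
have mA : measurable_fun setT A.
  apply: (ae_cvg_meas Pc mN); apply: aeW => w; have [_] := Ah w.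
  by under eq_fun do rewrite -NE.
have mD q : measurable_fun setT (drift_sum (m + q) (kq q)).
  apply: measurable_sum => r; apply: measurable_funM => //.
  by apply: (measurableT_comp (lip_measurable lip_b)); exact: Zm (dyadic_ge0 _ _).
have mB : measurable_fun setT B.
  by apply: (ae_cvg_meas Pc mD); apply: aeW => w; have [_] := Bh w.
pose J q := discrete_integral W (dyadic (m + q)) (fun r => simple_value H (dyadic (m + q) r)) (kq q).
have mJ q : measurable_fun setT (J q).
  exact: fm (dyadic_ge0 _ _) (discrete_integral_wrt hF hW (d0 _) (dS _) (asv _) _).
have J_cvg w : J q w @[q --> \oo] --> simple_integral W H t w.
  exact: (simple_integral_grid_cvg cW sH).
have mHW : measurable_fun setT (simple_integral W H t).
  by apply: (ae_cvg_meas Pc mJ); apply: aeW.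
have mI : measurable_fun setT I.
  apply: (ae_meas Pc (f := fun w => Z t w - x - B w)).
    apply: filterS ZI => w ->; have [hB _] := Bh w.
    by rewrite /Rintegral hB /=; ring.
  by apply: measurable_funB => //; apply: measurable_funB => //; exact: Zm.
have mS q : measurable_fun setT (euler_sum (m + q) (kq q)).
  apply: measurable_funD => //.
  apply: fm (dyadic_ge0 _ _) (discrete_integral_wrt hF hW (d0 _) (dS _) _ _) => j.
  exact: lip_wrt lip_s (dyadic_ge0 _ _).
have [q [q1 q2 q3]] : exists q, [/\ pr P [set w | eta < `|N q w - A w|] <= eta,
    pr P [set w | eta < `|J q w - simple_integral W H t w|] <= eta
  & pr P [set w | eta < `|drift_sum (m + q) (kq q) w - B w|] <= eta].
  have c1 : \forall q \near \oo, pr P [set w | eta < `|N q w - A w|] <= eta.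
    apply: (pr_cvg0 Pc (Z := fun q w => N q w - A w)) => //; first by move=> q; exact: measurable_funB.
    apply: aeW => w; apply/subr_cvg0; have [_] := Ah w.
    by under eq_fun do rewrite -NE.
  have c2 : \forall q \near \oo, pr P [set w | eta < `|J q w - simple_integral W H t w|] <= eta.
    apply: (pr_cvg0 Pc (Z := fun q w => J q w - simple_integral W H t w)) => //; first by move=> q; exact: measurable_funB.
    by apply: aeW => w; apply/subr_cvg0.
  have c3 : \forall q \near \oo, pr P [set w | eta < `|drift_sum (m + q) (kq q) w - B w|] <= eta.
    apply: (pr_cvg0 Pc (Z := fun q w => drift_sum (m + q) (kq q) w - B w)) => //; first by move=> q; exact: measurable_funB.
    by apply: aeW => w; apply/subr_cvg0; have [_] := Bh w.
  by have [q [p1 [p2 p3]]] := filter_ex (filterI c1 (filterI c2 c3)); exists q.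
exists q.
have e2 : 0 < e / 2 by rewrite divr_gt0.
have small := discrete_integral_small hF hW (d0 _) (dS (m + q)%N) (ag (m + q)%N) (kq q)
  (mulr_gt0 (ltr0n R 2) eta0) e2.
set D := discrete_integral _ _ _ _ in small.
have mDD : measurable_fun setT D.
  exact: fm (dyadic_ge0 _ _) (discrete_integral_wrt hF hW (d0 _) (dS _) (ag _) _).
have DE w : D w = J q w - discrete_integral W (dyadic (m + q)) (diffusion_coef (m + q)) (kq q) w.
  rewrite /D /J /discrete_integral -sumrB; apply: eq_bigr => j _; rewrite /g; ring.
have gt1 (V : Omega -> R) y : measurable_fun setT V -> measurable [set w | y < `|V w|].
  by move=> mV; apply: measurable_gt_set; exact: measurableT_comp.
have mA1 : measurable [set w | eta < A w] by exact: measurable_gt_set.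
have mA2 : measurable [set w | eta < `|N q w - A w|] by apply: gt1; exact: measurable_funB.
have mA3 : measurable [set w | eta < `|simple_integral W H t w - I w|].
  by apply: gt1; exact: measurable_funB.
have mA4 : measurable [set w | eta < `|J q w - simple_integral W H t w|].
  by apply: gt1; exact: measurable_funB.
have mA5 : measurable [set w | eta < `|drift_sum (m + q) (kq q) w - B w|].
  by apply: gt1; exact: measurable_funB.
have mA6 : measurable [set w | e / 2 < `|D w|] by exact: gt1.
have mA7 : measurable [set w | 2 * eta < N q w] by exact: measurable_gt_set.
have pA1 : pr P [set w | eta < A w] <= eta.
  apply: le_trans n1; rewrite le_eqVlt; apply/orP; left; apply/eqP; congr (pr P).
  apply/seteqP; split => w /=; have [hA _] := Ah w.
    by under eq_integral do rewrite real_normK ?num_real//; rewrite hA lte_fin.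
  by under eq_integral do rewrite real_normK ?num_real//; rewrite hA lte_fin.
have pA7 : pr P [set w | 2 * eta < N q w] <= eta + eta.
  apply: (le_trans (pr_le_U P mA7 mA1 mA2 _)); last exact: lerD.
  move=> w /= h7; have [hA|hA] := ltP eta (A w); [by left|right].
  by rewrite (lt_le_trans _ (ler_norm _))//; lra.
(* This version of [I] makes the decomposition of the error an identity at every [w]. *)
pose I' w := Z t w - x - B w.
have II' : {ae P, forall w, I' w = I w}.
  apply: filterS ZI => w zi; have [hB _] := Bh w.
  by rewrite /I' zi /Rintegral hB /=; ring.
have mI' : measurable_fun setT I'.
  by apply: measurable_funB => //; apply: measurable_funB => //; exact: Zm.
have mA3' : measurable [set w | eta < `|simple_integral W H t w - I' w|].
  by apply: gt1; exact: measurable_funB.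
have pA3 : pr P [set w | eta < `|simple_integral W H t w - I' w|] <= eta.
  apply: le_trans n2; rewrite le_eqVlt; apply/orP; left; apply/eqP.
  by apply: pr_ae => //; apply: filterS II' => w /= ->.
pose T w := Z (dyadic m k) w - (x + euler_sum (m + q) (k * 2 ^ q) w).
have TE w : T w = - (drift_sum (m + q) (kq q) w - B w) - (simple_integral W H t w - I' w)
    - (J q w - simple_integral W H t w) + D w.
  by rewrite DE /T /I' /euler_sum -/(kq q) -/t; ring.
have mT : measurable_fun setT T.
  by apply: measurable_funB; [exact: Zm|apply: measurable_funD].
have mAT := gt1 T e mT.
have m46 := measurableU _ _ mA4 mA6; have m346 := measurableU _ _ mA3' m46.
apply: (le_trans (pr_le_U P mAT mA5 m346 _)).
  move=> w; rewrite /= TE => hT.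
  have [|h5] := ltP eta `|drift_sum (m + q) (kq q) w - B w|; first by left.
  have [|h3] := ltP eta `|simple_integral W H t w - I' w|; first by right; left.
  have [|h4] := ltP eta `|J q w - simple_integral W H t w|; first by right; right; left.
  right; right; right => /=; move: hT h5 h3 h4 eta1; clear.
  set a1 := drift_sum _ _ _ - _; set a2 := simple_integral _ _ _ _ - _; set a3 := J _ _ - _.
  rewrite !ler_norml => hT /andP[p1 p2] /andP[p3 p4] /andP[p5 p6] p7.
  have : `|- a1 - a2 - a3 + D w| <= `|a1| + `|a2| + `|a3| + `|D w|.
    rewrite -(normrN a1) (le_trans (ler_normD _ _))// lerD2r (le_trans (ler_normB _ _))// lerD2r.
    exact: ler_normB.
  have n1 : `|a1| <= eta by rewrite ler_norml p1.
  have n2 : `|a2| <= eta by rewrite ler_norml p3.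
  have n3 : `|a3| <= eta by rewrite ler_norml p5.
  move: hT n1 n2 n3 p7; clear; set b1 := `|a1|; set b2 := `|a2|; set b3 := `|a3|; set b4 := `|D w|.
  by set b5 := `|_|; lra.
have p46 := prU P mA4 mA6; have p346 := prU P mA3' m46.
rewrite (le_trans _ eta2)//.
have e8 : 8 * (2 * eta) / (e / 2) ^+ 2 = 64 / e ^+ 2 * eta by field; rewrite gt_eqF.
rewrite e8 in small; rewrite /c mulrDl.
by move: q2 q3 pA3 pA7 small p46 p346; clear; lra.
Qed.

End Discretisation.

(** * The sigma-algebra of the Brownian path *)

Section MeanZeroOnSigmaAlgebra.
Context {R : realType} {d : measure_display} {Omega : measurableType d}.
Variable P : probability Omega R.
Hypothesis Pc : measure_is_complete P.
Local Notation L1 := (L1 P).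
Local Notation Ex := (Ex P).

(** The events on which [h] has mean zero form a Dynkin system, and [G] is closed under
    intersections, so the pi-lambda theorem applies. *)
Lemma Ex_indic_eq0_g_sigma (G : set (set Omega)) (h : Omega -> R) :
  setI_closed G -> G setT -> G `<=` measurable -> L1 h ->
  (forall A, G A -> Ex (fun w => \1_A w * h w) = 0) ->
  forall A, <<s G >> A -> Ex (fun w => \1_A w * h w) = 0.
Proof.
move=> GI GT Gm hh G0.
pose D := [set A : set Omega | measurable A /\ Ex (fun w => \1_A w * h w) = 0].
have E0 : Ex h = 0.
  by have := G0 _ GT; congr (_ = _); congr Ex; apply/funext => w; rewrite indicT mul1r.
have dD : dynkin D.
  split; first by split; [exact: measurableT|exact: G0].
    move=> A [mA A0]; split; first exact: measurableC.
    rewrite (_ : (fun w => _) = fun w => h w - \1_A w * h w); last first.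
      by apply/funext => w; rewrite indicC; ring.
    by rewrite (ExB hh (L1M_ind mA hh)) E0 A0 subrr.
  move=> A tA DA; have mA n : measurable (A n) by case: (DA n).
  have mU : measurable (\bigcup_n A n) by exact: bigcup_measurable.
  split => //; pose S n := \big[setU/set0]_(k < n) A k.
  have mS n : measurable (S n) by exact: bigsetU_measurable.
  have S0 n : Ex (fun w => \1_(S n) w * h w) = 0.
    rewrite (_ : (fun w => _) = fun w => \sum_(k < n) \1_(A k) w * h w).
      rewrite Ex_sum; last by move=> k _; exact: L1M_ind.
      by rewrite big1// => k _; case: (DA k).
    apply/funext => w; rewrite -mulr_suml; congr (_ * _); rewrite /S.
    elim: n => [|n IH]; first by rewrite !big_ord0 indicE in_set0.
    rewrite !big_ord_recr/= -IH; have dj : (\big[setU/set0]_(k < n) A k) `&` A n = set0.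
      rewrite -bigcup_mkord -subset0 => v [[k /= kn Akv] Anv].
      have kn' : k != n by rewrite neq_ltn kn.
      move/trivIsetP : tA => /(_ k n I I kn'); rewrite -subset0 => /(_ v); exact.
    rewrite !indicE in_setU; have [wX|wX] := boolP (w \in \big[setU/set0]_(k < n) A k); last by rewrite add0r.
    have [wA|wA] := boolP (w \in A n); last by rewrite addr0.
    by move: wX wA; rewrite !inE => wX wA; have : (set0 : set Omega) w by rewrite -dj.
  have [] := @Ex_dct _ _ _ P Pc (fun n w => \1_(S n) w * h w) (fun w => \1_(\bigcup_n A n) w * h w)
    (fun w => `|h w|).
  - by move=> n; exact: (L1_meas (L1M_ind (mS n) hh)).
  - apply: aeW => w; apply: cvgM; last exact: cvg_cst.
    apply: cvg_near_cst; have [[k _ Akw]|nA] := pselect ((\bigcup_n A n) w).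
      have Uw : (\bigcup_n A n) w by exists k.
      near=> n; rewrite !indicE (mem_set Uw); congr (_%:R); congr nat_of_bool; apply/mem_set.
      rewrite /S -bigcup_mkord; exists k => //=.
      by near: n; exact: nbhs_infty_gt.
    apply: nearW => n; rewrite !indicE (memNset nA) memNset// /S -bigcup_mkord => -[k _ Akw].
    by apply: nA; exists k.
  - exact: L1_norm.
  - by apply: aeW => w n; rewrite normrM ler_piMl// indic_le1.
  move=> _; under eq_fun do rewrite S0; move=> c.
  by rewrite -(cvg_lim (@Rhausdorff R) c) lim_cst.
rewrite -(setI_closed_g_dynkin_g_sigma_algebra GI) => A sA.
have : D A by apply: sA; split => // B GB; split; [exact: Gm|exact: G0].
by case.
Unshelve. all: by end_near. Qed.

End MeanZeroOnSigmaAlgebra.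

Section WienerAlgebra.
Context {R : realType} {d : measure_display} {Omega : measurableType d}.
Variables (P : probability Omega R) (F : R -> set (set Omega)) (W : R -> Omega -> R).
Hypothesis hF : complete_right_continuous_filtration P F.
Hypothesis hW : brownian_motion P F W.
Local Notation L1 := (L1 P).
Local Notation Ex := (Ex P).
Let Pc := filt_complete hF.

(** [W 0] vanishes only almost surely; subtracting it makes the walk start at 0 everywhere, so that
    the past at time 0 is trivial up to null events. *)
Definition walk (m i : nat) (w : Omega) : R := W (dyadic m i) w - W 0 w.

(* The past of the Brownian motion at time [dyadic m j], observed on the grid of level [m]. *)
Definition grid_past (m j : nat) : set (set Omega) :=
  <<s [set A | P.-negligible A \/
       exists i B, [/\ (i <= j)%N, measurable B & A = walk m i @^-1` B]] >>.

Definition wiener_algebra : set (set Omega) :=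
  <<s [set A | exists m j, grid_past m j A] >>.

Let d0 m i : 0 <= dyadic m i :> R. Proof. exact: dyadic_ge0. Qed.

Lemma grid_past_sa m j : sigma_algebra setT (grid_past m j).
Proof. exact: smallest_sigma_algebra. Qed.

Lemma wiener_sa : sigma_algebra setT wiener_algebra.
Proof. exact: smallest_sigma_algebra. Qed.

Lemma walk_wrt m i j : (i <= j)%N -> measurable_wrt (grid_past m j) (walk m i).
Proof. by move=> ij B mB; apply: sub_gen_smallest; right; exists i, B. Qed.

Lemma grid_past_min m j (M : set (set Omega)) : sigma_algebra setT M ->
  (forall N, P.-negligible N -> M N) ->
  (forall i, (i <= j)%N -> measurable_wrt M (walk m i)) -> grid_past m j `<=` M.
Proof.
by move=> sM nM wM; apply: smallest_sub => // _ [/nM//|[i [B [ij mB ->]]]]; exact: wM.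
Qed.

Lemma grid_past_null m j N : P.-negligible N -> grid_past m j N.
Proof. by move=> nN; apply: sub_gen_smallest; left. Qed.

Lemma grid_past_filt m j : grid_past m j `<=` F (dyadic m j).
Proof.
have [aW _ _ _ _] := hW; have sF := filt_sa hF (d0 m j).
have sub u : 0 <= u -> u <= dyadic m j -> measurable_wrt (F (dyadic m j)) (W u).
  by move=> u0 uj B mB; apply: (filt_mono hF u0 uj); exact: aW.
apply: grid_past_min => // [N nN|i ij].
  by apply: (filt_mono hF (lexx 0) (d0 m j)); exact: (filt_null hF nN).
by apply: (wrtB sF); apply: sub => //; rewrite dyadic_le.
Qed.

Lemma grid_past_mono m i j : (i <= j)%N -> grid_past m i `<=` grid_past m j.
Proof.
move=> ij; apply: grid_past_min; [exact: grid_past_sa|exact: grid_past_null|].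
by move=> k ki; apply: walk_wrt; exact: leq_trans ij.
Qed.

Lemma grid_past_refine m q j : grid_past m j `<=` grid_past (m + q) (j * 2 ^ q).
Proof.
apply: grid_past_min; [exact: grid_past_sa|exact: grid_past_null|move=> k kj].
by rewrite /walk -(dyadic_refine m q k); apply: walk_wrt; rewrite leq_mul2r kj orbT.
Qed.

Lemma grid_past_wiener m j : grid_past m j `<=` wiener_algebra.
Proof. by move=> A hA; apply: sub_gen_smallest; exists m, j. Qed.

Lemma wiener_meas : wiener_algebra `<=` measurable.
Proof.
apply: smallest_sub; first exact: sigma_algebra_measurable.
by move=> A [m [j /grid_past_filt]]; exact: (filt_meas hF (d0 m j)).
Qed.

Lemma wiener_null N : P.-negligible N -> wiener_algebra N.
Proof. by move=> nN; apply: (@grid_past_wiener 0 0); exact: grid_past_null. Qed.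

Lemma increment_wiener m i :
  measurable_wrt wiener_algebra (fun w => W (dyadic m i.+1) w - W (dyadic m i) w).
Proof.
have wk k : measurable_wrt wiener_algebra (walk m k).
  by move=> B mB; apply: (@grid_past_wiener m k); exact: walk_wrt.
have := wrtB wiener_sa (wk i.+1) (wk i); congr measurable_wrt; apply/funext => w.
by rewrite /walk; ring.
Qed.

Section Extension.
Variables (h : Omega -> R) (k : nat) (n : nat).
Hypothesis ah : measurable_wrt (F (dyadic n k)) h.
Hypothesis hb : forall w, `|h w| <= 1.
Hypothesis h_past : forall m C, grid_past (n + m) (k * 2 ^ m) C -> Ex (fun w => \1_C w * h w) = 0.

Let hL : L1 h.
Proof. exact: (L1_bnd P (measurable_wrt_meas (filt_meas hF (d0 _ _)) ah) hb). Qed.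

(** The new increment is independent of everything known when it starts, including [h], so
    intersecting with one of its events multiplies a zero mean by a probability. *)
Let h_indep m j C B : (k * 2 ^ m <= j)%N -> F (dyadic (n + m) j) C ->
   measurable B -> Ex (fun w => \1_C w * h w) = 0 ->
   Ex (fun w => \1_(C `&` (fun w => W (dyadic (n + m) j.+1) w - W (dyadic (n + m) j) w) @^-1` B) w * h w) = 0.
Proof.
move=> kj FC mB E0; pose V w := W (dyadic (n + m) j.+1) w - W (dyadic (n + m) j) w.
have jj : dyadic (n + m) j < dyadic (n + m) j.+1 :> R by rewrite dyadic_lt.
have sF := filt_sa hF (d0 (n + m)%N j); have mF := filt_meas hF (d0 (n + m)%N j).
have ah' : measurable_wrt (F (dyadic (n + m) j)) h.
  move=> B' mB'; apply: (filt_mono hF (d0 n k)); last exact: ah.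
  by rewrite -(dyadic_refine n m k) dyadic_le.
have aZ : measurable_wrt (F (dyadic (n + m) j)) (fun w => \1_C w * h w).
  exact: (wrtM sF (wrt_indic sF FC) ah').
have Z1 := L1M_ind (mF _ FC) hL.
have mV := increment_meas hF hW (d0 (n + m)%N j) jj.
have mI : measurable_fun setT (\1_B : R -> R) by exact: measurable_indic.
have I1 : L1 (fun w => \1_B (V w)).
  apply: (L1_bnd P (M := 1)); first exact: measurableT_comp.
  by move=> w; exact: indic_le1.
have ZI : L1 (fun w => \1_C w * h w * \1_B (V w)).
  have bI w : `|\1_B (V w) : R| <= 1.
    by rewrite indicE; case: (_ \in _); rewrite ?normr1 ?normr0.
  have := L1M_bnd (L1_meas I1) bI Z1.
  by apply: eq_L1 => w; rewrite mulrC.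
have := Ex_mul_increment hF hW (d0 (n + m)%N j) jj mI I1 aZ Z1 ZI.
rewrite E0 mul0r; congr (_ = _); congr Ex; apply/funext => w.
by rewrite indicI (_ : \1_(_ @^-1` B) w = \1_B (V w))//; ring.
Qed.

(** Induction over the grid times after that of [h]: the past at the next time is generated by
    intersections of a past event with an event of the new increment, a family closed under
    intersection. *)
Let step m j C : (k * 2 ^ m <= j)%N -> grid_past (n + m) j C -> Ex (fun w => \1_C w * h w) = 0.
Proof.
pose V j w := W (dyadic (n + m) j.+1) w - W (dyadic (n + m) j) w.
have subm i : grid_past (n + m) i `<=` measurable.
  by move=> A /grid_past_filt; exact: (filt_meas hF (d0 _ _)).
have Vm i : measurable_fun setT (V i).
  by apply: (increment_meas hF hW (d0 _ _)); rewrite dyadic_lt.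
move/subnKC <-; elim: (j - _)%N C => [|i IH] C; first by rewrite addn0; exact: h_past.
rewrite addnS; set p := (_ + i)%N in IH *.
pose G := [set A | exists2 C', grid_past (n + m) p C' & exists2 B, measurable B & A = C' `&` V p @^-1` B].
have GI : setI_closed G.
  move=> _ _ [C1 s1 [B1 m1 ->]] [C2 s2 [B2 m2 ->]]; exists (C1 `&` C2).
    exact: (saI (grid_past_sa _ _)).
  by exists (B1 `&` B2); [exact: measurableI|rewrite preimage_setI setIACA].
have GC C' : grid_past (n + m) p C' -> G C'.
  by move=> hC; exists C' => //; exists setT => //; rewrite preimage_setT setIT.
have GV : measurable_wrt <<s G >> (V p).
  move=> B mB; apply: sub_gen_smallest; exists setT; first exact: (saT (grid_past_sa _ _)).
  by exists B => //; rewrite setTI.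
have sG : sigma_algebra setT <<s G >> by exact: smallest_sigma_algebra.
have sub : grid_past (n + m) p.+1 `<=` <<s G >>.
  have wp i' : (i' <= p)%N -> measurable_wrt <<s G >> (walk (n + m) i').
    by move=> h' B mB; apply: sub_gen_smallest; apply: GC; exact: walk_wrt.
  apply: grid_past_min => // [N nN|i']; first by apply: sub_gen_smallest; apply: GC; exact: grid_past_null.
  rewrite leq_eqVlt => /orP[/eqP ->|]; last exact: wp.
  have := wrtD sG (wp p (leqnn p)) GV; congr measurable_wrt; apply/funext => w.
  by rewrite /walk /V; ring.
move=> /sub; apply: (Ex_indic_eq0_g_sigma Pc GI) => //.
- by apply: GC; exact: (saT (grid_past_sa _ _)).
- move=> _ [C' /subm mC' [B mB ->]]; apply: measurableI => //.
  by rewrite -[X in measurable X]setTI; exact: Vm.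
- move=> _ [C' sC' [B mB ->]]; apply: h_indep => //; [exact: leq_addr|exact: grid_past_filt|exact: IH].
Qed.

(** The later increments carry no further information on [h], a variable known at [dyadic n k]: mean
    zero on the past of the path propagates to the whole path. *)
Lemma Ex_wiener_eq0 C : wiener_algebra C -> Ex (fun w => \1_C w * h w) = 0.
Proof.
pose G := [set A | exists m j, grid_past m j A].
have dir m j m' j' : grid_past m j `<=` grid_past (m + m') (j * 2 ^ m' + j' * 2 ^ m).
  by move=> A /(grid_past_refine (q := m')); apply: grid_past_mono; exact: leq_addr.
apply: (Ex_indic_eq0_g_sigma Pc (G := G)) => //.
- move=> A B [m [j sA]] [m' [j' sB]]; exists (m + m')%N, (j * 2 ^ m' + j' * 2 ^ m)%N.
  apply: (saI (grid_past_sa _ _)); first exact: dir.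
  by rewrite addnC [X in grid_past _ X]addnC; exact: dir.
- by exists 0%N, 0%N; exact: (saT (grid_past_sa _ _)).
- by move=> A [m [j /grid_past_filt]]; exact: (filt_meas hF (d0 m j)).
move=> A [m [j sA]].
(* Levels [m] and [n] are both refined to [n + m], and the time index is enlarged to lie after both
   given times. *)
apply: (@step m (j * 2 ^ n + k * 2 ^ m)); first exact: leq_addl.
by rewrite addnC; apply: dir.
Qed.

End Extension.
End WienerAlgebra.

(** * Strong solutions by the Euler scheme *)

(** Heine's theorem on [[0, t]], with the modulus of continuity expressed by a dyadic mesh. *)
Lemma path_uniform {R : realType} (g : R -> R) (t e : R) :
  {within `[0, +oo[, continuous g} -> 0 < e ->
  exists m, forall u v, 0 <= u <= t -> 0 <= v <= t -> `|u - v| <= mesh m -> `|g u - g v| <= e.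
Proof.
move=> cg e0; apply: contrapT => nm.
have bad m : exists uv : R * R, [/\ 0 <= uv.1 <= t, 0 <= uv.2 <= t, `|uv.1 - uv.2| <= mesh m
    & e < `|g uv.1 - g uv.2|].
  apply: contrapT => h; apply: nm; exists m => u v ut vt uv.
  by rewrite leNgt; apply/negP => h'; apply: h; exists (u, v).
have {bad}[uv huv] := choice bad; pose u n := (uv n).1.
have [c [ct cc]] : exists c, (`[0, t]%classic : set R) c /\ cluster (u n @[n --> \oo]) c.
  have := @segment_compact R 0 t (u n @[n --> \oo]) _.
  case; first by exists 0%N => // n _; have [h _ _ _] := huv n; rewrite /= in_itv.
  by move=> c [ct cc]; exists c.
have c0 : 0 <= c by move: ct; rewrite /= in_itv => /andP[].
have e2 : 0 < e / 2 by rewrite divr_gt0.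
have : \forall y \near c, y \in `[0%R, +oo[ -> `|g c - g y| < e / 2.
  move/subspace_continuousP : cg => /(_ c); rewrite /= in_itv/= c0 => /(_ isT) /cvgrPdist_lt/(_ _ e2).
  exact.
move=> /nbhs_ballP[r /= r0 hr].
have [N _ Nr] : \forall n \near \oo, mesh n < r / 2.
  by have := @mesh_cvg0 R => /cvgr0_norm_lt /(_ (r / 2) ltac:(rewrite divr_gt0//)); apply: filterS => n; rewrite gtr0_norm ?mesh_gt0.
have r2 : 0 < r / 2 by rewrite divr_gt0.
have [y [[n Nn yn] /= cy]] : ([set y | exists2 n, (N <= n)%N & u n = y] `&` ball c (r / 2)) !=set0.
  apply: cc; last exact: nbhsx_ballx.
  by exists N => // n /= Nn; exists n.
have [h1 h2 h3 h4] := huv n.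
have cu : `|c - u n| < r / 2 by move: cy; rewrite -yn /ball /=.
have gu : `|g c - g (u n)| < e / 2.
  apply: (hr (u n)); last by rewrite in_itv/= andbT; case/andP: h1.
  by rewrite /ball/= (lt_trans cu)// ltr_pdivrMr// ltr_pMr// ltr1n.
have gv : `|g c - g (uv n).2| < e / 2.
  apply: (hr (uv n).2); last by rewrite in_itv/= andbT; case/andP: h2.
  rewrite /ball/= -(subrK (u n) c) -addrA (le_lt_trans (ler_normD _ _))//.
  by rewrite [r]splitr ltrD// (le_lt_trans h3)// Nr.
move: h4; rewrite ltNge => /negP; apply.
rewrite -(subrK (g c) (g (uv n).1)) -addrA (le_trans (ler_normD _ _))//.
by rewrite distrC [leRHS]splitr; apply: lerD; exact: ltW.
Qed.

Section Elementary.
Context {R : realType}.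

Lemma sqr_sum_le (n : nat) (h : nat -> R) :
  (\sum_(r < n) h r) ^+ 2 <= n%:R * \sum_(r < n) h r ^+ 2.
Proof.
elim: n => [|n IH]; first by rewrite !big_ord0 mulr0 expr2 mul0r.
rewrite !big_ord_recr/=; move: IH; set S := \sum_(r < n) h r; set Q := \sum_(r < n) _.
have [->|n0] := posnP n.
  rewrite mul0r => S0; have /eqP : S ^+ 2 = 0 by apply/eqP; rewrite eq_le S0 sqr_ge0.
  rewrite sqrf_eq0 => /eqP ->; rewrite add0r mul1r lerDr.
  by apply: sumr_ge0 => r _; exact: sqr_ge0.
move=> IH; have n0' : 0 < n%:R :> R by rewrite ltr0n.
have : 0 <= n%:R * (Q + n%:R * h n ^+ 2 - 2 * S * h n).
  by have := sqr_ge0 (S - n%:R * h n); nra.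
by rewrite pmulr_rge0// -natr1; nra.
Qed.

Lemma block_sum (n k : nat) (phi c : nat -> R) : (0 < n)%N ->
  \sum_(r < k * n) phi (r %/ n)%N * c r =
  \sum_(j < k) phi j * \sum_(i < n) c (j * n + i)%N.
Proof.
move=> n0; elim: k => [|k IH]; first by rewrite mul0n !big_ord0.
rewrite big_ord_recr/= -IH mulSnr big_split_ord/=; congr (_ + _).
rewrite mulr_sumr; apply: eq_bigr => i _.
by rewrite divnMDl// divn_small// addn0.
Qed.

Lemma discrete_gronwall (N : nat) (phi : nat -> R) (a c : R) : 0 <= c ->
  (forall k, (k <= N)%N -> phi k <= a + c * \sum_(j < k) phi j) ->
  forall k, (k <= N)%N -> phi k <= a * (1 + c) ^+ k.
Proof.
move=> c0 h k kN; apply: (le_trans (h k kN)).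
elim: k kN => [|k IH] kN; first by rewrite big_ord0 mulr0 addr0 mulr1.
rewrite big_ord_recr/= mulrDr addrA exprSr mulrA mulrDr mulr1.
have kN' := ltnW kN; apply: lerD; first exact: IH.
by rewrite mulrC ler_wpM2r//; exact: le_trans (h k kN') (IH kN').
Qed.

Lemma expr_1D_le (y : R) (n : nat) : 0 <= y -> (1 + y) ^+ n <= expR (y * n%:R).
Proof.
move=> y0; elim: n => [|n IH]; first by rewrite mulr0 expR0.
rewrite exprS -natr1 mulrDr mulr1 [y * _ + y]addrC expRD ler_pM ?expR_ge1Dx ?exprn_ge0//.
  by rewrite addr_ge0.
by rewrite addr_ge0.
Qed.

Definition clip (L y : R) : R := Num.max (- L) (Num.min L y).

Lemma clip_id L y : `|y| <= L -> clip L y = y.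
Proof. by rewrite ler_norml => /andP[y1 y2]; rewrite /clip min_r// max_r. Qed.

Lemma clip_le L y : 0 <= L -> `|clip L y| <= L.
Proof.
move=> L0; rewrite /clip ler_norml le_max lexx/= ge_max ge_min lexx/= andbT.
by rewrite (le_trans _ L0)// oppr_le0.
Qed.

Lemma clip_lip L y z : 0 <= L -> `|clip L y - clip L z| <= `|y - z|.
Proof.
move=> L0; wlog yz : y z / y <= z.
  by move=> H; have [/H//|/ltW/H] := leP y z; rewrite distrC [leRHS]distrC.
rewrite distrC [leRHS]distrC (ger0_norm (x := z - y)) ?subr_ge0//.
rewrite /clip /Num.max /Num.min; do 4 (case: ifP => //); move=> h1 h2 h3 h4;
 rewrite ler_norml; apply/andP; split; lra.
Qed.

Lemma measurable_clip L : measurable_fun [set: R] (clip L).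
Proof. by apply: measurable_maxr => //; exact: measurable_minr. Qed.

End Elementary.

(** * The clipped Euler scheme and its error *)

Section StrongSolution.
Context {R : realType} {d : measure_display} {Omega : measurableType d}.
Variables (P : probability Omega R) (F : R -> set (set Omega)) (W : R -> Omega -> R).
Hypothesis hF : complete_right_continuous_filtration P F.
Hypothesis hW : brownian_motion P F W.
Local Notation L1 := (L1 P).
Local Notation Ex := (Ex P).
Let Pc := filt_complete hF.
Variables (b s : R -> R) (K x : R) (Z : R -> Omega -> R).
Hypotheses (aZ : adapted F Z) (cZ : continuous_paths Z).
Hypothesis lip : forall y z, `|b y - b z| + `|s y - s z| <= K * `|y - z|.
Hypothesis sol : forall t : R, 0 <= t -> exists I : Omega -> R,
  is_ito_integral P F W (fun u w => s (Z u w)) t I /\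
  {ae P, forall w, Z t w = x + \int[lebesgue_measure]_(u in `[0, t]) b (Z u w) + I w}.

Let lb := lip_b lip.
Let ls := lip_s lip.
Let d0 p i : 0 <= dyadic p i :> R. Proof. exact: dyadic_ge0. Qed.
Let dS p i : dyadic p i < dyadic p i.+1 :> R. Proof. by rewrite dyadic_lt. Qed.

(** Clipping the argument bounds the coefficients, so every iterate has a second moment; values
    within [L] do not notice it. The scheme uses only the deterministic [x] and increments of [W],
    hence is a functional of the path. *)
Fixpoint euler (L : R) (m j : nat) (w : Omega) : R :=
  if j is j'.+1 then
    euler L m j' w + mesh m * b (clip L (euler L m j' w)) +
    s (clip L (euler L m j' w)) * (W (dyadic m j'.+1) w - W (dyadic m j') w)
  else x.

Let mclip (c : R -> R) L : (forall y z, `|c y - c z| <= K * `|y - z|) ->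
  measurable_fun setT (fun y => c (clip L y)).
Proof. by move=> lc; apply: measurableT_comp (lip_measurable lc) (measurable_clip L). Qed.

Lemma euler_wiener L m j : measurable_wrt (wiener_algebra P W) (euler L m j).
Proof.
have sH := wiener_sa P W; elim: j => [|j IH]; first exact: (wrt_cst sH).
apply: (wrtD sH); last apply: (wrtM sH).
- apply: (wrtD sH) => //.
  by apply: (wrt_comp (g := fun y => mesh m * b (clip L y))) => //; apply: measurable_funM => //; exact: mclip.
- by apply: (wrt_comp (g := fun y => s (clip L y))) => //; exact: mclip.
- exact: increment_wiener.
Qed.

Lemma euler_wrt L m i j : (i <= j)%N -> measurable_wrt (F (dyadic m j)) (euler L m i).
Proof.
have sH k := filt_sa hF (d0 m k); elim: i j => [|i IH] j ij; first exact: (wrt_cst (sH j)).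
have ij' := ltnW ij; apply: (wrtD (sH j)); last apply: (wrtM (sH j)).
- apply: (wrtD (sH j)); first exact: IH.
  by apply: (wrt_comp (g := fun y => mesh m * b (clip L y))); [apply: measurable_funM => //; exact: mclip|exact: IH].
- by apply: (wrt_comp (g := fun y => s (clip L y))); [exact: mclip|exact: IH].
- move=> B mB; apply: (filt_mono hF (d0 m i.+1)); first by rewrite dyadic_le.
  exact: (increment_wrt hF hW (d0 m i) (dS m i)).
Qed.

(** Freezing the coefficients on blocks of [2 ^ q] fine steps writes the coarse scheme on the grid
    of level [m + q], where it can be subtracted term by term from the Euler sum of [Z]. *)
Lemma euler_refine L m q k w : euler L m k w = x +
  \sum_(r < k * 2 ^ q) mesh (m + q) * b (clip L (euler L m (r %/ 2 ^ q) w)) +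
  discrete_integral W (dyadic (m + q)) (fun r w => s (clip L (euler L m (r %/ 2 ^ q) w))) (k * 2 ^ q) w.
Proof.
have n0 : (0 < 2 ^ q)%N by rewrite expn_gt0.
have n0R : (2 ^ q)%:R != 0 :> R by rewrite pnatr_eq0 -lt0n.
have -> : \sum_(r < k * 2 ^ q) mesh (m + q) * b (clip L (euler L m (r %/ 2 ^ q) w)) =
    \sum_(j < k) mesh m * b (clip L (euler L m j w)).
  under eq_bigr do rewrite mulrC.
  rewrite (block_sum _ (fun j => b (clip L (euler L m j w))) (fun=> mesh (m + q)))//.
  apply: eq_bigr => j _; rewrite sumr_const card_ord mulrC; congr (_ * _).
  by rewrite /mesh expnD natrM invfM -[_ *+ _]mulr_natr -mulrA mulVf ?mulr1.
rewrite /discrete_integral.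
rewrite (block_sum _ (fun j => s (clip L (euler L m j w)))
  (fun r => W (dyadic (m + q) r.+1) w - W (dyadic (m + q) r) w))//.
have tel a n : \sum_(i < n) (W (dyadic (m + q) (a + i).+1) w - W (dyadic (m + q) (a + i)) w) =
    W (dyadic (m + q) (a + n)) w - W (dyadic (m + q) a) w.
  elim: n => [|n IH]; first by rewrite big_ord0 addn0 subrr.
  by rewrite big_ord_recr/= IH addnS; ring.
under [X in _ + _ + X]eq_bigr do rewrite tel -mulSnr !dyadic_refine.
elim: k => [|k IH]; first by rewrite !big_ord0 !addr0.
by rewrite !big_ord_recr/= {1}IH; ring.
Qed.

(* The paths that have stayed in [[-L, L]] up to time [t], with oscillations over the mesh
   of level [m] at most [e]. *)
Definition tame (L : R) (m : nat) (e t : R) : set Omega :=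
  [set w | forall p i j, dyadic p i <= t -> dyadic p j <= t -> `|Z (dyadic p i) w| <= L /\
     (`|dyadic p i - dyadic p j : R| <= mesh m -> `|Z (dyadic p i) w - Z (dyadic p j) w| <= e)].

Lemma tame_mono L m e t u : t <= u -> tame L m e u `<=` tame L m e t.
Proof. by move=> tu w h p i j it jt; apply: h; exact: le_trans tu. Qed.

(** Tameness is tested at dyadic times only, so it is a countable intersection of events known at
    time [t]. *)
Lemma tame_filt L m e t : 0 <= t -> F t (tame L m e t).
Proof.
move=> t0; have sF := filt_sa hF t0.
pose bad p i j := [set w | L < `|Z (dyadic p i) w|] `|`
  [set w | `|dyadic p i - dyadic p j : R| <= mesh m /\ e < `|Z (dyadic p i) w - Z (dyadic p j) w|].
pose bad' p i j := if (dyadic p i <= t) && (dyadic p j <= t) then bad p i j else set0.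
have -> : tame L m e t = ~` (\bigcup_p \bigcup_i \bigcup_j bad' p i j).
  apply/seteqP; split => w.
    move=> h [p _ [i _ [j _]]]; rewrite /bad'; case: ifP => // /andP[it jt].
    have [h1 h2] := h p i j it jt; move=> [/=|/= []]; first by rewrite ltNge h1.
    by move=> /h2; rewrite leNgt => /negP.
  move=> nb p i j it jt; have : ~ bad' p i j w.
    by move=> h; apply: nb; exists p => //; exists i => //; exists j.
  rewrite /bad' it jt /= /bad => /not_orP[/= h1 h2]; split.
    by rewrite leNgt; apply/negP.
  by move=> h3; rewrite leNgt; apply/negP => h4; exact: h2.
apply: (saC sF); apply: (sa_bigcup sF) => p; apply: (sa_bigcup sF) => i.
apply: (sa_bigcup sF) => j; rewrite /bad'.
case: ifP => [/andP[it jt]|_]; last exact: (sa0 sF).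
have Zw p' i' : dyadic p' i' <= t -> measurable_wrt (F t) (Z (dyadic p' i')).
  by move=> it' B mB; apply: (filt_mono hF (d0 p' i') it'); exact: aZ.
have gt (V : Omega -> R) y : measurable_wrt (F t) V -> F t [set w | y < `|V w|].
  move=> hV; have := hV (Num.norm @^-1` `]y, +oo[%classic).
  rewrite (_ : _ @^-1` _ = [set w | y < `|V w|]); last first.
    by apply/seteqP; split => w /=; rewrite in_itv/= andbT.
  apply; rewrite -[X in measurable X]setTI; exact: normr_measurable.
apply: (saU sF); first by apply: gt; exact: Zw.
case: (boolP (`|dyadic p i - dyadic p j : R| <= mesh m)) => h.
  rewrite (_ : [set w | _ /\ _] = [set w | e < `|Z (dyadic p i) w - Z (dyadic p j) w|]).
    by apply: (gt (fun w => Z (dyadic p i) w - Z (dyadic p j) w)); apply: (wrtB sF); exact: Zw.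
  by apply/seteqP; split => w /= => [[]|].
rewrite (_ : [set w | _ /\ _] = set0); first exact: (sa0 sF).
by apply/seteqP; split => w //= [].
Qed.

Lemma tame_meas L m e t : 0 <= t -> measurable (tame L m e t).
Proof. by move=> t0; apply: (filt_meas hF t0); exact: tame_filt. Qed.

Section ErrorEstimate.
Variables (L e : R) (m : nat).
Hypotheses (L0 : 0 <= L) (e0 : 0 <= e).
Local Notation A t := (tame L m e t).
Local Notation E := (euler L m).

(** Tameness is required only up to the current time, so that the errors at earlier times bound
    adapted integrands. *)
Definition euler_error (j : nat) (w : Omega) : R :=
  \1_(A (dyadic m j)) w * (Z (dyadic m j) w - E j w) ^+ 2.

Let Em j : measurable_fun setT (E j).
Proof. exact: (measurable_wrt_meas (filt_meas hF (d0 m j)) (euler_wrt L m (leqnn j))). Qed.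

Let Zm u : 0 <= u -> measurable_fun setT (Z u).
Proof. by move=> u0; exact: (measurable_wrt_meas (filt_meas hF u0) (aZ u0)). Qed.

Let A_meas p r : measurable (A (dyadic p r)). Proof. exact: tame_meas. Qed.

Let tame_bound t p r w : dyadic p r <= t -> A t w -> `|Z (dyadic p r) w| <= L.
Proof. by move=> rt h; have [] := h p r r rt rt. Qed.

(* On a tame path the coefficients of [Z] may be clipped as well, which makes the integrands bounded. *)
Definition gap (c : R -> R) (q r : nat) (w : Omega) : R :=
  \1_(A (dyadic (m + q) r)) w *
  (c (Z (dyadic (m + q) r) w) - c (clip L (E (r %/ 2 ^ q)%N w))).

Section Gap.
Variable c : R -> R.
Hypothesis lc : forall y z, `|c y - c z| <= K * `|y - z|.

Let K0 : 0 <= K.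
Proof.
have := lc 1 0; rewrite subr0 normr1 mulr1.
by apply: le_trans.
Qed.

Lemma gap_le q r w : `|gap c q r w| <= K * (2 * L).
Proof.
rewrite /gap indicE; have [h|h] := boolP (w \in _); last first.
  by rewrite mul0r normr0 mulr_ge0// mulr_ge0.
rewrite mul1r (le_trans (lc _ _))// ler_wpM2l// (le_trans (ler_normB _ _))//.
have Zb : `|Z (dyadic (m + q) r) w| <= L by move: h; rewrite inE; apply: tame_bound.
by have Eb := clip_le (E (r %/ 2 ^ q)%N w) L0; lra.
Qed.

Lemma gap_wrt q r : measurable_wrt (F (dyadic (m + q) r)) (gap c q r).
Proof.
have sF := filt_sa hF (d0 (m + q)%N r); have n0 : (0 < 2 ^ q)%N by rewrite expn_gt0.
apply: (wrtM sF); first by apply: (wrt_indic sF); exact: tame_filt.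
apply: (wrtB sF); first exact: (lip_wrt aZ lc (d0 _ _)).
apply: (wrt_comp (g := fun y => c (clip L y))); first exact: mclip.
move=> B mB; apply: (filt_mono hF (d0 m (r %/ 2 ^ q)%N)); last exact: (euler_wrt L m (leqnn _)).
by rewrite -(dyadic_refine m q) dyadic_le leq_trunc_div.
Qed.

(** The coarse time [v] below [u] is within [mesh m], so on a tame path [Z] moves by at most [e]
    between them; the rest is the error of the scheme at [v]. The factors 2 come from the square of
    a sum. *)
Lemma gap_sqr_le q r w : gap c q r w ^+ 2 <=
  K ^+ 2 * (2 * euler_error (r %/ 2 ^ q)%N w + 2 * e ^+ 2).
Proof.
set j := (r %/ 2 ^ q)%N; have n0 : (0 < 2 ^ q)%N by rewrite expn_gt0.
have er0 : 0 <= euler_error j w by rewrite mulr_ge0 ?sqr_ge0// indic_ge0.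
have r0 : 0 <= 2 * euler_error j w + 2 * e ^+ 2.
  by rewrite addr_ge0// mulr_ge0// sqr_ge0.
rewrite /gap indicE; have [h|h] := boolP (w \in _); last first.
  by rewrite mul0r expr2 mul0r mulr_ge0// sqr_ge0.
move: h; rewrite inE mul1r => h.
set u := dyadic (m + q) r in h *; set v : R := dyadic m j.
have vE : v = dyadic (m + q) (j * 2 ^ q) by rewrite dyadic_refine.
have vu : v <= u by rewrite vE dyadic_le leq_trunc_div.
have hv : A v w := tame_mono vu h.
have uv : `|u - v| <= mesh m.
  rewrite ger0_norm ?subr_ge0// lerBlDr addrC -dyadicS -(dyadic_refine m q) dyadic_le.
  by apply: ltnW; rewrite ltn_ceil.
have osc : `|Z u w - Z v w| <= e.
  have vu' : dyadic (m + q) (j * 2 ^ q) <= u by rewrite -vE.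
  by have [_] := h (m + q)%N r (j * 2 ^ q)%N (lexx _) vu'; rewrite -vE; apply.
have Zc : clip L (Z u w) = Z u w by apply: clip_id; exact: tame_bound h.
have -> : euler_error j w = (Z v w - E j w) ^+ 2.
  by rewrite /euler_error indicE mem_set// mul1r.
rewrite -(real_normK (num_real (c _ - _))).
apply: (@le_trans _ _ ((K * `|Z u w - E j w|) ^+ 2)).
  rewrite lerXn2r ?nnegrE ?mulr_ge0//.
  by rewrite -{1}Zc (le_trans (lc _ _))// ler_wpM2l// clip_lip.
rewrite exprMn ler_wpM2l ?sqr_ge0// real_normK ?num_real//.
have -> : Z u w - E j w = (Z u w - Z v w) + (Z v w - E j w) by ring.
have o2 : (Z u w - Z v w) ^+ 2 <= e ^+ 2.
  by rewrite -(real_normK (num_real (Z u w - Z v w))) lerXn2r ?nnegrE.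
move: o2; set y := Z u w - Z v w; set z := Z v w - E j w => o2.
by have := sqr_ge0 (y - z); nra.
Qed.

End Gap.

Lemma euler_sqr_L1 j : L1 (fun w => E j w ^+ 2).
Proof.
pose C := `|b 0| + `|s 0| + (`|K| * L).
have cC (c : R -> R) y : (forall y z, `|c y - c z| <= K * `|y - z|) -> `|c 0| <= `|b 0| + `|s 0| ->
    `|c (clip L y)| <= C.
  move=> lc c0; rewrite -[c _](subrK (c 0)) (le_trans (ler_normD _ _))// addrC lerD//.
  rewrite (le_trans (lc _ _))// subr0 (le_trans (ler_norm _))// normrM normr_id ler_wpM2l//.
  exact: clip_le.
elim: j => [|j IH]; first exact: (L1_cst P (x ^+ 2)).
pose V w := W (dyadic m j.+1) w - W (dyadic m j) w.
have V2 : L1 (fun w => V w ^+ 2) := increment_sqr_L1 hF hW (d0 m j) (dS m j).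
apply: (L1_dom _ (L1D (L1D (L1Z 3 IH) (L1_cst P (3 * C ^+ 2))) (L1Z (3 * C ^+ 2) V2))).
  exact: (measurable_funX 2 (Em j.+1)).
apply: aeW => w /=; rewrite ger0_norm ?sqr_ge0//.
have m1 : mesh m <= 1 :> R by rewrite invf_le1 ?ler1n ?expn_gt0// ltr0n expn_gt0.
have B1 : (mesh m * b (clip L (E j w))) ^+ 2 <= C ^+ 2.
  rewrite -(real_normK (num_real (_ * _))) lerXn2r ?nnegrE// ?addr_ge0 ?mulr_ge0//.
  rewrite normrM ger0_norm ?(ltW (mesh_gt0 _))// -[leRHS]mul1r ler_pM ?(ltW (mesh_gt0 _))//.
  by apply: cC => //; rewrite lerDl.
have B2 : s (clip L (E j w)) ^+ 2 <= C ^+ 2.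
  rewrite -(real_normK (num_real (s _))) lerXn2r ?nnegrE// ?addr_ge0 ?mulr_ge0//.
  by apply: cC => //; rewrite lerDr.
rewrite -/(V w); move: B1 B2; set y := mesh m * _; set z := s _; set a := E j w; set v := V w => B1 B2.
have B3 : (z * v) ^+ 2 <= C ^+ 2 * v ^+ 2 by rewrite exprMn ler_wpM2r// sqr_ge0.
apply: (@le_trans _ _ (3 * (a ^+ 2 + y ^+ 2 + (z * v) ^+ 2))); last by lra.
by have := sqr_ge0 (a - y); have := sqr_ge0 (a - z * v); have := sqr_ge0 (y - z * v); nra.
Qed.

Lemma euler_error_L1 j : L1 (euler_error j).
Proof.
apply: (L1_dom _ (L1D (L1_cst P (2 * L ^+ 2)) (L1Z 2 (euler_sqr_L1 j)))).
  apply: measurable_funM; first exact: measurable_indic.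
  by apply: measurable_funX; apply: measurable_funB => //; exact: Zm.
apply: aeW => w; rewrite /euler_error indicE; have [h|h] := boolP (w \in _); last first.
  by rewrite mul0r normr0 addr_ge0// mulr_ge0// sqr_ge0.
rewrite mul1r ger0_norm ?sqr_ge0//.
have Zb : Z (dyadic m j) w ^+ 2 <= L ^+ 2.
  rewrite -(real_normK (num_real (Z _ _))) lerXn2r ?nnegrE//.
  by move: h; rewrite inE; exact: tame_bound.
by have := sqr_ge0 (Z (dyadic m j) w + E j w); nra.
Qed.

(** On tame paths the error splits into a drift part and a stochastic part, and
    [(D + I)^2 <= 2 D^2 + 2 I^2]. Cauchy-Schwarz bounds the first by [t] times, and the isometry the
    second by 8 times, the same sum, whence [2 t + 16]. *)
Lemma euler_step_error q k :
  let V w := \1_(A (dyadic m k)) w *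
    (x + euler_sum W b s Z (m + q) (k * 2 ^ q) w - E k w) ^+ 2 in
  L1 V /\ Ex V <= (2 * dyadic m k + 16) *
    (\sum_(j < k) (K ^+ 2 * (2 * Ex (euler_error j) + 2 * e ^+ 2)) * mesh m).
Proof.
move=> V; pose N := (k * 2 ^ q)%N; pose t : R := dyadic m k; pose h : R := mesh (m + q).
have h0 : 0 <= h by exact: ltW (mesh_gt0 _).
have t0 : 0 <= t := d0 m k.
have Nh : N%:R * h = t by rewrite /t -(dyadic_refine m q).
pose D w := \sum_(r < N) h * gap b q r w.
pose I := discrete_integral W (dyadic (m + q)) (gap s q) N.
have gL c r : (forall y z, `|c y - c z| <= K * `|y - z|) -> L1 (fun w => gap c q r w ^+ 2).
  move=> lc; apply: (L1_bnd P (M := (K * (2 * L)) ^+ 2)).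
    apply: measurable_funX; exact: (measurable_wrt_meas (filt_meas hF (d0 _ _)) (gap_wrt lc q r)).
  move=> w; have := gap_le lc q r w; rewrite normrX => g1; rewrite lerXn2r ?nnegrE//.
  exact: le_trans g1.
have gE c r : (forall y z, `|c y - c z| <= K * `|y - z|) -> Ex (fun w => gap c q r w ^+ 2) <=
    K ^+ 2 * (2 * Ex (euler_error (r %/ 2 ^ q)%N) + 2 * e ^+ 2).
  move=> lc; have er := euler_error_L1 (r %/ 2 ^ q)%N; have er2 := L1Z 2 er.
  have c2 := L1_cst P (2 * e ^+ 2).
  rewrite -(ExZ 2 er) -(Ex_cst P (2 * e ^+ 2)) -(ExD er2 c2) -(ExZ _ (L1D er2 c2)).
  apply: (Ex_le Pc); [|exact: gL|exact: (L1Z _ (L1D er2 c2))].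
  by apply: aeW => w; exact: gap_sqr_le.
have [I2 I2le] := discrete_isometry hF hW (d0 (m + q)%N 0) (dS (m + q)%N) (gap_wrt ls q)
  (fun r w => gap_le ls q r w) N.
have mD : measurable_fun setT D.
  apply: measurable_sum => r; apply: measurable_funM => //.
  exact: (measurable_wrt_meas (filt_meas hF (d0 _ _)) (gap_wrt lb q r)).
have SD : L1 (fun w => t * \sum_(r < N) h * gap b q r w ^+ 2).
  by apply: L1Z; apply: L1_sum => r _; apply: L1Z; exact: gL.
have Dle w : D w ^+ 2 <= t * \sum_(r < N) h * gap b q r w ^+ 2.
  rewrite /D -!mulr_sumr exprMn -Nh; have := sqr_sum_le N (fun r => gap b q r w).
  set S1 := (\sum_(r < N) _) ^+ 2; set S2 := \sum_(r < N) _ => S12.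
  have -> : N%:R * h * (h * S2) = h ^+ 2 * (N%:R * S2) by ring.
  by rewrite ler_wpM2l// sqr_ge0.
have D2 : L1 (fun w => D w ^+ 2).
  apply: (L1_dom (measurable_funX 2 mD) SD); apply: aeW => w.
  by rewrite ger0_norm ?sqr_ge0.
have VE w : V w <= 2 * D w ^+ 2 + 2 * I w ^+ 2 /\ 0 <= V w.
  split; last by rewrite mulr_ge0 ?sqr_ge0 ?indic_ge0.
  rewrite /V indicE; have [hA|hA] := boolP (w \in _); last first.
    by rewrite mul0r addr_ge0// mulr_ge0// sqr_ge0.
  move: hA; rewrite inE mul1r => hA.
  have gr c (r : 'I_N) : gap c q r w = c (Z (dyadic (m + q) r) w) - c (clip L (E (r %/ 2 ^ q)%N w)).
    rewrite /gap indicE mem_set ?mul1r//; apply: tame_mono hA.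
    by rewrite -(dyadic_refine m q) dyadic_le ltnW.
  have -> : x + euler_sum W b s Z (m + q) N w - E k w = D w + I w.
    rewrite (euler_refine L m q k w) /euler_sum /drift_sum /D /I /discrete_integral -/N.
    under [\sum_(r < N) h * gap _ _ _ _]eq_bigr do rewrite gr mulrBr.
    under [\sum_(j < N) gap _ _ _ _ * _]eq_bigr do rewrite gr mulrBl.
    by rewrite !sumrB /diffusion_coef /h; ring.
  by have := sqr_ge0 (D w - I w); nra.
have B1 := L1Z 2 D2; have B2 := L1Z 2 I2.
have mV : measurable_fun setT V.
  apply: measurable_funM; first exact: measurable_indic.
  apply: measurable_funX; apply: measurable_funB => //; apply: measurable_funD => //.
  apply: measurable_funD.
    apply: measurable_sum => r; apply: measurable_funM => //.
    by apply: (measurableT_comp (lip_measurable lb)); exact: Zm.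
  exact: (measurable_wrt_meas (filt_meas hF (d0 _ _)) (discrete_integral_wrt hF hW (d0 _ _) (dS _)
    (fun r => lip_wrt aZ ls (d0 _ _)) N)).
have V1 : L1 V.
  apply: (L1_dom mV (L1D B1 B2)); apply: aeW => w; have [v1 v2] := VE w.
  by rewrite ger0_norm.
split => //.
have : Ex V <= 2 * Ex (fun w => D w ^+ 2) + 2 * Ex (fun w => I w ^+ 2).
  rewrite -(ExZ 2 D2) -(ExZ 2 I2) -(ExD B1 B2).
  by apply: (Ex_le Pc) => //; [apply: aeW => w; have [] := VE w|exact: L1D].
move=> /le_trans; apply.
pose Q := \sum_(r < N) (K ^+ 2 * (2 * Ex (euler_error (r %/ 2 ^ q)%N) + 2 * e ^+ 2)) * h.
have QE : Q = \sum_(j < k) (K ^+ 2 * (2 * Ex (euler_error j) + 2 * e ^+ 2)) * mesh m.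
  rewrite /Q /N (block_sum _ (fun j => K ^+ 2 * (2 * Ex (euler_error j) + 2 * e ^+ 2)) (fun=> h)) ?expn_gt0//.
  apply: eq_bigr => j _; rewrite sumr_const card_ord; congr (_ * _).
  have n0R : (2 ^ q)%:R != 0 :> R by rewrite pnatr_eq0 -lt0n expn_gt0.
  by rewrite /h /mesh expnD natrM invfM -[_ *+ _]mulr_natr -mulrA mulVf ?mulr1.
rewrite -QE.
have D3 : Ex (fun w => D w ^+ 2) <= t * Q.
  apply: (le_trans (Ex_le Pc (aeW _ Dle) D2 SD)).
  rewrite ExZ; last by apply: L1_sum => r _; apply: L1Z; exact: gL.
  rewrite ler_wpM2l// Ex_sum; last by move=> r _; apply: L1Z; exact: gL.
  apply: ler_sum => r _; rewrite (ExZ _ (gL _ _ lb)) mulrC ler_wpM2r//; exact: gE.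
have I3 : Ex (fun w => I w ^+ 2) <= 8 * Q.
  apply: (le_trans I2le); rewrite ler_wpM2l//; apply: ler_sum => r _.
  by rewrite dyadicS addrC addKr mulrC ler_wpM2r//; exact: gE.
have -> : (2 * dyadic m k + 16) * Q = 2 * (t * Q) + 2 * (8 * Q) by rewrite /t; ring.
by rewrite lerD// ler_wpM2l.
Qed.

(** The preceding bound does not depend on [q]. Along refinements [q l] for which the Euler sums
    converge almost surely to [Z], Fatou's lemma replaces them by [Z]. *)
Lemma euler_error_step k : Ex (euler_error k) <= (2 * dyadic m k + 16) *
    (\sum_(j < k) (K ^+ 2 * (2 * Ex (euler_error j) + 2 * e ^+ 2)) * mesh m).
Proof.
have half_gt0 l : 0 < 2^-1 ^+ l :> R by rewrite exprn_gt0 ?invr_gt0.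
have [q hq] := choice (fun l => euler_sum_small hF hW aZ cZ lip sol m k (half_gt0 l)).
pose V l w := \1_(A (dyadic m k)) w *
    (x + euler_sum W b s Z (m + q l) (k * 2 ^ q l) w - E k w) ^+ 2.
have mes l : measurable_fun setT (euler_sum W b s Z (m + q l) (k * 2 ^ q l)).
  apply: measurable_funD.
    apply: measurable_sum => r; apply: measurable_funM => //.
    by apply: (measurableT_comp (lip_measurable lb)); exact: Zm.
  exact: (measurable_wrt_meas (filt_meas hF (d0 _ _)) (discrete_integral_wrt hF hW (d0 _ _) (dS _)
    (fun r => lip_wrt aZ ls (d0 _ _)) _)).
have c0 : {ae P, forall w, (Z (dyadic m k) w - (x + euler_sum W b s Z (m + q l) (k * 2 ^ q l) w))
    @[l --> \oo] --> (0 : R)}.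
  apply: (cvg_of_small (Z := fun l w => Z (dyadic m k) w - (x + euler_sum W b s Z (m + q l) (k * 2 ^ q l) w))) => //.
  move=> l; apply: measurable_funB; first exact: Zm.
  exact: measurable_funD.
have Vc : {ae P, forall w, V l w @[l --> \oo] --> euler_error k w}.
  apply: filterS c0 => w hw; apply: cvgM; first exact: cvg_cst.
  have h1 : x + euler_sum W b s Z (m + q l) (k * 2 ^ q l) w - E k w @[l --> \oo] -->
      Z (dyadic m k) w - E k w.
    have h2 : (Z (dyadic m k) w - E k w) - (Z (dyadic m k) w - (x + euler_sum W b s Z (m + q l) (k * 2 ^ q l) w))
        @[l --> \oo] --> (Z (dyadic m k) w - E k w) - 0.
      by apply: cvgB => //; exact: cvg_cst.
    rewrite subr0 in h2; apply: cvg_trans h2; apply: near_eq_cvg; apply: nearW => l; ring.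
  by rewrite expr2; under eq_fun do rewrite expr2; exact: cvgM.
have [] // := @Ex_fatou _ _ _ P Pc V (euler_error k) (fun=> (2 * dyadic m k + 16) *
    (\sum_(j < k) (K ^+ 2 * (2 * Ex (euler_error j) + 2 * e ^+ 2)) * mesh m)) _ _ _ Vc _ (cvg_cst _).
- by move=> l; have [] := euler_step_error (q l) k.
- by move=> l w; rewrite mulr_ge0 ?indic_ge0 ?sqr_ge0.
- by move=> l; have [_] := euler_step_error (q l) k.
Qed.

(** The constant of Gronwall's inequality: [c * T * expR (c * T)] with [c = (2 T + 16) * 2 K^2]. It
    involves neither [L] nor [m]. *)
Definition error_cst (T : R) : R :=
  (2 * T + 16) * (2 * K ^+ 2) * T * expR ((2 * T + 16) * (2 * K ^+ 2) * T).

Lemma euler_error_le k : Ex (euler_error k) <= error_cst (dyadic m k) * e ^+ 2.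
Proof.
set T : R := dyadic m k; pose c := (2 * T + 16) * (2 * K ^+ 2).
have T0 : 0 <= T := d0 m k.
have c0 : 0 <= c.
  by apply: mulr_ge0; [rewrite addr_ge0// mulr_ge0|rewrite mulr_ge0// sqr_ge0].
have h0 : 0 <= mesh m :> R by exact: ltW (mesh_gt0 _).
have phi0 j : 0 <= Ex (euler_error j).
  apply: (Ex_ge0 Pc); last exact: euler_error_L1.
  by apply: aeW => w; rewrite mulr_ge0 ?indic_ge0 ?sqr_ge0.
have ch0 : 0 <= c * mesh m by rewrite mulr_ge0.
have a0 : 0 <= c * T * e ^+ 2 by apply: mulr_ge0; [exact: mulr_ge0|exact: sqr_ge0].
have := @discrete_gronwall R k (fun j => Ex (euler_error j)) (c * T * e ^+ 2) (c * mesh m) ch0.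
have H j : (j <= k)%N -> Ex (euler_error j) <=
    c * T * e ^+ 2 + c * mesh m * \sum_(i < j) Ex (euler_error i).
  move=> jk; apply: (le_trans (euler_error_step j)).
  have jT : dyadic m j <= T by rewrite dyadic_le.
  apply: (@le_trans _ _ ((2 * T + 16) *
    (\sum_(i < j) (K ^+ 2 * (2 * Ex (euler_error i) + 2 * e ^+ 2)) * mesh m))).
    rewrite ler_wpM2r//; last by rewrite lerD2r ler_wpM2l.
    apply: sumr_ge0 => i _; apply: mulr_ge0 => //; apply: mulr_ge0; first exact: sqr_ge0.
    by rewrite addr_ge0 ?(mulr_ge0 _ (phi0 i)) ?(mulr_ge0 _ (sqr_ge0 e)).
  have -> : \sum_(i < j) (K ^+ 2 * (2 * Ex (euler_error i) + 2 * e ^+ 2)) * mesh m =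
      2 * K ^+ 2 * (mesh m * \sum_(i < j) Ex (euler_error i) + e ^+ 2 * dyadic m j).
    under eq_bigr do rewrite mulrDr mulrDl.
    rewrite big_split/= sumr_const card_ord mulr_sumr mulrDr mulr_sumr; congr (_ + _).
      by apply: eq_bigr => i _; ring.
    by rewrite -[_ *+ _]mulr_natr /dyadic /mesh; ring.
  rewrite mulrA -/c mulrDr addrC; apply: lerD; last by rewrite mulrA.
  by rewrite -mulrA ler_wpM2l// mulrC ler_wpM2r// sqr_ge0.
move=> /(_ H k (leqnn k)) /le_trans; apply.
rewrite /error_cst -/c [leRHS]mulrAC ler_wpM2l//.
apply: (le_trans (expr_1D_le _ ch0)).
by rewrite -mulrA [mesh m * _]mulrC.
Qed.

End ErrorEstimate.

(** A continuous path is bounded and uniformly continuous on [[0, T]], so letting the bound and the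
    level grow together captures every path. *)
Lemma tame_eventually (e T : R) (m0 : nat) (w : Omega) : 0 < e ->
  \forall l \near \oo, tame l%:R (m0 + l) e T w.
Proof.
move=> e0; have [C C0 hC] := path_bounded T (@cZ w).
have [m1 hm1] := path_uniform T (@cZ w) e0.
exists (Num.truncn C + 1 + m1)%N => // l /= lm p i j it jt.
have im : 0 <= (dyadic p i : R) <= T by apply/andP; split; [exact: dyadic_ge0|exact: it].
have jm : 0 <= (dyadic p j : R) <= T by apply/andP; split; [exact: dyadic_ge0|exact: jt].
split.
  apply: (le_trans (hC _ im)); apply: ltW; apply: (lt_le_trans (truncnS_gt C)).
  by rewrite ler_nat -addn1 (leq_trans _ lm)// leq_addr.
move=> ij; apply: hm1 => //; apply: (le_trans ij); rewrite /mesh.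
rewrite lef_pV2 ?posrE ?ltr0n ?expn_gt0// ler_nat leq_exp2l//.
by rewrite (leq_trans _ (leq_addl _ _))// (leq_trans _ lm)// leq_addl.
Qed.

(** The oscillation [e] is fixed first, making the mean square error on tame paths small whatever
    the bound; bound and level are then chosen so that untame paths are improbable. Clipped schemes
    thus converge to [Z] in probability, fast enough to converge almost surely. *)
Lemma dyadic_value_wiener m0 k0 : measurable_wrt (wiener_algebra P W) (Z (dyadic m0 k0)).
Proof.
pose T : R := dyadic m0 k0; have T0 : 0 <= T := d0 m0 k0.
have C0 : 0 <= error_cst T.
  apply: mulr_ge0 (expR_ge0 _); apply: mulr_ge0 => //.
  by apply: mulr_ge0; [rewrite addr_ge0// mulr_ge0|rewrite mulr_ge0// sqr_ge0].
have mZ : measurable_fun setT (Z T) by exact: (measurable_wrt_meas (filt_meas hF T0) (aZ T0)).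
have sH := wiener_sa P W; have mH := wiener_meas hF hW.
have approx n : exists2 Y : Omega -> R, measurable_wrt (wiener_algebra P W) Y &
    pr P [set w | 2^-1 ^+ n < `|Z T w - Y w|] <= 2^-1 ^+ n.
  pose eta : R := 2^-1 ^+ n; have eta0 : 0 < eta by rewrite exprn_gt0 ?invr_gt0.
  (* Chosen so that [error_cst T * e^2] is at most [eta / 2 * eta^2], as Chebyshev's inequality at
     level [eta] requires; [e <= 1] serves to bound [e^2] by [e]. *)
  pose e := Num.min 1 (eta / 2 * eta ^+ 2 / (1 + error_cst T)).
  have C1 : 0 < 1 + error_cst T by rewrite ltr_wpDr.
  have e0 : 0 < e by rewrite lt_min ltr01/= divr_gt0 ?mulr_gt0 ?exprn_gt0.
  have e1 : error_cst T * e ^+ 2 <= eta / 2 * eta ^+ 2.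
    have e_le1 : e <= 1 by rewrite ge_min lexx.
    have : e * (1 + error_cst T) <= eta / 2 * eta ^+ 2.
      by rewrite -ler_pdivlMr// ge_min lexx orbT.
    apply: le_trans; rewrite mulrC ler_pM ?sqr_ge0//; last by rewrite lerDr.
    by rewrite expr2 ler_piMl// ltW.
  pose B l := tame l%:R (m0 + l) e T.
  have mB l : measurable (B l) by exact: tame_meas.
  have eta2 : 0 < eta / 2 by rewrite divr_gt0.
  have [l hl] : exists l, pr P (~` B l) <= eta / 2.
    have mI l : measurable_fun setT (\1_(~` B l) : Omega -> R).
      by apply: measurable_indic; exact: measurableC.
    have cI : {ae P, forall w, (\1_(~` B l) w : R) @[l --> \oo] --> (0 : R)}.
      apply: aeW => w; apply: cvg_near_cst; apply: filterS (tame_eventually T m0 w e0) => l h.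
      have nB : ~ (~` B l) w by move=> nB; exact: nB h.
      by rewrite indicE (memNset nB).
    have min0 : 0 < Num.min (eta / 2) (2^-1 : R) by rewrite lt_min eta2 invr_gt0 ltr0n.
    have [l hl] := filter_ex (pr_cvg0 Pc mI cI min0); exists l.
    apply: (le_trans _ (le_trans hl _)); last by rewrite ge_min lexx.
    apply: pr_le; [exact: measurableC| |].
      by apply: measurable_gt_set; exact: measurableT_comp.
    move=> w nB /=; rewrite indicE mem_set// normr1.
    by rewrite (@le_lt_trans _ _ 2^-1)// ?ge_min ?lexx ?orbT// invf_lt1// ltr1n.
  pose m := (m0 + l)%N; pose k := (k0 * 2 ^ l)%N.
  have TE : dyadic m k = T by exact: dyadic_refine.
  have l0 : 0 <= l%:R :> R by [].
  exists (euler l%:R m k); first exact: euler_wiener.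
  have mE : measurable_fun setT (euler l%:R m k).
    exact: (measurable_wrt_meas (filt_meas hF (d0 m k)) (euler_wrt _ m (leqnn k))).
  pose V w := \1_(B l) w * (Z T w - euler l%:R m k w).
  have mV : measurable_fun setT V.
    by apply: measurable_funM; [exact: measurable_indic|exact: measurable_funB].
  have VE : (fun w => V w ^+ 2) = euler_error l%:R e m k.
    apply/funext => w; rewrite /V /euler_error TE exprMn; congr (_ * _).
    by rewrite indicE; case: (_ \in _); rewrite expr2 ?mulr1 ?mulr0.
  have V2 : L1 (fun w => V w ^+ 2) by rewrite VE; exact: euler_error_L1.
  have ch := chebyshev_sqr Pc mV V2 eta0.
  have gt1 (U : Omega -> R) : measurable_fun setT U -> measurable [set w | eta < `|U w|].
    by move=> mU; apply: measurable_gt_set; exact: measurableT_comp.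
  have mZE : measurable_fun setT (fun w => Z T w - euler l%:R m k w) by exact: measurable_funB.
  apply: (le_trans (pr_le_U P (gt1 _ mZE) (measurableC (mB l)) (gt1 _ mV) _)).
    move=> w /= h; have [hB|hB] := pselect (B l w); [right|by left].
    by rewrite /V indicE mem_set// mul1r.
  rewrite -/eta [leRHS]splitr lerD// (le_trans ch)// ler_pdivrMr ?exprn_gt0//.
  rewrite VE; apply: (le_trans _ e1).
  by have := @euler_error_le l%:R e m l0 (ltW e0) k; rewrite TE.
have {}approx n : exists Y : Omega -> R, measurable_wrt (wiener_algebra P W) Y /\
    pr P [set w | 2^-1 ^+ n < `|Z T w - Y w|] <= 2^-1 ^+ n.
  by have [Y h1 h2] := approx n; exists Y.
have [Y hY] := choice approx.
have hY1 n : measurable_wrt (wiener_algebra P W) (Y n) by have [] := hY n.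
have hY2 n : pr P [set w | 2^-1 ^+ n < `|Z T w - Y n w|] <= 2^-1 ^+ n by have [] := hY n.
apply: (@wrt_cvg _ _ _ _ sH P Y (Z T) Pc mH (@wiener_null _ _ _ P W) hY1).
have mY n : measurable_fun setT (Y n) := measurable_wrt_meas mH (hY1 n).
have := cvg_of_small (Z := fun n w => Z T w - Y n w) (fun n => measurable_funB mZ (mY n)) hY2.
apply: filterS => w h; have h2 : Z T w - (Z T w - Y n w) @[n --> \oo] --> Z T w - 0.
  by apply: cvgB => //; exact: cvg_cst.
rewrite subr0 in h2; apply: cvg_trans h2; apply: near_eq_cvg; apply: nearW => n.
by rewrite opprB addrCA subrr addr0.
Qed.

Lemma strong_solution t : 0 <= t -> measurable_wrt (wiener_algebra P W) (Z t).
Proof.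
move=> t0; have sH := wiener_sa P W; have mH := wiener_meas hF hW.
apply: (@wrt_cvg _ _ _ _ sH P (fun p => Z (dyadic_floor p t)) (Z t) Pc mH (@wiener_null _ _ _ P W)).
  by move=> p; exact: dyadic_value_wiener.
apply: aeW => w; apply: (path_cvg (@cZ w)) => //; first by move=> p; exact: dyadic_ge0.
exact: dyadic_floor_cvg.
Qed.

End StrongSolution.

(** * The initial value is constant *)

Lemma indic_le {R : realType} (T : Type) (D : set T) (w : T) : \1_D w <= 1 :> R.
Proof. by rewrite indicE; case: (_ \in _). Qed.

Section Densities.
Context {R : realType} {d : measure_display} {Omega : measurableType d}.
Variables (P : probability Omega R) (F : R -> set (set Omega)) (W : R -> Omega -> R).
Hypothesis hF : complete_right_continuous_filtration P F.
Hypothesis hW : brownian_motion P F W.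
Local Notation L1 := (L1 P).
Local Notation Ex := (Ex P).
Let Pc := filt_complete hF.
Local Notation H := (wiener_algebra P W).
Let sH := wiener_sa P W.
Let mH := wiener_meas hF hW.

(** A version of the conditional probability of [D] given [M], kept in [[0, 1]] at every point so
    that it can serve as a weight. *)
Definition is_density (M : set (set Omega)) (D : set Omega) (a : Omega -> R) : Prop :=
  [/\ measurable_wrt M a, forall w, 0 <= a w <= 1 &
    forall C, M C -> Ex (fun w => \1_C w * a w) = Ex (fun w => \1_C w * \1_D w)].

(** Any version lies in [[0, 1]] almost surely; clamping enforces this everywhere without changing
    its integrals. *)
Lemma density_exists M D : sigma_algebra setT M -> M `<=` measurable -> measurable D ->
  exists a, is_density M D a.
Proof.
move=> sM mM mD; have [V [MV V1 VE]] := cond_exp sM mM (L1_indic P mD).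
have V0 : {ae P, forall w, 0 <= V w}.
  apply: (ae_ge0_of_sets Pc mM MV V1) => A MA; rewrite VE//.
  apply: (Ex_ge0 Pc); last exact: (L1M_ind (mM _ MA) (L1_indic P mD)).
  by apply: aeW => w; rewrite mulr_ge0 ?indic_ge0.
have V1' : {ae P, forall w, 0 <= 1 - V w}.
  have h1 := L1B (L1_cst P 1) V1.
  apply: (ae_ge0_of_sets Pc mM _ h1) => [|A MA]; first exact: (wrtB sM (wrt_cst sM 1) MV).
  have mA := mM _ MA; have hA := L1M_ind mA (L1_cst P 1); have hV := L1M_ind mA V1.
  rewrite (_ : (fun w => _) = fun w => \1_A w * 1 - \1_A w * V w); last first.
    by apply/funext => w; ring.
  rewrite (ExB hA hV) VE// -(ExB hA (L1M_ind mA (L1_indic P mD))).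
  apply: (Ex_ge0 Pc); last exact: L1B hA (L1M_ind mA (L1_indic P mD)).
  apply: aeW => w; rewrite -mulrBr; apply: mulr_ge0; first exact: indic_ge0.
  by rewrite subr_ge0; exact: indic_le.
pose g (y : R) := Num.max 0 (Num.min 1 y).
have mg : measurable_fun setT g by apply: measurable_maxr => //; exact: measurable_minr.
have gE : {ae P, forall w, g (V w) = V w}.
  apply: filterS2 V0 V1' => w v0 v1; rewrite /g min_r ?max_r//.
  by rewrite -subr_ge0.
have Vm := L1_meas V1.
exists (fun w => g (V w)); split; first exact: (wrt_comp mg MV).
- by move=> w; rewrite /g le_max lexx/= ge_max ler01 ge_min lexx.
move=> C MC; rewrite -VE//; apply/esym/(Ex_eq Pc); last exact: L1M_ind (mM _ MC) V1.
  by apply: filterS gE => w ->.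
Qed.

Lemma density_L1 D a : is_density H D a -> L1 a.
Proof.
move=> [Ha a01 _]; apply: (L1_bnd P (M := 1)); first exact: (measurable_wrt_meas mH Ha).
by move=> w; have /andP[a0 a1] := a01 w; rewrite ger0_norm.
Qed.

Lemma densityM_L1 D a g : is_density H D a -> L1 g -> L1 (fun w => a w * g w).
Proof.
move=> [Ha a01 _]; apply: (L1M_bnd (M := 1)); first exact: (measurable_wrt_meas mH Ha).
by move=> w; have /andP[a0 a1] := a01 w; rewrite ger0_norm.
Qed.

Lemma density_unique D a a' : measurable_wrt H a' -> L1 a' ->
  (forall C, H C -> Ex (fun w => \1_C w * a' w) = Ex (fun w => \1_C w * \1_D w)) ->
  is_density H D a -> {ae P, forall w, a w = a' w}.
Proof.
move=> Ha' La' E' da; have La := density_L1 da; have [Ha _ E] := da.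
by apply: (ae_eq_of_sets Pc sH mH) => // C HC; rewrite E// E'.
Qed.

(* Immersion: the Brownian motion is still independent of its past once the rest of [F]
   is known, so conditioning on its whole path only involves its past. *)
Lemma density_filt n k D a : F (dyadic n k) D -> is_density H D a ->
  measurable_wrt (F (dyadic n k)) a.
Proof.
set t : R := dyadic n k; have t0 : 0 <= t := dyadic_ge0 n k; move=> FD da.
have sF := filt_sa hF t0; have mF := filt_meas hF t0; have mD := mF _ FD.
have sM : sigma_algebra setT (F t `&` H).
  split; first by split; [exact: (sa0 sF)|exact: (sa0 sH)].
    by move=> A [FA HA]; rewrite setTD; split; [exact: (saC sF)|exact: (saC sH)].
  move=> A hA; split; [apply: (sa_bigcup sF)|apply: (sa_bigcup sH)] => m; by have [] := hA m.
have mM : F t `&` H `<=` measurable by move=> A [FA _]; exact: mF.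
(* Conditioning on the intersection of [F t] and [H] gives a weight that is adapted by construction.
   This intersection contains the past of the path, so [\1_D - a'] has mean zero there, hence on the
   whole path, and [a'] is the density given [H] as well. *)
have [a' [Ma' a'01 E']] := density_exists sM mM mD.
have Fa' : measurable_wrt (F t) a' by move=> B mB; have [] := Ma' B mB.
have Ha' : measurable_wrt H a' by move=> B mB; have [] := Ma' B mB.
have La' : L1 a'.
  apply: (L1_bnd P (M := 1)); first exact: (measurable_wrt_meas mH Ha').
  by move=> w; have /andP[a0 a1] := a'01 w; rewrite ger0_norm.
have L1D := L1_indic P mD.
pose h w := \1_D w - a' w.
have E0 C : H C -> Ex (fun w => \1_C w * h w) = 0.
  apply: (Ex_wiener_eq0 hF hW (h := h) (n := n) (k := k)).
  - exact: (wrtB sF (wrt_indic sF FD) Fa').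
  - move=> w; have /andP[a0 a1] := a'01 w; have d0 := indic_ge0 (R := R) D w.
    have d1 : \1_D w <= 1 :> R by exact: indic_le.
    by rewrite ler_norml; apply/andP; split; rewrite /h; lra.
  - move=> m C' sC; have MC : (F t `&` H) C'.
      split; last exact: grid_past_wiener sC.
      by rewrite /t -(dyadic_refine n m k); exact: (grid_past_filt hF hW).
    have mC := mM _ MC.
    rewrite (_ : (fun w => _) = fun w => \1_C' w * \1_D w - \1_C' w * a' w); last first.
      by apply/funext => w; rewrite /h; ring.
    by rewrite (ExB (L1M_ind mC L1D) (L1M_ind mC La')) E'// subrr.
have aa' : {ae P, forall w, a w = a' w}.
  apply: (density_unique Ha' La' _ da) => C HC; have mC := mH HC; apply/esym/eqP.
  rewrite -subr_eq0 -(ExB (L1M_ind mC L1D) (L1M_ind mC La')) -(E0 _ HC).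
  by apply/eqP; congr Ex; apply/funext => w; rewrite /h; ring.
have nF N : P.-negligible N -> F t N.
  by move=> nN; apply: (filt_mono hF (lexx 0) t0); exact: (filt_null hF nN).
apply: (@wrt_ae _ _ _ _ sF P a' a Pc mF nF) Fa'.
by apply: filterS aa' => w ->.
Qed.

(** Events of [F 0] are independent of the path: the past of the walk at time 0 consists of null
    events and their complements, on which the centred indicator of [D] has mean zero. *)
Lemma density0 D a : F 0 D -> is_density H D a -> {ae P, forall w, a w = pr P D}.
Proof.
move=> FD; have mD := filt_meas hF (lexx 0) FD.
have [pD0 pD1] : 0 <= pr P D /\ pr P D <= 1.
  rewrite /pr fine_ge0//; split => //; rewrite -lee_fin fineK ?fin_num_measure//.
  exact: probability_le1.
have h1 := L1_indic P mD; have h2 := L1_cst P (pr P D).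
apply: density_unique; [exact: (wrt_cst sH)|exact: L1_cst|move=> C HC].
have mC := mH HC; apply/esym/eqP; rewrite -subr_eq0 -(ExB (L1M_ind mC h1) (L1M_ind mC h2)).
apply/eqP; pose h w := \1_D w - pr P D.
have -> : (fun w => \1_C w * \1_D w - \1_C w * pr P D) = (fun w => \1_C w * h w).
  by apply/funext => w; rewrite /h; ring.
have h0 : Ex h = 0 by rewrite (ExB h1 h2) Ex_cst Ex_ind// subrr.
have d00 : dyadic 0 0 = 0 :> R by exact: dyadic0.
apply: (Ex_wiener_eq0 hF hW (h := h) (n := 0) (k := 0)) HC.
- have sF := filt_sa hF (lexx 0).
  by rewrite d00; exact: (wrtB sF (wrt_indic sF FD) (wrt_cst sF _)).
- move=> w; have d0 := indic_ge0 (R := R) D w.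
  have d1 : \1_D w <= 1 :> R by exact: indic_le.
  by rewrite ler_norml; apply/andP; split; rewrite /h; lra.
move=> m C' sC; pose M := [set A | P.-negligible A \/ P.-negligible (~` A)].
have : M C'.
  move: sC; rewrite mul0n; apply: grid_past_min.
  - split; first by left; exact: negligible_set0.
      by move=> A; rewrite setTD => -[nA|nA]; [right; rewrite setCK|left].
    move=> A hA; have [[m0 nm0]|all0] := pselect (exists m0, P.-negligible (~` A m0)).
      by right; apply: negligibleS nm0; rewrite setC_bigcup; exact: bigcap_inf.
    left; apply: negligible_bigcup => m0; have [//|h'] := hA m0.
    by exfalso; apply: all0; exists m0.
  - by move=> N; left.
  - move=> i; rewrite leqn0 => /eqP -> B mB.
    have -> : walk W (0 + m) 0 = fun=> 0 by apply/funext => w; rewrite /walk dyadic0 subrr.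
    rewrite preimage_cst; case: ifP => _; [right; rewrite setCT|left]; exact: negligible_set0.
have mh : measurable_fun setT h by exact: (L1_meas (L1B h1 h2)).
case=> nC.
  rewrite -[RHS](Ex_cst P); apply/esym/(Ex_eq Pc); last exact: L1_cst.
  have nC' : {ae P, forall w, ~ C' w} by apply: negligibleS nC => w /= /contrapT.
  by apply: filterS nC' => w nw; rewrite indicE memNset// mul0r.
transitivity (Ex h) => //; apply/esym/(Ex_eq Pc); last exact: L1B.
by apply: filterS (nC : {ae P, forall w, C' w}) => w Cw; rewrite indicE mem_set// mul1r.
Qed.

End Densities.

(** * A strategy observed on a dyadic grid *)

Section GridObservation.
Context {R : realType} {d : measure_display} {Omega : measurableType d}.
Local Notation Rp := (`[0%R, +oo[%classic : set R).
Variables (beta c01 c10 : R) (f : bool -> R -> R) (X : bool -> R -> Omega -> R).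
Hypotheses (hbeta : 0 < beta) (hc01 : 0 <= c01) (hc10 : 0 <= c10).
Hypothesis hf : forall i y, 0 < f i y.
Variable a : nat -> Omega -> \bar R.
Variable w : Omega.
Hypotheses (a0 : a 0%N w = 0%E) (am : forall n, (a n w <= a n.+1 w)%E).
Hypothesis ay : a n w @[n --> \oo] --> +oo%E.
Local Notation cost := (switch_cost c01 c10).
Local Notation rt i := (rate beta (f i) (X i) ^~ w).

(* The technology held just before the grid time [dyadic n k], when switches are only
   carried out at grid times. *)
Definition observed (n k : nat) (v : Omega) : bool :=
  if k is k'.+1 then technology a (dyadic n k') v else false.

Definition grid_cost (n N : nat) : R := \sum_(k < N)
  (observed n k w != observed n k.+1 w)%:R *
  (cost (observed n k w) * expR (- (beta * dyadic n k))).

(** Observation merges switches that fall between the same grid times and dates the remaining ones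
    later, where they are discounted more; both lower the cost. *)
Lemma grid_cost_le n N :
  ((grid_cost n N)%:E <= switching_cost beta c01 c10 a w)%E.
Proof.
have mono := switching_mono am.
(* [j] counts the true switches made by the last observed time. Its parity is the observed
   technology, so an observed change forces a true switch of the same kind. *)
suff [j [_ h _]] : exists j, [/\ odd j = observed n N w,
    grid_cost n N <= partial_cost beta c01 c10 a w j & (a j w <= (dyadic n N)%:E)%E].
  apply: (@le_trans _ _ (partial_cost beta c01 c10 a w j.*2)%:E).
    rewrite lee_fin (le_trans h)//.
    exact: (partial_cost_mono hbeta hc01 hc10 a0 am (leq_double_self j)).
  exact: (partial_cost_le hbeta hc01 hc10 a0 am).
elim: N => [|N [j [oj hj aj]]].
  exists 0%N; split => //; rewrite ?a0 ?lee_fin ?dyadic_ge0//.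
  by rewrite /grid_cost /partial_cost !big_ord0.
have [j' /andP[h1 h2]] := switching_index a0 ay (dyadic_ge0 n N : 0 <= (dyadic n N : R)).
have tj' : observed n N.+1 w = odd j' by exact: (technology_between am ay h1 h2).
have jj' : (j <= j')%N.
  rewrite leqNgt; apply/negP => /mono h.
  by have := le_lt_trans (le_trans h aj) h2; rewrite ltxx.
exists j'; split => //; last by rewrite (le_trans h1)// lee_fin dyadic_le.
rewrite /grid_cost big_ord_recr/= -/(observed n N.+1 w) tj' -oj.
have [e|ne] := eqVneq (odd j) (odd j').
  rewrite mul0r addr0 (le_trans hj)//.
  exact: (partial_cost_mono hbeta hc01 hc10 a0 am jj').
have {}jj' : (j < j')%N by rewrite ltn_neqAle jj' andbT; apply: contraNneq ne => ->.
rewrite mul1r; apply: le_trans (partial_cost_mono hbeta hc01 hc10 a0 am jj').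
rewrite [leRHS]/partial_cost big_ord_recr/= lerD// ler_wpM2l ?switch_cost_ge0//.
have ajS : (a j.+1 w <= (dyadic n N)%:E)%E by apply: le_trans h1; exact: mono.
have [_ _ ->] := discE hbeta (switching_ge0 a0 am j.+1).
have := switching_ge0 a0 am j.+1; move: ajS; case: (a j.+1 w) => [r| |]//=.
by rewrite !lee_fin => h3 _; rewrite ler_expR lerN2 ler_pM2l.
Qed.

Hypothesis mrt : forall i, measurable_fun Rp (rt i).
Hypothesis rt_fin : forall i, (\int[lebesgue_measure]_(s in Rp) (rt i s)%:E < +oo)%E.

Definition grid_profit (n N : nat) : R := \sum_(k < N)
  (profit_until beta (f (observed n k.+1 w)) (X (observed n k.+1 w)) (dyadic n k.+1)%:E w -
   profit_until beta (f (observed n k.+1 w)) (X (observed n k.+1 w)) (dyadic n k)%:E w).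

Let G (u s : R) := rt (technology a u w) s.

Let mG u : measurable_fun Rp (G u). Proof. exact: mrt. Qed.

Lemma grid_profitE n N : (grid_profit n N)%:E =
  (\int[lebesgue_measure]_(s in `[0%R, dyadic n N[) (G (dyadic_floor n s) s)%:E)%E.
Proof.
have sub r : (`[dyadic n r, dyadic n r.+1[%classic : set R) `<=` Rp.
  move=> s; rewrite /= !in_itv/= => /andP[h _]; rewrite andbT.
  exact: le_trans (dyadic_ge0 n r) h.
have mGr r u : measurable_fun (`[dyadic n r, dyadic n r.+1[%classic : set R) (G u).
  by apply: measurable_funS (mG u) => //; exact: sub.
have [_ ->] := integral_dyadic_floor (p := n) N (fun r => mGr r (dyadic n r)).
rewrite /grid_profit -sumEFin; apply: eq_bigr => r _.
set i := observed n r.+1 w; have -> : G (dyadic n r) = rt i by [].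
rewrite (integral_itv_bndo_bndc (f := fun s => (rt i s)%:E)); last first.
  by apply/measurable_EFinP; exact: (mGr r (dyadic n r)).
have e : (`[dyadic n r, dyadic n r.+1]%classic : set R) =
    time_itv (dyadic n r) (dyadic n r.+1)%:E.
  by apply/seteqP; split => s; rewrite /time_itv /= in_itv/= !lee_fin.
rewrite e (integral_between (mrt i) (fun s => rate_ge0 beta (hf i) _ s w) (rt_fin i) (dyadic_ge0 n r))//.
by rewrite lee_fin dyadic_le.
Qed.

Let bd (s : R) : R := rt true s + rt false s.

Let G_le u s : 0 <= G u s <= bd s.
Proof.
rewrite /G /bd; have h i := rate_ge0 beta (hf i) (X i) s w.
by case: technology; rewrite h ?lerDl ?lerDr h.
Qed.

Let bdE : (\int[lebesgue_measure]_(s in Rp) (bd s)%:E = (fine (\int[lebesgue_measure]_(s in Rp) (rt true s)%:E) +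
  fine (\int[lebesgue_measure]_(s in Rp) (rt false s)%:E))%:E)%E.
Proof.
have h i s : (0 <= (rt i s)%:E)%E by rewrite lee_fin rate_ge0.
have fn i : (\int[lebesgue_measure]_(s in Rp) (rt i s)%:E)%E \is a fin_num.
  by rewrite ge0_fin_numE//; apply: integral_ge0 => s _.
rewrite EFinD !fineK// -ge0_integralD//; apply/measurable_EFinP; exact: mrt.
Qed.

Let mRp : measurable Rp. Proof. exact: measurable_itv. Qed.

Let subRp n N : (`[0%R, dyadic n N[%classic : set R) `<=` Rp.
Proof. by move=> s; rewrite /= !in_itv/= => /andP[->]. Qed.

Let mbd : measurable_fun Rp bd.
Proof. by apply: measurable_funD; exact: mrt. Qed.

Let mfl n N : measurable_fun (`[0%R, dyadic n N[%classic : set R) (fun s => G (dyadic_floor n s) s).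
Proof.
apply: (integral_dyadic_floor (p := n) N _).1 => r; apply: measurable_funS (mG _) => //.
move=> s; rewrite /= !in_itv/= => /andP[h _]; rewrite andbT; exact: le_trans (dyadic_ge0 n r) h.
Qed.

Lemma grid_profit_bound n N : 0 <= grid_profit n N <=
  fine (\int[lebesgue_measure]_(s in Rp) (rt true s)%:E)%E +
  fine (\int[lebesgue_measure]_(s in Rp) (rt false s)%:E)%E.
Proof.
rewrite -!lee_fin grid_profitE -bdE; apply/andP; split.
  by apply: integral_ge0 => s _; rewrite lee_fin; have /andP[] := G_le (dyadic_floor n s) s.
apply: (@le_trans _ _ (\int[lebesgue_measure]_(s in `[0%R, dyadic n N[) (bd s)%:E)%E).
  apply: ge0_le_integral => //.
  - by move=> s _; rewrite lee_fin; have /andP[] := G_le (dyadic_floor n s) s.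
  - by apply/measurable_EFinP; exact: mfl.
  - by apply/measurable_EFinP; apply: measurable_funS mbd => //; exact: subRp.
  - by move=> s _; rewrite lee_fin; have /andP[] := G_le (dyadic_floor n s) s.
apply: ge0_subset_integral => //; first by apply/measurable_EFinP; exact: mbd.
  by move=> s _; rewrite lee_fin addr_ge0// rate_ge0.
Qed.

(** Grid floors approach [s] from the left, so they eventually see the technology of [s] unless a
    switch occurs exactly at [s]. *)
Let floor_technology s : 0 <= s -> (forall j, a j w <> s%:E) ->
  \forall n \near \oo, technology a (dyadic_floor n s) w = technology a s w.
Proof.
move=> s0 ns; have [j /andP[h1 h2]] := switching_index a0 ay s0.
rewrite (technology_between am ay h1 h2).
have h1' : (a j w < s%:E)%E by rewrite lt_neqAle h1 andbT; apply/eqP; exact: ns.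
have aj0 := switching_ge0 a0 am j.
have [r ar] : exists r : R, a j w = r%:E.
  by move: aj0 h1'; case: (a j w) => [r| |]//; exists r.
have rs : r < s by rewrite -lte_fin -ar.
near=> n; apply: (technology_between am ay).
  rewrite ar lee_fin ltW//; near: n; exact: (cvgr_gt s (dyadic_floor_cvg s0)).
apply: le_lt_trans h2; rewrite lee_fin.
by have /andP[] := dyadic_floor_itv n s0.
Unshelve. all: by end_near. Qed.

(** At level [n] the horizon is time [n], so mesh and horizon reach their limits together; the
    exceptional times are the countably many switching times. *)
Lemma grid_profit_cvg : grid_profit n (n * 2 ^ n) @[n --> \oo] -->
  fine (discounted_profit beta f X a w).
Proof.
pose D n : set R := `[0, dyadic n (n * 2 ^ n)[%classic.
have DE n s : D n s = (0 <= s < n%:R) :> Prop.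
  have -> : n%:R = dyadic n (n * 2 ^ n) :> R by rewrite -[n in dyadic n]add0n dyadic_refine /dyadic expn0 divr1.
  by rewrite /D /= in_itv.
have mD n : measurable (D n) by exact: measurable_itv.
have subD n : D n `<=` Rp by exact: subRp.
pose f_ n := (fun s => (G (dyadic_floor n s) s)%:E) \_ (D n).
have If n : (\int[lebesgue_measure]_(s in Rp) f_ n s = (grid_profit n (n * 2 ^ n))%:E)%E.
  by rewrite grid_profitE -integral_mkcondr setIidr.
pose tech s := G s s.
have mtech : measurable_fun Rp tech := measurable_technology_rate ay mrt.
have [] := @dominated_convergence _ _ _ (@lebesgue_measure R) Rp mRp f_ (EFin \o tech) (EFin \o bd).
- move=> n; apply/(measurable_restrict _ (mD n) mRp); rewrite setIidr//.
  by apply/measurable_EFinP; exact: mfl.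
- by apply/measurable_EFinP; exact mtech.
- have cR : countable (range (fun j => fine (a j w))).
    by apply: sub_countable (card_image_le _ _) _; exact: countableP.
  exists (range (fun j => fine (a j w))); split.
  + exact: countable_measurable.
  + exact: countable_lebesgue_measure0.
  move=> s /= H; apply: contrapT => ns; apply: H => s0'.
  have s0 : 0 <= s by move: s0'; rewrite /= in_itv/= andbT.
  have nas j : a j w <> s%:E by move=> h; apply: ns; exists j => //; rewrite h.
  apply: cvg_near_cst; near=> n; rewrite /f_ patchE mem_set.
    rewrite /tech /G (_ : technology a (dyadic_floor n s) w = technology a s w)//.
    near: n; exact: floor_technology.
  rewrite DE s0/=; apply: (lt_le_trans (truncnS_gt s)); rewrite ler_nat.
  by near: n; exact: nbhs_infty_ge.
- apply/integrableP; split; first by apply/measurable_EFinP; exact: mbd.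
  under eq_integral do rewrite /= ger0_norm ?addr_ge0 ?rate_ge0//.
  by rewrite bdE ltry.
- apply: aeW => s n _; rewrite /f_ patchE; case: ifP => _.
    by rewrite lee_fin; have /andP[h1 h2] := G_le (dyadic_floor n s) s; rewrite ger0_norm.
  by rewrite abse0 lee_fin addr_ge0// rate_ge0.
move=> iT _; under eq_fun do rewrite If.
have -> : (\int[lebesgue_measure]_(s in Rp) (EFin \o tech) s)%E = discounted_profit beta f X a w by [].
have fd := discounted_profit_fin hf ay mrt rt_fin.
by rewrite -{1}(fineK fd) => /fine_cvgP[].
Unshelve. all: by end_near. Qed.

End GridObservation.

(** The arithmetic of one time step: the first two assumptions are holding inequalities for the two
    technologies, the last two are switches between them with costs [c1] and [c2]. *)
Lemma switching_balance {R : realFieldType} (e1 e2 c1 c2 n1 n2 p q r s u v : R) :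
  e1 + n1 <= p + q -> e2 + n2 <= r + s -> r - c1 <= u -> q - c2 <= v ->
  e1 + e2 - (c1 + c2) + (n1 + n2) <= (p + u) + (v + s).
Proof. lra. Qed.

(** * Weights in place of events, and constancy of the initial value *)

Section Constancy.
Context {R : realType} {d : measure_display} {Omega : measurableType d}.
Variables (P : probability Omega R) (F : R -> set (set Omega)) (W : R -> Omega -> R).
Hypothesis hF : complete_right_continuous_filtration P F.
Hypothesis hW : brownian_motion P F W.
Local Notation L1 := (L1 P).
Local Notation Ex := (Ex P).
Let Pc := filt_complete hF.
Local Notation H := (wiener_algebra P W).
Let sH := wiener_sa P W.
Let mH := wiener_meas hF hW.
Variables (beta c01 c10 : R) (f : bool -> R -> R) (X : bool -> R -> Omega -> R).
Hypotheses (hbeta : 0 < beta) (hc10 : 0 < c10) (hc : c10 < c01).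
Hypothesis hf : forall i y, 0 < f i y.
Hypothesis hfm : forall i, measurable_fun [set: R] (f i).
Hypothesis aX : forall i, adapted F (X i).
Hypothesis cX : forall i, continuous_paths (X i).
Hypothesis wX : forall i t, 0 <= t -> measurable_wrt H (X i t).
Variable Y : bool -> R -> Omega -> R.
Hypothesis cY : forall i, continuous_paths (Y i).
Hypothesis iY : forall i, square_sup_integrable P F (Y i).
Hypothesis Yoo : forall i, {ae P, forall w, Y i t w @[t --> +oo] --> (0 : R)}.
Local Notation cost := (switch_cost c01 c10).
Hypothesis hval : forall i, is_stopping_value P F beta f X i (cost i) (Y (~~ i)) (Y i).
Local Notation profit i t := (profit_until beta (f i) (X i) t%:E).
Let hc01 : 0 < c01. Proof. exact: lt_trans hc. Qed.

Let total_fin i : (\int[P]_w total_profit beta (f i) (X i) w < +oo)%E.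
Proof.
exact: (total_profit_integral_fin hF hbeta (hf i) (hfm i) (@aX i) (@cX i)
  (@cY i) (iY i) (Yoo i) (Yoo (~~ i)) (@hval i)).
Qed.

Let profit_L1 i t : 0 <= t -> L1 (profit i t).
Proof.
move=> t0; have regP := profit_until_regular hF (hf i) (hfm i) (@aX i) (@cX i) (total_fin i).
by exact: (regular_L1 hF regP (st_cst hF (x := t%:E) t0)).
Qed.

Let Y_L1 i t : 0 <= t -> L1 (Y i t).
Proof. by move=> t0; exact: (process_L1 hF (@cY i) (iY i) (Yoo i) t0). Qed.

Let profit_wiener i t : 0 <= t -> measurable_wrt H (profit i t).
Proof.
move=> t0; apply/(measurable_wrtP sH); apply: measurableT_comp => //.
apply: (measurable_integral_rate beta (hf i) (hfm i) (T := g_sigma_algebraType H) (x := X i)).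
- by move=> s s0; apply/(measurable_wrtP sH); exact: wX.
- exact: (@cX i).
- exact: measurable_time_itv.
- exact: time_itv_sub.
Qed.

Definition density (D : set Omega) : Omega -> R := xget (fun=> 0) [set a | is_density P H D a].

Let densityP D : measurable D -> is_density P H D (density D).
Proof.
move=> mD; have [a da] := density_exists hF sH mH mD.
by rewrite /density; case: xgetP => [g _ //|/(_ a)].
Qed.

(** For a functional [Z] of the path, the event may be traded for its conditional probability given
    the path; [Z] may be unbounded, hence the unbounded form of the weight lemma. *)
Let Ex_density D Z : measurable D -> L1 Z -> measurable_wrt H Z ->
  Ex (fun w => density D w * Z w) = Ex (fun w => \1_D w * Z w).
Proof.
move=> mD LZ HZ; have da := densityP mD; have La := density_L1 hF hW da.
have [Ha a01 Ea] := da; have L1D := L1_indic P mD.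
apply/eqP; rewrite -subr_eq0 -(ExB (densityM_L1 hF hW da LZ) (L1M_ind mD LZ)); apply/eqP.
have -> : (fun w => density D w * Z w - \1_D w * Z w) = (fun w => Z w * (density D w - \1_D w)).
  by apply/funext => w; ring.
apply: (weight_eq0_unbounded (K := 1) Pc sH mH LZ HZ).
- exact: (L1_meas (L1B La L1D)).
- move=> w; have /andP[p0 p1] := a01 w; have d0 := indic_ge0 (R := R) D w.
  have d1 : \1_D w <= 1 :> R by exact: indic_le.
  by rewrite ler_norml; apply/andP; split; lra.
move=> B HB; have mB := mH HB.
rewrite (_ : (fun w => _) = fun w => \1_B w * density D w - \1_B w * \1_D w); last first.
  by apply/funext => w; ring.
by rewrite (ExB (L1M_ind mB La) (L1M_ind mB L1D)) Ea// subrr.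
Qed.

(** [Y] is not known to be a functional of the path, so weighting it by the density is not the same
    as restricting it to [D]; only profits can be traded back. *)
Definition shared_value (i : bool) (t : R) (D : set Omega) : R :=
  Ex (fun w => density D w * Y i t w).

(** Densities of disjoint events add up almost surely, by uniqueness of the density of the union. *)
Lemma shared_valueU i t D1 D2 : 0 <= t -> measurable D1 -> measurable D2 -> D1 `&` D2 = set0 ->
  shared_value i t (D1 `|` D2) = shared_value i t D1 + shared_value i t D2.
Proof.
move=> t0 m1 m2 dj; have m12 := measurableU _ _ m1 m2.
have d1 := densityP m1; have d2 := densityP m2; have d12 := densityP m12.
have l1 := density_L1 hF hW d1; have l2 := density_L1 hF hW d2.
have i1 := L1_indic P m1; have i2 := L1_indic P m2.
have e : {ae P, forall w, density (D1 `|` D2) w = density D1 w + density D2 w}.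
  apply: (density_unique hF hW _ (L1D l1 l2) _ d12).
    by have [h1 _ _] := d1; have [h2 _ _] := d2; exact: (wrtD sH h1 h2).
  move=> C HC; have mC := mH HC; have [_ _ e1] := d1; have [_ _ e2] := d2.
  rewrite (_ : (fun w => _) = fun w => \1_C w * density D1 w + \1_C w * density D2 w); last first.
    by apply/funext => w; ring.
  rewrite (ExD (L1M_ind mC l1) (L1M_ind mC l2)) e1// e2//.
  rewrite -(ExD (L1M_ind mC i1) (L1M_ind mC i2)); congr Ex; apply/funext => w.
  rewrite -mulrDr; congr (_ * _); rewrite !indicE in_setU.
  have [w1|w1] := boolP (w \in D1); last by rewrite add0r.
  have [w2|w2] := boolP (w \in D2); last by rewrite addr0.
  by move: w1 w2; rewrite !inE => w1 w2; have : (set0 : set Omega) w by rewrite -dj.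
have y := Y_L1 i t0; have y1 := densityM_L1 hF hW d1 y; have y2 := densityM_L1 hF hW d2 y.
rewrite /shared_value -(ExD y1 y2); apply/esym/(Ex_eq Pc); last exact: L1D.
by apply: filterS e => w ->; ring.
Qed.

Lemma shared_value0 i t : 0 <= t -> shared_value i t set0 = 0.
Proof.
move=> t0; have := @shared_valueU i t set0 set0 t0 measurable0 measurable0 (setI0 _).
by rewrite setU0 => /eqP; rewrite -subr_eq0 opprD addrA subrr sub0r oppr_eq0 => /eqP.
Qed.

Lemma shared_value_norm i t D : 0 <= t -> measurable D ->
  `|shared_value i t D| <= Ex (fun w => `|Y i t w|).
Proof.
move=> t0 mD; have da := densityP mD; have y := Y_L1 i t0; have ya := densityM_L1 hF hW da y.
have h w : `|density D w * Y i t w| <= `|Y i t w|.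
  have [_ /(_ w)/andP[p0 p1] _] := da.
  by rewrite normrM ger0_norm// ler_piMl.
rewrite /shared_value ler_norml -(ExN (L1_norm y)); apply/andP; split; apply: (Ex_le Pc) => //.
- by apply: aeW => w; have := h w; rewrite ler_norml => /andP[].
- by apply: L1N; exact: L1_norm.
- by apply: aeW => w; have := h w; rewrite ler_norml => /andP[].
- exact: L1_norm.
Qed.

(** The density of [D] is known at time [t], so the supermartingale formed by [Y i] plus the profit
    may be integrated against it; the profit, a functional of the path, is then traded back to the
    event itself. *)
Lemma shared_value_hold i n k u D : dyadic n k <= u -> F (dyadic n k) D ->
  Ex (fun w => \1_D w * (profit i u w - profit i (dyadic n k) w)) + shared_value i u D <=
  shared_value i (dyadic n k) D.
Proof.
set t : R := dyadic n k => tu FD; have t0 : 0 <= t := dyadic_ge0 n k.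
have u0 := le_trans t0 tu; have mF := filt_meas hF t0; have mD := mF _ FD.
have da := densityP mD; have [_ a01 _] := da.
have Fa := density_filt hF hW FD da.
have yt := Y_L1 i t0; have yu := Y_L1 i u0; have pt := profit_L1 i t0; have pu := profit_L1 i u0.
pose Vt w := Y i t w + profit i t w; pose Vu w := Y i u w + profit i u w.
have lt := L1D yt pt; have lu := L1D yu pu.
have g1 := L1B lt lu.
have G B : F t B -> 0 <= Ex (fun w => \1_B w * (Vt w - Vu w)).
  move=> FB; have mB := mF _ FB.
  rewrite (_ : (fun w => _) = fun w => \1_B w * Vt w - \1_B w * Vu w); last first.
    by apply/funext => w; ring.
  rewrite (ExB (L1M_ind mB lt) (L1M_ind mB lu)) subr_ge0.
  exact: (value_supermg hF hbeta (hf i) (hfm i) (@aX i) (@cX i) (@cY i) (@cY (~~ i)) (iY i)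
    (iY (~~ i)) (Yoo i) (Yoo (~~ i)) (@hval i) t0 tu FB).
have := weight_ge0 Pc mF g1 G Fa a01.
have pd := L1B pu pt.
have pH : measurable_wrt H (fun w => profit i u w - profit i t w).
  exact: (wrtB sH (profit_wiener i u0) (profit_wiener i t0)).
rewrite -(Ex_density mD pd pH) /shared_value.
have y1 := densityM_L1 hF hW da yt; have y2 := densityM_L1 hF hW da yu.
have y3 := densityM_L1 hF hW da pd.
rewrite (_ : (fun w => _) = fun w => density D w * Y i t w -
   (density D w * (profit i u w - profit i t w) + density D w * Y i u w)); last first.
  by apply/funext => w; rewrite /Vt /Vu; ring.
by rewrite (ExB y1 (L1D y3 y2)) (ExD y3 y2) subr_ge0.
Qed.

(** The obstacle inequality is pointwise and the weight is nonnegative, with mean the probability of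
    [D]. *)
Lemma shared_value_switch i t D : 0 <= t -> measurable D ->
  shared_value (~~ i) t D - cost i * expR (- (beta * t)) * pr P D <= shared_value i t D.
Proof.
move=> t0 mD; have da := densityP mD; have [_ a01 Ea] := da; have la := density_L1 hF hW da.
have y := Y_L1 i t0; have y' := Y_L1 (~~ i) t0.
have ya := densityM_L1 hF hW da y; have ya' := densityM_L1 hF hW da y'.
have <- : Ex (density D) = pr P D.
  have := Ea _ (saT sH); rewrite /pr -(Ex_ind P mD); congr (_ = _); congr Ex;
    by apply/funext => w; rewrite indicT mul1r.
rewrite -(ExZ _ la) /shared_value -(ExB ya' (L1Z _ la)).
apply: (Ex_le Pc) => //; last exact: (L1B ya' (L1Z _ la)).
have := process_ge_obstacle hF hbeta (hf i) (hfm i) (@aX i) (@cX i) (@cY i) (@cY (~~ i)) (iY i)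
    (iY (~~ i)) (Yoo i) (Yoo (~~ i)) (@hval i).
apply: filterS => w /(_ t t0) h; have /andP[p0 _] := a01 w.
by rewrite [cost i * _ * _]mulrC -mulrBr ler_wpM2l// addrC.
Qed.

Section TimeSteps.
(** [eta k] is the technology held just before the [k]-th grid time and [eta k.+1] the one held from
    it on, which is known at that time. *)
Variables (n : nat) (eta : nat -> Omega -> bool) (A : set Omega).
Hypothesis eta0 : forall w, eta 0%N w = false.
Hypothesis eta_filt : forall k i, F (dyadic n k) [set w | eta k.+1 w = i].
Hypothesis FA : F 0 A.
Local Notation tk k := (dyadic n k : R).

Definition held (k : nat) (i : bool) : set Omega := A `&` [set w | eta k w = i].

Let flip (k : nat) (i j : bool) : set Omega := held k i `&` held k.+1 j.

Definition step_profit (k : nat) (w : Omega) : R :=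
  profit (eta k.+1 w) (tk k.+1) w - profit (eta k.+1 w) (tk k) w.

Definition step_cost (k : nat) (w : Omega) : R :=
  (eta k w != eta k.+1 w)%:R * (cost (eta k w) * expR (- (beta * tk k))).

Let t0 k : 0 <= tk k. Proof. exact: dyadic_ge0. Qed.

Let FtA k : F (tk k) A. Proof. exact: (filt_mono hF (lexx 0) (t0 k)). Qed.

Let held_next k i : F (tk k) (held k.+1 i).
Proof. exact: (saI (filt_sa hF (t0 k)) (FtA k) (@eta_filt k i)). Qed.

Let held_filt k i : F (tk k) (held k i).
Proof.
case: k => [|k]; last first.
  by apply: (filt_mono hF (t0 k) _ (held_next k i)); rewrite dyadic_le.
apply: (saI (filt_sa hF (t0 0))); first exact: FtA.
have [->|nf] := eqVneq i false.
  rewrite (_ : [set w | _] = setT); first exact: (saT (filt_sa hF (t0 0))).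
  by apply/seteqP; split => w // _; exact: eta0.
rewrite (_ : [set w | _] = set0); first exact: (sa0 (filt_sa hF (t0 0))).
by apply/seteqP; split => w //= h; move: nf; rewrite -h eta0.
Qed.

Let held_meas k i : measurable (held k i).
Proof. exact: (filt_meas hF (t0 k)). Qed.

Let flip_meas k i j : measurable (flip k i j). Proof. exact: measurableI. Qed.

Let split_now k i t : 0 <= t ->
  shared_value i t (held k i) = shared_value i t (flip k i false) + shared_value i t (flip k i true).
Proof.
move=> t0'; have dj : flip k i false `&` flip k i true = set0.
  by rewrite -subset0 => w [[_ [_ /= e1]] [_ [_ /= e2]]]; rewrite e1 in e2.
rewrite -(shared_valueU i t0' (flip_meas k i false) (flip_meas k i true) dj).
congr shared_value; apply/seteqP; split => w; last by move=> [[]|[]].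
move=> [Aw ew]; have [e|e] : eta k.+1 w = false \/ eta k.+1 w = true by case: eta; [right|left].
  by left; split; split.
by right; split; split.
Qed.

Let split_next k j t : 0 <= t -> shared_value j t (held k.+1 j) =
  shared_value j t (flip k false j) + shared_value j t (flip k true j).
Proof.
move=> t0'; have dj : flip k false j `&` flip k true j = set0.
  by rewrite -subset0 => w [[[_ /= e1] _] [[_ /= e2] _]]; rewrite e1 in e2.
rewrite -(shared_valueU j t0' (flip_meas k false j) (flip_meas k true j) dj).
congr shared_value; apply/seteqP; split => w; last by move=> [[]|[]].
move=> [Aw ew]; have [e|e] : eta k w = false \/ eta k w = true by case: eta; [right|left].
  by left; split; split.
by right; split; split.
Qed.

Definition carried_value (k : nat) : R :=
  shared_value false (tk k) (held k false) + shared_value true (tk k) (held k true).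

Lemma step_L1 k : L1 (step_profit k) /\ L1 (step_cost k).
Proof.
have m j : measurable [set w | eta k.+1 w = j] := filt_meas hF (t0 k) (@eta_filt k j).
have m' j : measurable [set w | eta k w = j].
  case: k {m} => [|k]; last exact: (filt_meas hF (t0 k) (@eta_filt k j)).
  have [->|nf] := eqVneq j false.
    by rewrite (_ : [set w | _] = setT)//; apply/seteqP; split => w // _; exact: eta0.
  rewrite (_ : [set w | _] = set0)//.
  by apply/seteqP; split => w //= h; move: nf; rewrite -h eta0.
have ind (g : Omega -> bool) j w : \1_[set v | g v = j] w = (g w == j)%:R :> R.
  rewrite indicE; congr (_%:R); congr nat_of_bool; apply/idP/idP; first by rewrite inE => /eqP.
  by move=> /eqP h; rewrite inE.
have pl j := L1B (profit_L1 j (t0 k.+1)) (profit_L1 j (t0 k)).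
split.
  have := L1D (L1M_ind (m false) (pl false)) (L1M_ind (m true) (pl true)).
  apply: eq_L1 => w; rewrite !ind /step_profit; case: (eta k.+1 w) => /=; ring.
have mb i j : measurable ([set w | eta k w = i] `&` [set w | eta k.+1 w = j]) by exact: measurableI.
have := L1D (L1Z (cost false * expR (- (beta * tk k))) (L1_indic P (mb false true)))
  (L1Z (cost true * expR (- (beta * tk k))) (L1_indic P (mb true false))).
apply: eq_L1 => w; rewrite !indicI !ind /step_cost.
by case: (eta k w); case: (eta k.+1 w) => /=; ring.
Qed.

Let indic_held k i w : \1_(held k i) w = \1_A w * (eta k w == i)%:R :> R.
Proof.
rewrite indicI; congr (_ * _); rewrite indicE; congr (_%:R); congr nat_of_bool.
by apply/idP/idP; [rewrite inE => /eqP|move=> /eqP h; rewrite inE].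
Qed.

Let indic_flip k i j w :
  \1_(flip k i j) w = \1_A w * ((eta k w == i)%:R * (eta k.+1 w == j)%:R) :> R.
Proof.
have -> : \1_(flip k i j) w = \1_(held k i) w * \1_(held k.+1 j) w :> R by exact: indicI.
rewrite !indic_held; have AA : \1_A w * \1_A w = \1_A w :> R.
  by rewrite indicE; case: (_ \in _); rewrite ?mulr1 ?mulr0.
by rewrite mulrACA AA.
Qed.

(** At each grid time, value is first moved between technologies at the price of the switching costs
    and then held until the next one. The four events [flip] record the technology before and
    after. *)
Lemma carried_step k : Ex (fun w => \1_A w * (step_profit k w - step_cost k w)) +
  carried_value k.+1 <= carried_value k.
Proof.
have mA := filt_meas hF (lexx 0) FA.
have tS : tk k <= tk k.+1 by rewrite dyadic_le.
have pl j := L1B (profit_L1 j (t0 k.+1)) (profit_L1 j (t0 k)).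
have h j := shared_value_hold j tS (held_next k j).
have s1 := shared_value_switch false (t0 k) (flip_meas k false true).
have s2 := shared_value_switch true (t0 k) (flip_meas k true false).
pose E := expR (- (beta * tk k)).
have e : Ex (fun w => \1_A w * (step_profit k w - step_cost k w)) =
   Ex (fun w => \1_(held k.+1 false) w * (profit false (tk k.+1) w - profit false (tk k) w)) +
   Ex (fun w => \1_(held k.+1 true) w * (profit true (tk k.+1) w - profit true (tk k) w)) -
   (cost false * E * pr P (flip k false true) + cost true * E * pr P (flip k true false)).
  have i1 := L1_indic P (flip_meas k false true); have i2 := L1_indic P (flip_meas k true false).
  have a1 := L1M_ind (held_meas k.+1 false) (pl false).
  have a2 := L1M_ind (held_meas k.+1 true) (pl true).
  have b1 := L1Z (cost false * E) i1; have b2 := L1Z (cost true * E) i2.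
  rewrite /pr -!Ex_ind// -(ExZ _ i1) -(ExZ _ i2) -(ExD b1 b2) -(ExD a1 a2) -(ExB (L1D a1 a2) (L1D b1 b2)).
  congr Ex; apply/funext => w; rewrite !indic_held !indic_flip /step_profit /step_cost -/E.
  case: (eta k w); case: (eta k.+1 w) => /=; ring.
rewrite e /carried_value (split_now k false (t0 k)) (split_now k true (t0 k)).
have h1 := h false; have h2 := h true; rewrite /= -/E in s1 s2.
rewrite (split_next k false (t0 k)) in h1; rewrite (split_next k true (t0 k)) in h2.
exact: switching_balance h1 h2 s1 s2.
Qed.

Lemma carried_sum N : Ex (fun w => \1_A w * \sum_(k < N) (step_profit k w - step_cost k w)) +
  carried_value N <= carried_value 0.
Proof.
have mA := filt_meas hF (lexx 0) FA.
elim: N => [|N IH].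
  rewrite (_ : (fun w => _) = fun=> 0) ?Ex_cst ?add0r//.
  by apply/funext => w; rewrite big_ord0 mulr0.
apply: le_trans IH.
have lN : L1 (fun w => \1_A w * (step_profit N w - step_cost N w)).
  by apply: L1M_ind => //; apply: L1B; have [] := step_L1 N.
have lS : L1 (fun w => \1_A w * \sum_(k < N) (step_profit k w - step_cost k w)).
  by apply: L1M_ind => //; apply: L1_sum => k _; apply: L1B; have [] := step_L1 k.
rewrite (_ : (fun w => _) = fun w => \1_A w * (\sum_(k < N) (step_profit k w - step_cost k w)) +
    \1_A w * (step_profit N w - step_cost N w)); last first.
  by apply/funext => w; rewrite big_ord_recr/= mulrDr.
by rewrite (ExD lS lN) -addrA lerD2l carried_step.
Qed.

(** At time 0 everything is carried by technology 0, with weight the density of [A], which is almost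
    surely its probability; this is where the information in [F 0] is lost. *)
Lemma carried_value0 : carried_value 0 = pr P A * Ex (Y false 0).
Proof.
rewrite /carried_value (_ : held 0 true = set0); last first.
  by rewrite -subset0 => w [_ /=]; rewrite eta0.
rewrite (_ : held 0 false = A); last first.
  by apply/seteqP; split => [w []//|w Aw]; split => //; exact: eta0.
rewrite shared_value0// addr0 dyadic0 /shared_value -(ExZ _ (Y_L1 false (lexx 0))).
have mA := filt_meas hF (lexx 0) FA; have da := densityP mA.
apply/esym/(Ex_eq Pc); last exact: L1Z (Y_L1 false (lexx 0)).
by apply: filterS (density0 hF hW FA da) => w ->.
Qed.

Lemma carried_value_norm N :
  `|carried_value N| <= Ex (fun w => `|Y false (tk N) w|) + Ex (fun w => `|Y true (tk N) w|).
Proof.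
by rewrite (le_trans (ler_normD _ _))// lerD// shared_value_norm.
Qed.

End TimeSteps.

Local Notation cand := (candidate beta c01 c10 (Y false) (Y true)).

Let cand_strategy : strategy F cand. Proof. exact: (candidate_strategy hF beta c01 c10 cY iY). Qed.

Let cand_cvgy w : cand n w @[n --> \oo] --> +oo%E.
Proof. exact: (candidate_cvgy hF beta hc10 hc cY iY). Qed.

Lemma technology_filt t i : 0 <= t -> F t [set w | technology cand t w = i].
Proof.
move=> t0; have sF := filt_sa hF t0; have [st _ _] := cand_strategy.
have le n : F t [set w | (cand n w <= t%:E)%E] by apply: (left_sub hF t0); have [_] := st n; exact.
have true_set : F t [set w | technology cand t w = true].
  rewrite (_ : [set w | _] = \bigcup_n ([set w | (cand n.*2.+1 w <= t%:E)%E] `\`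
      [set w | (cand n.*2.+2 w <= t%:E)%E])).
    by apply: (sa_bigcup sF) => n; exact: (saD sF).
  apply/seteqP; split => w /=; rewrite /technology (switching_limity (@cand_cvgy w)) ltry.
    by move=> /asboolP[n /andP[h1 h2]]; exists n => //; split => //; apply/negP; rewrite -ltNge.
  by move=> [n _ [h1 /negP h2]]; apply/asboolP; exists n; rewrite h1 ltNge.
case: i; first exact: true_set.
rewrite (_ : [set w | _] = ~` [set w | technology cand t w = true]); first exact: (saC sF).
by apply/seteqP; split => w /=; case: technology.
Qed.

Let total_ae : {ae P, forall w i, (total_profit beta (f i) (X i) w < +oo)%E}.
Proof.
have h i := total_profit_ae hF (hf i) (hfm i) (@aX i) (@cX i) (total_fin i).
by apply: filterS2 (h true) (h false) => w h1 h2 [].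
Qed.

Let tot w := fine (total_profit beta (f true) (X true) w) + fine (total_profit beta (f false) (X false) w).

Let tot_L1 : L1 tot.
Proof.
have h i := total_profit_L1 hF (hf i) (hfm i) (@aX i) (@cX i) (total_fin i).
exact: L1D.
Qed.

Let mrate i w := measurable_rate beta (hfm i) (adapted_meas hF (@aX i)) (@cX i) w.

Let Y_norm_cvg0 i : Ex (fun w => `|Y i n%:R w|) @[n --> \oo] --> 0.
Proof.
have [g g1 gY] := process_bound hF (@cY i) (iY i).
have [] // := @Ex_dct _ _ _ P Pc (fun n w => `|Y i n%:R w|) (fun=> 0) g.
- by move=> n; apply: measurableT_comp => //; exact: (L1_meas (Y_L1 i (ler0n R n))).
- apply: filterS (Yoo i) => w h; apply/norm_cvg0P.
  by apply: (cvg_comp _ _ _ h); exact: cvgr_idn.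
- by apply: filterS gY => w h n; rewrite normr_id; exact: h.
by move=> _; rewrite Ex_cst.
Qed.

(** By telescoping, the grid version of the candidate earns at most the probability of [A] times the
    mean initial value, up to the value left at the horizon. In the limit this bounds the gain of
    the candidate on [A], whose mean is exactly that of [Y false 0] on [A]. *)
Lemma Ex_indic_value_le A : F 0 A ->
  Ex (fun w => \1_A w * Y false 0 w) <= pr P A * Ex (Y false 0).
Proof.
move=> FA; have mA := filt_meas hF (lexx 0) FA; have [st a0 am] := cand_strategy.
have cost_fin := candidate_cost_fin hF hbeta hc10 hc hf hfm (@aX) (@cX) (@cY) iY Yoo (@hval).
have cL := cost_of_L1 hF hbeta hc10 hc cand_strategy cost_fin.
have cE := cost_ofE hF hbeta hc10 hc cand_strategy cost_fin.
pose eta n := observed cand n.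
have eta0 n w : eta n 0%N w = false by [].
have eta_filt n k i : F (dyadic n k) [set w | eta n k.+1 w = i].
  exact: (technology_filt i (dyadic_ge0 n k)).
pose N n := (n * 2 ^ n)%N.
have tN n : dyadic n (N n) = n%:R :> R.
  by rewrite /N -[n in dyadic n]add0n dyadic_refine /dyadic expn0 divr1.
pose gp n w := grid_profit beta f X cand w n (N n).
have gpE n w : gp n w = \sum_(k < N n) step_profit n (eta n) k w by [].
have gcE n w : grid_cost beta c01 c10 cand w n (N n) = \sum_(k < N n) step_cost n (eta n) k w by [].
have sL n k := step_L1 (eta0 n) (eta_filt n) k.
have gpL n : L1 (gp n) by apply: L1_sum => k _; have [] := sL n k.
have gcL n : L1 (fun w => grid_cost beta c01 c10 cand w n (N n)).
  by apply: L1_sum => k _; have [] := sL n k.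
(* The grid cost is replaced by the larger true cost, so that only profits have to converge; the
   value left at the horizon [n] is bounded in absolute mean and tends to 0. *)
have ineq n : Ex (fun w => \1_A w * (gp n w - cost_of beta c01 c10 cand w)) -
    (Ex (fun w => `|Y false n%:R w|) + Ex (fun w => `|Y true n%:R w|)) <= pr P A * Ex (Y false 0).
  rewrite -(carried_value0 n (eta0 n) FA).
  apply: le_trans (carried_sum (eta0 n) (eta_filt n) FA (N n)).
  apply: lerD.
    have -> : (fun w => \1_A w * \sum_(k < N n) (step_profit n (eta n) k w - step_cost n (eta n) k w)) =
       (fun w => \1_A w * (gp n w - grid_cost beta c01 c10 cand w n (N n))).
      by apply/funext => w; rewrite sumrB.
    apply: (Ex_le Pc); [|exact: L1M_ind mA (L1B (gpL n) cL)|exact: L1M_ind mA (L1B (gpL n) (gcL n))].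
    apply: filterS cE => w ce; rewrite ler_wpM2l ?indic_ge0// lerD2l lerN2 -lee_fin -ce.
    exact: (grid_cost_le hbeta (ltW hc01) (ltW hc10) (a0 w) (am ^~ w) (@cand_cvgy w)).
  have := carried_value_norm (eta0 n) (eta_filt n) FA (N n).
  by rewrite tN ler_norml => /andP[].
have gp_cvg : {ae P, forall w, gp n w @[n --> \oo] --> profit_of beta f X cand w}.
  apply: filterS total_ae => w tw.
  exact: (grid_profit_cvg hf (a0 w) (am ^~ w) (@cand_cvgy w) (mrate ^~ w) tw).
have gp_bound : {ae P, forall w n, 0 <= gp n w <= tot w}.
  apply: filterS total_ae => w tw n.
  exact: (grid_profit_bound hf cand (mrate ^~ w) tw n (N n)).
have lim1 : Ex (fun w => \1_A w * (gp n w - cost_of beta c01 c10 cand w)) @[n --> \oo] -->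
    Ex (fun w => \1_A w * Y false 0 w).
  rewrite -(Ex_candidate_gain hF hbeta hc10 hc hf hfm (@aX) (@cX) (@cY) iY Yoo (@hval) FA).
  have [] // := @Ex_dct _ _ _ P Pc (fun n w => \1_A w * (gp n w - cost_of beta c01 c10 cand w))
    (fun w => \1_A w * (profit_of beta f X cand w - cost_of beta c01 c10 cand w))
    (fun w => tot w + `|cost_of beta c01 c10 cand w|).
  - by move=> n; exact: (L1_meas (L1M_ind mA (L1B (gpL n) cL))).
  - apply: filterS gp_cvg => w h; apply: cvgM; first exact: cvg_cst.
    by apply: cvgB => //; exact: cvg_cst.
  - exact: (L1D tot_L1 (L1_norm cL)).
  apply: filterS gp_bound => w h n; have /andP[h1 h2] := h n.
  rewrite normrM -[leRHS]mul1r ler_pM ?indic_le1// (le_trans (ler_normB _ _))// lerD2r.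
  by rewrite ger0_norm.
have lim2 : Ex (fun w => \1_A w * (gp n w - cost_of beta c01 c10 cand w)) -
    (Ex (fun w => `|Y false n%:R w|) + Ex (fun w => `|Y true n%:R w|)) @[n --> \oo] -->
    Ex (fun w => \1_A w * Y false 0 w) - (0 + 0).
  by apply: cvgB => //; apply: cvgD; exact: Y_norm_cvg0.
rewrite addr0 subr0 in lim2; rewrite -(cvg_lim (@Rhausdorff R) lim2).
apply: limr_le; first by apply/cvg_ex; eexists; exact: lim2.
by apply: nearW => n; exact: ineq.
Qed.

(** Testing on events of [F 0] shows that [Y false 0] does not exceed its mean; the difference is
    nonnegative with mean zero, hence vanishes. *)
Lemma value0_constant : {ae P, forall w, Y false 0 w = Ex (Y false 0)}.
Proof.
have sF := filt_sa hF (lexx 0); have mF := filt_meas hF (lexx 0).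
have y := Y_L1 false (lexx 0); have aY := progressively_measurable_adapted hF (iY false).1.
have g1 := L1B (L1_cst P (Ex (Y false 0))) y.
have g0 : {ae P, forall w, 0 <= Ex (Y false 0) - Y false 0 w}.
  apply: (ae_ge0_of_sets Pc mF _ g1) => [|A FA].
    exact: (wrtB sF (wrt_cst sF _) (@aY 0 (lexx 0))).
  have mA := mF _ FA.
  rewrite (_ : (fun w => _) = fun w => Ex (Y false 0) * \1_A w - \1_A w * Y false 0 w); last first.
    by apply/funext => w; ring.
  rewrite (ExB (L1Z _ (L1_indic P mA)) (L1M_ind mA y)) (ExZ _ (L1_indic P mA)) Ex_ind// subr_ge0.
  by rewrite mulrC; exact: Ex_indic_value_le.
have e0 : Ex (fun w => Ex (Y false 0) - Y false 0 w) <= 0.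
  by rewrite (ExB (L1_cst P _) y) Ex_cst subrr.
by apply: filterS (Ex_eq0 Pc g0 g1 e0) => w /eqP; rewrite subr_eq0 => /eqP.
Qed.

End Constancy.

Theorem proposition3p5 (R : realType) (d : measure_display)
  (Omega : measurableType d) (P : probability Omega R)
  (F : R -> set (set Omega)) (W : R -> Omega -> R)
  (beta c01 c10 K x : R) (f b sigma : bool -> R -> R)
  (X : bool -> R -> Omega -> R) (Y1 Y2 : R -> Omega -> R)
  (hF : complete_right_continuous_filtration P F)
  (hW : brownian_motion P F W)
  (hbeta : 0 < beta) (hc10 : 0 < c10) (hc : c10 < c01)
  (hf : forall i y, 0 < f i y)
  (hfm : forall i, measurable_fun [set: R] (f i))
  (hbm : forall i, measurable_fun [set: R] (b i))
  (hsm : forall i, measurable_fun [set: R] (sigma i))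
  (hs : forall i y, 0 <= sigma i y)
  (hK : 0 <= K)
  (hlip : forall i y z,
     `|b i y - b i z| + `|sigma i y - sigma i z| <= K * `|y - z|)
  (hgrowth : forall i y,
     `|b i y| ^+ 2 + `|sigma i y| ^+ 2 <= K ^+ 2 * (1 + `|y| ^+ 2))
  (hX : forall i : bool,
     log_value_process P F W b sigma x (fun _ _ => i) (X i))
  (hY1c : continuous_paths Y1) (hY2c : continuous_paths Y2)
  (hY1i : square_sup_integrable P F Y1) (hY2i : square_sup_integrable P F Y2)
  (hY1 : is_stopping_value P F beta f X false c01 Y2 Y1)
  (hY1oo : {ae P, forall w, Y1 t w @[t --> +oo] --> (0 : R)})
  (hY2 : is_stopping_value P F beta f X true c10 Y1 Y2)
  (hY2oo : {ae P, forall w, Y2 t w @[t --> +oo] --> (0 : R)}) :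
  {ae P, forall w, (Y1 0 w)%:E = optimal_gain P F beta c01 c10 f X} /\
  admissible P F beta c01 c10 f X (candidate beta c01 c10 Y1 Y2) /\
  mean_gain P beta c01 c10 f X (candidate beta c01 c10 Y1 Y2) =
    optimal_gain P F beta c01 c10 f X.
Proof.
pose Y (i : bool) := if i then Y2 else Y1.
have aX i : adapted F (X i) by have [] := hX i.
have cX i : continuous_paths (X i) by have [] := hX i.
have cY i : continuous_paths (Y i) by case: i.
have iY i : square_sup_integrable P F (Y i) by case: i.
have Yoo i : {ae P, forall w, Y i t w @[t --> +oo] --> (0 : R)} by case: i.
have hval i : is_stopping_value P F beta f X i (switch_cost c01 c10 i) (Y (~~ i)) (Y i).
  by case: i.
(* The stochastic equation for [X i] enters only here: its solution is a functional of the Brownian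
   path. *)
have wX i t : 0 <= t -> measurable_wrt (wiener_algebra P W) (X i t).
  move=> t0; apply: (strong_solution hF hW (@aX i) (@cX i) (hlip i) (x := x)) t0.
  by have [_ _] := hX i.
have opt := optimal_gainE hF hbeta hc10 hc hf hfm (@aX) (@cX) (@cY) iY Yoo (@hval).
split; [|split].
- have := value0_constant hF hW hbeta hc10 hc hf hfm (@aX) (@cX) wX (@cY) iY Yoo (@hval).
  by apply: filterS => w; rewrite opt => <-.
- exact: (candidate_admissible hF hbeta hc10 hc hf hfm (@aX) (@cX) (@cY) iY Yoo (@hval)).
- by rewrite opt; exact: (mean_gain_candidate hF hbeta hc10 hc hf hfm (@aX) (@cX) (@cY) iY Yoo (@hval)).
Qed.
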